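(* Let $g$ be a conformal metric of constant curvature one on the two-sphere representing an effective $\mathbb{Z}$-divisor (i.e. $g$ represents $D=\sum_j(\alpha_j-1)P_j$ where all $\alpha_j-1$ are non-negative integers). Then $g$ is a trivial reducible metric; that is, $g$ is the pullback $f^*g_{\rm st}$, under some rational function $f$ on the two-sphere, of the standard metric $g_{\rm st}$ on the Riemann sphere $\overline{\mathbb{C}}$.
   Context: The two-sphere is viewed as a compact Riemann surface $\Sigma$. A conformal metric $g$ on $\Sigma$ has a conical singularity at $p$ with angle $2\pi\alpha>0$ if near $p$, $g=e^{2\varphi}|dz|^2$ with $z$ a local complex coordinate, $z(p)=0$, and $\varphi-(\alpha-1)\ln|z|$ continuous near $p$. $g$ represents $D=\sum_{j=1}^n(\alpha_j-1)P_j$ ($P_j$ is the point $p_j$ viewed as a divisor) if $g$ is smooth on $\Sigma^*=\Sigma\setminus\{p_1,\dots,p_n\}$ and has a conical singularity of angle $2\pi\alpha_j$ at each $p_j$. Constant curvature one means Gauss curvature $1$ on $\Sigma^*$. The standard metric is $g_{\rm st}=\frac{4|dw|^2}{(1+|w|^2)^2}$. A developing map of $g$ is a multi-valued locally univalent meromorphic function $f$ on $\Sigma^*$ (obtained by analytic continuation of a locally injective function element along all paths in $\Sigma^*$) with $g=f^*g_{\rm st}$; its monodromy lies in $\mathrm{PSU}(2)$. $g$ is reducible if the monodromy group of a developing map has a fixed point on $\overline{\mathbb{C}}$, and trivial reducible if this monodromy group is trivial. *)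

(* Defs.v *)
From Stdlib Require Import Reals List Lra.
From Coquelicot Require Import Coquelicot.
Open Scope R_scope.

(** * The Riemann sphere *)

(** [Some z] is the finite point [z]; [None] is the point at infinity. *)
Definition sphere : Type := option C.

(** The inverse of the standard complex coordinate centred at [p], which is
    [z - a] at [Some a] and [1 / z] at infinity.  Every definition below that
    speaks of a coordinate near [p] uses this one. *)
Definition param (p : sphere) (z : C) : sphere :=
  match p with
  | Some a => Some (Cplus a z)
  | None => if Ceq_dec z (RtoC 0) then None else Some (Cinv z)
  end.

(** The coordinate itself, meaningful only near [p]: the value at infinity when
    [p] is finite and at [Some 0] when [p] is infinite is irrelevant. *)
Definition coord (p q : sphere) : C :=
  match p, q with
  | Some a, Some w => Cminus w a
  | Some _, None => RtoC 0
  | None, Some w => Cinv w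
  | None, None => RtoC 0
  end.

Definition near (p : sphere) : (sphere -> Prop) -> Prop :=
  filtermap (param p) (locally (RtoC 0)).

(** * Smooth real functions of a complex variable *)

Definition dx (f : C -> R) (z : C) : R := Derive (fun x => f (x, snd z)) (fst z).
Definition dy (f : C -> R) (z : C) : R := Derive (fun y => f (fst z, y)) (snd z).

(** [f] is of class C^k on the open set [U]. *)
Fixpoint class_C (k : nat) (U : C -> Prop) (f : C -> R) : Prop :=
  (forall z, U z -> continuous f z) /\
  match k with
  | O => True
  | S k' =>
      (forall z, U z -> ex_derive (fun x => f (x, snd z)) (fst z)
                     /\ ex_derive (fun y => f (fst z, y)) (snd z))
      /\ class_C k' U (dx f) /\ class_C k' U (dy f)
  end.

Definition smooth_near_0 (f : C -> R) : Prop :=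
  exists eps : R, 0 < eps /\ forall k, class_C k (fun z => Cmod z < eps) f.

(** * Conformal metrics *)

(** A conformal metric is given, at each point [p], by its coefficient
    [e^(2 phi) > 0] with respect to [|dz|^2], [z] being the standard coordinate
    centred at [p].  The coefficient at a conical point carries no information:
    nothing below depends on it. *)
Record conformal_metric : Type := {
  coef :> sphere -> R;
  coef_pos : forall p, 0 < coef p
}.

(** The coefficient of [g] in the coordinate centred at [p], as a function of
    that coordinate.  At infinity, [|d (1/w)|^2 = |w|^-4 |dw|^2]. *)
Definition coef_at (g : conformal_metric) (p : sphere) (z : C) : R :=
  match p with
  | Some a => g (Some (Cplus a z))
  | None => if Ceq_dec z (RtoC 0) then g None
            else g (Some (Cinv z)) / Cmod z ^ 4
  end.

(** The function [phi] such that [g = e^(2 phi) |dz|^2] near [p]. *)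
Definition potential (g : conformal_metric) (p : sphere) (z : C) : R :=
  ln (coef_at g p z) / 2.

Definition smooth_at (g : conformal_metric) (p : sphere) : Prop :=
  smooth_near_0 (potential g p).

(** [K = - e^(-2 phi) (phi_xx + phi_yy)] *)
Definition gauss_curvature (g : conformal_metric) (p : sphere) : R :=
  let phi := potential g p in
  - exp (- (2 * phi (RtoC 0)))
    * (dx (dx phi) (RtoC 0) + dy (dy phi) (RtoC 0)).

(** A conical singularity of angle [2 PI alpha]: [phi - (alpha - 1) ln |z|],
    defined off [p], is continuous near [p] after extension to [p]. *)
Definition conical (g : conformal_metric) (p : sphere) (alpha : R) : Prop :=
  0 < alpha /\
  exists psi : C -> R,
    locally (RtoC 0) (fun z => continuous psi z) /\
    locally' (RtoC 0) (fun z =>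
      potential g p z - (alpha - 1) * ln (Cmod z) = psi z).

(** * Divisors *)

(** The list of pairs [(p_j, alpha_j)] encodes the divisor
    [sum_j (alpha_j - 1) P_j], with the [p_j] distinct. *)
Definition divisor : Type := list (sphere * R).

Definition regular (D : divisor) (p : sphere) : Prop := ~ In p (map fst D).

Definition represents (g : conformal_metric) (D : divisor) : Prop :=
  NoDup (map fst D) /\
  (forall p, regular D p -> smooth_at g p) /\
  (forall p alpha, In (p, alpha) D -> conical g p alpha).

Definition constant_curvature_one (g : conformal_metric) (D : divisor) : Prop :=
  forall p, regular D p -> gauss_curvature g p = 1.

Definition effective_Z_divisor (D : divisor) : Prop :=
  forall p alpha, In (p, alpha) D -> exists k : nat, alpha - 1 = INR k.

(** * Meromorphic maps and the standard metric *)

(** Meromorphic functions are treated as holomorphic maps into the sphere. *)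
Definition is_derive_at (f : sphere -> sphere) (p : sphere) (l : C) : Prop :=
  filterlim f (near p) (near (f p)) /\
  @is_derive C_AbsRing C_NormedModule
    (fun z : C => coord (f p) (f (param p z))) (RtoC 0) l.

Definition meromorphic_at (f : sphere -> sphere) (p : sphere) : Prop :=
  near p (fun q => exists l, is_derive_at f q l).

Definition locally_injective_at (f : sphere -> sphere) (p : sphere) : Prop :=
  exists U : sphere -> Prop, near p U /\
    forall q q', U q -> U q' -> f q = f q' -> q = q'.

Definition st_coef (p : sphere) : R :=
  match p with
  | Some w => 4 / (1 + Cmod w ^ 2) ^ 2
  | None => 4
  end.

Lemma st_coef_pos (p : sphere) : 0 < st_coef p.
Proof.
destruct p as [w|]; unfold st_coef; [|lra].
apply Rdiv_lt_0_compat; [lra|].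
apply pow_lt; pose proof (pow2_ge_0 (Cmod w)); lra.
Qed.

Definition g_st : conformal_metric := {| coef := st_coef; coef_pos := st_coef_pos |}.

(** [g = f^* h] at the point [p]. *)
Definition is_pullback_at (f : sphere -> sphere) (h g : conformal_metric)
    (p : sphere) : Prop :=
  exists l : C, is_derive_at f p l /\ g p = h (f p) * Cmod l ^ 2.

(** * Rational functions *)

Definition poly_eval (d : nat) (a : nat -> C) (z : C) : C :=
  sum_n (fun k => Cmult (a k) (Cpow z k)) d.

(** The value at infinity is fixed by continuity. *)
Definition rational_function (f : sphere -> sphere) : Prop :=
  exists (d : nat) (a b : nat -> C),
    (exists z, poly_eval d b z <> RtoC 0) /\
    (forall z, ~ (poly_eval d a z = RtoC 0 /\ poly_eval d b z = RtoC 0)) /\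
    (forall z, f (Some z) =
       if Ceq_dec (poly_eval d b z) (RtoC 0) then None
       else Some (Cdiv (poly_eval d a z) (poly_eval d b z))) /\
    filterlim f (near None) (near (f None)).

(** * Analytic continuation, developing maps and monodromy *)

Definition germ_eq (p : sphere) (f h : sphere -> sphere) : Prop :=
  near p (fun q => f q = h q).

(** Only the germ at [p] of a function element [f] matters. *)
Definition function_element (f : sphere -> sphere) (p : sphere) : Prop :=
  meromorphic_at f p /\ locally_injective_at f p.

Definition path_in (D : divisor) (gamma : R -> sphere) : Prop :=
  forall t, 0 <= t <= 1 ->
    regular D (gamma t) /\
    filterlim gamma (within (fun s => 0 <= s <= 1) (locally t)) (near (gamma t)).

(** [F t] is a function element at [gamma t] for each [t], and the elements at
    nearby times are direct continuations of each other. *)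
Definition continuation (gamma : R -> sphere) (F : R -> sphere -> sphere) : Prop :=
  forall t, 0 <= t <= 1 ->
    function_element (F t) (gamma t) /\
    within (fun s => 0 <= s <= 1) (locally t)
      (fun s => germ_eq (gamma s) (F s) (F t)).

(** [f1] at [gamma 1] is the continuation along [gamma] of [f0] at [gamma 0]. *)
Definition continues_to (gamma : R -> sphere) (f0 f1 : sphere -> sphere) : Prop :=
  exists F, continuation gamma F /\
    germ_eq (gamma 0) (F 0) f0 /\ germ_eq (gamma 1) (F 1) f1.

Definition loop_in (D : divisor) (p0 : sphere) (gamma : R -> sphere) : Prop :=
  path_in D gamma /\ gamma 0 = p0 /\ gamma 1 = p0.

Definition moebius (a b c d : C) (p : sphere) : sphere :=
  match p with
  | Some z =>
      if Ceq_dec (Cplus (Cmult c z) d) (RtoC 0) then None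
      else Some (Cdiv (Cplus (Cmult a z) b) (Cplus (Cmult c z) d))
  | None => if Ceq_dec c (RtoC 0) then None else Some (Cdiv a c)
  end.

Definition PSU2 (M : sphere -> sphere) : Prop :=
  exists a b : C, Cmod a ^ 2 + Cmod b ^ 2 = 1 /\
    forall p, M p = moebius a b (Copp (Cconj b)) (Cconj a) p.

Definition monodromy_along (f0 : sphere -> sphere)
    (gamma : R -> sphere) (M : sphere -> sphere) : Prop :=
  PSU2 M /\ continues_to gamma f0 (fun p => M (f0 p)).

Definition monodromy_group (D : divisor) (p0 : sphere) (f0 : sphere -> sphere)
    (M : sphere -> sphere) : Prop :=
  exists gamma, loop_in D p0 gamma /\ monodromy_along f0 gamma M.

(** The multi-valued function whose branches are the continuations, along all
    paths off the support of [D], of the element [f0] at [p0]. *)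
Definition developing_map (g : conformal_metric) (D : divisor)
    (p0 : sphere) (f0 : sphere -> sphere) : Prop :=
  regular D p0 /\
  function_element f0 p0 /\
  (forall gamma, path_in D gamma -> gamma 0 = p0 ->
     exists f1, continues_to gamma f0 f1) /\
  (forall gamma f1, path_in D gamma -> gamma 0 = p0 -> continues_to gamma f0 f1 ->
     near (gamma 1) (fun q => is_pullback_at f1 g_st g q)) /\
  (forall gamma, loop_in D p0 gamma -> exists M, monodromy_along f0 gamma M).

(** Since [developing_map] gives every loop a monodromy, the last clause does
    speak about all loops. *)
Definition trivial_reducible (g : conformal_metric) (D : divisor) : Prop :=
  exists p0 f0, developing_map g D p0 f0 /\
    forall M, monodromy_group D p0 f0 M -> forall p, M p = p.

(* Main.v *)
Require Import Defs.
From Stdlib Require Import Reals List Lra Lia Psatz Factorial ClassicalEpsilon.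
From Coquelicot Require Import Coquelicot.
Open Scope R_scope.

(** Write the metric on the plane as [exp(2 phi) |dz|^2].  Curvature one is
    Liouville's equation [lap phi = - exp(2 phi)].  The divisor being effective and
    integral, there is a polynomial [P] with a zero of order [alpha_j - 1] at each
    finite cone point, and [psi = phi - ln 2 - ln |P|] is continuous on the whole plane
    and satisfies [lap psi = - 4 |P|^2 exp(2 psi)] off the cone points.

    This equation says that a connection with values in su(2), built from [psi]
    and [P], has zero curvature ([liouville_flat]).  Hence there are parallel
    sections ([parallel_transport]).  Rescaled by [exp(- psi / 2)], the components of
    a unit section are a pair of holomorphic functions [A], [M] with
    [|A|^2 + |M|^2 = exp(- psi)] ([section_norm]) and [A' M - A M' = P]
    ([section_wronskian]).  Consequently
    [exp(phi) = 2 |P| exp(psi) = 2 |A' M - A M'| / (|A|^2 + |M|^2)]: the metric is the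
    pullback of the standard one by [A / M].

    The obstruction to a global pair is the monodromy of the connection around the
    cone points.  In the coordinate [ln z] at a cone point the connection is
    periodic, so a section and its translate by the period keep a constant
    distance.  On the other hand [A] and [M] are bounded near the puncture, since
    [psi] is continuous there, and by Cauchy's estimate on large discs their
    oscillation over a period tends to zero.  The constant is therefore zero: there
    is no local monodromy, [A] and [M] extend across the puncture, and
    [psi = - ln (|A|^2 + |M|^2)] solves the equation at the cone point as well
    ([isolated_singularity], [global_potential]).  Integrality is what makes the
    connection periodic: for other cone angles [P] would be multivalued.

    Over the whole plane there is then an entire pair [A], [M].  The behaviour of the
    metric at infinity bounds [exp(- psi)] by a power of [|z|], so both functions are
    polynomials ([developing_pair]) and [f = A / M] is a rational function.  That
    [f] pulls back the standard metric also at infinity follows by continuity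
    ([metric_at_infinity]).

    Finally [f] is a globally defined developing map: by the identity theorem every
    continuation of its germ coincides with [f] ([continuation_unique]).  A
    monodromy transformation fixes all values of [f] near the base point, and a
    Moebius transformation with three fixed points is the identity
    ([rat_map_trivial_monodromy]).

    The necessary complex analysis (Goursat's theorem, Cauchy's formula, removable
    singularities, the identity theorem and Liouville's theorem) is developed for
    functions of [zeta = ln z] that are periodic with period [2 i PI].  Circles around
    [0] become vertical segments, and only integrals along horizontal and vertical
    segments are needed. *)

(** * Continuity of complex functions and complex derivatives *)

Lemma Cmod_sqr (z : C) : Cmod z ^ 2 = fst z ^ 2 + snd z ^ 2.
Proof. exact (Cmod2_alt z). Qed.

Lemma Cmod_fst_le (z : C) : Rabs (fst z) <= Cmod z.
Proof. apply (re_le_Cmod z). Qed.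

Lemma Cmod_snd_le (z : C) : Rabs (snd z) <= Cmod z.
Proof.
eapply Rle_trans; [|apply Rmax_Cmod]. apply Rmax_r.
Qed.

Lemma Cmod_le_abs (z : C) : Cmod z <= Rabs (fst z) + Rabs (snd z).
Proof.
apply Rsqr_incr_0_var; [|pose proof (Rabs_pos (fst z)); pose proof (Rabs_pos (snd z)); lra].
rewrite !Rsqr_pow2, Cmod_sqr.
rewrite <- (pow2_abs (fst z)), <- (pow2_abs (snd z)).
pose proof (Rabs_pos (fst z)); pose proof (Rabs_pos (snd z)); nra.
Qed.

Lemma Cmod_minus_sym (z w : C) : Cmod (z - w) = Cmod (w - z).
Proof. rewrite <- Cmod_opp. f_equal. ring. Qed.

Lemma Cmod_triangle_rev (z w : C) : Cmod z - Cmod w <= Cmod (z - w).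
Proof.
pose proof (Cmod_triangle (z - w) w) as H.
replace (z - w + w)%C with z in H by ring. lra.
Qed.

Lemma Cmod_minus_triangle (z w : C) : Cmod (z - w) <= Cmod z + Cmod w.
Proof.
pose proof (Cmod_triangle z (- w)) as H. rewrite Cmod_opp in H. exact H.
Qed.

Lemma Cmod_pos (z : C) : z <> RtoC 0 -> 0 < Cmod z.
Proof. apply Cmod_gt_0. Qed.

Lemma locally_C (z : C) (P : C -> Prop) :
  locally z P <-> exists d, 0 < d /\ forall w, Cmod (w - z) < d -> P w.
Proof.
split.
- intros [d H]. exists d. split; [apply cond_pos|]. intros w Hw. apply H.
  split; unfold ball; simpl; unfold AbsRing_ball; simpl; unfold abs, minus, plus, opp; simpl.
  + eapply Rle_lt_trans; [|exact Hw]. apply (Cmod_fst_le (w - z)).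
  + eapply Rle_lt_trans; [|exact Hw]. apply (Cmod_snd_le (w - z)).
- intros [d [Hd H]].
  assert (Hd' : 0 < d / 2) by lra.
  exists (mkposreal _ Hd'). intros w [H1 H2]. apply H.
  eapply Rle_lt_trans; [apply Cmod_le_abs|].
  unfold ball in H1, H2; simpl in H1, H2; unfold AbsRing_ball, abs, minus, plus, opp in H1, H2;
  simpl in H1, H2. simpl. unfold Rminus in *. lra.
Qed.

Lemma continuous_CC (f : C -> C) (z : C) :
  continuous f z <->
  forall eps, 0 < eps -> exists d, 0 < d /\
    forall w, Cmod (w - z) < d -> Cmod (f w - f z) < eps.
Proof.
split.
- intros H eps He.
  specialize (H (fun y => Cmod (y - f z) < eps)).
  assert (K : locally (f z) (fun y => Cmod (y - f z) < eps)).
  { apply locally_C. exists eps. split; auto. }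
  specialize (H K). apply locally_C in H. exact H.
- intros H P HP. apply locally_C in HP. destruct HP as [e [He HP]].
  destruct (H e He) as [d [Hd H']].
  apply locally_C. exists d. split; auto.
Qed.

Lemma continuous_CR (f : C -> R) (z : C) :
  continuous f z <->
  forall eps, 0 < eps -> exists d, 0 < d /\
    forall w, Cmod (w - z) < d -> Rabs (f w - f z) < eps.
Proof.
split.
- intros H eps He.
  specialize (H (fun y => Rabs (y - f z) < eps)).
  assert (K : locally (f z) (fun y => Rabs (y - f z) < eps)).
  { exists (mkposreal _ He). intros y Hy. exact Hy. }
  specialize (H K). apply locally_C in H. exact H.
- intros H P [e HP].
  destruct (H e (cond_pos e)) as [d [Hd H']].
  apply locally_C. exists d. split; auto. intros w Hw. apply HP. apply H'. exact Hw.
Qed.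

Section ContinuousC.
Context {T : UniformSpace}.
Implicit Types f g : T -> C.

Lemma continuous_Re f x : continuous f x -> continuous (fun t => fst (f t)) x.
Proof. intros H. apply (continuous_comp f fst); [exact H|]. apply continuous_fst. Qed.

Lemma continuous_Im f x : continuous f x -> continuous (fun t => snd (f t)) x.
Proof. intros H. apply (continuous_comp f snd); [exact H|]. apply continuous_snd. Qed.

Lemma continuous_pair (u v : T -> R) x :
  continuous u x -> continuous v x -> continuous (fun t => (u t, v t) : C) x.
Proof.
intros H1 H2 P [e HP].
specialize (H1 (fun y => ball (u x) e y)). specialize (H2 (fun y => ball (v x) e y)).
unfold filtermap in *.
assert (K1 : locally (u x) (fun y => ball (u x) e y)) by (exists e; auto).
assert (K2 : locally (v x) (fun y => ball (v x) e y)) by (exists e; auto).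
specialize (H1 K1). specialize (H2 K2).
generalize (filter_and _ _ H1 H2). apply filter_imp.
intros t [A B]. apply HP. split; assumption.
Qed.

Lemma continuous_C_of f x :
  continuous (fun t => fst (f t)) x -> continuous (fun t => snd (f t)) x -> continuous f x.
Proof.
intros H1 H2. apply continuous_ext with (fun t => (fst (f t), snd (f t)) : C).
- intros t. symmetry. apply surjective_pairing.
- apply continuous_pair; assumption.
Qed.

Lemma continuous_Rplus (u v : T -> R) x :
  continuous u x -> continuous v x -> continuous (fun t => u t + v t) x.
Proof. intros. apply (continuous_plus u v); assumption. Qed.

Lemma continuous_Rminus (u v : T -> R) x :
  continuous u x -> continuous v x -> continuous (fun t => u t - v t) x.
Proof. intros. apply (continuous_minus u v); assumption. Qed.

Lemma continuous_Rmult (u v : T -> R) x :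
  continuous u x -> continuous v x -> continuous (fun t => u t * v t) x.
Proof. intros. apply (continuous_mult u v); assumption. Qed.

Lemma continuous_Ropp (u : T -> R) x :
  continuous u x -> continuous (fun t => - u t) x.
Proof. intros. apply (continuous_opp u); assumption. Qed.

Lemma continuous_Rinv (u : T -> R) x :
  continuous u x -> u x <> 0 -> continuous (fun t => / u t) x.
Proof. intros H H0. apply (continuous_comp u Rinv); [exact H|]. apply continuous_Rinv. exact H0. Qed.

Lemma continuous_Rpow (u : T -> R) n x :
  continuous u x -> continuous (fun t => u t ^ n) x.
Proof.
intros H. induction n as [|n IH]; simpl; [apply continuous_const|].
apply continuous_Rmult; assumption.
Qed.

Lemma continuous_Cplus f g x :
  continuous f x -> continuous g x -> continuous (fun t => f t + g t)%C x.
Proof.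
intros H1 H2. apply continuous_C_of; simpl; apply continuous_Rplus;
  solve [apply continuous_Re; assumption | apply continuous_Im; assumption].
Qed.

Lemma continuous_Copp f x : continuous f x -> continuous (fun t => - f t)%C x.
Proof.
intros H1. apply continuous_C_of; simpl; apply continuous_Ropp;
  solve [apply continuous_Re; assumption | apply continuous_Im; assumption].
Qed.

Lemma continuous_Cminus f g x :
  continuous f x -> continuous g x -> continuous (fun t => f t - g t)%C x.
Proof. intros. apply continuous_Cplus; [assumption|]. apply continuous_Copp; assumption. Qed.

Lemma continuous_Cmult f g x :
  continuous f x -> continuous g x -> continuous (fun t => f t * g t)%C x.
Proof.
intros H1 H2. apply continuous_C_of; simpl;
 [apply continuous_Rminus | apply continuous_Rplus]; apply continuous_Rmult;
  solve [apply continuous_Re; assumption | apply continuous_Im; assumption].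
Qed.

Lemma Csqr_neq0 (z : C) : z <> RtoC 0 -> fst z ^ 2 + snd z ^ 2 <> 0.
Proof.
intros H. rewrite <- Cmod_sqr. apply pow_nonzero. apply Rgt_not_eq, Cmod_pos, H.
Qed.

Lemma continuous_Cinv f x :
  continuous f x -> f x <> RtoC 0 -> continuous (fun t => / f t)%C x.
Proof.
intros H1 H0. apply Csqr_neq0 in H0.
assert (Hs : continuous (fun t => / (fst (f t) ^ 2 + snd (f t) ^ 2)) x).
{ apply continuous_Rinv; [|exact H0].
  apply continuous_Rplus; apply continuous_Rpow;
  [apply continuous_Re|apply continuous_Im]; assumption. }
apply continuous_C_of; simpl; unfold Rdiv; apply continuous_Rmult; try exact Hs;
  [|apply continuous_Ropp]; solve [apply continuous_Re; assumption | apply continuous_Im; assumption].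
Qed.

Lemma continuous_Cdiv f g x :
  continuous f x -> continuous g x -> g x <> RtoC 0 -> continuous (fun t => f t / g t)%C x.
Proof. intros. apply continuous_Cmult; [assumption|]. apply continuous_Cinv; assumption. Qed.

Lemma continuous_Cpow f n x : continuous f x -> continuous (fun t => f t ^ n)%C x.
Proof.
intros H. induction n as [|n IH]; simpl; [apply continuous_const|].
apply continuous_Cmult; assumption.
Qed.

Lemma continuous_Cmod f x : continuous f x -> continuous (fun t => Cmod (f t)) x.
Proof.
intros H. apply (continuous_comp f Cmod); [exact H|].
apply continuous_CR. intros eps He. exists eps. split; [exact He|].
intros w Hw. eapply Rle_lt_trans; [|exact Hw].
apply Rabs_le. pose proof (Cmod_triangle_rev w (f x)).
pose proof (Cmod_triangle_rev (f x) w). rewrite Cmod_minus_sym in H1. lra.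
Qed.
End ContinuousC.

(** The slope form of the complex derivative: the quotient [q] is a function
    defined everywhere, so that products, inverses and compositions of
    differentiable functions are handled by algebra alone. *)
Definition Cd (f : C -> C) (z l : C) : Prop :=
  exists q : C -> C, continuous q z /\ q z = l /\
    forall w, f w = (f z + (w - z) * q w)%C.

Lemma Cd_continuous f z l : Cd f z l -> continuous f z.
Proof.
intros [q [Hq [_ Hf]]].
apply continuous_ext with (fun w => f z + (w - z) * q w)%C.
{ intros w. symmetry. apply Hf. }
apply continuous_Cplus; [apply continuous_const|].
apply continuous_Cmult; [|exact Hq].
apply continuous_Cminus; [apply continuous_id|apply continuous_const].
Qed.

Lemma Cd_epsilon f z l :
  Cd f z l <-> forall eps, 0 < eps -> exists d, 0 < d /\
    forall w, Cmod (w - z) < d -> Cmod (f w - f z - (w - z) * l) <= eps * Cmod (w - z).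
Proof.
split.
- intros [q [Hq [Hl Hf]]] eps He.
  destruct (proj1 (continuous_CC q z) Hq eps He) as [d [Hd H]].
  exists d. split; [exact Hd|]. intros w Hw.
  rewrite (Hf w), <- Hl.
  replace (f z + (w - z) * q w - f z - (w - z) * q z)%C with ((q w - q z) * (w - z))%C by ring.
  rewrite Cmod_mult. apply Rmult_le_compat_r; [apply Cmod_ge_0|]. left. apply H, Hw.
- intros H.
  exists (fun w => if Ceq_dec w z then l else (f w - f z) / (w - z))%C.
  destruct (Ceq_dec z z) as [_|N]; [|congruence].
  split; [|split; [reflexivity|]].
  + apply continuous_CC. intros eps He.
    assert (He' : 0 < eps / 2) by lra.
    destruct (H _ He') as [d [Hd Hw]]. exists d. split; [exact Hd|].
    intros w Hwd. destruct (Ceq_dec z z) as [_|N]; [|congruence].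
    destruct (Ceq_dec w z) as [E|N].
    * replace (l - l)%C with (RtoC 0) by ring. rewrite Cmod_0. exact He.
    * assert (N' : (w - z)%C <> RtoC 0) by (apply Cminus_eq_contra; exact N).
      replace ((f w - f z) / (w - z) - l)%C with ((f w - f z - (w - z) * l) / (w - z))%C
        by (field; exact N').
      rewrite Cmod_div by exact N'. apply Rle_lt_trans with (eps / 2); [|lra].
      apply Rle_div_l; [apply Cmod_pos, N'|]. apply Hw, Hwd.
  + intros w. destruct (Ceq_dec w z) as [E|N].
    * subst. ring.
    * field. apply Cminus_eq_contra; exact N.
Qed.

Lemma Cd_unique f z l1 l2 : Cd f z l1 -> Cd f z l2 -> l1 = l2.
Proof.
rewrite !Cd_epsilon. intros H1 H2.
destruct (Ceq_dec l1 l2) as [E|N]; [exact E|exfalso].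
assert (Hp : 0 < Cmod (l1 - l2)) by (apply Cmod_pos, Cminus_eq_contra; exact N).
assert (He : 0 < Cmod (l1 - l2) / 3) by lra.
destruct (H1 _ He) as [d1 [Hd1 K1]]. destruct (H2 _ He) as [d2 [Hd2 K2]].
set (t := Rmin d1 d2 / 2).
assert (Ht : 0 < t) by (unfold t; pose proof (Rmin_glb_lt _ _ _ Hd1 Hd2); lra).
assert (T1 : t < d1) by (unfold t in *; pose proof (Rmin_l d1 d2); lra).
assert (T2 : t < d2) by (unfold t in *; pose proof (Rmin_r d1 d2); lra).
assert (E : (z + RtoC t - z)%C = RtoC t) by ring.
assert (M : Cmod (RtoC t) = t) by (rewrite Cmod_R, Rabs_pos_eq; lra).
specialize (K1 (z + RtoC t)%C). specialize (K2 (z + RtoC t)%C).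
rewrite E, M in *. specialize (K1 T1). specialize (K2 T2).
assert (t * Cmod (l1 - l2) <= 2 * (Cmod (l1 - l2) / 3 * t)).
{ rewrite <- M at 1. rewrite <- Cmod_mult.
  replace (t * (l1 - l2))%C with
    ((f (z + t) - f z - t * l2) - (f (z + t) - f z - t * l1))%C by ring.
  eapply Rle_trans; [apply Cmod_minus_triangle|]. lra. }
nra.
Qed.

Lemma Cd_ext_loc f g z l :
  (exists d, 0 < d /\ forall w, Cmod (w - z) < d -> f w = g w) -> Cd f z l -> Cd g z l.
Proof.
intros [d [Hd E]]. rewrite !Cd_epsilon. intros H eps He.
destruct (H eps He) as [d' [Hd' K]].
exists (Rmin d d'). split; [apply Rmin_glb_lt; assumption|].
intros w Hw. rewrite <- !E.
- apply K. eapply Rlt_le_trans; [exact Hw|apply Rmin_r].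
- replace (z - z)%C with (RtoC 0) by ring. rewrite Cmod_0. exact Hd.
- eapply Rlt_le_trans; [exact Hw|apply Rmin_l].
Qed.

Lemma Cd_ext f g z l : (forall w, f w = g w) -> Cd f z l -> Cd g z l.
Proof. intros H. apply Cd_ext_loc. exists 1. split; [lra|auto]. Qed.

Lemma Cd_eq f z l l' : l = l' -> Cd f z l -> Cd f z l'.
Proof. intros ->. auto. Qed.

Lemma Cd_const c z : Cd (fun _ => c) z (RtoC 0).
Proof.
exists (fun _ => RtoC 0). split; [apply continuous_const|]. split; [reflexivity|].
intros; ring.
Qed.

Lemma Cd_id z : Cd (fun w => w) z (RtoC 1).
Proof.
exists (fun _ => RtoC 1). split; [apply continuous_const|]. split; [reflexivity|].
intros; ring.
Qed.

Lemma Cd_plus f g z l m : Cd f z l -> Cd g z m -> Cd (fun w => f w + g w)%C z (l + m)%C.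
Proof.
intros [q [Hq [Hl Hf]]] [r [Hr [Hm Hg]]].
exists (fun w => q w + r w)%C. split; [apply continuous_Cplus; assumption|].
split; [subst; reflexivity|]. intros w. rewrite (Hf w), (Hg w). ring.
Qed.

Lemma Cd_mult f g z l m :
  Cd f z l -> Cd g z m -> Cd (fun w => f w * g w)%C z (l * g z + f z * m)%C.
Proof.
intros Hf0 Hg0. pose proof (Cd_continuous _ _ _ Hg0) as Cg.
destruct Hf0 as [q [Hq [Hl Hf]]]. destruct Hg0 as [r [Hr [Hm Hg]]].
exists (fun w => q w * g w + f z * r w)%C. split.
{ apply continuous_Cplus; apply continuous_Cmult; try assumption. apply continuous_const. }
split; [subst; reflexivity|].
intros w. rewrite (Hf w) at 1. rewrite (Hg w). ring.
Qed.

Lemma Cd_scal c f z l : Cd f z l -> Cd (fun w => c * f w)%C z (c * l)%C.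
Proof.
intros H. eapply Cd_eq; [|apply Cd_mult; [apply Cd_const|exact H]]. simpl. ring.
Qed.

Lemma Cd_opp f z l : Cd f z l -> Cd (fun w => - f w)%C z (- l)%C.
Proof.
intros H. apply Cd_ext with (fun w => (- 1) * f w)%C; [intros; ring|].
eapply Cd_eq; [|apply Cd_scal, H]. ring.
Qed.

Lemma Cd_minus f g z l m : Cd f z l -> Cd g z m -> Cd (fun w => f w - g w)%C z (l - m)%C.
Proof. intros. apply Cd_plus; [assumption|]. apply Cd_opp; assumption. Qed.

Lemma Cd_comp f g z l m :
  Cd f z l -> Cd g (f z) m -> Cd (fun w => g (f w)) z (m * l)%C.
Proof.
intros Hf0 [r [Hr [Hm Hg]]]. pose proof (Cd_continuous _ _ _ Hf0) as Cf.
destruct Hf0 as [q [Hq [Hl Hf]]].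
exists (fun w => r (f w) * q w)%C. split.
{ apply continuous_Cmult; [|assumption]. apply (continuous_comp f r); assumption. }
split; [subst; reflexivity|].
intros w. rewrite (Hg (f w)). replace (f w - f z)%C with ((w - z) * q w)%C.
- ring.
- rewrite (Hf w). ring.
Qed.

Lemma continuous_nonzero (f : C -> C) z :
  continuous f z -> f z <> RtoC 0 ->
  exists d, 0 < d /\ forall w, Cmod (w - z) < d -> f w <> RtoC 0.
Proof.
intros H N. destruct (proj1 (continuous_CC f z) H (Cmod (f z)) (Cmod_pos _ N)) as [d [Hd K]].
exists d. split; [exact Hd|]. intros w Hw E. specialize (K w Hw). rewrite E in K.
rewrite Cmod_minus_sym in K. replace (f z - 0)%C with (f z) in K by ring. lra.
Qed.

Lemma Cd_inv f z l : Cd f z l -> f z <> RtoC 0 -> Cd (fun w => / f w)%C z (- l / (f z * f z))%C.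
Proof.
intros Hf0 N. pose proof (Cd_continuous _ _ _ Hf0) as Cf.
destruct (continuous_nonzero f z Cf N) as [d [Hd K]].
destruct Hf0 as [q [Hq [Hl Hf]]].
apply Cd_ext_loc with (fun w => / f z + (w - z) * (- q w / (f z * f w)))%C.
{ exists d. split; [exact Hd|]. intros w Hw. specialize (K w Hw).
  assert (E : (f w - f z = (w - z) * q w)%C) by (rewrite (Hf w); ring).
  transitivity (/ f z - (f w - f z) / (f z * f w))%C.
  - rewrite E. field. split; assumption.
  - field. split; assumption. }
exists (fun w => - q w / (f z * f w))%C. split.
{ apply continuous_Cdiv; [apply continuous_Copp; exact Hq| |].
  - apply continuous_Cmult; [apply continuous_const|exact Cf].
  - apply Cmult_neq_0; exact N. }
split; [subst; reflexivity|]. intros w. replace (z - z)%C with (RtoC 0) by ring. ring.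
Qed.

Lemma Cd_div f g z l m : Cd f z l -> Cd g z m -> g z <> RtoC 0 ->
  Cd (fun w => f w / g w)%C z ((l * g z - f z * m) / (g z * g z))%C.
Proof.
intros Hf Hg N. eapply Cd_eq; [|apply Cd_mult; [exact Hf|apply Cd_inv; [exact Hg|exact N]]].
cbv beta. field. exact N.
Qed.

Lemma Cd_pow f n z l : Cd f z l ->
  Cd (fun w => f w ^ n)%C z (INR n * f z ^ (pred n) * l)%C.
Proof.
intros H. induction n as [|n IH].
- apply Cd_ext with (fun _ => RtoC 1); [reflexivity|].
  eapply Cd_eq; [|apply Cd_const]. simpl. ring.
- simpl (pred _). eapply Cd_eq; [|apply (Cd_mult _ _ _ _ _ H IH)].
  cbv beta. rewrite S_INR, RtoC_plus. destruct n as [|n]; simpl (pred _).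
  + change (INR 0) with 0. change (f z ^ 0)%C with (RtoC 1). ring.
  + rewrite (Cpow_S (f z) n). ring.
Qed.

(** ** Partial derivatives *)

Lemma is_derive_epsilon (f : R -> R) x l :
  is_derive f x l <-> forall eps, 0 < eps -> exists d, 0 < d /\
    forall s, Rabs (s - x) < d -> Rabs (f s - f x - l * (s - x)) <= eps * Rabs (s - x).
Proof.
split.
- intros [_ H] eps He. specialize (H x (fun P HP => HP) (mkposreal eps He)).
  destruct H as [d H]. exists d. split; [apply cond_pos|]. intros s Hs. specialize (H s Hs).
  eapply Rle_trans; [|exact H]. right.
  unfold norm, minus, plus, opp, scal, mult; simpl. unfold abs, mult; simpl. f_equal. ring.
- intros H. split; [apply is_linear_scal_l|]. intros x' Hx'.
  apply (is_filter_lim_locally_unique (V := AbsRing_NormedModule R_AbsRing)) in Hx'. subst x'.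
  intros eps. destruct (H eps (cond_pos eps)) as [d [Hd K]]. exists (mkposreal d Hd).
  intros s Hs. specialize (K s Hs). eapply Rle_trans; [|exact K]. right.
  unfold norm, minus, plus, opp, scal, mult; simpl. unfold abs, mult; simpl. f_equal. ring.
Qed.

Lemma Cd_partials (f : C -> C) x y l : Cd f (x, y) l ->
  is_derive (fun s => fst (f (s, y))) x (fst l) /\
  is_derive (fun s => snd (f (s, y))) x (snd l) /\
  is_derive (fun t => fst (f (x, t))) y (- snd l) /\
  is_derive (fun t => snd (f (x, t))) y (fst l).
Proof.
rewrite Cd_epsilon. intros H.
assert (Ex : forall s, ((s, y) - (x, y) = RtoC (s - x))%C).
{ intros s. unfold RtoC, Cminus, Cplus, Copp; simpl. f_equal; ring. }
assert (Ey : forall t, ((x, t) - (x, y))%C = (0, t - y)).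
{ intros s. unfold RtoC, Cminus, Cplus, Copp; simpl. f_equal; ring. }
assert (My : forall t, Cmod (0, t) = Rabs t).
{ intros t. unfold Cmod. simpl. replace (0 * (0 * 1) + t * (t * 1)) with (Rsqr t) by (unfold Rsqr; ring).
  apply sqrt_Rsqr_abs. }
split; [|split; [|split]]; apply is_derive_epsilon; intros eps He; destruct (H eps He) as [d [Hd K]];
 exists d; (split; [exact Hd|]); intros s Hs;
 [specialize (K (s, y))|specialize (K (s, y))|specialize (K (x, s))|specialize (K (x, s))];
 rewrite ?Ex, ?Cmod_R, ?Ey, ?My in K; specialize (K Hs);
 (eapply Rle_trans; [|exact K]);
 [ eapply Rle_trans; [|apply Cmod_fst_le] | eapply Rle_trans; [|apply Cmod_snd_le]
 | eapply Rle_trans; [|apply Cmod_fst_le] | eapply Rle_trans; [|apply Cmod_snd_le]];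
 right; simpl; f_equal; ring.
Qed.

(** The increment is split along the two sides of a right angle, and the mean
    value theorem applied to each. *)
Lemma C1_differentiable (F p q : C -> R) (z : C) :
  (exists d, 0 < d /\ forall w, Cmod (w - z) < d ->
     is_derive (fun s => F (s, snd w)) (fst w) (p w) /\
     is_derive (fun t => F (fst w, t)) (snd w) (q w)) ->
  continuous p z -> continuous q z ->
  forall eps, 0 < eps -> exists d, 0 < d /\ forall w, Cmod (w - z) < d ->
    Rabs (F w - F z - (p z * (fst w - fst z) + q z * (snd w - snd z))) <= eps * Cmod (w - z).
Proof.
intros [d0 [Hd0 HD]] Hp Hq eps He.
assert (He' : 0 < eps / 2) by lra.
destruct (proj1 (continuous_CR p z) Hp _ He') as [d1 [Hd1 K1]].
destruct (proj1 (continuous_CR q z) Hq _ He') as [d2 [Hd2 K2]].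
exists (Rmin d0 (Rmin d1 d2)).
split; [repeat apply Rmin_glb_lt; assumption|].
intros w Hw.
assert (W0 : Cmod (w - z) < d0) by (eapply Rlt_le_trans; [exact Hw|apply Rmin_l]).
assert (W1 : Cmod (w - z) < d1).
{ eapply Rlt_le_trans; [exact Hw|]. eapply Rle_trans; [apply Rmin_r|apply Rmin_l]. }
assert (W2 : Cmod (w - z) < d2).
{ eapply Rlt_le_trans; [exact Hw|]. eapply Rle_trans; [apply Rmin_r|apply Rmin_r]. }
destruct z as [x y]. destruct w as [s t]. simpl fst in *. simpl snd in *.
set (r := Cmod ((s, t) - (x, y))) in *.
assert (Sub : forall a b, Rmin x s <= a <= Rmax x s -> Rmin y t <= b <= Rmax y t ->
   Cmod ((a, b) - (x, y)) <= r).
{ intros a b Ha Hb. unfold r. apply Rsqr_incr_0_var; [|apply Cmod_ge_0].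
  rewrite !Rsqr_pow2, !Cmod_sqr. simpl.
  assert ((a - x) ^ 2 <= (s - x) ^ 2).
  { rewrite <- (pow2_abs (a - x)), <- (pow2_abs (s - x)).
    apply pow_incr. split; [apply Rabs_pos|].
    unfold Rmin, Rmax in Ha; destruct (Rle_dec x s); unfold Rabs; repeat destruct Rcase_abs; lra. }
  assert ((b - y) ^ 2 <= (t - y) ^ 2).
  { rewrite <- (pow2_abs (b - y)), <- (pow2_abs (t - y)).
    apply pow_incr. split; [apply Rabs_pos|].
    unfold Rmin, Rmax in Hb; destruct (Rle_dec y t); unfold Rabs; repeat destruct Rcase_abs; lra. }
  simpl in *. unfold Rminus in *. lra. }
assert (Mx : Rmin x s <= x <= Rmax x s) by (split; [apply Rmin_l|apply Rmax_l]).
assert (My : Rmin y t <= y <= Rmax y t) by (split; [apply Rmin_l|apply Rmax_l]).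
assert (Mt : Rmin y t <= t <= Rmax y t) by (split; [apply Rmin_r|apply Rmax_r]).
destruct (MVT_gen (fun a => F (a, t)) x s (fun a => p (a, t))) as [a [Ha Ea]].
{ intros a Ha. apply (HD (a, t)). eapply Rle_lt_trans; [apply Sub; [lra|exact Mt]|exact W0]. }
{ intros a Ha. apply continuity_pt_filterlim.
  apply (ex_derive_continuous (fun a => F (a, t))). exists (p (a, t)). apply (HD (a, t)).
  eapply Rle_lt_trans; [apply Sub; [exact Ha|exact Mt]|exact W0]. }
destruct (MVT_gen (fun b => F (x, b)) y t (fun b => q (x, b))) as [b [Hb Eb]].
{ intros b Hb. apply (HD (x, b)). eapply Rle_lt_trans; [apply Sub; [exact Mx|lra]|exact W0]. }
{ intros b Hb. apply continuity_pt_filterlim.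
  apply (ex_derive_continuous (fun b => F (x, b))). exists (q (x, b)). apply (HD (x, b)).
  eapply Rle_lt_trans; [apply Sub; [exact Mx|exact Hb]|exact W0]. }
assert (Q1 : Rabs (p (a, t) - p (x, y)) <= eps / 2).
{ left. apply K1. eapply Rle_lt_trans; [apply Sub; assumption|exact W1]. }
assert (Q2 : Rabs (q (x, b) - q (x, y)) <= eps / 2).
{ left. apply K2. eapply Rle_lt_trans; [apply Sub; assumption|exact W2]. }
replace (F (s, t) - F (x, y) - (p (x, y) * (s - x) + q (x, y) * (t - y)))
  with ((p (a, t) - p (x, y)) * (s - x) + (q (x, b) - q (x, y)) * (t - y)) by nra.
eapply Rle_trans; [apply Rabs_triang|]. rewrite !Rabs_mult.
assert (Rabs (s - x) <= r) by (apply (Cmod_fst_le ((s, t) - (x, y)))).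
assert (Rabs (t - y) <= r) by (apply (Cmod_snd_le ((s, t) - (x, y)))).
pose proof (Rabs_pos (s - x)). pose proof (Rabs_pos (t - y)).
pose proof (Rabs_pos (p (a, t) - p (x, y))). pose proof (Rabs_pos (q (x, b) - q (x, y))).
nra.
Qed.

(** How holomorphy is obtained below: parallel sections of a connection come
    with their real partial derivatives. *)
Lemma Cauchy_Riemann_Cd (f : C -> C) (p q : C -> R) z :
  (exists d, 0 < d /\ forall w, Cmod (w - z) < d ->
     is_derive (fun s => fst (f (s, snd w))) (fst w) (p w) /\
     is_derive (fun t => fst (f (fst w, t))) (snd w) (- q w) /\
     is_derive (fun s => snd (f (s, snd w))) (fst w) (q w) /\
     is_derive (fun t => snd (f (fst w, t))) (snd w) (p w)) ->
  continuous p z -> continuous q z -> Cd f z (p z, q z).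
Proof.
intros [d [Hd H]] Hp Hq. apply Cd_epsilon. intros eps He.
assert (He' : 0 < eps / 2) by lra.
destruct (C1_differentiable (fun w => fst (f w)) p (fun w => - q w) z) with (eps := eps / 2)
  as [d1 [Hd1 K1]]; auto.
{ exists d. split; [exact Hd|]. intros w Hw. split; apply (H w Hw). }
{ apply continuous_Ropp, Hq. }
destruct (C1_differentiable (fun w => snd (f w)) q p z) with (eps := eps / 2)
  as [d2 [Hd2 K2]]; auto.
{ exists d. split; [exact Hd|]. intros w Hw. split; apply (H w Hw). }
exists (Rmin d1 d2). split; [apply Rmin_glb_lt; assumption|].
intros w Hw. eapply Rle_trans; [apply Cmod_le_abs|].
specialize (K1 w). specialize (K2 w).
rewrite (Rmin_comm d1 d2) in Hw.
assert (L1 : Cmod (w - z) < d1) by (eapply Rlt_le_trans; [exact Hw|apply Rmin_r]).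
assert (L2 : Cmod (w - z) < d2) by (eapply Rlt_le_trans; [exact Hw|apply Rmin_l]).
specialize (K1 L1). specialize (K2 L2).
match type of K1 with Rabs ?a <= _ => match goal with |- Rabs ?b + _ <= _ =>
  replace b with a by (simpl; ring) end end.
match type of K2 with Rabs ?a <= _ => match goal with |- _ + Rabs ?b <= _ =>
  replace b with a by (simpl; ring) end end.
lra.
Qed.

(** ** The exponential *)

Definition cexp (z : C) : C := (exp (fst z) * cos (snd z), exp (fst z) * sin (snd z)).

Lemma cexp_plus z w : cexp (z + w) = (cexp z * cexp w)%C.
Proof.
unfold cexp, Cplus, Cmult; simpl. rewrite exp_plus, cos_plus, sin_plus.
f_equal; ring.
Qed.

Lemma cexp_0 : cexp (RtoC 0) = RtoC 1.
Proof. unfold cexp, RtoC; simpl. rewrite exp_0, cos_0, sin_0. f_equal; ring. Qed.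

Lemma Cmod_cexp z : Cmod (cexp z) = exp (fst z).
Proof.
apply Rsqr_inj; [apply Cmod_ge_0|left; apply exp_pos|].
rewrite !Rsqr_pow2, Cmod_sqr. unfold cexp; simpl.
pose proof (sin2_cos2 (snd z)) as H. unfold Rsqr in H. nra.
Qed.

Lemma cexp_neq0 z : cexp z <> RtoC 0.
Proof. apply Cmod_gt_0. rewrite Cmod_cexp. apply exp_pos. Qed.

Lemma cexp_opp z : cexp (- z) = (/ cexp z)%C.
Proof.
assert (H : (cexp (- z) * cexp z = RtoC 1)%C).
{ rewrite <- cexp_plus. rewrite <- cexp_0. f_equal. ring. }
transitivity (cexp (- z) * cexp z / cexp z)%C; [field|rewrite H; field]; apply cexp_neq0.
Qed.

Lemma continuous_of_R {T : UniformSpace} (u : T -> R) (h : R -> R) x :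
  continuous u x -> ex_derive h (u x) -> continuous (fun t => h (u t)) x.
Proof. intros H D. apply (continuous_comp u h); [exact H|]. apply (ex_derive_continuous h), D. Qed.

Lemma continuous_cexp {T : UniformSpace} (f : T -> C) x :
  continuous f x -> continuous (fun t => cexp (f t)) x.
Proof.
intros H. unfold cexp. apply continuous_pair; apply continuous_Rmult;
 (apply continuous_of_R; [first [apply continuous_Re, H|apply continuous_Im, H]|auto_derive; exact I]).
Qed.

Lemma Cd_cexp z : Cd cexp z (cexp z).
Proof.
unfold cexp at 2. apply (Cauchy_Riemann_Cd cexp (fun w => exp (fst w) * cos (snd w))
  (fun w => exp (fst w) * sin (snd w))).
- exists 1. split; [lra|]. intros w _. unfold cexp; simpl.
  split; [|split; [|split]]; auto_derive; auto; ring.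
- apply (continuous_Re cexp), continuous_cexp, continuous_id.
- apply (continuous_Im cexp), continuous_cexp, continuous_id.
Qed.

(** * Integrals along horizontal and vertical segments, and Goursat's theorem *)

Definition Cint (u : R -> C) (a b : R) : C :=
  (RInt (fun t => fst (u t)) a b, RInt (fun t => snd (u t)) a b).

Definition cont_on (u : R -> C) (a b : R) : Prop := forall t, a <= t <= b -> continuous u t.

Lemma ex_RInt_cont (u : R -> R) a b : a <= b ->
  (forall t, a <= t <= b -> continuous u t) -> ex_RInt u a b.
Proof.
intros Hab H. apply (ex_RInt_continuous u). intros t Ht.
rewrite Rmin_left, Rmax_right in Ht by exact Hab. apply H, Ht.
Qed.

Lemma cont_on_ex (u : R -> C) a b : a <= b -> cont_on u a b ->
  ex_RInt (fun t => fst (u t)) a b /\ ex_RInt (fun t => snd (u t)) a b.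
Proof.
intros Hab H. split; apply ex_RInt_cont; try exact Hab; intros t Ht;
 [apply continuous_Re|apply continuous_Im]; apply H, Ht.
Qed.

Lemma cont_on_sub u a b c d : cont_on u a b -> a <= c -> d <= b -> cont_on u c d.
Proof. intros H H1 H2 t Ht. apply H. lra. Qed.

Lemma Cint_bound u a b M : a <= b -> cont_on u a b ->
  (forall t, a <= t <= b -> Cmod (u t) <= M) -> Cmod (Cint u a b) <= (b - a) * M.
Proof.
intros Hab Hc HM. destruct (cont_on_ex u a b Hab Hc) as [E1 E2].
assert (H : is_RInt (V := C_R_NormedModule) u a b (Cint u a b)).
{ apply is_RInt_ext with (fun t => (fst (u t), snd (u t)) : C).
  { intros; symmetry; apply surjective_pairing. }
  apply (is_RInt_fct_extend_pair (U := R_NormedModule) (V := R_NormedModule)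
    (fun t => (fst (u t), snd (u t)))); simpl; apply (RInt_correct (V := R_CompleteNormedModule)); assumption. }
assert (N : forall z : C, norm (V := C_R_NormedModule) z = Cmod z).
{ intros z. transitivity (sqrt (Rabs (fst z) ^ 2 + Rabs (snd z) ^ 2)); [reflexivity|].
  rewrite !pow2_abs. reflexivity. }
rewrite <- N. eapply norm_RInt_le_const; [exact Hab| |exact H].
intros t Ht. rewrite N. apply HM, Ht.
Qed.

Lemma Cint_ext u v a b : a <= b -> (forall t, a <= t <= b -> u t = v t) -> Cint u a b = Cint v a b.
Proof.
intros Hab H. unfold Cint. f_equal; apply RInt_ext; intros t Ht;
 rewrite Rmin_left, Rmax_right in Ht by exact Hab; rewrite H; auto; lra.
Qed.

Lemma Cint_plus u v a b : a <= b -> cont_on u a b -> cont_on v a b ->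
  Cint (fun t => u t + v t)%C a b = (Cint u a b + Cint v a b)%C.
Proof.
intros Hab Hu Hv. destruct (cont_on_ex u a b Hab Hu), (cont_on_ex v a b Hab Hv).
unfold Cint, Cplus; simpl. f_equal; apply (RInt_plus (V := R_CompleteNormedModule)); assumption.
Qed.

Lemma Cint_scal c u a b : a <= b -> cont_on u a b ->
  Cint (fun t => c * u t)%C a b = (c * Cint u a b)%C.
Proof.
intros Hab Hu. destruct (cont_on_ex u a b Hab Hu) as [H1 H2].
assert (S : forall (v : R -> R) k, ex_RInt v a b -> ex_RInt (fun t => k * v t) a b /\
   RInt (fun t => k * v t) a b = k * RInt v a b).
{ intros v k Hv. split; [apply (ex_RInt_scal (V := R_NormedModule) v), Hv|].
  apply (RInt_scal (V := R_CompleteNormedModule) v), Hv. }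
destruct (S _ (fst c) H1) as [A1 B1]. destruct (S _ (snd c) H1) as [A2 B2].
destruct (S _ (fst c) H2) as [A3 B3]. destruct (S _ (snd c) H2) as [A4 B4].
unfold Cint, Cmult; simpl. f_equal.
- rewrite <- B1, <- B4.
  apply (RInt_minus (V := R_CompleteNormedModule) (fun t => fst c * fst (u t))); assumption.
- rewrite <- B2, <- B3.
  apply (RInt_plus (V := R_CompleteNormedModule) (fun t => fst c * snd (u t))); assumption.
Qed.

Lemma Cint_minus u v a b : a <= b -> cont_on u a b -> cont_on v a b ->
  Cint (fun t => u t - v t)%C a b = (Cint u a b - Cint v a b)%C.
Proof.
intros Hab Hu Hv.
transitivity (Cint (fun t => u t + (- 1) * v t)%C a b).
{ apply Cint_ext; [exact Hab|]. intros; ring. }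
rewrite Cint_plus, Cint_scal; try assumption; [ring|].
intros t Ht. apply continuous_Cmult; [apply continuous_const|apply Hv, Ht].
Qed.

Lemma Cint_const c a b : Cint (fun _ => c) a b = (RtoC (b - a) * c)%C.
Proof.
unfold Cint, Cmult, RtoC; simpl. rewrite !RInt_const. f_equal; unfold scal; simpl; unfold mult; simpl; ring.
Qed.

Lemma Cint_Chasles u a b c : a <= b -> b <= c -> cont_on u a c ->
  (Cint u a b + Cint u b c)%C = Cint u a c.
Proof.
intros Hab Hbc Hu.
destruct (cont_on_ex u a b Hab) as [H1 H2]; [apply (cont_on_sub u a c); auto; lra|].
destruct (cont_on_ex u b c Hbc) as [H3 H4]; [apply (cont_on_sub u a c); auto; lra|].
unfold Cint, Cplus; simpl. f_equal; apply (RInt_Chasles (V := R_CompleteNormedModule)); assumption.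
Qed.

Lemma Cint_shift u a b c : a <= b -> cont_on u (a + c) (b + c) ->
  Cint (fun t => u (t + c)) a b = Cint u (a + c) (b + c).
Proof.
intros Hab H. destruct (cont_on_ex u (a + c) (b + c)) as [H1 H2]; [lra|exact H|].
assert (S : forall v : R -> R, ex_RInt v (a + c) (b + c) ->
  RInt (fun t => v (t + c)) a b = RInt v (a + c) (b + c)).
{ intros v Hv. pose proof (RInt_comp_lin (V := R_CompleteNormedModule) v 1 c a b) as K.
  rewrite !Rmult_1_l in K. rewrite <- (K Hv). apply RInt_ext. intros t _.
  unfold scal; simpl; unfold mult; simpl. rewrite !Rmult_1_l. reflexivity. }
unfold Cint. f_equal; [apply (S (fun t => fst (u t)))|apply (S (fun t => snd (u t)))]; assumption.
Qed.

Lemma cont_on_minus u v a b : cont_on u a b -> cont_on v a b -> cont_on (fun t => u t - v t)%C a b.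
Proof. intros H1 H2 t Ht. apply continuous_Cminus; auto. Qed.

Definition cont_rect (f : C -> C) x0 x1 y0 y1 : Prop :=
  forall x y, x0 <= x <= x1 -> y0 <= y <= y1 -> continuous f (x, y).

Lemma cont_rect_sub f x0 x1 y0 y1 a0 a1 b0 b1 : cont_rect f x0 x1 y0 y1 ->
  x0 <= a0 -> a1 <= x1 -> y0 <= b0 -> b1 <= y1 -> cont_rect f a0 a1 b0 b1.
Proof. intros H ? ? ? ? x y Hx Hy. apply H; lra. Qed.

Lemma cont_rect_h f x0 x1 y0 y1 y : cont_rect f x0 x1 y0 y1 -> y0 <= y <= y1 ->
  cont_on (fun x => f (x, y)) x0 x1.
Proof.
intros H Hy x Hx. apply (continuous_comp (fun x => (x, y) : C) f).
- apply continuous_pair; [apply continuous_id|apply continuous_const].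
- apply H; assumption.
Qed.

Lemma cont_rect_v f x0 x1 y0 y1 x : cont_rect f x0 x1 y0 y1 -> x0 <= x <= x1 ->
  cont_on (fun y => f (x, y)) y0 y1.
Proof.
intros H Hx y Hy. apply (continuous_comp (fun y => (x, y) : C) f).
- apply continuous_pair; [apply continuous_const|apply continuous_id].
- apply H; assumption.
Qed.

Definition Crect (f : C -> C) x0 x1 y0 y1 : C :=
  (Cint (fun x => f (x, y0)) x0 x1 - Cint (fun x => f (x, y1)) x0 x1
   + Ci * (Cint (fun y => f (x1, y)) y0 y1 - Cint (fun y => f (x0, y)) y0 y1))%C.

Lemma Crect_split_x f x0 xm x1 y0 y1 : x0 <= xm <= x1 -> y0 <= y1 -> cont_rect f x0 x1 y0 y1 ->
  Crect f x0 x1 y0 y1 = (Crect f x0 xm y0 y1 + Crect f xm x1 y0 y1)%C.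
Proof.
intros Hx Hy H. unfold Crect.
rewrite <- (Cint_Chasles (fun x => f (x, y0)) x0 xm x1), <- (Cint_Chasles (fun x => f (x, y1)) x0 xm x1);
 try lra; try (eapply cont_rect_h; [exact H|lra]). ring.
Qed.

Lemma Crect_split_y f x0 x1 y0 ym y1 : x0 <= x1 -> y0 <= ym <= y1 -> cont_rect f x0 x1 y0 y1 ->
  Crect f x0 x1 y0 y1 = (Crect f x0 x1 y0 ym + Crect f x0 x1 ym y1)%C.
Proof.
intros Hx Hy H. unfold Crect.
rewrite <- (Cint_Chasles (fun y => f (x0, y)) y0 ym y1), <- (Cint_Chasles (fun y => f (x1, y)) y0 ym y1);
 try lra; try (eapply cont_rect_v; [exact H|lra]). ring.
Qed.

Lemma Crect_minus f g x0 x1 y0 y1 : x0 <= x1 -> y0 <= y1 ->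
  cont_rect f x0 x1 y0 y1 -> cont_rect g x0 x1 y0 y1 ->
  Crect (fun w => f w - g w)%C x0 x1 y0 y1 = (Crect f x0 x1 y0 y1 - Crect g x0 x1 y0 y1)%C.
Proof.
intros Hx Hy H H'. unfold Crect.
rewrite !Cint_minus; try assumption; try (eapply cont_rect_v; [eassumption|lra]);
 try (eapply cont_rect_h; [eassumption|lra]). ring.
Qed.

Lemma Crect_bound f x0 x1 y0 y1 M : x0 <= x1 -> y0 <= y1 -> cont_rect f x0 x1 y0 y1 ->
  (forall x y, x0 <= x <= x1 -> y0 <= y <= y1 -> Cmod (f (x, y)) <= M) ->
  Cmod (Crect f x0 x1 y0 y1) <= 2 * ((x1 - x0) + (y1 - y0)) * M.
Proof.
intros Hx Hy H HM. unfold Crect.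
eapply Rle_trans; [apply Cmod_triangle|]. rewrite Cmod_mult.
assert (Hi : Cmod Ci = 1).
{ unfold Cmod, Ci; simpl. replace (0 * (0 * 1) + 1 * (1 * 1)) with 1 by ring. apply sqrt_1. }
rewrite ?Hi.
assert (A1 := Cint_bound (fun x => f (x, y0)) x0 x1 M Hx).
assert (A2 := Cint_bound (fun x => f (x, y1)) x0 x1 M Hx).
assert (A3 := Cint_bound (fun y => f (x0, y)) y0 y1 M Hy).
assert (A4 := Cint_bound (fun y => f (x1, y)) y0 y1 M Hy).
specialize (A1 ltac:(eapply cont_rect_h; [eassumption|lra]) ltac:(intros; apply HM; lra)).
specialize (A2 ltac:(eapply cont_rect_h; [eassumption|lra]) ltac:(intros; apply HM; lra)).
specialize (A3 ltac:(eapply cont_rect_v; [eassumption|lra]) ltac:(intros; apply HM; lra)).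
specialize (A4 ltac:(eapply cont_rect_v; [eassumption|lra]) ltac:(intros; apply HM; lra)).
eapply Rle_trans; [apply Rplus_le_compat; [apply Cmod_minus_triangle|
  apply Rmult_le_compat_l; [lra|apply Cmod_minus_triangle]]|].
lra.
Qed.

Lemma Crect_primitive f G x0 x1 y0 y1 : x0 <= x1 -> y0 <= y1 ->
  (forall w, Cd G w (f w)) -> (forall w, continuous f w) ->
  Crect f x0 x1 y0 y1 = RtoC 0.
Proof.
intros Hx Hy HG Hf.
assert (H1 : forall y, Cint (fun x => f (x, y)) x0 x1 = (G (x1, y) - G (x0, y))%C).
{ intros y. unfold Cint, Cminus, Cplus, Copp; simpl. f_equal; apply is_RInt_unique.
  - apply (is_RInt_derive (fun x => fst (G (x, y)))).
    + intros x _. apply (Cd_partials G x y _ (HG (x, y))).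
    + intros x _. apply continuous_Re. apply (continuous_comp (fun x => (x, y) : C) f); [|apply Hf].
      apply continuous_pair; [apply continuous_id|apply continuous_const].
  - apply (is_RInt_derive (fun x => snd (G (x, y)))).
    + intros x _. apply (Cd_partials G x y _ (HG (x, y))).
    + intros x _. apply continuous_Im. apply (continuous_comp (fun x => (x, y) : C) f); [|apply Hf].
      apply continuous_pair; [apply continuous_id|apply continuous_const]. }
assert (H2 : forall x, (Ci * Cint (fun y => f (x, y)) y0 y1)%C = (G (x, y1) - G (x, y0))%C).
{ intros x.
  assert (E1 : RInt (fun y => fst (f (x, y))) y0 y1 = snd (G (x, y1)) - snd (G (x, y0))).
  { apply is_RInt_unique. apply (is_RInt_derive (fun y => snd (G (x, y)))).
    + intros y _. apply (Cd_partials G x y _ (HG (x, y))).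
    + intros y _. apply continuous_Re. apply (continuous_comp (fun y => (x, y) : C) f); [|apply Hf].
      apply continuous_pair; [apply continuous_const|apply continuous_id]. }
  assert (E2 : RInt (fun y => - snd (f (x, y))) y0 y1 = fst (G (x, y1)) - fst (G (x, y0))).
  { apply is_RInt_unique. apply (is_RInt_derive (fun y => fst (G (x, y)))).
    + intros y _. apply (Cd_partials G x y _ (HG (x, y))).
    + intros y _. apply continuous_Ropp, continuous_Im.
      apply (continuous_comp (fun y => (x, y) : C) f); [|apply Hf].
      apply continuous_pair; [apply continuous_const|apply continuous_id]. }
  assert (E3 : RInt (fun y => - snd (f (x, y))) y0 y1 = - RInt (fun y => snd (f (x, y))) y0 y1).
  { apply (RInt_opp (fun y => snd (f (x, y)))). apply ex_RInt_cont; [exact Hy|].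
    intros y _. apply continuous_Im. apply (continuous_comp (fun y => (x, y) : C) f); [|apply Hf].
    apply continuous_pair; [apply continuous_const|apply continuous_id]. }
  unfold Cint, Ci, Cmult, Cminus, Cplus, Copp; simpl. f_equal; lra. }
unfold Crect. rewrite !H1.
replace (Ci * (Cint (fun y => f (x1, y)) y0 y1 - Cint (fun y => f (x0, y)) y0 y1))%C with
 (Ci * Cint (fun y => f (x1, y)) y0 y1 - Ci * Cint (fun y => f (x0, y)) y0 y1)%C by ring.
rewrite !H2. ring.
Qed.

(** The linear part of [f] at [z] has a primitive, so only the error term of
    the derivative contributes to the integral over a small rectangle. *)
Lemma Crect_small f z l eps D x0 x1 y0 y1 : x0 <= x1 -> y0 <= y1 -> cont_rect f x0 x1 y0 y1 ->
  0 <= eps ->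
  (forall x y, x0 <= x <= x1 -> y0 <= y <= y1 ->
     Cmod (f (x, y) - f z - ((x, y) - z) * l) <= eps * Cmod ((x, y) - z) /\
     Cmod ((x, y) - z) <= D) ->
  Cmod (Crect f x0 x1 y0 y1) <= 2 * ((x1 - x0) + (y1 - y0)) * (eps * D).
Proof.
intros Hx Hy H He HM.
set (g := fun w => (f z + (w - z) * l)%C).
assert (Cg : forall w, continuous g w).
{ intros w. apply continuous_Cplus; [apply continuous_const|]. apply continuous_Cmult; [|apply continuous_const].
  apply continuous_Cminus; [apply continuous_id|apply continuous_const]. }
assert (E0 : Crect g x0 x1 y0 y1 = RtoC 0).
{ apply Crect_primitive with (fun w => f z * w + / 2 * l * ((w - z) * (w - z)))%C; try assumption.
  intros w. eapply Cd_eq; [|apply Cd_plus; [apply Cd_scal, Cd_id|apply Cd_scal, Cd_mult;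
    (apply Cd_minus; [apply Cd_id|apply Cd_const])]].
  unfold g. field. }
replace (Crect f x0 x1 y0 y1) with (Crect (fun w => f w - g w)%C x0 x1 y0 y1).
- apply Crect_bound; try assumption.
  + intros x y Hxx Hyy. apply continuous_Cminus; [apply H; assumption|apply Cg].
  + intros x y Hxx Hyy. destruct (HM x y Hxx Hyy) as [A B]. unfold g.
    replace (f (x, y) - (f z + ((x, y) - z) * l))%C with (f (x, y) - f z - ((x, y) - z) * l)%C by ring.
    eapply Rle_trans; [exact A|]. apply Rmult_le_compat_l; assumption.
- rewrite Crect_minus; try assumption; [rewrite E0; ring|]. intros x y _ _. apply Cg.
Qed.

(** Applied to each coordinate of the nested rectangles of a bisection. *)
Lemma nested_point (u s : nat -> R) : (forall n, u n <= u (S n)) ->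
  (forall n, u (S n) + s (S n) <= u n + s n) -> (forall n, 0 <= s n) ->
  exists x, forall n, u n <= x <= u n + s n.
Proof.
intros Hi Hd Hs.
assert (Mi : forall n k, u n <= u (n + k)%nat).
{ intros n k. induction k as [|k IH]; [rewrite Nat.add_0_r; lra|].
  rewrite Nat.add_succ_r. specialize (Hi (n + k)%nat). lra. }
assert (Md : forall n k, u (n + k)%nat + s (n + k)%nat <= u n + s n).
{ intros n k. induction k as [|k IH]; [rewrite Nat.add_0_r; lra|].
  rewrite Nat.add_succ_r. specialize (Hd (n + k)%nat). lra. }
assert (Mx : forall n m, u n <= u m + s m).
{ intros n m. specialize (Mi n m). specialize (Md m n). specialize (Hs (n + m)%nat).
  rewrite (Nat.add_comm m n) in Md. lra. }
destruct (completeness (fun r => exists n, r = u n)) as [x [Hx1 Hx2]].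
- exists (u 0%nat + s 0%nat). intros r [n ->]. apply Mx.
- exists (u 0%nat), 0%nat. reflexivity.
- exists x. intros n. split.
  + apply Hx1. exists n. reflexivity.
  + apply Hx2. intros r [m ->]. apply Mx.
Qed.

Lemma pow2_small (a eps : R) : 0 < eps -> exists n, a * (/ 2) ^ n < eps.
Proof.
intros He.
destruct (Rle_or_lt a 0) as [Ha|Ha].
{ exists 0%nat. simpl. lra. }
assert (He' : 0 < eps / a) by (apply Rdiv_lt_0_compat; assumption).
destruct (pow_lt_1_zero (/ 2) ltac:(rewrite Rabs_pos_eq; lra) (eps / a) He') as [N HN].
exists N. specialize (HN N (le_n N)). rewrite Rabs_pos_eq in HN by (apply pow_le; lra).
apply Rmult_lt_compat_l with (r := a) in HN; [|exact Ha].
replace (a * (eps / a)) with eps in HN by (field; lra). exact HN.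
Qed.

(** Bisection: one of the four quarters of a rectangle carries at least a
    quarter of the integral, whereas near a point where [f] is differentiable
    the integral is small compared with the square of the size. *)
Lemma Goursat_closed f x0 x1 y0 y1 : x0 <= x1 -> y0 <= y1 ->
  (forall x y, x0 <= x <= x1 -> y0 <= y <= y1 -> exists l, Cd f (x, y) l) ->
  Crect f x0 x1 y0 y1 = RtoC 0.
Proof.
intros Hx Hy HD.
assert (HC : cont_rect f x0 x1 y0 y1).
{ intros x y Hxx Hyy. destruct (HD x y Hxx Hyy) as [l Hl]. apply (Cd_continuous _ _ _ Hl). }
destruct (Ceq_dec (Crect f x0 x1 y0 y1) 0) as [E|N]; [exact E|exfalso].
apply Cmod_pos in N. set (I0 := Cmod (Crect f x0 x1 y0 y1)) in *.
set (a := x1 - x0). set (b := y1 - y0).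
set (A := fun n => a * (/ 2) ^ n). set (B := fun n => b * (/ 2) ^ n).
assert (HA : forall n, 0 <= A n).
{ intros n. apply Rmult_le_pos; [unfold a; lra|apply pow_le; lra]. }
assert (HB : forall n, 0 <= B n).
{ intros n. apply Rmult_le_pos; [unfold b; lra|apply pow_le; lra]. }
assert (SA : forall n, A n = A (S n) + A (S n)) by (intros n; unfold A; simpl; field).
assert (SB : forall n, B n = B (S n) + B (S n)) by (intros n; unfold B; simpl; field).
set (J := fun (p : C) n => Cmod (Crect f (fst p) (fst p + A n) (snd p) (snd p + B n))).
set (pick := fun (p : C) n =>
   let p1 := (fst p + A (S n), snd p) : C in
   let p2 := (fst p, snd p + B (S n)) : C in
   let p3 := (fst p + A (S n), snd p + B (S n)) : C in
   if Rle_dec (J p n / 4) (J p (S n)) then p else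
   if Rle_dec (J p n / 4) (J p1 (S n)) then p1 else
   if Rle_dec (J p n / 4) (J p2 (S n)) then p2 else p3).
set (q := fix q n := match n with O => (x0, y0) : C | S m => pick (q m) m end).
assert (Hpick : forall p n,
   (fst (pick p n) = fst p \/ fst (pick p n) = fst p + A (S n)) /\
   (snd (pick p n) = snd p \/ snd (pick p n) = snd p + B (S n))).
{ intros p n. unfold pick. repeat destruct Rle_dec; simpl; auto. }
assert (Hin : forall n, x0 <= fst (q n) /\ fst (q n) + A n <= x1 /\
                        y0 <= snd (q n) /\ snd (q n) + B n <= y1).
{ induction n as [|n IH].
  - simpl. unfold A, B, a, b. simpl. lra.
  - simpl (q (S n)). destruct (Hpick (q n) n) as [[E1|E1] [E2|E2]]; rewrite E1, E2;
    specialize (SA n); specialize (SB n); specialize (HA (S n)); specialize (HB (S n)); lra. }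
assert (HJ : forall n, I0 * (/ 4) ^ n <= J (q n) n).
{ induction n as [|n IH].
  - simpl. unfold J, I0, A, B, a, b; simpl. right. rewrite Rmult_1_r. f_equal. f_equal; ring.
  - assert (Step : J (q n) n / 4 <= J (q (S n)) (S n)).
    { simpl (q (S n)). unfold pick. set (p := q n).
      repeat destruct Rle_dec; try assumption.
      destruct (Hin n) as [I1 [I2 [I3 I4]]]. fold p in I1, I2, I3, I4.
      assert (Q : J p n <= J p (S n) + J (fst p + A (S n), snd p) (S n)
        + J (fst p, snd p + B (S n)) (S n) + J (fst p + A (S n), snd p + B (S n)) (S n)).
      { pose proof (HA (S n)). pose proof (HB (S n)). pose proof (SA n). pose proof (SB n).
        unfold J. simpl fst. simpl snd.
        rewrite (Crect_split_x f (fst p) (fst p + A (S n)) (fst p + A n)); try lra.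
        2: { apply (cont_rect_sub f x0 x1 y0 y1); try assumption; lra. }
        rewrite (Crect_split_y f (fst p) (fst p + A (S n)) (snd p) (snd p + B (S n)) (snd p + B n)); try lra.
        2: { apply (cont_rect_sub f x0 x1 y0 y1); try assumption; lra. }
        rewrite (Crect_split_y f (fst p + A (S n)) (fst p + A n) (snd p) (snd p + B (S n)) (snd p + B n)); try lra.
        2: { apply (cont_rect_sub f x0 x1 y0 y1); try assumption; lra. }
        replace (fst p + A (S n) + A (S n)) with (fst p + A n) by lra.
        replace (snd p + B (S n) + B (S n)) with (snd p + B n) by lra.
        eapply Rle_trans; [apply Cmod_triangle|].
        eapply Rle_trans; [apply Rplus_le_compat; apply Cmod_triangle|]. lra. }
      lra. }
    simpl pow. lra. }
destruct (nested_point (fun n => fst (q n)) A) as [x Hxn].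
{ intros n. simpl (q (S n)). destruct (Hpick (q n) n) as [[E1|E1] _]; rewrite E1; specialize (HA (S n)); lra. }
{ intros n. simpl (q (S n)). destruct (Hpick (q n) n) as [[E1|E1] _]; rewrite E1; specialize (SA n); specialize (HA (S n)); lra. }
{ exact HA. }
destruct (nested_point (fun n => snd (q n)) B) as [y Hyn].
{ intros n. simpl (q (S n)). destruct (Hpick (q n) n) as [_ [E1|E1]]; rewrite E1; specialize (HB (S n)); lra. }
{ intros n. simpl (q (S n)). destruct (Hpick (q n) n) as [_ [E1|E1]]; rewrite E1; specialize (SB n); specialize (HB (S n)); lra. }
{ exact HB. }
destruct (HD x y) as [l Hl].
{ specialize (Hxn 0%nat). specialize (Hin 0%nat). unfold A, a in *. simpl in *. lra. }
{ specialize (Hyn 0%nat). specialize (Hin 0%nat). unfold B, b in *. simpl in *. lra. }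
set (L := a + b).
assert (HL : 0 <= L) by (unfold L, a, b; lra).
assert (He : 0 < I0 / (2 * L * L + 1) ).
{ apply Rdiv_lt_0_compat; [exact N|]. nra. }
set (eps := I0 / (2 * L * L + 1)) in *.
destruct (proj1 (Cd_epsilon f (x, y) l) Hl eps He) as [d [Hd K]].
destruct (pow2_small L d Hd) as [n Hn].
assert (HS : Cmod (Crect f (fst (q n)) (fst (q n) + A n) (snd (q n)) (snd (q n) + B n))
   <= 2 * ((fst (q n) + A n - fst (q n)) + (snd (q n) + B n - snd (q n))) * (eps * (L * (/ 2) ^ n))).
{ destruct (Hin n) as [I1 [I2 [I3 I4]]]. specialize (HA n). specialize (HB n).
  apply (Crect_small f (x, y) l); try lra.
  - apply (cont_rect_sub f x0 x1 y0 y1); assumption.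
  - intros s t Hs Ht.
    assert (Hm : Cmod ((s, t) - (x, y)) <= L * (/ 2) ^ n).
    { eapply Rle_trans; [apply Cmod_le_abs|]. simpl.
      specialize (Hxn n). specialize (Hyn n). simpl in Hxn, Hyn.
      replace (L * (/ 2) ^ n) with (A n + B n) by (unfold A, B, L; ring).
      apply Rplus_le_compat; apply Rabs_le; lra. }
    split; [|exact Hm]. apply K. lra. }
specialize (HJ n). unfold J in HJ.
replace (fst (q n) + A n - fst (q n) + (snd (q n) + B n - snd (q n))) with (L * (/ 2) ^ n) in HS
 by (unfold A, B, L; ring).
assert (E4 : (/ 4) ^ n = (/ 2) ^ n * (/ 2) ^ n).
{ rewrite <- Rpow_mult_distr. f_equal. field. }
rewrite E4 in HJ. set (t := (/ 2) ^ n) in *.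
assert (Ht : 0 < t) by (apply pow_lt; lra).
assert (I0 * (t * t) <= (2 * L * L * eps) * (t * t)) by lra.
assert (Q : I0 <= 2 * L * L * eps).
{ apply Rmult_le_reg_r with (t * t); [nra|exact H]. }
assert (E : eps * (2 * L * L + 1) = I0) by (unfold eps; field; nra).
lra.
Qed.

Lemma cont_bounded (u : R -> R) a b : a <= b -> (forall t, a <= t <= b -> continuous u t) ->
  exists M, 0 <= M /\ forall t, a <= t <= b -> u t <= M.
Proof.
intros Hab H. destruct (continuity_ab_maj u a b Hab) as [m [Hm _]].
{ intros t Ht. apply continuity_pt_filterlim, H, Ht. }
exists (Rabs (u m)). split; [apply Rabs_pos|]. intros t Ht.
eapply Rle_trans; [apply Hm, Ht|]. apply Rle_abs.
Qed.

Lemma cont_rect_uniform f x0 x1 y0 y1 : cont_rect f x0 x1 y0 y1 ->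
  forall eps, 0 < eps -> exists d, 0 < d /\ forall x y x' y',
    x0 <= x <= x1 -> y0 <= y <= y1 -> x0 <= x' <= x1 -> y0 <= y' <= y1 ->
    Rabs (x' - x) < d -> Rabs (y' - y) < d -> Cmod (f (x', y') - f (x, y)) < eps.
Proof.
intros H eps He. assert (He' : 0 < eps / 2) by lra.
assert (CR : forall x y, x0 <= x <= x1 -> y0 <= y <= y1 ->
   continuity_2d_pt (fun x y => fst (f (x, y))) x y /\ continuity_2d_pt (fun x y => snd (f (x, y))) x y).
{ intros x y Hx Hy. split; apply continuity_2d_pt_filterlim.
  - change (continuous (fun z : C => fst (f (fst z, snd z))) (x, y)).
    apply continuous_ext with (fun z : C => fst (f z)); [intros [? ?]; reflexivity|].
    apply continuous_Re, H; assumption.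
  - change (continuous (fun z : C => snd (f (fst z, snd z))) (x, y)).
    apply continuous_ext with (fun z : C => snd (f z)); [intros [? ?]; reflexivity|].
    apply continuous_Im, H; assumption. }
destruct (uniform_continuity_2d (fun x y => fst (f (x, y))) x0 x1 y0 y1) with (mkposreal _ He') as [d1 K1].
{ intros; apply CR; assumption. }
destruct (uniform_continuity_2d (fun x y => snd (f (x, y))) x0 x1 y0 y1) with (mkposreal _ He') as [d2 K2].
{ intros; apply CR; assumption. }
exists (Rmin d1 d2). split; [apply Rmin_glb_lt; apply cond_pos|].
intros x y x' y' Hx Hy Hx' Hy' Dx Dy.
pose proof (Rmin_l d1 d2). pose proof (Rmin_r d1 d2).
eapply Rle_lt_trans; [apply Cmod_le_abs|]. simpl.
assert (Rabs (fst (f (x', y')) - fst (f (x, y))) < eps / 2) by (apply K1; lra).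
assert (Rabs (snd (f (x', y')) - snd (f (x, y))) < eps / 2) by (apply K2; lra).
unfold Rminus in *. lra.
Qed.

(** The horizontal sides nearly cancel by uniform continuity, and the vertical
    sides are short. *)
Lemma Crect_thin f x0 x1 y0 y1 : x0 <= x1 -> y0 <= y1 -> cont_rect f x0 x1 y0 y1 ->
  forall eps, 0 < eps -> exists d, 0 < d /\ forall s t, y0 <= s -> s <= t -> t <= y1 -> t - s < d ->
    Cmod (Crect f x0 x1 s t) <= eps.
Proof.
intros Hx Hy H eps He.
assert (He' : 0 < eps / (2 * (x1 - x0 + 1))) by (apply Rdiv_lt_0_compat; lra).
destruct (cont_rect_uniform f x0 x1 y0 y1 H _ He') as [d1 [Hd1 K1]].
assert (B : forall x, x0 <= x <= x1 -> exists M, 0 <= M /\ forall y, y0 <= y <= y1 -> Cmod (f (x, y)) <= M).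
{ intros x Hxx. apply (cont_bounded (fun y => Cmod (f (x, y)))); [exact Hy|].
  intros t Ht. apply (continuous_Cmod (fun y => f (x, y))). apply (cont_rect_v f x0 x1 y0 y1 x); assumption. }
destruct (B x0) as [M0 [HM0 B0]]; [lra|]. destruct (B x1) as [M1 [HM1 B1]]; [lra|].
set (d2 := eps / (2 * (M0 + M1 + 1))).
assert (Hd2 : 0 < d2) by (apply Rdiv_lt_0_compat; lra).
exists (Rmin d1 d2). split; [apply Rmin_glb_lt; assumption|].
intros s t Hs Hst Ht Hd.
pose proof (Rmin_l d1 d2). pose proof (Rmin_r d1 d2).
unfold Crect.
assert (Hi : Cmod Ci = 1).
{ unfold Cmod, Ci; simpl. replace (0 * (0 * 1) + 1 * (1 * 1)) with 1 by ring. apply sqrt_1. }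
eapply Rle_trans; [apply Cmod_triangle|]. rewrite Cmod_mult, Hi.
assert (T1 : Cmod (Cint (fun x => f (x, s)) x0 x1 - Cint (fun x => f (x, t)) x0 x1) <= eps / 2).
{ rewrite <- Cint_minus; try assumption.
  2: eapply cont_rect_h; [exact H|lra]. 2: eapply cont_rect_h; [exact H|lra].
  eapply Rle_trans; [apply Cint_bound with (M := eps / (2 * (x1 - x0 + 1))); [exact Hx| |]|].
  - apply (cont_on_minus (fun x => f (x, s)) (fun x => f (x, t))); eapply cont_rect_h; [exact H|lra|exact H|lra].
  - intros x Hxx. left. apply K1; try lra; apply Rabs_def1; lra.
  - apply Rle_trans with ((x1 - x0 + 1) * (eps / (2 * (x1 - x0 + 1)))).
    + apply Rmult_le_compat_r; lra.
    + right. field. lra. }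
assert (T2 : Cmod (Cint (fun y => f (x1, y)) s t) <= (t - s) * M1).
{ apply Cint_bound; [exact Hst| |].
  - eapply cont_on_sub; [eapply cont_rect_v; [exact H|lra]|lra|lra].
  - intros; apply B1; lra. }
assert (T3 : Cmod (Cint (fun y => f (x0, y)) s t) <= (t - s) * M0).
{ apply Cint_bound; [exact Hst| |].
  - eapply cont_on_sub; [eapply cont_rect_v; [exact H|lra]|lra|lra].
  - intros; apply B0; lra. }
assert (T4 : (t - s) * (M0 + M1) <= eps / 2).
{ apply Rle_trans with (d2 * (M0 + M1 + 1)).
  - apply Rmult_le_compat; lra.
  - right. unfold d2. field. lra. }
pose proof (Cmod_minus_triangle (Cint (fun y => f (x1, y)) s t) (Cint (fun y => f (x0, y)) s t)).
lra.
Qed.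

(** Differentiability may fail on the horizontal sides, where continuity is
    enough: shrink the rectangle and pass to the limit. *)
Lemma Goursat_inner f x0 x1 y0 y1 : x0 <= x1 -> y0 <= y1 -> cont_rect f x0 x1 y0 y1 ->
  (forall x y, x0 <= x <= x1 -> y0 < y < y1 -> exists l, Cd f (x, y) l) ->
  Crect f x0 x1 y0 y1 = RtoC 0.
Proof.
intros Hx Hy HC HD.
destruct (Ceq_dec (Crect f x0 x1 y0 y1) 0) as [E|N]; [exact E|exfalso].
apply Cmod_pos in N. set (I0 := Cmod (Crect f x0 x1 y0 y1)) in *.
assert (He : 0 < I0 / 3) by lra.
destruct (Crect_thin f x0 x1 y0 y1 Hx Hy HC _ He) as [d [Hd K]].
destruct (Rle_lt_or_eq_dec y0 y1 Hy) as [Hlt|Heq].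
2: { specialize (K y0 y1). unfold I0 in *. lra. }
set (h := Rmin (d / 2) ((y1 - y0) / 3)).
assert (Hh : 0 < h) by (apply Rmin_glb_lt; lra).
assert (h <= d / 2) by apply Rmin_l. assert (h <= (y1 - y0) / 3) by apply Rmin_r.
assert (E : I0 <= I0 / 3 + I0 / 3).
{ unfold I0 at 1. rewrite (Crect_split_y f x0 x1 y0 (y0 + h) y1); try lra; try assumption.
  rewrite (Crect_split_y f x0 x1 (y0 + h) (y1 - h) y1); try lra.
  2: apply (cont_rect_sub f x0 x1 y0 y1); try assumption; lra.
  rewrite (Goursat_closed f x0 x1 (y0 + h) (y1 - h)); try lra.
  2: { intros x y Hxx Hyy. apply HD; lra. }
  rewrite Cplus_0_l. eapply Rle_trans; [apply Cmod_triangle|].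
  apply Rplus_le_compat; apply K; lra. }
lra.
Qed.

(** The exceptional height [ys] covers continuous functions that are holomorphic off
    one point, such as the difference quotients in Cauchy's formula. *)
Lemma Goursat f x0 x1 y0 ys y1 : x0 <= x1 -> y0 <= ys <= y1 -> cont_rect f x0 x1 y0 y1 ->
  (forall x y, x0 <= x <= x1 -> y0 < y < y1 -> y <> ys -> exists l, Cd f (x, y) l) ->
  Crect f x0 x1 y0 y1 = RtoC 0.
Proof.
intros Hx Hy HC HD. rewrite (Crect_split_y f x0 x1 y0 ys y1); try assumption.
rewrite !Goursat_inner; try lra; try (apply (cont_rect_sub f x0 x1 y0 y1); try assumption; lra).
- ring.
- intros x y Hxx Hyy. apply HD; lra.
- intros x y Hxx Hyy. apply HD; lra.
Qed.

(** * Periodic holomorphic functions: Cauchy's formula in logarithmic coordinates *)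

Lemma cexp_period x y : cexp (x, y + 2 * PI) = cexp (x, y).
Proof. unfold cexp; simpl. rewrite cos_plus, sin_plus, cos_2PI, sin_2PI. f_equal; ring. Qed.

Lemma cexp_inj z w : Rabs (snd z - snd w) <= PI -> cexp z = cexp w -> z = w.
Proof.
intros Ha E. assert (Em : Cmod (cexp z) = Cmod (cexp w)) by (rewrite E; reflexivity).
rewrite !Cmod_cexp in Em. apply exp_inv in Em.
assert (Ec : cexp (z - w) = RtoC 1).
{ unfold Cminus. rewrite cexp_plus, cexp_opp, E. field. apply cexp_neq0. }
unfold cexp, Cminus, Cplus, Copp in Ec; simpl in Ec.
apply (f_equal fst) in Ec. simpl in Ec. rewrite Em in Ec.
replace (fst w + - fst w) with 0 in Ec by ring. rewrite exp_0, Rmult_1_l in Ec.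
destruct z as [x y]. destruct w as [x' y']. simpl in *. subst x'. f_equal.
assert (Ed : cos (Rabs (y - y')) = 1).
{ unfold Rabs. destruct Rcase_abs; [rewrite cos_neg|]; exact Ec. }
pose proof (Rabs_pos (y - y')) as Hp.
destruct (Req_dec (Rabs (y - y')) 0) as [Z|Z].
- destruct (Req_dec (y - y') 0) as [Z'|Z']; [lra|]. apply Rabs_no_R0 in Z'. contradiction.
- exfalso. rewrite <- cos_0 in Ed.
  assert (cos (Rabs (y - y')) < cos 0) by (apply cos_decreasing_1; lra). lra.
Qed.

(** The branch of the logarithm is unimportant; the bound on the argument places
    [z] in one period. *)
Lemma polar (w : C) : w <> RtoC 0 ->
  exists z, cexp z = w /\ fst z = ln (Cmod w) /\ - PI <= snd z <= PI.
Proof.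
intros N. pose proof (Cmod_pos w N) as Hr. set (r := Cmod w) in *.
assert (Hsq : (fst w / r) ^ 2 + (snd w / r) ^ 2 = 1).
{ pose proof (Cmod_sqr w) as E. fold r in E. field_simplify; [|lra]. rewrite <- E. field. lra. }
set (x := fst w / r) in *. set (y := snd w / r) in *.
assert (Hx : -1 <= x <= 1) by nra.
pose proof (acos_bound x) as Hb.
assert (Hs : sin (acos x) = Rabs y).
{ rewrite sin_acos by exact Hx. rewrite <- sqrt_Rsqr_abs. f_equal. unfold Rsqr. nra. }
assert (K : forall th, cos th = x -> sin th = y -> cexp (ln r, th) = w).
{ intros th E1 E2. unfold cexp; simpl. rewrite exp_ln, E1, E2 by exact Hr.
  unfold x, y. rewrite (surjective_pairing w) at 3. f_equal; field; lra. }
destruct (Rle_or_lt 0 y) as [Hy|Hy].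
- exists (ln r, acos x). split; [|simpl; split; [reflexivity|lra]].
  apply K; [apply cos_acos, Hx|rewrite Hs; apply Rabs_pos_eq, Hy].
- exists (ln r, - acos x). split; [|simpl; split; [reflexivity|lra]].
  apply K; [rewrite cos_neg; apply cos_acos, Hx|].
  rewrite sin_neg, Hs, Rabs_left by exact Hy. ring.
Qed.

Lemma Cint_period_aux (u : R -> C) a b : (forall t, continuous u t) -> (forall t, u (t + 2 * PI) = u t) ->
  a <= b <= a + 2 * PI -> Cint u a (a + 2 * PI) = Cint u b (b + 2 * PI).
Proof.
intros Hc Hp Hab. pose proof PI_RGT_0.
rewrite <- (Cint_Chasles u a b (a + 2 * PI)), <- (Cint_Chasles u b (a + 2 * PI) (b + 2 * PI));
 try lra; try (intros t _; apply Hc).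
rewrite <- (Cint_shift u a b (2 * PI)); [|lra|intros t _; apply Hc].
rewrite (Cint_ext (fun t => u (t + 2 * PI)) u a b); [ring|lra|auto].
Qed.

Lemma Cint_period (u : R -> C) t : (forall t, continuous u t) -> (forall t, u (t + 2 * PI) = u t) ->
  - PI - 2 * PI <= t <= PI -> Cint u t (t + 2 * PI) = Cint u (- PI) PI.
Proof.
intros Hc Hp Ht. transitivity (Cint u (- PI) (- PI + 2 * PI)); [|f_equal; ring].
destruct (Rle_or_lt t (- PI)).
- apply Cint_period_aux; auto; lra.
- symmetry. apply Cint_period_aux; auto; lra.
Qed.

Lemma Cmod_small_0 (z : C) : (forall eps, 0 < eps -> Cmod z <= eps) -> z = RtoC 0.
Proof.
intros H. destruct (Ceq_dec z 0) as [E|N]; [exact E|].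
apply Cmod_pos in N. specialize (H (Cmod z / 2)). lra.
Qed.

Definition holo (f : C -> C) (z : C) : Prop := exists l, Cd f z l.

Lemma holo_continuous f z : holo f z -> continuous f z.
Proof. intros [l H]. apply (Cd_continuous _ _ _ H). Qed.

Lemma holo_line f s t : holo f (s, t) -> continuous (fun y => f (s, y)) t.
Proof.
intros H. apply (continuous_comp (fun y => (s, y) : C) f).
- apply continuous_pair; [apply continuous_const|apply continuous_id].
- apply holo_continuous, H.
Qed.

(** The two horizontal sides cancel, so the integral over a period does not
    depend on the abscissa. *)
Lemma period_integral_const g t ys s0 s1 : s0 <= s1 -> t <= ys <= t + 2 * PI ->
  cont_rect g s0 s1 t (t + 2 * PI) ->
  (forall x y, s0 <= x <= s1 -> t < y < t + 2 * PI -> y <> ys -> holo g (x, y)) ->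
  (forall x, s0 <= x <= s1 -> g (x, t + 2 * PI) = g (x, t)) ->
  Cint (fun y => g (s0, y)) t (t + 2 * PI) = Cint (fun y => g (s1, y)) t (t + 2 * PI).
Proof.
intros Hs Ht HC HH HP. pose proof PI_RGT_0.
pose proof (Goursat g s0 s1 t ys (t + 2 * PI) Hs Ht HC HH) as G. unfold Crect in G.
rewrite (Cint_ext (fun x => g (x, t + 2 * PI)) (fun x => g (x, t)) s0 s1 Hs HP) in G.
set (A := Cint (fun x => g (x, t)) s0 s1) in G.
set (B := Cint (fun y => g (s0, y)) t (t + 2 * PI)) in *.
set (D := Cint (fun y => g (s1, y)) t (t + 2 * PI)) in *.
assert (E : (Ci * (D - B) = 0)%C) by (rewrite <- G; ring).
apply Ceq_minus. transitivity (- (/ Ci) * (Ci * (D - B)))%C; [field; apply Ci_nz|].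
rewrite E. ring.
Qed.

Lemma period_integral_const' g s0 s1 : s0 <= s1 ->
  (forall x y, s0 <= x <= s1 -> holo g (x, y)) ->
  (forall x y, s0 <= x <= s1 -> g (x, y + 2 * PI) = g (x, y)) ->
  Cint (fun y => g (s0, y)) (- PI) PI = Cint (fun y => g (s1, y)) (- PI) PI.
Proof.
intros Hs HH HP. pose proof PI_RGT_0.
assert (K : Cint (fun y => g (s0, y)) (- PI) (- PI + 2 * PI) = Cint (fun y => g (s1, y)) (- PI) (- PI + 2 * PI)).
{ apply period_integral_const with (ys := 0); try lra; auto.
  intros x y Hx _. apply holo_continuous, HH, Hx. }
replace (- PI + 2 * PI) with PI in K by ring. exact K.
Qed.

(** The integral does not depend on the abscissa, and the integrand tends to [1]
    when the abscissa tends to infinity. *)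
Lemma kernel_mean s w : Cmod w < exp s ->
  Cint (fun y => cexp (s, y) / (cexp (s, y) - w))%C (- PI) PI = RtoC (2 * PI).
Proof.
intros Hw. pose proof PI_RGT_0. set (g := fun z => (cexp z / (cexp z - w))%C).
assert (Nz : forall x y, s <= x -> (cexp (x, y) - w)%C <> RtoC 0).
{ intros x y Hx E. apply Ceq_minus in E. rewrite <- E, Cmod_cexp in Hw. simpl in Hw.
  destruct Hx as [Hx|Hx]; [apply exp_increasing in Hx; lra|subst; lra]. }
assert (Hh : forall x y, s <= x -> holo g (x, y)).
{ intros x y Hx. eexists. apply Cd_div; [apply Cd_cexp| |apply Nz, Hx].
  apply Cd_minus; [apply Cd_cexp|apply Cd_const]. }
assert (Hc : forall x, s <= x -> Cint (fun y => g (s, y)) (- PI) PI = Cint (fun y => g (x, y)) (- PI) PI).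
{ intros x Hx. apply period_integral_const'; [exact Hx| |].
  - intros a y Ha. apply Hh. lra.
  - intros a y Ha. unfold g. rewrite cexp_period. reflexivity. }
change (Cint (fun y => g (s, y)) (- PI) PI = RtoC (2 * PI)).
apply Ceq_minus, Cmod_small_0. intros eps He.
set (m := Cmod w * (1 + 2 * PI / eps) + exp s).
assert (Hm0 : 0 <= Cmod w) by apply Cmod_ge_0.
assert (Hq : 0 < 2 * PI / eps) by (apply Rdiv_lt_0_compat; lra).
assert (Hm : exp s <= m) by (unfold m; pose proof (Rmult_le_pos (Cmod w) (1 + 2 * PI / eps) Hm0 ltac:(lra)); lra).
pose proof (exp_pos s) as Hes.
set (x := ln m).
assert (Ex : exp x = m) by (apply exp_ln; lra).
assert (Hx : s <= x).
{ destruct (Rle_or_lt s x) as [L|L]; [exact L|]. apply exp_increasing in L. lra. }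
rewrite (Hc x Hx).
assert (E1 : RtoC (2 * PI) = Cint (fun _ => RtoC 1) (- PI) PI).
{ rewrite Cint_const. replace (PI - - PI) with (2 * PI) by ring. ring. }
rewrite E1, <- Cint_minus; [|lra|intros y _; apply holo_line, Hh, Hx|intros y _; apply continuous_const].
eapply Rle_trans; [apply Cint_bound with (M := eps / (2 * PI)); [lra| |]|].
- apply (cont_on_minus (fun y => g (x, y)) (fun _ => RtoC 1)).
  + intros y _. apply holo_line, Hh, Hx.
  + intros y _. apply continuous_const.
- intros y _. specialize (Nz x y Hx). unfold g.
  replace (cexp (x, y) / (cexp (x, y) - w) - 1)%C with (w / (cexp (x, y) - w))%C by (field; exact Nz).
  rewrite Cmod_div by exact Nz.
  assert (B : Cmod w * (2 * PI / eps) < Cmod (cexp (x, y) - w)).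
  { pose proof (Cmod_triangle_rev (cexp (x, y)) w) as T. rewrite Cmod_cexp in T. simpl fst in T.
    rewrite Ex in T. unfold m in T. lra. }
  apply Rle_div_l; [apply Cmod_pos, Nz|].
  apply Rle_trans with (eps / (2 * PI) * (Cmod w * (2 * PI / eps))).
  + right. field. lra.
  + apply Rmult_le_compat_l; [apply Rlt_le, Rdiv_lt_0_compat; lra|lra].
- right. field. lra.
Qed.

(** [F] is a periodic function of the logarithm of [z], bounded near the
    puncture [z = 0]. *)
Definition periodic_holo (F : C -> C) (S : R) : Prop :=
  (forall z, fst z < S -> holo F z) /\
  (forall x y, x < S -> F (x, y + 2 * PI) = F (x, y)) /\
  exists S0 B, forall z, fst z < S0 -> Cmod (F z) <= B.

Lemma periodic_holo_line F S s : periodic_holo F S -> s < S -> forall t, continuous (fun y => F (s, y)) t.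
Proof. intros [H _] Hs t. apply holo_line, H, Hs. Qed.

(** The difference quotient [(F - F z0) / (exp - exp z0)] is continuous at [z0],
    and on lines far to the left it is small because [F] stays bounded there. *)
Theorem Cauchy_formula F S z0 s : periodic_holo F S -> fst z0 < s -> s < S -> - PI <= snd z0 <= PI ->
  Cint (fun y => F (s, y) * (cexp (s, y) / (cexp (s, y) - cexp z0)))%C (- PI) PI
  = (RtoC (2 * PI) * F z0)%C.
Proof.
intros [HF [HP [S0 [B HB]]]] Hz Hs Hi. pose proof PI_RGT_0 as Hpi.
destruct z0 as [x0 t0] eqn:E0. simpl in Hz, Hi. rewrite <- E0 in *.
assert (Hx0 : fst z0 = x0) by (rewrite E0; reflexivity).
assert (Ht0 : snd z0 = t0) by (rewrite E0; reflexivity).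
destruct (HF z0 ltac:(rewrite Hx0; lra)) as [l Hl].
pose proof (Cd_cexp z0) as He.
destruct Hl as [q [Hq [Hql Hqf]]]. destruct He as [r [Hr [Hrl Hrf]]].
set (k := fun z => (q z / r z * cexp z)%C).
set (k0 := fun z => ((F z - F z0) * cexp z / (cexp z - cexp z0))%C).
assert (Nz : forall z, Rabs (snd z - t0) <= PI -> z <> z0 -> (cexp z - cexp z0)%C <> RtoC 0).
{ intros z Hd N E. apply N. apply Ceq_minus in E. apply cexp_inj; [|exact E]. rewrite Ht0. exact Hd. }
assert (Ek : forall z, Rabs (snd z - t0) <= PI -> z <> z0 -> k z = k0 z).
{ intros z Hd N. specialize (Nz z Hd N). unfold k, k0.
  assert (N1 : (z - z0)%C <> RtoC 0) by (apply Cminus_eq_contra; exact N).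
  assert (E1 : (F z - F z0)%C = ((z - z0) * q z)%C) by (rewrite (Hqf z); ring).
  assert (E2 : (cexp z - cexp z0)%C = ((z - z0) * r z)%C) by (rewrite (Hrf z); ring).
  rewrite E1, E2. rewrite E2 in Nz. field. split; [|exact N1].
  intros R0. apply Nz. rewrite R0. ring. }
assert (Hk0 : forall z, fst z < S -> (cexp z - cexp z0)%C <> RtoC 0 -> holo k0 z).
{ intros z Hzs N. destruct (HF z Hzs) as [m Hm]. eexists. unfold k0.
  apply Cd_div; [apply Cd_mult; [apply Cd_minus; [exact Hm|apply Cd_const]|apply Cd_cexp]| |exact N].
  apply Cd_minus; [apply Cd_cexp|apply Cd_const]. }
assert (Hnear : forall z, Rabs (snd z - t0) < PI -> z <> z0 -> exists d, 0 < d /\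
   forall w, Cmod (w - z) < d -> k0 w = k w).
{ intros z Hd N. assert (N1 : 0 < Cmod (z - z0)) by (apply Cmod_pos, Cminus_eq_contra, N).
  exists (Rmin (Cmod (z - z0)) (PI - Rabs (snd z - t0))). split; [apply Rmin_glb_lt; lra|].
  intros w Hw. symmetry. apply Ek.
  - assert (Hw2 : Cmod (w - z) < PI - Rabs (snd z - t0)) by (eapply Rlt_le_trans; [exact Hw|apply Rmin_r]).
    pose proof (Cmod_snd_le (w - z)) as T. simpl in T.
    replace (snd w - t0) with ((snd w + - snd z) + (snd z - t0)) by ring.
    eapply Rle_trans; [apply Rabs_triang|]. lra.
  - intros ->. assert (Cmod (z0 - z) < Cmod (z - z0)) by (eapply Rlt_le_trans; [exact Hw|apply Rmin_l]).
    rewrite Cmod_minus_sym in H. lra. }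
(* [k] is continuous at [z0] but not periodic; off [z0] it is replaced by [k0], which is. *)
set (g := fun z => if Ceq_dec z z0 then k z0 else k0 z).
assert (Hg : forall z, Rabs (snd z - t0) <= PI -> g z = k z).
{ intros z Hd. unfold g. destruct (Ceq_dec z z0) as [->|N]; [reflexivity|]. symmetry; apply Ek; assumption. }
assert (Hgc : forall z, fst z < S -> Rabs (snd z - t0) <= PI -> z <> z0 -> holo g z).
{ intros z Hzs Hd N. destruct (Hk0 z Hzs (Nz z Hd N)) as [m Hm]. exists m.
  apply Cd_ext_loc with k0; [|exact Hm].
  exists (Cmod (z - z0)). split; [apply Cmod_pos, Cminus_eq_contra, N|].
  intros w Hw. unfold g. destruct (Ceq_dec w z0) as [->|_]; [|reflexivity].
  rewrite Cmod_minus_sym in Hw. lra. }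
assert (Hgz : continuous g z0).
{ apply continuous_ext_loc with k.
  - apply locally_C. exists PI. split; [exact Hpi|]. intros w Hw. symmetry. apply Hg.
    pose proof (Cmod_snd_le (w - z0)) as T. simpl in T. rewrite Ht0 in T. unfold Rminus. lra.
  - unfold k. apply continuous_Cmult; [|apply continuous_cexp, continuous_id].
    apply continuous_Cdiv; [exact Hq|exact Hr|]. rewrite Hrl. apply cexp_neq0. }
assert (Hcont : forall z, fst z < S -> Rabs (snd z - t0) <= PI -> continuous g z).
{ intros z Hzs Hd. destruct (Ceq_dec z z0) as [->|N]; [exact Hgz|]. apply holo_continuous, Hgc; assumption. }
assert (Hab : forall y, t0 - PI <= y <= t0 - PI + 2 * PI -> Rabs (y - t0) <= PI).
{ intros y Hy. apply Rabs_le. lra. }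
assert (Hk0p : forall x y, x < S -> k0 (x, y + 2 * PI) = k0 (x, y)).
{ intros x y Hx. unfold k0. rewrite cexp_period, HP by exact Hx. reflexivity. }
assert (Hconst : forall s', s' < x0 -> Cint (fun y => g (s', y)) (t0 - PI) (t0 - PI + 2 * PI) =
   Cint (fun y => g (s, y)) (t0 - PI) (t0 - PI + 2 * PI)).
{ intros s' Hs'. apply period_integral_const with (ys := t0); try lra.
  - intros x y Hx Hy. apply Hcont; [simpl; lra|apply Hab, Hy].
  - intros x y Hx Hy Hne. apply Hgc; [simpl; lra|apply Hab; simpl; lra|]. rewrite E0. congruence.
  - intros x Hx. unfold g. destruct (Ceq_dec _ _) as [E|_].
    { exfalso. rewrite E0 in E. injection E as _ E. lra. }
    destruct (Ceq_dec _ _) as [E|_].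
    { exfalso. rewrite E0 in E. injection E as _ E. lra. }
    apply Hk0p. lra. }
assert (HI : Cint (fun y => k0 (s, y)) (- PI) PI = RtoC 0).
{ assert (Ns : forall y, (cexp (s, y) - cexp z0)%C <> RtoC 0).
  { intros y E. apply Ceq_minus in E. apply (f_equal Cmod) in E. rewrite !Cmod_cexp in E. simpl in E.
    apply exp_inv in E. lra. }
  rewrite <- (Cint_period (fun y => k0 (s, y)) (t0 - PI)); try lra.
  2: { intros t. apply holo_line, Hk0; [simpl; lra|apply Ns]. }
  2: { intros t. apply Hk0p, Hs. }
  rewrite (Cint_ext (fun y => k0 (s, y)) (fun y => g (s, y))); [|lra|].
  2: { intros y Hy. unfold g. destruct (Ceq_dec _ _) as [E|_]; [|reflexivity].
       exfalso. rewrite E0 in E. injection E as E _. lra. }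
  apply Cmod_small_0. intros eps Heps.
  assert (HB0 : 0 <= B).
  { specialize (HB (S0 - 1, 0) ltac:(simpl; lra)). pose proof (Cmod_ge_0 (F (S0 - 1, 0))). lra. }
  set (M := B + Cmod (F z0)).
  assert (HM : 0 <= M) by (unfold M; pose proof (Cmod_ge_0 (F z0)); lra).
  pose proof (exp_pos x0) as Hex.
  set (dlt := Rmin (eps * (exp x0 / 2) / (2 * PI * (M + 1))) (exp x0 / 2)).
  assert (Hdlt : 0 < dlt).
  { apply Rmin_glb_lt; [|lra]. apply Rdiv_lt_0_compat; nra. }
  set (s' := Rmin (ln dlt) (Rmin (S0 - 1) (x0 - 1))).
  assert (Hs1 : exp s' <= dlt).
  { rewrite <- (exp_ln dlt Hdlt). destruct (Rle_lt_or_eq_dec s' (ln dlt) (Rmin_l _ _)) as [L|L].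
    - left; apply exp_increasing, L.
    - rewrite L; lra. }
  assert (Hs2 : s' <= S0 - 1) by (eapply Rle_trans; [apply Rmin_r|apply Rmin_l]).
  assert (Hs3 : s' <= x0 - 1) by (eapply Rle_trans; [apply Rmin_r|apply Rmin_r]).
  rewrite <- (Hconst s') by lra.
  eapply Rle_trans; [apply Cint_bound with (M := eps / (2 * PI)); [lra| |]|].
  - intros y Hy. apply (continuous_comp (fun y => (s', y) : C) g).
    + apply continuous_pair; [apply continuous_const|apply continuous_id].
    + apply Hcont; [simpl; lra|apply Hab, Hy].
  - intros y Hy. unfold g. destruct (Ceq_dec _ _) as [E|_].
    { exfalso. rewrite E0 in E. injection E as E _. lra. }
    assert (Hd1 : dlt <= exp x0 / 2) by apply Rmin_r.
    assert (Hd2 : dlt <= eps * (exp x0 / 2) / (2 * PI * (M + 1))) by apply Rmin_l.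
    assert (T : exp x0 / 2 <= Cmod (cexp (s', y) - cexp z0)).
    { rewrite Cmod_minus_sym. pose proof (Cmod_triangle_rev (cexp z0) (cexp (s', y))) as T.
      rewrite !Cmod_cexp in T. simpl fst in T. rewrite Hx0 in T. lra. }
    unfold k0. rewrite Cmod_div by (intros E; rewrite E, Cmod_0 in T; lra).
    apply Rle_div_l; [lra|]. rewrite Cmod_mult, Cmod_cexp. simpl fst.
    apply Rle_trans with (M * dlt).
    + apply Rmult_le_compat; [apply Cmod_ge_0|left; apply exp_pos| |exact Hs1].
      eapply Rle_trans; [apply Cmod_minus_triangle|]. unfold M. apply Rplus_le_compat_r.
      apply HB. simpl. lra.
    + apply Rle_trans with (eps / (2 * PI) * (exp x0 / 2)).
      2: { apply Rmult_le_compat_l; [|exact T]. apply Rlt_le, Rdiv_lt_0_compat; lra. }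
      apply Rle_trans with ((M + 1) * (eps * (exp x0 / 2) / (2 * PI * (M + 1)))).
      * apply Rmult_le_compat; lra.
      * right. field. lra.
  - right. field. lra. }
assert (Hw : Cmod (cexp z0) < exp s) by (rewrite Cmod_cexp, Hx0; apply exp_increasing, Hz).
assert (Ns : forall y, (cexp (s, y) - cexp z0)%C <> RtoC 0).
{ intros y E. apply Ceq_minus in E. rewrite <- E, Cmod_cexp in Hw. simpl in Hw. lra. }
assert (Ck : forall t, continuous (fun y => cexp (s, y) / (cexp (s, y) - cexp z0))%C t).
{ intros t. assert (Ce : continuous (fun y => cexp (s, y)) t).
  { apply continuous_cexp, continuous_pair; [apply continuous_const|apply continuous_id]. }
  apply continuous_Cdiv; [exact Ce| |apply Ns]. apply continuous_Cminus; [exact Ce|apply continuous_const]. }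
assert (CF : forall t, continuous (fun y => F (s, y)) t) by (intros t; apply holo_line, HF, Hs).
rewrite <- (kernel_mean s (cexp z0) Hw). rewrite Cmult_comm.
apply Ceq_minus. rewrite <- Cint_scal; [|lra|intros y _; apply Ck].
rewrite <- Cint_minus; [|lra| |].
- rewrite <- HI. apply Cint_ext; [lra|]. intros y _. unfold k0. field. apply Ns.
- intros y _. apply continuous_Cmult; [apply CF|apply Ck].
- intros y _. apply continuous_Cmult; [apply continuous_const|apply Ck].
Qed.

(** * Removable singularities, identity theorem, Liouville's theorem *)

(** Integrals of Cauchy type, closed under differentiation: up to the factor [k]
    the derivative is the integral with exponent [k + 1]. *)
Definition kernel_int (u e : R -> C) (a b : R) (k : nat) (w : C) : C :=
  Cint (fun t => u t * (/ (e t - w)) ^ k)%C a b.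

(** With [p = 1 / (e - w)], [q = 1 / (e - w - h)]: the second order estimate, uniform
    in [e], that allows differentiation under the integral sign. *)
Lemma inverse_power_taylor (K : R) (k : nat) : 0 <= K -> exists c, 0 <= c /\
  forall p q h : C, Cmod p <= K -> Cmod q <= K -> (q - p)%C = (h * p * q)%C ->
  Cmod (q ^ k - p ^ k - INR k * h * p ^ (S k)) <= c * Cmod h ^ 2.
Proof.
intros HK. induction k as [|k [c [Hc IH]]].
- exists 0. split; [lra|]. intros p q h _ _ _. simpl.
  replace (1 - 1 - 0 * h * (p * 1))%C with (RtoC 0) by ring. rewrite Cmod_0. lra.
- exists (K * c + INR (S k) * K ^ (k + 3)). split.
  { apply Rplus_le_le_0_compat; apply Rmult_le_pos; try assumption; [apply pos_INR|apply pow_le, HK]. }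
  intros p q h Hp Hq E. specialize (IH p q h Hp Hq E).
  replace (q ^ S k - p ^ S k - INR (S k) * h * p ^ S (S k))%C with
    (q * (q ^ k - p ^ k - INR k * h * p ^ S k) + INR (S k) * (h * h * (p ^ (S (S k)) * q)))%C.
  + eapply Rle_trans; [apply Cmod_triangle|]. rewrite !Cmod_mult, Cmod_pow, Cmod_R.
    rewrite (Rabs_pos_eq (INR (S k))) by apply pos_INR. pose proof (Cmod_ge_0 h) as Hh.
    rewrite Rmult_plus_distr_r. apply Rplus_le_compat.
    * rewrite (Rmult_assoc K c). apply Rmult_le_compat; auto using Cmod_ge_0.
    * rewrite (Rmult_assoc (INR (S k)) (K ^ (k + 3))). apply Rmult_le_compat_l; [apply pos_INR|].
      apply Rle_trans with (Cmod h * Cmod h * (K ^ S (S k) * K)).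
      -- apply Rmult_le_compat_l; [nra|]. apply Rmult_le_compat; try apply pow_le; try apply Cmod_ge_0; [|exact Hq].
         apply pow_incr. split; [apply Cmod_ge_0|exact Hp].
      -- right. replace (k + 3)%nat with (S (S (S k))) by lia. simpl. ring.
  + rewrite S_INR, RtoC_plus. rewrite !Cpow_S.
    set (n := RtoC (INR k)). set (pk := (p ^ k)%C). set (qk := (q ^ k)%C). apply Ceq_minus.
    transitivity (- (pk + (n + 1) * h * p * pk) * ((q - p) - h * p * q))%C; [ring|].
    rewrite E. ring.
Qed.

Lemma kernel_int_Cd u e a b k w r : a <= b -> cont_on u a b -> cont_on e a b ->
  (forall t, a <= t <= b -> r <= Cmod (e t)) -> Cmod w < r ->
  Cd (kernel_int u e a b k) w (INR k * kernel_int u e a b (S k) w)%C.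
Proof.
intros Hab Hu He Hr Hw. set (d0 := (r - Cmod w) / 2). assert (Hd0 : 0 < d0) by (unfold d0; lra).
assert (Hz : forall z t, Cmod (z - w) < d0 -> a <= t <= b -> d0 <= Cmod (e t - z)).
{ intros z t Hz Ht. specialize (Hr t Ht).
  pose proof (Cmod_triangle_rev (e t) z). pose proof (Cmod_triangle_rev z w). unfold d0 in *. lra. }
assert (Nz : forall z t, Cmod (z - w) < d0 -> a <= t <= b -> (e t - z)%C <> RtoC 0).
{ intros z t H Ht. apply Cmod_gt_0. specialize (Hz z t H Ht). lra. }
assert (Hww : Cmod (w - w) < d0) by (replace (w - w)%C with (RtoC 0) by ring; rewrite Cmod_0; exact Hd0).
assert (Cc : forall z j, Cmod (z - w) < d0 -> cont_on (fun t => u t * (/ (e t - z)) ^ j)%C a b).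
{ intros z j H t Ht. apply continuous_Cmult; [apply Hu, Ht|]. apply continuous_Cpow, continuous_Cinv.
  - apply continuous_Cminus; [apply He, Ht|apply continuous_const].
  - apply Nz; assumption. }
destruct (cont_bounded (fun t => Cmod (u t)) a b Hab) as [M [HM0 HM]].
{ intros t Ht. apply continuous_Cmod, Hu, Ht. }
destruct (inverse_power_taylor (/ d0) k) as [c [Hc HT]]; [left; apply Rinv_0_lt_compat, Hd0|].
apply Cd_epsilon. intros eps Heps.
set (A := (b - a) * (M * c) + 1).
assert (HA : 0 < A).
{ unfold A. assert (0 <= (b - a) * (M * c)) by (apply Rmult_le_pos; [lra|apply Rmult_le_pos; assumption]). lra. }
exists (Rmin d0 (eps / A)). split; [apply Rmin_glb_lt; [exact Hd0|apply Rdiv_lt_0_compat; assumption]|].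
intros z Hzd.
assert (H1 : Cmod (z - w) < d0) by (eapply Rlt_le_trans; [exact Hzd|apply Rmin_l]).
assert (H2 : Cmod (z - w) < eps / A) by (eapply Rlt_le_trans; [exact Hzd|apply Rmin_r]).
set (h := (z - w)%C) in *.
assert (E : (kernel_int u e a b k z - kernel_int u e a b k w - h * (INR k * kernel_int u e a b (S k) w))%C
  = Cint (fun t => u t * ((/ (e t - z)) ^ k - (/ (e t - w)) ^ k - INR k * h * (/ (e t - w)) ^ (S k)))%C a b).
{ unfold kernel_int. rewrite Cmult_assoc.
  rewrite <- Cint_scal; [|exact Hab|apply Cc; exact Hww].
  rewrite <- Cint_minus; [|exact Hab|apply Cc; exact H1|apply Cc; exact Hww].
  rewrite <- Cint_minus; [|exact Hab| |].
  - apply Cint_ext; [exact Hab|]. intros t _. ring.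
  - apply (cont_on_minus (fun t => u t * (/ (e t - z)) ^ k)%C); apply Cc; assumption.
  - intros t Ht. apply continuous_Cmult; [apply continuous_const|]. apply (Cc w (S k) Hww t Ht). }
rewrite E. eapply Rle_trans; [apply Cint_bound with (M := M * (c * Cmod h ^ 2)); [exact Hab| |]|].
- intros t Ht. apply continuous_Cmult; [apply Hu, Ht|].
  assert (Cp : forall x j, Cmod (x - w) < d0 -> continuous (fun t => (/ (e t - x)) ^ j)%C t).
  { intros x j Hx. apply continuous_Cpow, continuous_Cinv; [|apply Nz; assumption].
    apply continuous_Cminus; [apply He, Ht|apply continuous_const]. }
  apply continuous_Cminus; [apply continuous_Cminus; apply Cp; assumption|].
  apply continuous_Cmult; [apply continuous_const|apply Cp; assumption].
- intros t Ht. rewrite Cmod_mult. apply Rmult_le_compat; try apply Cmod_ge_0; [apply HM, Ht|].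
  assert (Bd : forall x, Cmod (x - w) < d0 -> Cmod (/ (e t - x)) <= / d0).
  { intros x Hx. rewrite Cmod_inv by (apply Nz; assumption).
    apply Rinv_le_contravar; [exact Hd0|apply Hz; assumption]. }
  apply HT; [apply Bd, Hww|apply Bd, H1|].
  unfold h. field. split; apply Nz; assumption.
- apply Rle_trans with (A * (Cmod h * Cmod h)).
  + replace ((b - a) * (M * (c * Cmod h ^ 2))) with ((b - a) * (M * c) * (Cmod h * Cmod h)) by ring.
    apply Rmult_le_compat_r; [pose proof (Cmod_ge_0 h); nra|unfold A; lra].
  + rewrite <- Rmult_assoc. apply Rmult_le_compat_r; [apply Cmod_ge_0|].
    apply Rlt_le. apply Rlt_div_r in H2; [|exact HA]. lra.
Qed.

(** What makes the real part, the imaginary part and the squared modulus of [f]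
    of class C^2. *)
Definition C2_holo (f f1 f2 : C -> C) (U : C -> Prop) : Prop :=
  forall w, U w -> Cd f w (f1 w) /\ Cd f1 w (f2 w) /\ continuous f2 w.

Lemma circle_continuous s t : continuous (fun y => cexp (s, y)) t.
Proof. apply continuous_cexp, continuous_pair; [apply continuous_const|apply continuous_id]. Qed.

Lemma twopi_neq0 : RtoC (2 * PI) <> RtoC 0.
Proof. intros E. apply RtoC_inj in E. pose proof PI_RGT_0. lra. Qed.

(** Riemann's theorem: Cauchy's integral extends the function of [z = exp zeta]
    across the puncture. *)
Theorem removable_singularity F L s : periodic_holo F L -> s < L ->
  exists f f1 f2, C2_holo f f1 f2 (fun w => Cmod w < exp s) /\
    forall z, fst z < s -> - PI <= snd z <= PI -> F z = f (cexp z).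
Proof.
intros HF Hs. pose proof PI_RGT_0.
set (u := fun y => (F (s, y) * cexp (s, y))%C). set (e := fun y => cexp (s, y)).
set (I := kernel_int u e (- PI) PI).
assert (Hu : cont_on u (- PI) PI).
{ intros t _. apply continuous_Cmult; [apply (periodic_holo_line F L s HF Hs)|apply circle_continuous]. }
assert (He : cont_on e (- PI) PI) by (intros t _; apply circle_continuous).
assert (D : forall k w, Cmod w < exp s -> Cd (I k) w (INR k * I (S k) w)%C).
{ intros k w Hw. apply kernel_int_Cd with (r := exp s); try assumption; [lra|].
  intros t _. unfold e. rewrite Cmod_cexp. simpl. lra. }
set (c := (/ RtoC (2 * PI))%C).
exists (fun w => c * I 1%nat w)%C, (fun w => c * (INR 1 * I 2%nat w))%C,
  (fun w => c * (INR 1 * (INR 2 * I 3%nat w)))%C.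
split.
- intros w Hw. repeat split.
  + apply Cd_scal, D, Hw.
  + apply Cd_scal, Cd_scal, D, Hw.
  + do 3 (apply continuous_Cmult; [apply continuous_const|]).
    apply (Cd_continuous _ _ _ (D 3%nat w Hw)).
- intros z Hz Hi. pose proof (Cauchy_formula F L z s HF Hz Hs Hi) as K.
  unfold c, I, kernel_int.
  rewrite (Cint_ext _ (fun y => F (s, y) * (cexp (s, y) / (cexp (s, y) - cexp z)))%C); [|lra|].
  + rewrite K. field. apply twopi_neq0.
  + intros t _. unfold u, e. simpl. unfold Cdiv. ring.
Qed.

(** The Taylor coefficients, up to the factor [2 PI]; their independence of
    [s] is what makes both the identity theorem and Liouville's theorem work. *)
Definition taylor_coef (F : C -> C) (s : R) (n : nat) : C :=
  Cint (fun y => F (s, y) * (/ cexp (s, y)) ^ n)%C (- PI) PI.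

Lemma Cinv_pow_holo n z : holo (fun w => (/ cexp w) ^ n)%C z.
Proof. eexists. apply Cd_pow, Cd_inv; [apply Cd_cexp|apply cexp_neq0]. Qed.

Lemma taylor_coef_const F L s s' n : periodic_holo F L -> s <= s' -> s' < L ->
  taylor_coef F s n = taylor_coef F s' n.
Proof.
intros [HF [HP _]] Hs Hs'. unfold taylor_coef.
apply (period_integral_const' (fun w => F w * (/ cexp w) ^ n)%C); [exact Hs| |].
- intros x y Hx. destruct (HF (x, y)) as [l Hl]; [simpl; lra|].
  destruct (Cinv_pow_holo n (x, y)) as [m Hm]. eexists. apply Cd_mult; eassumption.
- intros x y Hx. rewrite HP, cexp_period by lra. reflexivity.
Qed.

Lemma taylor_coef_bound F L s n M : periodic_holo F L -> s < L ->
  (forall y, Cmod (F (s, y)) <= M) -> Cmod (taylor_coef F s n) <= 2 * PI * M * (/ exp s) ^ n.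
Proof.
intros HF Hs HM. pose proof PI_RGT_0.
eapply Rle_trans; [apply Cint_bound with (M := M * (/ exp s) ^ n); [lra| |]|].
- intros t _. apply continuous_Cmult; [apply (periodic_holo_line F L s HF Hs)|].
  apply holo_line with (f := fun w => ((/ cexp w) ^ n)%C). apply Cinv_pow_holo.
- intros t _. rewrite Cmod_mult, Cmod_pow, Cmod_inv, Cmod_cexp by apply cexp_neq0.
  apply Rmult_le_compat_r; [|apply HM]. apply pow_le. left. apply Rinv_0_lt_compat, exp_pos.
- right. ring.
Qed.

Lemma geometric_remainder (z w : C) N : z <> RtoC 0 -> (z - w)%C <> RtoC 0 ->
  (z / (z - w))%C = (sum_n (fun n => w ^ n * (/ z) ^ n) N + (w * / z) ^ (S N) * (z / (z - w)))%C.
Proof.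
intros Hz Hw. induction N as [|N IH].
- rewrite sum_O. simpl. field. split; assumption.
- rewrite sum_Sn. etransitivity; [exact IH|]. change plus with Cplus.
  rewrite <- (Cpow_mult_l w (/ z) (S N)), (Cpow_S (w * / z) (S N)).
  set (q := ((w * / z) ^ S N)%C).
  assert (E : (z / (z - w))%C = (1 + w * / z * (z / (z - w)))%C) by (field; split; assumption).
  rewrite E at 1. ring.
Qed.

Lemma Cint_sum (f : nat -> R -> C) a b N : a <= b -> (forall n, cont_on (f n) a b) ->
  cont_on (fun t => sum_n (fun n => f n t) N) a b /\
  Cint (fun t => sum_n (fun n => f n t) N) a b = sum_n (fun n => Cint (f n) a b) N.
Proof.
intros Hab H. induction N as [|N [IH1 IH2]].
- split.
  + intros t Ht. apply continuous_ext with (f 0%nat); [intros; rewrite sum_O; reflexivity|apply H, Ht].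
  + rewrite sum_O. apply Cint_ext; [exact Hab|]. intros; apply sum_O.
- assert (E : forall t, sum_n (fun n => f n t) (S N) = (sum_n (fun n => f n t) N + f (S N) t)%C).
  { intros. rewrite sum_Sn. reflexivity. }
  split.
  + intros t Ht. eapply continuous_ext; [intros; symmetry; apply E|].
    apply continuous_Cplus; [apply IH1, Ht|apply H, Ht].
  + rewrite sum_Sn. rewrite (Cint_ext _ (fun t => sum_n (fun n => f n t) N + f (S N) t)%C); [|exact Hab|auto].
    rewrite Cint_plus; [|exact Hab|exact IH1|apply H]. rewrite IH2. reflexivity.
Qed.

Lemma sum_n_zero_tail (a : nat -> C) d N : (d <= N)%nat -> (forall n, (d < n)%nat -> a n = RtoC 0) ->
  sum_n a N = sum_n a d.
Proof.
intros H Ha. induction H as [|N H IH]; [reflexivity|].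
rewrite sum_Sn, IH, Ha by lia. apply Cplus_0_r.
Qed.

(** The geometric expansion of the Cauchy kernel; its remainder is [O(r^N)] with
    [r < 1], and all terms beyond [d] vanish. *)
Theorem finite_taylor F L z s d : periodic_holo F L -> fst z < s -> s < L -> - PI <= snd z <= PI ->
  (forall n, (d < n)%nat -> taylor_coef F s n = RtoC 0) ->
  F z = sum_n (fun n => (/ RtoC (2 * PI) * taylor_coef F s n) * cexp z ^ n)%C d.
Proof.
intros HF Hz Hs Hi Hd. pose proof PI_RGT_0. set (w := cexp z).
assert (Hw : Cmod w < exp s) by (unfold w; rewrite Cmod_cexp; apply exp_increasing, Hz).
assert (Ns : forall y, (cexp (s, y) - w)%C <> RtoC 0).
{ intros y E. apply Ceq_minus in E. rewrite <- E, Cmod_cexp in Hw. simpl in Hw. lra. }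
assert (CF := periodic_holo_line F L s HF Hs).
assert (CE := circle_continuous s).
assert (Ck : forall t, continuous (fun y => cexp (s, y) / (cexp (s, y) - w))%C t).
{ intros t. apply continuous_Cdiv; [apply CE| |apply Ns]. apply continuous_Cminus; [apply CE|apply continuous_const]. }
assert (Ci' : forall t, continuous (fun y => / cexp (s, y))%C t).
{ intros t. apply continuous_Cinv; [apply CE|apply cexp_neq0]. }
set (T := fun n y => (w ^ n * (F (s, y) * (/ cexp (s, y)) ^ n))%C).
assert (CT : forall n, cont_on (T n) (- PI) PI).
{ intros n t _. apply continuous_Cmult; [apply continuous_const|].
  apply continuous_Cmult; [apply CF|]. apply continuous_Cpow, Ci'. }
set (T' := fun N y => (F (s, y) * ((w * / cexp (s, y)) ^ (S N) * (cexp (s, y) / (cexp (s, y) - w))))%C).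
assert (CT' : forall N, cont_on (T' N) (- PI) PI).
{ intros N t _. apply continuous_Cmult; [apply CF|]. apply continuous_Cmult; [|apply Ck].
  apply continuous_Cpow, continuous_Cmult; [apply continuous_const|apply Ci']. }
set (tl := taylor_coef F s) in *.
assert (E : forall N, (d <= N)%nat ->
  (RtoC (2 * PI) * F z - sum_n (fun n => tl n * w ^ n)%C d)%C = Cint (T' N) (- PI) PI).
{ intros N HN. rewrite <- (Cauchy_formula F L z s HF Hz Hs Hi). fold w.
  destruct (Cint_sum T (- PI) PI N ltac:(lra) CT) as [S1 S2].
  rewrite (Cint_ext _ (fun y => sum_n (fun n => T n y) N + T' N y)%C); [|lra|].
  - rewrite Cint_plus; [|lra|exact S1|apply CT']. rewrite S2.
    rewrite <- (sum_n_zero_tail (fun n => tl n * w ^ n)%C d N HN).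
    2: { intros n Hn. rewrite Hd by exact Hn. ring. }
    rewrite (sum_n_ext (fun n => Cint (T n) (- PI) PI) (fun n => tl n * w ^ n)%C);
     [match goal with |- ?x = ?y => change (@eq C x y) end; ring|].
    intros n. unfold T. rewrite Cint_scal; [apply Cmult_comm|lra|].
    intros t _. apply continuous_Cmult; [apply CF|]. apply continuous_Cpow, Ci'.
  - intros y _. rewrite (geometric_remainder (cexp (s, y)) w N) by (try apply cexp_neq0; apply Ns).
    unfold T, T'. rewrite Cmult_plus_distr_l. f_equal.
    rewrite <- (sum_n_mult_l (K := C_Ring) (F (s, y))). apply sum_n_ext. intros n.
    change mult with Cmult. match goal with |- ?x = ?y => change (@eq C x y) end. ring. }
assert (Z : (RtoC (2 * PI) * F z - sum_n (fun n => tl n * w ^ n)%C d)%C = RtoC 0).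
{ apply Cmod_small_0. intros eps He.
  destruct (cont_bounded (fun y => Cmod (F (s, y) * (cexp (s, y) / (cexp (s, y) - w)))%C) (- PI) PI) as [M [HM0 HM]]; [lra| |].
  { intros t _. apply continuous_Cmod, continuous_Cmult; [apply CF|apply Ck]. }
  set (r := Cmod w / exp s). pose proof (exp_pos s) as Hes.
  assert (Hr0 : 0 <= r) by (apply Rdiv_le_0_compat; [apply Cmod_ge_0|exact Hes]).
  assert (Hr : r < 1) by (apply Rlt_div_l; lra).
  assert (He' : 0 < eps / (2 * PI * (M + 1))) by (apply Rdiv_lt_0_compat; nra).
  destruct (pow_lt_1_zero r ltac:(rewrite Rabs_pos_eq; lra) _ He') as [N0 HN0].
  set (N := max d N0). rewrite (E N) by (unfold N; lia).
  eapply Rle_trans; [apply Cint_bound with (M := M * r ^ (S N)); [lra|apply CT'|]|].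
  - intros y Hy. unfold T'.
    replace (F (s, y) * ((w * / cexp (s, y)) ^ S N * (cexp (s, y) / (cexp (s, y) - w))))%C with
      ((F (s, y) * (cexp (s, y) / (cexp (s, y) - w))) * (w * / cexp (s, y)) ^ S N)%C by ring.
    rewrite Cmod_mult, Cmod_pow. apply Rmult_le_compat; try apply Cmod_ge_0; [apply pow_le, Cmod_ge_0|apply HM, Hy|].
    right. f_equal. rewrite Cmod_mult, Cmod_inv, Cmod_cexp by apply cexp_neq0. reflexivity.
  - assert (Hp : r ^ (S N) < eps / (2 * PI * (M + 1))).
    { specialize (HN0 (S N) ltac:(unfold N; lia)). rewrite Rabs_pos_eq in HN0; [exact HN0|apply pow_le, Hr0]. }
    apply Rle_trans with (2 * PI * (M + 1) * (eps / (2 * PI * (M + 1)))).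
    + replace (PI - - PI) with (2 * PI) by ring. rewrite <- Rmult_assoc.
      pose proof (pow_le r (S N) Hr0).
      apply Rmult_le_compat; try lra; try nra.
    + right. field. lra. }
assert (E2 : F z = (/ RtoC (2 * PI) * sum_n (fun n => tl n * w ^ n)%C d)%C).
{ apply Ceq_minus in Z. rewrite <- Z. field. apply twopi_neq0. }
rewrite E2. rewrite <- (sum_n_mult_l (K := C_Ring) (/ RtoC (2 * PI))%C).
apply sum_n_ext. intros n. change mult with Cmult. match goal with |- ?x = ?y => change (@eq C x y) end. ring.
Qed.

Lemma holo_pullback_exp f c r : 0 < r -> (forall z, Cmod (z - c) < r -> holo f z) ->
  periodic_holo (fun z => f (c + cexp z)%C) (ln r).
Proof.
intros Hr H.
assert (B : forall z, fst z < ln r -> Cmod (c + cexp z - c) < r).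
{ intros z Hz. replace (c + cexp z - c)%C with (cexp z) by ring. rewrite Cmod_cexp.
  rewrite <- (exp_ln r Hr). apply exp_increasing, Hz. }
split; [|split].
- intros z Hz. destruct (H _ (B z Hz)) as [l Hl]. eexists.
  apply (Cd_comp (fun w => c + cexp w)%C f); [|exact Hl].
  apply Cd_plus; [apply Cd_const|apply Cd_cexp].
- intros x y _. rewrite cexp_period. reflexivity.
- assert (Hc : continuous f c).
  { apply holo_continuous, H. replace (c - c)%C with (RtoC 0) by ring. rewrite Cmod_0. exact Hr. }
  destruct (proj1 (continuous_CC f c) Hc 1 Rlt_0_1) as [d [Hd K]].
  exists (ln d), (Cmod (f c) + 1). intros z Hz.
  specialize (K (c + cexp z)%C). replace (c + cexp z - c)%C with (cexp z) in K by ring.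
  rewrite Cmod_cexp in K.
  assert (Hlt : exp (fst z) < d) by (rewrite <- (exp_ln d Hd); apply exp_increasing, Hz).
  specialize (K Hlt). pose proof (Cmod_triangle_rev (f (c + cexp z)%C) (f c)). lra.
Qed.

(** The Taylor coefficients at [c] may be computed on a circle as small as desired,
    where [f] vanishes. *)
Theorem identity_disc f c r : (forall z, Cmod (z - c) < r -> holo f z) ->
  (exists d, 0 < d /\ forall z, Cmod (z - c) < d -> f z = RtoC 0) ->
  forall z, Cmod (z - c) < r -> f z = RtoC 0.
Proof.
intros H [d [Hd H0]] z Hz.
destruct (Ceq_dec z c) as [->|N].
{ apply H0. replace (c - c)%C with (RtoC 0) by ring. rewrite Cmod_0. exact Hd. }
apply Cminus_eq_contra in N. pose proof (Cmod_pos _ N) as Hm.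
destruct (polar _ N) as [x [Ex [Fx Ix]]].
assert (Hr : 0 < r) by lra.
pose proof (holo_pullback_exp f c r Hr H) as HF. set (F := fun z => f (c + cexp z)%C) in *.
assert (Hxr : fst x < ln r) by (rewrite Fx; apply ln_increasing; assumption).
set (s := (fst x + ln r) / 2).
assert (Zc : forall n, taylor_coef F s n = RtoC 0).
{ intros n. set (s' := Rmin s (ln d - 1)).
  rewrite <- (taylor_coef_const F (ln r) s' s n HF); [|apply Rmin_l|unfold s; lra].
  unfold taylor_coef. rewrite (Cint_ext _ (fun _ => RtoC 0)).
  - rewrite Cint_const. ring.
  - pose proof PI_RGT_0; lra.
  - intros t _. unfold F. rewrite H0; [ring|].
    replace (c + cexp (s', t) - c)%C with (cexp (s', t)) by ring. rewrite Cmod_cexp. simpl.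
    rewrite <- (exp_ln d Hd). apply exp_increasing.
    assert (s' <= ln d - 1) by apply Rmin_r. lra. }
assert (E : f z = F x) by (unfold F; rewrite Ex; f_equal; ring).
rewrite E, (finite_taylor F (ln r) x s 0 HF); try (unfold s; lra); try assumption.
- rewrite sum_O. rewrite Zc. ring.
- intros n _. apply Zc.
Qed.

(** The Taylor coefficients may be computed on a circle as large as desired, where
    the growth forces those beyond [d] to vanish. *)
Theorem Liouville_polynomial f d K R0 : (forall z, holo f z) -> 0 <= K ->
  (forall z, R0 <= Cmod z -> Cmod (f z) <= K * Cmod z ^ d) ->
  exists a : nat -> C, forall z, f z = poly_eval d a z.
Proof.
intros H HK HB. set (F := fun z => f (0 + cexp z)%C).
assert (HF : forall r, 0 < r -> periodic_holo F (ln r)).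
{ intros r Hr. apply (holo_pullback_exp f 0 r Hr). intros; apply H. }
assert (HFx : forall L, periodic_holo F L).
{ intros L. rewrite <- (ln_exp L). apply HF, exp_pos. }
pose proof PI_RGT_0 as Hpi.
assert (Zc : forall s n, (d < n)%nat -> taylor_coef F s n = RtoC 0).
{ intros s n Hn. apply Cmod_small_0. intros eps He.
  set (m := Rmax (exp s) (Rmax (Rmax 1 R0) (2 * PI * K / eps))).
  assert (M1 : exp s <= m) by apply Rmax_l.
  assert (M0 : Rmax 1 R0 <= m) by (eapply Rle_trans; [apply Rmax_l|apply Rmax_r]).
  pose proof (Rmax_l 1 R0). pose proof (Rmax_r 1 R0).
  assert (M2 : 1 <= m) by lra.
  assert (M3 : 2 * PI * K / eps <= m) by (eapply Rle_trans; [apply Rmax_r|apply Rmax_r]).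
  set (s' := ln m). assert (Es : exp s' = m) by (apply exp_ln; lra).
  assert (Hss : s <= s').
  { destruct (Rle_or_lt s s') as [Q|Q]; [exact Q|]. apply exp_increasing in Q. lra. }
  rewrite (taylor_coef_const F (s' + 1) s s' n (HFx _) Hss) by lra.
  eapply Rle_trans; [apply (taylor_coef_bound F (s' + 1) s' n (K * m ^ d) (HFx _)); [lra|]|].
  - intros y. unfold F. eapply Rle_trans; [apply HB|]; rewrite Cplus_0_l, Cmod_cexp; simpl fst; rewrite Es; lra.
  - rewrite Es. replace n with (d + S (n - d - 1))%nat by lia. rewrite pow_add.
    assert (Hmd : 0 < m ^ d) by (apply pow_lt; lra).
    rewrite pow_inv.
    replace (2 * PI * (K * m ^ d) * (/ m ^ d * (/ m) ^ S (n - d - 1))) with (2 * PI * K * (/ m) ^ S (n - d - 1))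
     by (field; lra).
    assert (Hi : 0 < / m <= 1).
    { split; [apply Rinv_0_lt_compat; lra|]. rewrite <- Rinv_1. apply Rinv_le_contravar; lra. }
    assert (Hpw : (/ m) ^ S (n - d - 1) <= / m).
    { simpl. rewrite <- (Rmult_1_r (/ m)) at 3. apply Rmult_le_compat_l; [lra|].
      rewrite <- (pow1 (n - d - 1)). apply pow_incr. lra. }
    apply Rle_trans with (2 * PI * K * / m).
    + apply Rmult_le_compat_l; [nra|exact Hpw].
    + apply Rle_div_l; [lra|]. apply Rle_div_l in M3; [|exact He]. lra. }
set (a := fun n => (/ RtoC (2 * PI) * taylor_coef F 0 n)%C).
assert (Ea : forall s n, taylor_coef F s n = taylor_coef F 0 n).
{ intros s n. destruct (Rle_or_lt s 0).
  - apply (taylor_coef_const F 1); [apply HFx|lra|lra].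
  - symmetry. apply (taylor_coef_const F (s + 1)); [apply HFx|lra|lra]. }
exists a.
assert (Hne : forall z, z <> RtoC 0 -> f z = poly_eval d a z).
{ intros z N. destruct (polar z N) as [x [Ex [_ Ix]]].
  assert (E : f z = F x) by (unfold F; rewrite Ex; f_equal; ring).
  rewrite E, (finite_taylor F (fst x + 2) x (fst x + 1) d (HFx _)); try lra; try exact Ix.
  - unfold poly_eval. apply sum_n_ext. intros n. rewrite Ea, Ex. reflexivity.
  - intros n Hn. apply Zc, Hn. }
intros z. destruct (Ceq_dec z 0) as [->|N]; [|apply Hne, N].
apply Ceq_minus, Cmod_small_0. intros eps He.
assert (Cp : continuous (fun z => f z - poly_eval d a z)%C (RtoC 0)).
{ apply continuous_Cminus; [apply holo_continuous, H|]. unfold poly_eval. clear. induction d as [|d IH].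
  - apply continuous_ext with (fun z : C => a 0%nat * z ^ 0)%C; [intros; rewrite sum_O; reflexivity|].
    apply continuous_Cmult; [apply continuous_const|apply continuous_Cpow, continuous_id].
  - apply continuous_ext with (fun z : C => sum_n (fun k => a k * z ^ k)%C d + a (S d) * z ^ (S d))%C;
      [intros; rewrite sum_Sn; reflexivity|].
    apply continuous_Cplus; [exact IH|].
    apply continuous_Cmult; [apply continuous_const|apply continuous_Cpow, continuous_id]. }
destruct (proj1 (continuous_CC _ _) Cp eps He) as [e [Hee Q]].
specialize (Q (RtoC (e / 2))). cbv beta in Q.
assert (Q1 : Cmod (RtoC (e / 2) - RtoC 0) < e).
{ replace (RtoC (e / 2) - RtoC 0)%C with (RtoC (e / 2)) by ring. rewrite Cmod_R, Rabs_pos_eq; lra. }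
specialize (Q Q1). rewrite (Hne (RtoC (e / 2))) in Q.
2: { intros E. apply RtoC_inj in E. lra. }
left. rewrite Cmod_minus_sym in Q.
match type of Q with Cmod ?x < _ => replace x with (f 0 - poly_eval d a 0)%C in Q by ring end.
exact Q.
Qed.

(** Cauchy's formula at two points that differ by the period [2 i PI] of [exp].  The
    bound tends to zero as [r] grows, so that a bounded holomorphic function on a
    left half-plane is asymptotically periodic. *)
Theorem Cauchy_oscillation f c r M : PI < r -> (forall z, Cmod (z - c) < r -> holo f z) ->
  (forall z, Cmod (z - c) < r -> Cmod (f z) <= M) ->
  Cmod (f (c + (0, PI)) - f (c + (0, (- PI)%R)))%C <= 8 * PI * M * r / (r - PI) ^ 2.
Proof.
intros Hr H HM. pose proof PI_RGT_0 as Hpi.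
pose proof (holo_pullback_exp f c r ltac:(lra) H) as HF. set (F := fun z => f (c + cexp z)%C) in *.
set (rho := (r + PI) / 2). set (s := ln rho).
assert (Es : exp s = rho) by (apply exp_ln; unfold rho; lra).
assert (Hs : s < ln r) by (apply ln_increasing; unfold rho; lra).
assert (Hp : ln PI < s) by (apply ln_increasing; unfold rho; lra).
assert (E1 : cexp (ln PI, PI / 2) = (0, PI)).
{ unfold cexp; simpl. rewrite exp_ln, cos_PI2, sin_PI2 by exact Hpi. f_equal; ring. }
assert (E2 : cexp (ln PI, - (PI / 2)) = (0, (- PI)%R)).
{ unfold cexp; simpl. rewrite exp_ln, cos_neg, sin_neg, cos_PI2, sin_PI2 by exact Hpi. f_equal; ring. }
pose proof (Cauchy_formula F (ln r) (ln PI, PI / 2) s HF Hp Hs ltac:(simpl; lra)) as C1.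
pose proof (Cauchy_formula F (ln r) (ln PI, - (PI / 2)) s HF Hp Hs ltac:(simpl; lra)) as C2.
rewrite E1 in C1. rewrite E2 in C2.
replace (F (ln PI, PI / 2)) with (f (c + (0, PI))%C) in C1 by (unfold F; rewrite E1; reflexivity).
replace (F (ln PI, - (PI / 2))) with (f (c + (0, (- PI)%R))%C) in C2 by (unfold F; rewrite E2; reflexivity).
assert (CF := periodic_holo_line F (ln r) s HF Hs). assert (CE := circle_continuous s).
assert (HF' : forall y, Cmod (F (s, y)) <= M).
{ intros y. apply HM. replace (c + cexp (s, y) - c)%C with (cexp (s, y)) by ring.
  rewrite Cmod_cexp. simpl. rewrite Es. unfold rho; lra. }
assert (HM0 : 0 <= M) by (eapply Rle_trans; [apply Cmod_ge_0|apply (HF' 0)]).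
assert (Mi : Cmod (0, PI) = PI /\ Cmod (0, (- PI)%R) = PI).
{ unfold Cmod; simpl. split.
  - replace (0 * (0 * 1) + PI * (PI * 1)) with (Rsqr PI) by (unfold Rsqr; ring). apply sqrt_Rsqr; lra.
  - replace (0 * (0 * 1) + - PI * (- PI * 1)) with (Rsqr PI) by (unfold Rsqr; ring). apply sqrt_Rsqr; lra. }
destruct Mi as [Mi1 Mi2].
assert (Lo : forall y w, Cmod w = PI -> rho - PI <= Cmod (cexp (s, y) - w)).
{ intros y w Hw. pose proof (Cmod_triangle_rev (cexp (s, y)) w) as T. rewrite Cmod_cexp in T. simpl in T.
  rewrite Es, Hw in T. exact T. }
assert (Nz : forall y w, Cmod w = PI -> (cexp (s, y) - w)%C <> RtoC 0).
{ intros y w Hw. apply Cmod_gt_0. specialize (Lo y w Hw). unfold rho in Lo. lra. }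
assert (Ck : forall w, Cmod w = PI -> forall t, continuous (fun y => F (s, y) * (cexp (s, y) / (cexp (s, y) - w)))%C t).
{ intros w Hw t. apply continuous_Cmult; [apply CF|].
  apply continuous_Cdiv; [apply CE| |apply Nz, Hw]. apply continuous_Cminus; [apply CE|apply continuous_const]. }
assert (D : Cmod (RtoC (2 * PI) * (f (c + (0, PI)) - f (c + (0, (- PI)%R))))%C <=
   (PI - - PI) * (M * (rho * (2 * PI) / (rho - PI) ^ 2))).
{ replace (RtoC (2 * PI) * (f (c + (0, PI)) - f (c + (0, (- PI)%R))))%C with
   (RtoC (2 * PI) * f (c + (0, PI)) - RtoC (2 * PI) * f (c + (0, (- PI)%R)))%C by ring.
  rewrite <- C1, <- C2, <- Cint_minus; [|lra|intros t _; apply Ck, Mi1|intros t _; apply Ck, Mi2].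
  apply Cint_bound; [lra| |].
  - intros t _. apply continuous_Cminus; apply Ck; assumption.
  - intros y _.
    replace (F (s, y) * (cexp (s, y) / (cexp (s, y) - (0, PI))) -
      F (s, y) * (cexp (s, y) / (cexp (s, y) - (0, (- PI)%R))))%C with
      (F (s, y) * (cexp (s, y) * ((0, PI) - (0, (- PI)%R)) /
        ((cexp (s, y) - (0, PI)) * (cexp (s, y) - (0, (- PI)%R)))))%C
      by (field; split; apply Nz; assumption).
    rewrite Cmod_mult. apply Rmult_le_compat; try apply Cmod_ge_0; [apply HF'|].
    rewrite Cmod_div, !Cmod_mult, Cmod_cexp by (apply Cmult_neq_0; apply Nz; assumption). simpl fst. rewrite Es.
    pose proof (Lo y _ Mi1) as L1. pose proof (Lo y _ Mi2) as L2.
    assert (Hd : 0 < rho - PI) by (unfold rho; lra).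
    apply Rmult_le_compat.
    + apply Rmult_le_pos; [unfold rho; lra|apply Cmod_ge_0].
    + left. apply Rinv_0_lt_compat. apply Rmult_lt_0_compat; lra.
    + apply Rmult_le_compat_l; [unfold rho; lra|].
      eapply Rle_trans; [apply Cmod_minus_triangle|]. lra.
    + apply Rinv_le_contravar; [apply pow_lt, Hd|]. simpl. rewrite Rmult_1_r. apply Rmult_le_compat; lra. }
rewrite Cmod_mult, Cmod_R, Rabs_pos_eq in D by lra.
apply Rmult_le_reg_l with (2 * PI); [lra|]. eapply Rle_trans; [exact D|].
replace (PI - - PI) with (2 * PI) by ring. apply Rmult_le_compat_l; [lra|].
replace (8 * PI * M * r / (r - PI) ^ 2) with (M * (r * (2 * PI) / (rho - PI) ^ 2)).
- apply Rmult_le_compat_l; [exact HM0|]. apply Rmult_le_compat_r.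
  + left. apply Rinv_0_lt_compat, pow_lt. unfold rho; lra.
  + apply Rmult_le_compat_r; [lra|unfold rho; lra].
- unfold rho. field. lra.
Qed.

(** * Flat su(2) connections *)

(** The infinitesimal rotation of [C^2 = R^4] with coordinates
    [A = Y 0 + i Y 1], [M = Y 2 + i Y 3] given by
    [A' = i al A + (e1 + i e2) conj M], [M' = i al M - (e1 + i e2) conj A]. *)
Definition su2 (al e1 e2 : R) (Y : nat -> R) (i : nat) : R :=
  match i with
  | 0%nat => - al * Y 1%nat + e1 * Y 2%nat + e2 * Y 3%nat
  | 1%nat => al * Y 0%nat + e2 * Y 2%nat - e1 * Y 3%nat
  | 2%nat => - al * Y 3%nat - e1 * Y 0%nat - e2 * Y 1%nat
  | _ => al * Y 2%nat - e2 * Y 0%nat + e1 * Y 1%nat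
  end.

Definition sqnorm (Y : nat -> R) : R := Y 0%nat ^ 2 + Y 1%nat ^ 2 + Y 2%nat ^ 2 + Y 3%nat ^ 2.

Lemma su2_skew al e1 e2 Y :
  Y 0%nat * su2 al e1 e2 Y 0 + Y 1%nat * su2 al e1 e2 Y 1
  + Y 2%nat * su2 al e1 e2 Y 2 + Y 3%nat * su2 al e1 e2 Y 3 = 0.
Proof. unfold su2; ring. Qed.

Lemma Rabs_mult_le a b A B : Rabs a <= A -> Rabs b <= B -> Rabs (a * b) <= A * B.
Proof. intros. rewrite Rabs_mult. apply Rmult_le_compat; auto using Rabs_pos. Qed.

Lemma su2_bound al e1 e2 Y k B i : Rabs al <= k -> Rabs e1 <= k -> Rabs e2 <= k ->
  (forall j, Rabs (Y j) <= B) -> Rabs (su2 al e1 e2 Y i) <= 3 * k * B.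
Proof.
intros Ha H1 H2 HB.
assert (T : forall a b c, Rabs a <= k * B -> Rabs b <= k * B -> Rabs c <= k * B ->
  Rabs (a + b + c) <= 3 * k * B).
{ intros a b c A1 A2 A3. apply Rabs_le_between in A1, A2, A3. apply Rabs_le; lra. }
rewrite <- (Rabs_Ropp al) in Ha. pose proof H1 as H1'. rewrite <- (Rabs_Ropp e1) in H1'.
pose proof H2 as H2'. rewrite <- (Rabs_Ropp e2) in H2'. pose proof Ha as Ha'. rewrite (Rabs_Ropp al) in Ha'.
unfold su2. destruct i as [|[|[|i]]].
- apply T; apply Rabs_mult_le; auto.
- replace (al * Y 0%nat + e2 * Y 2%nat - e1 * Y 3%nat) with (al * Y 0%nat + e2 * Y 2%nat + - e1 * Y 3%nat) by ring.
  apply T; apply Rabs_mult_le; auto.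
- replace (- al * Y 3%nat - e1 * Y 0%nat - e2 * Y 1%nat) with (- al * Y 3%nat + - e1 * Y 0%nat + - e2 * Y 1%nat) by ring.
  apply T; apply Rabs_mult_le; auto.
- replace (al * Y 2%nat - e2 * Y 0%nat + e1 * Y 1%nat) with (al * Y 2%nat + - e2 * Y 0%nat + e1 * Y 1%nat) by ring.
  apply T; apply Rabs_mult_le; auto.
Qed.

Lemma sqnorm_comp Y i : (i < 4)%nat -> Y i ^ 2 <= sqnorm Y.
Proof.
intros Hi. unfold sqnorm.
pose proof (pow2_ge_0 (Y 0%nat)). pose proof (pow2_ge_0 (Y 1%nat)).
pose proof (pow2_ge_0 (Y 2%nat)). pose proof (pow2_ge_0 (Y 3%nat)).
destruct i as [|[|[|[|i]]]]; try lia; lra.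
Qed.

(** ** Linear equations on the line: Picard iteration *)

Section Picard.
Variables (al e1 e2 : R -> R) (c : nat -> R).
Hypothesis Hal : forall t, continuous al t.
Hypothesis He1 : forall t, continuous e1 t.
Hypothesis He2 : forall t, continuous e2 t.

Fixpoint picard (n : nat) (i : nat) (t : R) : R :=
  match n with
  | O => c i
  | S n' => RInt (fun s => su2 (al s) (e1 s) (e2 s) (fun j => picard n' j s) i) 0 t
  end.

Lemma su2_continuous (Y : nat -> R -> R) i t : (forall j, continuous (Y j) t) ->
  continuous (fun s => su2 (al s) (e1 s) (e2 s) (fun j => Y j s) i) t.
Proof.
intros H.
assert (A1 : forall j, continuous (fun s => al s * Y j s) t) by (intros j; apply continuous_Rmult; auto).
assert (A2 : forall j, continuous (fun s => - al s * Y j s) t).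
{ intros j. apply continuous_Rmult; [apply continuous_Ropp|]; auto. }
assert (B1 : forall j, continuous (fun s => e1 s * Y j s) t) by (intros j; apply continuous_Rmult; auto).
assert (B2 : forall j, continuous (fun s => e2 s * Y j s) t) by (intros j; apply continuous_Rmult; auto).
unfold su2. destruct i as [|[|[|i]]].
- apply continuous_Rplus; [apply continuous_Rplus|]; auto.
- apply continuous_Rminus; [apply continuous_Rplus|]; auto.
- apply continuous_Rminus; [apply continuous_Rminus|]; auto.
- apply continuous_Rplus; [apply continuous_Rminus|]; auto.
Qed.

Lemma picard_continuous n : forall i t, continuous (picard n i) t.
Proof.
induction n as [|n IH]; intros i t.
- apply continuous_const.
- apply (ex_derive_continuous (picard (S n) i)).
  exists (su2 (al t) (e1 t) (e2 t) (fun j => picard n j t) i).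
  apply (is_derive_RInt (fun s => su2 (al s) (e1 s) (e2 s) (fun j => picard n j s) i) _ 0).
  + apply filter_forall. intros b. apply (RInt_correct (V := R_CompleteNormedModule)).
    apply (ex_RInt_continuous (V := R_CompleteNormedModule)). intros z _. apply su2_continuous. intros j. apply IH.
  + apply su2_continuous. intros j. apply IH.
Qed.

Lemma picard_derive n i t :
  is_derive (picard (S n) i) t (su2 (al t) (e1 t) (e2 t) (fun j => picard n j t) i).
Proof.
apply (is_derive_RInt (fun s => su2 (al s) (e1 s) (e2 s) (fun j => picard n j s) i) _ 0).
- apply filter_forall. intros b. apply (RInt_correct (V := R_CompleteNormedModule)).
  apply (ex_RInt_continuous (V := R_CompleteNormedModule)). intros z _. apply su2_continuous. intros j. apply picard_continuous.
- apply su2_continuous. intros j. apply picard_continuous.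
Qed.

Lemma picard_0 n i : picard (S n) i 0 = 0.
Proof. simpl. apply (RInt_point (V := R_CompleteNormedModule)). Qed.

Lemma derive_dominated (f f' g g' : R -> R) (b : R) :
  (forall t, is_derive f t (f' t)) -> (forall t, is_derive g t (g' t)) ->
  f 0 = 0 -> g 0 = 0 -> (forall t, 0 <= t <= b -> Rabs (f' t) <= g' t) ->
  forall t, 0 <= t <= b -> Rabs (f t) <= g t.
Proof.
intros Hf Hg F0 G0 H t Ht.
assert (M : forall h h' : R -> R, (forall s, is_derive h s (h' s)) -> h 0 = 0 ->
   (forall s, 0 <= s <= b -> 0 <= h' s) -> 0 <= h t).
{ intros h h' Hd H0 Hp.
  destruct (MVT_gen h 0 t h') as [x [Hx E]].
  - intros s _. apply Hd.
  - intros s _. apply continuity_pt_filterlim. apply (ex_derive_continuous h). exists (h' s). apply Hd.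
  - rewrite Rmin_left, Rmax_right in Hx by lra. specialize (Hp x ltac:(lra)). nra. }
apply Rabs_le. split.
- enough (0 <= g t + f t) by lra. apply (M (fun s => g s + f s) (fun s => g' s + f' s)).
  + intros s. apply (is_derive_plus g f); auto.
  + rewrite F0, G0. ring.
  + intros s Hs. specialize (H s Hs). apply Rabs_le_between in H. lra.
- enough (0 <= g t - f t) by lra. apply (M (fun s => g s - f s) (fun s => g' s - f' s)).
  + intros s. apply (is_derive_minus g f); auto.
  + rewrite F0, G0. ring.
  + intros s Hs. specialize (H s Hs). apply Rabs_le_between in H. lra.
Qed.

Lemma picard_bound b k B : 0 <= k -> (forall t, Rabs t <= b -> Rabs (al t) <= k /\ Rabs (e1 t) <= k /\ Rabs (e2 t) <= k) ->
  (forall j, Rabs (c j) <= B) ->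
  forall n i t, Rabs t <= b -> Rabs (picard n i t) <= B * ((3 * k * Rabs t) ^ n / INR (fact n)).
Proof.
intros Hk HK HB.
assert (HB0 : 0 <= B) by (eapply Rle_trans; [apply Rabs_pos|apply (HB 0%nat)]).
induction n as [|n IH]; intros i t Ht.
- simpl. specialize (HB i). lra.
- set (g := fun s => B * ((3 * k * s) ^ (S n) / INR (fact (S n)))).
  set (g' := fun s => 3 * k * (B * ((3 * k * s) ^ n / INR (fact n)))).
  assert (Hg : forall s, is_derive g s (g' s)).
  { intros s. unfold g, g'. remember (INR (fact (S n))) as F eqn:EF.
    rewrite fact_simpl, mult_INR in EF. pose proof (INR_fact_neq_0 n) as N1.
    pose proof (not_0_INR (S n) ltac:(lia)) as N2.
    assert (N3 : F <> 0) by (rewrite EF; apply Rmult_integral_contrapositive; split; assumption).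
    auto_derive; [exact I|]. change (Init.Nat.pred (S n)) with n.
    change (match n with 0%nat => 1 | S _ => INR n + 1 end) with (INR (S n)).
    rewrite EF. field. split; assumption. }
  assert (G0 : g 0 = 0).
  { unfold g. rewrite Rmult_0_r. rewrite pow_i by (apply Nat.lt_0_succ). field. apply INR_fact_neq_0. }
  assert (Hd : forall s, Rabs s <= b ->
    Rabs (su2 (al s) (e1 s) (e2 s) (fun j => picard n j s) i) <= g' (Rabs s)).
  { intros s Hs. destruct (HK s Hs) as [K1 [K2 K3]]. unfold g'. apply su2_bound; auto. }
  destruct (Rle_or_lt 0 t) as [P|P].
  + rewrite Rabs_pos_eq in Ht by exact P. rewrite (Rabs_pos_eq t P).
    apply (derive_dominated (picard (S n) i) _ g g' b (picard_derive n i) Hg (picard_0 n i) G0); [|lra].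
    intros s Hs. pose proof (Hd s ltac:(rewrite Rabs_pos_eq; lra)) as Q.
    rewrite (Rabs_pos_eq s) in Q by lra. exact Q.
  + rewrite Rabs_left in Ht by exact P. rewrite (Rabs_left t P).
    replace t with (- - t) at 1 by ring.
    apply (derive_dominated (fun s => picard (S n) i (- s))
      (fun s => - su2 (al (- s)) (e1 (- s)) (e2 (- s)) (fun j => picard n j (- s)) i) g g' b); try assumption; try lra.
    * intros s. pose proof (picard_derive n i (- s)) as D.
      evar_last; [apply (is_derive_comp (picard (S n) i) Ropp s); [exact D|]|].
      -- apply (is_derive_opp (fun x : R => x)). apply is_derive_id.
      -- unfold scal; simpl; unfold mult; simpl. unfold opp, one; simpl. ring.
    * rewrite Ropp_0. apply picard_0.
    * intros s Hs. rewrite Rabs_Ropp. pose proof (Hd (- s)) as Q.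
      rewrite !Rabs_Ropp, (Rabs_pos_eq s) in Q by lra. apply Q; lra.
Qed.

Lemma CVU_of_bound (f : nat -> R -> R) (D : R -> Prop) (Bd : nat -> R) :
  (forall n x, D x -> Rabs (f n x) <= Bd n) -> ex_series Bd ->
  CVU_dom (fun N x => sum_n (fun n => f n x) N) D.
Proof.
intros H Hs. apply CVU_dom_cauchy. intros eps.
pose proof (Cauchy_ex_series Bd Hs eps) as [N HN].
assert (W : forall n m x, D x -> (N <= n)%nat -> (n <= m)%nat ->
   Rabs (sum_n (fun k => f k x) n - sum_n (fun k => f k x) m) < eps).
{ intros n m x Hx Hn Hm. destruct (Nat.eq_dec n m) as [->|Hne].
  { replace (_ - _) with 0 by ring. rewrite Rabs_R0. apply cond_pos. }
  rewrite Rabs_minus_sym.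
  assert (E : sum_n (fun k => f k x) m - sum_n (fun k => f k x) n = sum_n_m (fun k => f k x) (S n) m).
  { symmetry. apply (sum_n_m_sum_n (fun k => f k x) n m Hm). }
  rewrite E. eapply Rle_lt_trans; [|apply (HN (S n) m); lia].
  eapply Rle_trans; [apply (norm_sum_n_m (fun k => f k x))|].
  eapply Rle_trans; [|apply Rle_abs].
  apply sum_n_m_le. intros k. apply H, Hx. }
exists N. intros n m x Hx Hn Hm. destruct (Nat.le_ge_cases n m) as [L|L].
- apply W; assumption.
- rewrite Rabs_minus_sym. apply W; assumption.
Qed.

Lemma ex_series_exp_bound B K : ex_series (fun n => B * (K ^ n / INR (fact n))).
Proof.
apply (ex_series_scal_l (K := R_AbsRing) B (fun n => K ^ n / INR (fact n))). exists (exp K).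
apply is_series_ext with (fun n => scal (pow_n K n) (/ INR (fact n))).
- intros n. rewrite pow_n_pow. reflexivity.
- apply is_exp_Reals.
Qed.

Lemma picard_sum_derive n i t :
  is_derive (fun s => sum_n (fun m => picard m i s) (S n)) t
    (su2 (al t) (e1 t) (e2 t) (fun j => sum_n (fun m => picard m j t) n) i).
Proof.
induction n as [|n IH].
- apply is_derive_ext with (fun s => picard 0 i s + picard 1 i s).
  { intros s. rewrite sum_Sn, sum_O. reflexivity. }
  evar_last; [apply (is_derive_plus (picard 0 i) (picard 1 i)); [apply is_derive_const|apply picard_derive]|].
  unfold plus, zero; simpl. rewrite Rplus_0_l. unfold su2. destruct i as [|[|[|i]]]; rewrite !sum_O; reflexivity.
- apply is_derive_ext with (fun s => sum_n (fun m => picard m i s) (S n) + picard (S (S n)) i s).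
  { intros s. rewrite (sum_Sn _ (S n)). reflexivity. }
  evar_last; [apply (is_derive_plus (fun s => sum_n (fun m => picard m i s) (S n)) (picard (S (S n)) i));
    [apply IH|apply picard_derive]|].
  change (@plus R_NormedModule) with Rplus.
  assert (E : forall j, sum_n (fun m => picard m j t) (S n) = sum_n (fun m => picard m j t) n + picard (S n) j t)
   by (intros; rewrite sum_Sn; reflexivity).
  unfold su2. destruct i as [|[|[|i]]]; rewrite !E; change (@plus R_AbelianMonoid) with Rplus; unfold plus; simpl plus; ring.
Qed.
End Picard.

Lemma cont_bounded_abs (u : R -> R) b : 0 <= b -> (forall t, continuous u t) ->
  exists M, 0 <= M /\ forall t, Rabs t <= b -> Rabs (u t) <= M.
Proof.
intros Hb H. destruct (cont_bounded (fun t => Rabs (u t)) (- b) b) as [M [HM K]]; [lra| |].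
- intros t _. apply (continuous_comp u Rabs); [apply H|]. apply continuous_Rabs.
- exists M. split; [exact HM|]. intros t Ht. apply K. apply Rabs_le_between, Ht.
Qed.

(** The sum of the Picard increments converges uniformly on every bounded
    interval, by comparison with the exponential series.  Components are indexed by
    all of [nat], the last case of [su2] being repeated, so only the first four
    initial values can be prescribed. *)
Theorem linear_ode (al e1 e2 : R -> R) (v : nat -> R) :
  (forall t, continuous al t) -> (forall t, continuous e1 t) -> (forall t, continuous e2 t) ->
  exists Y : R -> nat -> R,
    (forall i, (i < 4)%nat -> Y 0 i = v i) /\
    forall i t, is_derive (fun s => Y s i) t (su2 (al t) (e1 t) (e2 t) (Y t) i).
Proof.
intros Ca C1 C2. set (c := fun j => v (Nat.min j 3)).
assert (HB : exists B, forall j, Rabs (c j) <= B).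
{ exists (Rabs (v 0%nat) + Rabs (v 1%nat) + Rabs (v 2%nat) + Rabs (v 3%nat)).
  intros j. pose proof (Rabs_pos (v 0%nat)). pose proof (Rabs_pos (v 1%nat)).
  pose proof (Rabs_pos (v 2%nat)). pose proof (Rabs_pos (v 3%nat)).
  unfold c. destruct j as [|[|[|j]]]; [simpl; lra|simpl; lra|simpl; lra|]. rewrite Nat.min_r by lia. lra. }
destruct HB as [B HB].
set (T := picard al e1 e2 c).
assert (HK : forall b, 0 <= b -> exists k, 0 <= k /\ forall t, Rabs t <= b ->
   Rabs (al t) <= k /\ Rabs (e1 t) <= k /\ Rabs (e2 t) <= k).
{ intros b Hb. destruct (cont_bounded_abs al b Hb Ca) as [M0 [P0 Q0]].
  destruct (cont_bounded_abs e1 b Hb C1) as [M1 [P1 Q1]].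
  destruct (cont_bounded_abs e2 b Hb C2) as [M2 [P2 Q2]].
  exists (M0 + M1 + M2). split; [lra|]. intros t Ht.
  specialize (Q0 t Ht). specialize (Q1 t Ht). specialize (Q2 t Ht). repeat split; lra. }
assert (HT : forall b, 0 <= b -> exists K, 0 <= K /\ forall n i t, Rabs t <= b ->
   Rabs (T n i t) <= B * (K ^ n / INR (fact n))).
{ intros b Hb. destruct (HK b Hb) as [k [Hk K]]. exists (3 * k * b). split; [nra|].
  intros n i t Ht. eapply Rle_trans; [apply (picard_bound al e1 e2 c Ca C1 C2 b k B Hk K HB n i t Ht)|].
  assert (0 <= B) by (eapply Rle_trans; [apply Rabs_pos|apply (HB 0%nat)]).
  apply Rmult_le_compat_l; [assumption|]. apply Rmult_le_compat_r.
  - left. apply Rinv_0_lt_compat, INR_fact_lt_0.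
  - apply pow_incr. pose proof (Rabs_pos t). split; [nra|]. apply Rmult_le_compat_l; [lra|exact Ht]. }
assert (Hex : forall i t, ex_series (fun n => T n i t)).
{ intros i t. destruct (HT (Rabs t) (Rabs_pos t)) as [K [_ HKt]].
  apply (ex_series_le (V := R_CompleteNormedModule) _ (fun n => B * (K ^ n / INR (fact n)))).
  - intros n. apply HKt. lra.
  - apply ex_series_exp_bound. }
exists (fun t i => Series (fun n => T n i t)). split.
- intros i Hi. rewrite (Series_incr_1 (fun n => T n i 0)) by apply Hex.
  rewrite (Series_ext (fun k => T (S k) i 0) (fun _ => 0)) by (intros n; apply picard_0).
  rewrite (is_series_unique (fun _ => 0) 0).
  + simpl. unfold c. rewrite Rplus_0_r. f_equal. lia.
  + apply (is_lim_seq_ext (fun _ => 0) _ 0); [|apply is_lim_seq_const].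
    intros n. symmetry. rewrite sum_n_const. apply Rmult_0_r.
- intros i t. set (b := Rabs t + 1). pose proof (Rabs_pos t) as Hpt.
  destruct (HT b ltac:(unfold b; lra)) as [K [HK0 HKt]].
  destruct (HK b ltac:(unfold b; lra)) as [k [Hk Hkt]].
  set (D := fun x => - b < x < b).
  assert (HD : forall x, D x -> Rabs x <= b) by (intros x Hx; apply Rabs_le; unfold D in Hx; lra).
  assert (DS : forall n i t, is_derive (fun s => sum_n (fun m => T m i s) (S n)) t
    (su2 (al t) (e1 t) (e2 t) (fun j => sum_n (fun m => T m j t) n) i)).
  { intros. apply picard_sum_derive; assumption. }
  assert (DS0 : forall i t, is_derive (fun s => sum_n (fun m => T m i s) 0) t 0).
  { intros. apply is_derive_ext with (fun _ => c i0); [intros; rewrite sum_O; reflexivity|].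
    apply (is_derive_const (c i0)). }
  assert (U1 : CVU_dom (fun N x => sum_n (fun n => T n i x) N) D).
  { apply CVU_of_bound with (fun n => B * (K ^ n / INR (fact n))).
    - intros n x Hx. apply HKt, HD, Hx.
    - apply ex_series_exp_bound. }
  set (dT := fun n x => match n with O => 0 | S m => su2 (al x) (e1 x) (e2 x) (fun j => T m j x) i end).
  assert (U2 : CVU_dom (fun N x => sum_n (fun n => dT n x) N) D).
  { apply CVU_of_bound with (fun n => match n with O => 0 | S m => 3 * k * (B * (K ^ m / INR (fact m))) end).
    - intros [|n] x Hx; simpl; [rewrite Rabs_R0; lra|].
      destruct (Hkt x (HD x Hx)) as [A1 [A2 A3]]. apply su2_bound; auto.
    - apply ex_series_incr_1. apply (ex_series_scal_l (K := R_AbsRing) (3 * k) (fun m => B * (K ^ m / INR (fact m)))).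
      apply ex_series_exp_bound. }
  assert (ED : forall n x, Derive (fun s => sum_n (fun m => T m i s) n) x = sum_n (fun n => dT n x) n).
  { intros n x. induction n as [|n IH].
    - rewrite sum_O. apply is_derive_unique, DS0.
    - rewrite sum_Sn, <- IH. apply is_derive_unique.
      apply is_derive_ext with (fun s => sum_n (fun m => T m i s) n + T (S n) i s);
        [intros; rewrite sum_Sn; reflexivity|].
      apply (is_derive_plus (fun s => sum_n (fun m => T m i s) n) (T (S n) i)).
      + apply Derive_correct. destruct n as [|n]; eexists; [apply DS0|apply DS].
      + apply picard_derive; assumption. }
  assert (CT : forall n j x, continuous (T n j) x) by (intros; apply picard_continuous; assumption).
  pose proof (CVU_Derive (fun N x => sum_n (fun n => T n i x) N) D) as CV.
  evar_last; [apply CV|].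
  + apply open_and; [apply open_gt|apply open_lt].
  + intros x y z Hx Hy Hz. unfold D in *. lra.
  + exact U1.
  + intros [|n] x _; eexists; [apply DS0|apply DS].
  + intros n x _. apply continuity_pt_filterlim. eapply continuous_ext; [intros; symmetry; apply ED|].
    clear ED CV U1 U2. induction n as [|n IH].
    * apply continuous_ext with (fun _ => 0); [intros; rewrite sum_O; reflexivity|apply continuous_const].
    * apply continuous_ext with (fun x => sum_n (fun n => dT n x) n + dT (S n) x);
       [intros; rewrite sum_Sn; reflexivity|].
      apply continuous_Rplus; [apply IH|]. simpl. apply su2_continuous; auto.
  + intros eps. destruct (U2 eps) as [N HN]. exists N. intros n Hn x Hx.
    rewrite ED. rewrite (Lim_seq_ext _ (fun n => sum_n (fun n => dT n x) n)) by (intros; apply ED).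
    apply HN; assumption.
  + unfold D, b. destruct (Rabs_def2 t (Rabs t + 1)); lra.
  + match goal with |- real ?x = ?y => cut (x = Finite y); [intros ->; reflexivity|] end.
    rewrite <- (Lim_seq_incr_1 (fun n => Derive (fun s => sum_n (fun m => T m i s) n) t)).
    apply is_lim_seq_unique.
    apply is_lim_seq_ext with (fun n => su2 (al t) (e1 t) (e2 t) (fun j => sum_n (fun m => T m j t) n) i).
    { intros n. symmetry. apply is_derive_unique, DS. }
    assert (L : forall j, is_lim_seq (fun n => sum_n (fun m => T m j t) n) (Series (fun n => T n j t))).
    { intros j. apply (Series_correct _ (Hex j t)). }
    assert (L' : forall a j, is_lim_seq (fun n => a * sum_n (fun m => T m j t) n) (a * Series (fun n => T n j t))).
    { intros a j. apply (is_lim_seq_scal_l _ a _ (L j)). }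
    unfold su2. destruct i as [|[|[|i]]].
    * apply is_lim_seq_plus'; [apply is_lim_seq_plus'|]; apply L'.
    * apply is_lim_seq_minus'; [apply is_lim_seq_plus'|]; apply L'.
    * apply is_lim_seq_minus'; [apply is_lim_seq_minus'|]; apply L'.
    * apply is_lim_seq_plus'; [apply is_lim_seq_minus'|]; apply L'.
Qed.

(** ** Parallel transport in two variables *)

Lemma derive_Rmult (f g : R -> R) (x df dg : R) : is_derive f x df -> is_derive g x dg ->
  is_derive (fun t => f t * g t) x (df * g x + f x * dg).
Proof. intros Hf Hg. apply (is_derive_mult f g); auto. intros; apply Rmult_comm. Qed.

Lemma derive_Rplus (f g : R -> R) (x df dg : R) : is_derive f x df -> is_derive g x dg ->
  is_derive (fun t => f t + g t) x (df + dg).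
Proof. intros Hf Hg. apply (is_derive_plus f g); auto. Qed.

Lemma derive_Rminus (f g : R -> R) (x df dg : R) : is_derive f x df -> is_derive g x dg ->
  is_derive (fun t => f t - g t) x (df - dg).
Proof. intros Hf Hg. apply (is_derive_minus f g); auto. Qed.

Lemma derive_Ropp (f : R -> R) (x df : R) : is_derive f x df -> is_derive (fun t => - f t) x (- df).
Proof. intros Hf. apply (is_derive_opp f); auto. Qed.

Lemma derive_scal (f : R -> R) (k x df : R) : is_derive f x df -> is_derive (fun t => k * f t) x (k * df).
Proof. intros Hf. apply (is_derive_scal f x k df); auto. Qed.

Lemma derive_val (f : R -> R) (x l l' : R) : is_derive f x l -> l = l' -> is_derive f x l'.
Proof. intros H <-. exact H. Qed.

Lemma derive_sqr (f : R -> R) (x df : R) : is_derive f x df -> is_derive (fun t => f t ^ 2) x (2 * f x * df).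
Proof.
intros Hf. apply is_derive_ext with (fun t => f t * f t); [intros; apply (Rsqr_pow2 (f t))|].
apply derive_val with (df * f x + f x * df); [apply derive_Rmult; exact Hf|ring].
Qed.

Lemma su2_derive (al e1 e2 : R -> R) (Y : R -> nat -> R) (al' e1' e2' : R) (Y' : nat -> R) (t : R) i :
  is_derive al t al' -> is_derive e1 t e1' -> is_derive e2 t e2' ->
  (forall j, is_derive (fun s => Y s j) t (Y' j)) ->
  is_derive (fun s => su2 (al s) (e1 s) (e2 s) (Y s) i) t
    (su2 al' e1' e2' (Y t) i + su2 (al t) (e1 t) (e2 t) Y' i).
Proof.
intros Ha H1 H2 HY.
assert (P : forall f f' j, is_derive f t f' -> is_derive (fun s => f s * Y s j) t (f' * Y t j + f t * Y' j)).
{ intros f f' j Hf. apply (derive_Rmult f (fun s => Y s j)); auto. }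
pose proof (derive_Ropp _ _ _ Ha) as Ha'.
pose proof (fun j => P _ _ j Ha) as Pa. pose proof (fun j => P _ _ j Ha') as Pn.
pose proof (fun j => P _ _ j H1) as P1. pose proof (fun j => P _ _ j H2) as P2. clear P.
unfold su2. destruct i as [|[|[|i]]].
- eapply derive_val; [apply derive_Rplus; [apply derive_Rplus; [apply Pn|apply P1]|apply P2]|]. cbv beta; ring.
- eapply derive_val; [apply derive_Rminus; [apply derive_Rplus; [apply Pa|apply P2]|apply P1]|]. cbv beta; ring.
- eapply derive_val; [apply derive_Rminus; [apply derive_Rminus; [apply Pn|apply P1]|apply P2]|]. cbv beta; ring.
- eapply derive_val; [apply derive_Rplus; [apply derive_Rminus; [apply Pa|apply P2]|apply P1]|]. cbv beta; ring.
Qed.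

Lemma sqnorm_derive (Y : R -> nat -> R) (Y' : nat -> R) (t : R) : (forall j, is_derive (fun s => Y s j) t (Y' j)) ->
  is_derive (fun s => sqnorm (Y s)) t
    (2 * (Y t 0%nat * Y' 0%nat + Y t 1%nat * Y' 1%nat + Y t 2%nat * Y' 2%nat + Y t 3%nat * Y' 3%nat)).
Proof.
intros H. unfold sqnorm. eapply derive_val.
- apply derive_Rplus; [apply derive_Rplus; [apply derive_Rplus|]|]; apply derive_sqr; apply H.
- cbv beta. ring.
Qed.

Lemma derive_zero_const (f : R -> R) a b : (forall t, Rmin a b <= t <= Rmax a b -> is_derive f t 0) -> f a = f b.
Proof.
intros H. destruct (MVT_gen f a b (fun _ => 0)) as [c [_ E]].
- intros t Ht. apply H. lra.
- intros t Ht. apply continuity_pt_filterlim. apply (ex_derive_continuous f). exists 0. apply H, Ht.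
- lra.
Qed.

(** Rotations preserve the norm. *)
Lemma transport_norm (al e1 e2 : R -> R) (Y : R -> nat -> R) :
  (forall i t, is_derive (fun s => Y s i) t (su2 (al t) (e1 t) (e2 t) (Y t) i)) ->
  forall t, sqnorm (Y t) = sqnorm (Y 0).
Proof.
intros H t. apply (derive_zero_const (fun s => sqnorm (Y s))). intros s _.
eapply derive_val; [apply sqnorm_derive; intros j; apply H|].
rewrite su2_skew. ring.
Qed.

Lemma gronwall (u u' : R -> R) b k : (forall t, Rabs t <= b -> is_derive u t (u' t)) ->
  (forall t, Rabs t <= b -> Rabs (u' t) <= u t + k) ->
  forall t, Rabs t <= b -> u t + k <= (u 0 + k) * exp (Rabs t).
Proof.
intros Hd Hb t Ht.
destruct (Rle_or_lt 0 t) as [P|P].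
- rewrite (Rabs_pos_eq t P) in *.
  destruct (MVT_gen (fun s => (u s + k) * exp (- s)) 0 t
    (fun s => u' s * exp (- s) + (u s + k) * (- exp (- s)))) as [c [Hc E]].
  + intros s Hs. rewrite Rmin_left, Rmax_right in Hs by lra.
    assert (Rabs s <= b) by (rewrite Rabs_pos_eq; lra).
    apply (derive_Rmult (fun s => u s + k) (fun s => exp (- s))).
    * apply derive_val with (u' s + 0); [|ring]. apply derive_Rplus; [apply Hd; assumption|apply (is_derive_const k)].
    * auto_derive; [exact I|ring].
  + intros s Hs. rewrite Rmin_left, Rmax_right in Hs by lra.
    assert (Rabs s <= b) by (rewrite Rabs_pos_eq; lra).
    apply continuity_pt_filterlim.
    apply (continuous_Rmult (fun s => u s + k) (fun s => exp (- s))).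
    * apply (continuous_Rplus u (fun _ => k)); [|apply continuous_const]. apply (ex_derive_continuous u). exists (u' s). auto.
    * apply (ex_derive_continuous (fun s => exp (- s))). auto_derive; exact I.
  + rewrite Rmin_left, Rmax_right in Hc by lra.
    assert (Hcb : Rabs c <= b) by (rewrite Rabs_pos_eq; lra).
    specialize (Hb c Hcb). apply Rabs_le_between in Hb.
    pose proof (exp_pos (- c)). pose proof (exp_pos t).
    rewrite Rminus_0_r, Ropp_0, exp_0, Rmult_1_r in E.
    assert (E2 : exp t * exp (- t) = 1) by (rewrite <- exp_plus; replace (t + - t) with 0 by ring; apply exp_0).
    assert (R1 : u' c * exp (- c) + (u c + k) * (- exp (- c)) <= 0).
    { replace (u' c * exp (- c) + (u c + k) * (- exp (- c))) with (- ((u c + k - u' c) * exp (- c))) by ring.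
      pose proof (Rmult_le_pos (u c + k - u' c) (exp (- c))). lra. }
    assert (Q : (u t + k) * exp (- t) <= u 0 + k) by nra.
    replace (u t + k) with ((u t + k) * exp (- t) * exp t) by (rewrite (Rmult_assoc (u t + k)), (Rmult_comm (exp (- t))), E2; ring).
    apply Rmult_le_compat_r; lra.
- rewrite (Rabs_left t P) in *.
  destruct (MVT_gen (fun s => (u s + k) * exp s) t 0
    (fun s => u' s * exp s + (u s + k) * exp s)) as [c [Hc E]].
  + intros s Hs. rewrite Rmin_left, Rmax_right in Hs by lra.
    assert (Rabs s <= b) by (rewrite Rabs_left1; lra).
    apply (derive_Rmult (fun s => u s + k) exp).
    * apply derive_val with (u' s + 0); [|ring]. apply derive_Rplus; [apply Hd; assumption|apply (is_derive_const k)].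
    * auto_derive; [exact I|ring].
  + intros s Hs. rewrite Rmin_left, Rmax_right in Hs by lra.
    assert (Rabs s <= b) by (rewrite Rabs_left1; lra).
    apply continuity_pt_filterlim.
    apply (continuous_Rmult (fun s => u s + k) exp).
    * apply (continuous_Rplus u (fun _ => k)); [|apply continuous_const]. apply (ex_derive_continuous u). exists (u' s). auto.
    * apply (ex_derive_continuous exp). auto_derive; exact I.
  + rewrite Rmin_left, Rmax_right in Hc by lra.
    assert (Hcb : Rabs c <= b) by (rewrite Rabs_left1; lra).
    specialize (Hb c Hcb). apply Rabs_le_between in Hb.
    pose proof (exp_pos c). pose proof (exp_pos (- t)).
    rewrite exp_0, Rmult_1_r in E.
    assert (E2 : exp t * exp (- t) = 1) by (rewrite <- exp_plus; replace (t + - t) with 0 by ring; apply exp_0).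
    assert (R1 : 0 <= u' c * exp c + (u c + k) * exp c).
    { pose proof (Rmult_le_pos (u c + k + u' c) (exp c)). lra. }
    assert (Q : (u t + k) * exp t <= u 0 + k) by nra.
    replace (u t + k) with ((u t + k) * exp t * exp (- t)) by (rewrite (Rmult_assoc (u t + k)), E2; ring).
    apply Rmult_le_compat_r; lra.
Qed.

(** A forced transport equation: the rotation part does not contribute to the growth. *)
Lemma transport_forced (al e1 e2 : R -> R) (Z F : R -> nat -> R) b rho : 0 <= rho ->
  (forall i t, Rabs t <= b -> is_derive (fun s => Z s i) t (su2 (al t) (e1 t) (e2 t) (Z t) i + F t i)) ->
  (forall i t, Rabs t <= b -> Rabs (F t i) <= rho) ->
  forall t, Rabs t <= b -> sqnorm (Z t) <= (sqnorm (Z 0) + 4 * rho ^ 2) * exp b.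
Proof.
intros Hr Hd HF t Ht.
pose proof (gronwall (fun s => sqnorm (Z s))
 (fun s => 2 * (Z s 0%nat * F s 0%nat + Z s 1%nat * F s 1%nat + Z s 2%nat * F s 2%nat + Z s 3%nat * F s 3%nat)) b (4 * rho ^ 2)) as G.
assert (P : forall s, 0 <= sqnorm (Z s)).
{ intros s. unfold sqnorm. pose proof (pow2_ge_0 (Z s 0%nat)). pose proof (pow2_ge_0 (Z s 1%nat)).
  pose proof (pow2_ge_0 (Z s 2%nat)). pose proof (pow2_ge_0 (Z s 3%nat)). lra. }
assert (G' := G ltac:(intros s Hs; eapply derive_val;
   [apply sqnorm_derive; intros j; apply Hd, Hs|];
   pose proof (su2_skew (al s) (e1 s) (e2 s) (Z s)) as SK; cbv beta;
   set (s0 := su2 _ _ _ _ 0) in *; set (s1 := su2 _ _ _ _ 1) in *;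
   set (s2 := su2 _ _ _ _ 2) in *; set (s3 := su2 _ _ _ _ 3) in *; lra)).
assert (G'' := fun H => G' H t Ht). clear G G'.
pose proof (pow2_ge_0 rho) as Hr2.
assert (Q : sqnorm (Z t) + 4 * rho ^ 2 <= (sqnorm (Z 0) + 4 * rho ^ 2) * exp (Rabs t)).
{ apply G''. intros s Hs.
  assert (S : forall j, Rabs (2 * (Z s j * F s j)) <= Z s j ^ 2 + rho ^ 2).
  { intros j. specialize (HF j s Hs). apply Rabs_le_between in HF.
    assert (F s j ^ 2 <= rho ^ 2) by nra.
    apply Rabs_le. pose proof (pow2_ge_0 (Z s j - F s j)). pose proof (pow2_ge_0 (Z s j + F s j)). nra. }
  pose proof (S 0%nat) as S0. pose proof (S 1%nat) as S1. pose proof (S 2%nat) as S2. pose proof (S 3%nat) as S3.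
  apply Rabs_le_between in S0, S1, S2, S3. unfold sqnorm. apply Rabs_le. lra. }
assert (L : exp (Rabs t) <= exp b).
{ destruct Ht as [Ht|Ht]; [left; apply exp_increasing, Ht|rewrite Ht; lra]. }
apply Rle_trans with ((sqnorm (Z 0) + 4 * rho ^ 2) * exp (Rabs t)); [lra|].
apply Rmult_le_compat_l; [|exact L]. specialize (P 0). lra.
Qed.

(** Uniformity in [t] comes from the compactness of the segment [Rabs t <= b]. *)
Lemma uniform_differential (w wx : C -> R) x0 b d0 : 0 < d0 ->
  (forall x y, Rabs (x - x0) < d0 -> is_derive (fun s => w (s, y)) x (wx (x, y)) /\ continuous wx (x, y)) ->
  forall eps, 0 < eps -> exists d, 0 < d /\ forall h t, Rabs h < d -> Rabs t <= b ->
    Rabs (w (x0 + h, t) - w (x0, t) - h * wx (x0, t)) <= eps * Rabs h.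
Proof.
intros Hd0 H eps He.
destruct (uniform_continuity_2d (fun x y => wx (x, y)) (x0 - d0 / 2) (x0 + d0 / 2) (- b) b) with (mkposreal eps He)
 as [d1 K].
{ intros x y Hx Hy. apply continuity_2d_pt_filterlim.
  change (continuous (fun z : C => wx (fst z, snd z)) (x, y)).
  apply continuous_ext with wx; [intros [? ?]; reflexivity|].
  apply H. apply Rabs_def1; lra. }
exists (Rmin d1 (d0 / 2)). split; [apply Rmin_glb_lt; [apply cond_pos|lra]|].
intros h t Hh Ht.
assert (H1 : Rabs h < d1) by (eapply Rlt_le_trans; [exact Hh|apply Rmin_l]).
assert (H2 : Rabs h < d0 / 2) by (eapply Rlt_le_trans; [exact Hh|apply Rmin_r]).
apply Rabs_le_between in Ht.
destruct (MVT_gen (fun s => w (s, t)) x0 (x0 + h) (fun s => wx (s, t))) as [c [Hc E]].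
- intros s Hs. apply H. apply Rabs_def2 in H2. unfold Rmin, Rmax in Hs.
  destruct (Rle_dec x0 (x0 + h)); apply Rabs_def1; lra.
- intros s Hs. apply continuity_pt_filterlim. apply (ex_derive_continuous (fun s => w (s, t))).
  exists (wx (s, t)). apply H. apply Rabs_def2 in H2. unfold Rmin, Rmax in Hs.
  destruct (Rle_dec x0 (x0 + h)); apply Rabs_def1; lra.
- rewrite E. replace (wx (c, t) * (x0 + h - x0) - h * wx (x0, t)) with ((wx (c, t) - wx (x0, t)) * h) by ring.
  rewrite Rabs_mult. apply Rmult_le_compat_r; [apply Rabs_pos|]. left.
  assert (Hcx : Rabs (c - x0) <= Rabs h).
  { unfold Rmin, Rmax in Hc. destruct (Rle_dec x0 (x0 + h)); unfold Rabs; repeat destruct Rcase_abs; lra. }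
  apply Rabs_def2 in H2. apply Rabs_le_between in Hcx.
  assert (Rabs h < d0 / 2) by (apply Rabs_def1; lra).
  apply (K x0 t c t); try lra.
  + apply Rle_lt_trans with (Rabs h); [apply Rabs_le; lra|exact H1].
  + replace (t - t) with 0 by ring. rewrite Rabs_R0. apply cond_pos.
Qed.

(** ** Flat connections have parallel frames *)

Lemma choice_fun {A B : Type} (P : A -> B -> Prop) : (forall a, exists b, P a b) -> exists f, forall a, P a (f a).
Proof.
intros H. exists (fun a => proj1_sig (constructive_indefinite_description _ (H a))).
intros a. apply proj2_sig.
Qed.

Lemma su2_lin al e1 e2 al' e1' e2' (Y Z : nat -> R) i :
  su2 al e1 e2 Y i - su2 al' e1' e2' Z i
  = su2 al' e1' e2' (fun j => Y j - Z j) i + su2 (al - al') (e1 - e1') (e2 - e2') Y i.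
Proof. unfold su2; destruct i as [|[|[|i]]]; ring. Qed.

Lemma sqr_le_abs x r : 0 <= r -> x ^ 2 <= r ^ 2 -> Rabs x <= r.
Proof.
intros Hr H. apply Rsqr_incr_0_var; [|exact Hr]. rewrite <- Rsqr_abs, !Rsqr_pow2. exact H.
Qed.

Lemma sqnorm_le (Y : nat -> R) r : (forall i, (i < 4)%nat -> Rabs (Y i) <= r) -> sqnorm Y <= 4 * r ^ 2.
Proof.
intros H. unfold sqnorm.
assert (S : forall i, (i < 4)%nat -> Y i ^ 2 <= r ^ 2).
{ intros i Hi. rewrite <- pow2_abs. apply pow_incr. split; [apply Rabs_pos|auto]. }
pose proof (S 0%nat ltac:(lia)). pose proof (S 1%nat ltac:(lia)).
pose proof (S 2%nat ltac:(lia)). pose proof (S 3%nat ltac:(lia)). lra.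
Qed.

Lemma su2_bound4 al e1 e2 Y k B i : Rabs al <= k -> Rabs e1 <= k -> Rabs e2 <= k ->
  (forall j, (j < 4)%nat -> Rabs (Y j) <= B) -> Rabs (su2 al e1 e2 Y i) <= 3 * k * B.
Proof.
intros Ha H1 H2 HB.
replace (su2 al e1 e2 Y i) with (su2 al e1 e2 (fun j => Y (Nat.min j 3)) i).
- apply su2_bound; try assumption. intros j. apply HB. lia.
- unfold su2; destruct i as [|[|[|i]]]; reflexivity.
Qed.

Lemma continuous_slice_x (f : C -> R) (k : R -> R) x y :
  continuous k x -> continuous f (k x, y) -> continuous (fun s => f (k s, y)) x.
Proof.
intros Hk Hf. apply (continuous_comp (fun s => (k s, y) : C) f); [|exact Hf].
apply continuous_pair; [exact Hk|apply continuous_const].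
Qed.

Lemma continuous_slice_y (f : C -> R) x y : continuous f (x, y) -> continuous (fun t => f (x, t)) y.
Proof.
intros Hf. apply (continuous_comp (fun t => (x, t) : C) f); [|exact Hf].
apply continuous_pair; [apply continuous_const|apply continuous_id].
Qed.

(** The coefficients of [su2] in the two coordinate directions: a connection on the
    trivial bundle [C^2] over the plane. *)
Record connection := {
  ax : C -> R; bx : C -> R; cx : C -> R;
  ay : C -> R; by_ : C -> R; cy : C -> R
}.

Definition opx (w : connection) (z : C) : (nat -> R) -> nat -> R := su2 (ax w z) (bx w z) (cx w z).
Definition opy (w : connection) (z : C) : (nat -> R) -> nat -> R := su2 (ay w z) (by_ w z) (cy w z).

(** The last field is [d_y opx + opx opy = d_x opy + opy opx], that is, zero
    curvature.  The domain is [D * R]: in logarithmic coordinates it is a half-plane. *)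
Record flat_connection (w : connection) (D : R -> Prop) (ax' bx' cx' ay' by' cy' : C -> R) : Prop := {
  flat_open : forall x, D x -> exists d, 0 < d /\ forall s, Rabs (s - x) < d -> D s;
  flat_cont : forall x y, D x ->
     continuous (ax w) (x, y) /\ continuous (bx w) (x, y) /\ continuous (cx w) (x, y) /\
     continuous (ay w) (x, y) /\ continuous (by_ w) (x, y) /\ continuous (cy w) (x, y);
  flat_dx : forall x y, D x ->
     is_derive (fun s => ay w (s, y)) x (ay' (x, y)) /\ continuous ay' (x, y) /\
     is_derive (fun s => by_ w (s, y)) x (by' (x, y)) /\ continuous by' (x, y) /\
     is_derive (fun s => cy w (s, y)) x (cy' (x, y)) /\ continuous cy' (x, y);
  flat_dy : forall x y, D x ->
     is_derive (fun t => ax w (x, t)) y (ax' (x, y)) /\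
     is_derive (fun t => bx w (x, t)) y (bx' (x, y)) /\
     is_derive (fun t => cx w (x, t)) y (cx' (x, y));
  flat_zero : forall z Y i, D (fst z) ->
     su2 (ax' z) (bx' z) (cx' z) Y i + opx w z (opy w z Y) i
     = su2 (ay' z) (by' z) (cy' z) Y i + opy w z (opx w z Y) i
}.

(** Transport along the real axis, then along each vertical line.  Zero
    curvature makes the defect [Y(x0+h, t) - Y(x0, t) - h opx Y(x0, t)] satisfy
    the vertical transport equation up to a forcing term [o(h)], and it is
    [o(h)] on the axis.  The retraction [kap] onto the domain is the identity
    near the abscissas of interest. *)
Theorem parallel_transport w D ax' bx' cx' ay' by' cy' (kap : R -> R) (v : nat -> R) :
  flat_connection w D ax' bx' cx' ay' by' cy' ->
  (forall x, continuous kap x) -> (forall x, D (kap x)) -> sqnorm v = 1 ->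
  exists Y : R -> R -> nat -> R,
    (forall x y, sqnorm (Y x y) = 1) /\
    (forall x y i, (i < 4)%nat -> (exists d, 0 < d /\ forall s, Rabs (s - x) < d -> kap s = s) ->
       is_derive (fun s => Y s y i) x (opx w (x, y) (Y x y) i) /\
       is_derive (fun t => Y x t i) y (opy w (x, y) (Y x y) i)).
Proof.
intros [Hop Hc Hdx Hdy Hz] Hk HDk Hv.
destruct (linear_ode (fun x => ax w (kap x, 0)) (fun x => bx w (kap x, 0)) (fun x => cx w (kap x, 0)) v)
  as [c [Hc0 Hcd]].
1: intros t; destruct (Hc (kap t) 0 (HDk t)) as [C1 [C2 [C3 _]]]; exact (continuous_slice_x (ax w) kap t 0 (Hk t) C1).
1: intros t; destruct (Hc (kap t) 0 (HDk t)) as [C1 [C2 [C3 _]]]; exact (continuous_slice_x (bx w) kap t 0 (Hk t) C2).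
1: intros t; destruct (Hc (kap t) 0 (HDk t)) as [C1 [C2 [C3 _]]]; exact (continuous_slice_x (cx w) kap t 0 (Hk t) C3).
destruct (choice_fun (fun x (Y : R -> nat -> R) => (forall i, (i < 4)%nat -> Y 0 i = c x i) /\
  forall i t, is_derive (fun s => Y s i) t (opy w (kap x, t) (Y t) i))) as [Y HY].
{ intros x. apply (linear_ode (fun t => ay w (kap x, t)) (fun t => by_ w (kap x, t)) (fun t => cy w (kap x, t))).
  - intros t. destruct (Hc (kap x) t (HDk x)) as [_ [_ [_ [C1 [C2 C3]]]]]. exact (continuous_slice_y (ay w) _ _ C1).
  - intros t. destruct (Hc (kap x) t (HDk x)) as [_ [_ [_ [C1 [C2 C3]]]]]. exact (continuous_slice_y (by_ w) _ _ C2).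
  - intros t. destruct (Hc (kap x) t (HDk x)) as [_ [_ [_ [C1 [C2 C3]]]]]. exact (continuous_slice_y (cy w) _ _ C3). }
assert (N1 : forall x y, sqnorm (Y x y) = 1).
{ intros x y. destruct (HY x) as [H0 H1].
  rewrite (transport_norm _ _ _ (Y x) H1).
  replace (sqnorm (Y x 0)) with (sqnorm (c x)) by (unfold sqnorm; rewrite !H0 by lia; reflexivity).
  rewrite (transport_norm _ _ _ c Hcd). rewrite <- Hv. unfold sqnorm. rewrite !Hc0 by lia. reflexivity. }
assert (N2 : forall x y i, (i < 4)%nat -> Rabs (Y x y i) <= 1).
{ intros x y i Hi. apply sqr_le_abs; [lra|]. pose proof (sqnorm_comp (Y x y) i Hi). rewrite N1 in H. lra. }
exists Y. split; [exact N1|].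
intros x0 y i Hi [d0 [Hd0 Hkap]].
assert (K0 : kap x0 = x0) by (apply Hkap; replace (x0 - x0) with 0 by ring; rewrite Rabs_R0; exact Hd0).
assert (D0 : D x0) by (rewrite <- K0; apply HDk).
destruct (Hop x0 D0) as [d1 [Hd1 HD1]].
assert (Vert : forall x t j, Rabs (x - x0) < d0 -> is_derive (fun s => Y x s j) t (opy w (x, t) (Y x t) j)).
{ intros x t j Hx. destruct (HY x) as [_ H1]. pose proof (H1 j t) as Q. rewrite (Hkap x Hx) in Q. exact Q. }
split; [|apply Vert; replace (x0 - x0) with 0 by ring; rewrite Rabs_R0; exact Hd0].
set (b := Rabs y).
assert (Hb : 0 <= b) by apply Rabs_pos.
assert (Hcx : forall f : C -> R, (forall t, continuous f (x0, t)) -> exists M, 0 <= M /\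
  forall t, Rabs t <= b -> Rabs (f (x0, t)) <= M).
{ intros f Hf. apply (cont_bounded_abs (fun t => f (x0, t)) b Hb). intros t.
  apply (continuous_slice_y f), Hf. }
destruct (Hcx ay') as [A1 [PA1 QA1]]; [intros t; destruct (Hdx x0 t D0) as [_ [C1 [_ [C2 [_ C3]]]]]; exact C1|].
destruct (Hcx by') as [A2 [PA2 QA2]]; [intros t; destruct (Hdx x0 t D0) as [_ [C1 [_ [C2 [_ C3]]]]]; exact C2|].
destruct (Hcx cy') as [A3 [PA3 QA3]]; [intros t; destruct (Hdx x0 t D0) as [_ [C1 [_ [C2 [_ C3]]]]]; exact C3|].
set (K := A1 + A2 + A3 + 1).
assert (HK : 1 <= K) by (unfold K; lra).
assert (Small : forall eps, 0 < eps -> exists d, 0 < d /\ d <= d0 /\ forall h, Rabs h < d ->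
  forall t, Rabs t <= b -> forall j, (j < 4)%nat ->
    Rabs (Y (x0 + h) t j - Y x0 t j - h * opx w (x0, t) (Y x0 t) j) <= eps * Rabs h).
{ intros eps He.
  set (R2 := exp b). assert (HR2 : 1 <= R2) by (unfold R2; pose proof (exp_ineq1_le b); lra).
  (* The forcing term is at most |h| times (3 e1 + 3 K e2) in each component:
     [e1] bounds the Taylor error of the coefficients, [e2] the displacement. *)
  set (e2 := eps / (24 * K * R2)).
  assert (He2 : 0 < e2) by (apply Rdiv_lt_0_compat; [exact He|nra]).
  set (e1 := Rmin 1 (eps / (24 * R2))).
  assert (He1 : 0 < e1) by (apply Rmin_glb_lt; [lra|apply Rdiv_lt_0_compat; lra]).
  assert (He1' : e1 <= 1) by apply Rmin_l.
  assert (He1'' : e1 <= eps / (24 * R2)) by apply Rmin_r.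
  destruct (uniform_differential (ay w) ay' x0 b d1 Hd1) with (eps := e1) as [r1 [Hr1 U1]]; [|exact He1|].
  { intros x t Hx. destruct (Hdx x t (HD1 x Hx)) as [D1 [C1 [D2 [C2 [D3 C3]]]]]. exact (conj D1 C1). }
  destruct (uniform_differential (by_ w) by' x0 b d1 Hd1) with (eps := e1) as [r2 [Hr2 U2]]; [|exact He1|].
  { intros x t Hx. destruct (Hdx x t (HD1 x Hx)) as [D1 [C1 [D2 [C2 [D3 C3]]]]]. exact (conj D2 C2). }
  destruct (uniform_differential (cy w) cy' x0 b d1 Hd1) with (eps := e1) as [r3 [Hr3 U3]]; [|exact He1|].
  { intros x t Hx. destruct (Hdx x t (HD1 x Hx)) as [D1 [C1 [D2 [C2 [D3 C3]]]]]. exact (conj D3 C3). }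
  assert (Hax : forall j, (j < 4)%nat -> exists d, 0 < d /\ forall h, Rabs h < d ->
     Rabs (c (x0 + h) j - c x0 j - h * opx w (x0, 0) (c x0) j) <= e1 * Rabs h).
  { intros j Hj. pose proof (Hcd j x0) as Dj. rewrite K0 in Dj.
    destruct (proj1 (is_derive_epsilon _ _ _) Dj e1 He1) as [d [Hd Q]].
    exists d. split; [exact Hd|]. intros h Hh. specialize (Q (x0 + h)).
    replace (x0 + h - x0) with h in Q by ring. specialize (Q Hh).
    rewrite (Rmult_comm h). exact Q. }
  destruct (Hax 0%nat ltac:(lia)) as [s0 [Hs0 X0]]. destruct (Hax 1%nat ltac:(lia)) as [s1 [Hs1 X1]].
  destruct (Hax 2%nat ltac:(lia)) as [s2 [Hs2 X2]]. destruct (Hax 3%nat ltac:(lia)) as [s3 [Hs3 X3]].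
  set (M0 := Rabs (opx w (x0, 0) (c x0) 0) + Rabs (opx w (x0, 0) (c x0) 1)
    + Rabs (opx w (x0, 0) (c x0) 2) + Rabs (opx w (x0, 0) (c x0) 3)).
  assert (HM0 : forall j, (j < 4)%nat -> Rabs (opx w (x0, 0) (c x0) j) <= M0).
  { intros j Hj. unfold M0. pose proof (Rabs_pos (opx w (x0, 0) (c x0) 0)). pose proof (Rabs_pos (opx w (x0, 0) (c x0) 1)).
    pose proof (Rabs_pos (opx w (x0, 0) (c x0) 2)). pose proof (Rabs_pos (opx w (x0, 0) (c x0) 3)).
    destruct j as [|[|[|[|j]]]]; try lia; lra. }
  assert (PM0 : 0 <= M0) by (eapply Rle_trans; [apply Rabs_pos|apply (HM0 0%nat); lia]).
  set (B1 := 3 * (K + 1) + M0 + 1).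
  set (d2 := e2 / (4 * B1 * R2)).
  assert (HB1 : 0 < B1) by (unfold B1; lra).
  assert (Hd2 : 0 < d2) by (apply Rdiv_lt_0_compat; [exact He2|nra]).
  set (d := Rmin d0 (Rmin (Rmin r1 (Rmin r2 r3)) (Rmin (Rmin s0 s1) (Rmin (Rmin s2 s3) d2)))).
  assert (Hd : 0 < d) by (repeat apply Rmin_glb_lt; assumption).
  assert (Ld : d <= d0 /\ d <= r1 /\ d <= r2 /\ d <= r3 /\ d <= s0 /\ d <= s1 /\ d <= s2 /\ d <= s3 /\ d <= d2).
  { unfold d. repeat match goal with |- context [Rmin ?a ?b] =>
      lazymatch b with context [Rmin] => fail | _ =>
      lazymatch a with context [Rmin] => fail | _ =>
        pose proof (Rmin_l a b); pose proof (Rmin_r a b);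
        let m := fresh "m" in set (m := Rmin a b) in * end end end.
    repeat split; lra. }
  destruct Ld as [L0 [L1 [L2 [L3 [L4 [L5 [L6 [L7 L8]]]]]]]].
  exists d. split; [exact Hd|]. split; [exact L0|].
  intros h Hh.
  assert (Hxh : Rabs (x0 + h - x0) < d0) by (replace (x0 + h - x0) with h by ring; lra).
  pose proof (Rabs_pos h) as Hhp.
  assert (Hax' : forall j, (j < 4)%nat ->
     Rabs (c (x0 + h) j - c x0 j - h * opx w (x0, 0) (c x0) j) <= e1 * Rabs h).
  { intros j Hj. destruct j as [|[|[|[|j]]]]; try lia; [apply X0|apply X1|apply X2|apply X3]; lra. }
  assert (Wc : forall t, Rabs t <= b -> Rabs (ay w (x0 + h, t) - ay w (x0, t)) <= (K + 1) * Rabs h /\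
     Rabs (by_ w (x0 + h, t) - by_ w (x0, t)) <= (K + 1) * Rabs h /\
     Rabs (cy w (x0 + h, t) - cy w (x0, t)) <= (K + 1) * Rabs h).
  { intros t Ht. specialize (U1 h t ltac:(lra) Ht). specialize (U2 h t ltac:(lra) Ht). specialize (U3 h t ltac:(lra) Ht).
    specialize (QA1 t Ht). specialize (QA2 t Ht). specialize (QA3 t Ht).
    assert (G : forall u u' m, Rabs (u - h * u') <= e1 * Rabs h -> Rabs u' <= m -> m <= K -> Rabs u <= (K + 1) * Rabs h).
    { intros u u' m G1 G2 G3. replace u with ((u - h * u') + h * u') by ring.
      eapply Rle_trans; [apply Rabs_triang|]. rewrite Rabs_mult. nra. }
    split; [|split]; eapply G; try eassumption; unfold K; lra. }
  set (Dd := fun t j => Y (x0 + h) t j - Y x0 t j).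
  assert (HDd : forall t j, Rabs t <= b -> (j < 4)%nat -> Rabs (Dd t j) <= e2).
  { intros t j Ht Hj.
    assert (Q : sqnorm (Dd t) <= (sqnorm (Dd 0) + 4 * (3 * ((K + 1) * Rabs h) * 1) ^ 2) * exp b).
    { apply (transport_forced (fun t => ay w (x0, t)) (fun t => by_ w (x0, t)) (fun t => cy w (x0, t)) Dd
        (fun t j => su2 (ay w (x0 + h, t) - ay w (x0, t)) (by_ w (x0 + h, t) - by_ w (x0, t))
          (cy w (x0 + h, t) - cy w (x0, t)) (Y (x0 + h) t) j)); try assumption.
      - nra.
      - intros k s Hs. rewrite <- (su2_lin _ _ _ _ _ _ (Y (x0 + h) s) (Y x0 s)).
        apply derive_Rminus; apply Vert; [exact Hxh|].
        replace (x0 - x0) with 0 by ring; rewrite Rabs_R0; exact Hd0.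
      - intros k s Hs. destruct (Wc s Hs) as [W1 [W2 W3]]. apply su2_bound4; try assumption.
        intros m Hm. apply N2, Hm. }
    assert (Q0 : sqnorm (Dd 0) <= 4 * ((M0 + 1) * Rabs h) ^ 2).
    { apply sqnorm_le. intros k Hk'. unfold Dd. destruct (HY (x0 + h)) as [Y1 _]. destruct (HY x0) as [Y2 _].
      rewrite Y1, Y2 by exact Hk'. specialize (Hax' k Hk'). specialize (HM0 k Hk').
      replace (c (x0 + h) k - c x0 k) with
        ((c (x0 + h) k - c x0 k - h * opx w (x0, 0) (c x0) k) + h * opx w (x0, 0) (c x0) k) by ring.
      eapply Rle_trans; [apply Rabs_triang|]. rewrite Rabs_mult. nra. }
    apply sqr_le_abs; [lra|]. eapply Rle_trans; [apply (sqnorm_comp (Dd t) j Hj)|].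
    eapply Rle_trans; [exact Q|]. fold R2.
    assert (Z1 : sqnorm (Dd 0) + 4 * (3 * ((K + 1) * Rabs h) * 1) ^ 2 <= 4 * (B1 * Rabs h) ^ 2).
    { assert (E : 4 * ((M0 + 1) * Rabs h) ^ 2 + 4 * (3 * ((K + 1) * Rabs h) * 1) ^ 2 <= 4 * (B1 * Rabs h) ^ 2).
      { rewrite !Rpow_mult_distr. unfold B1. pose proof (pow2_ge_0 (Rabs h)).
        assert (0 <= 8 * (M0 + 1) * (3 * (K + 1)) * Rabs h ^ 2) by (apply Rmult_le_pos; [nra|assumption]). nra. }
      lra. }
    assert (Z2 : B1 * Rabs h <= e2 / (4 * R2)).
    { apply Rle_trans with (B1 * d2); [apply Rmult_le_compat_l; lra|]. right. unfold d2. field. lra. }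
    assert (Z3 : 4 * (B1 * Rabs h) ^ 2 * R2 <= 4 * (e2 / (4 * R2)) ^ 2 * R2).
    { apply Rmult_le_compat_r; [lra|]. apply Rmult_le_compat_l; [lra|]. apply pow_incr. split; [nra|exact Z2]. }
    apply Rle_trans with (4 * (B1 * Rabs h) ^ 2 * R2); [apply Rmult_le_compat_r; lra|].
    eapply Rle_trans; [exact Z3|].
    replace (4 * (e2 / (4 * R2)) ^ 2 * R2) with (e2 ^ 2 * (/ (4 * R2))) by (field; lra).
    rewrite <- (Rmult_1_r (e2 ^ 2)) at 2. apply Rmult_le_compat_l; [apply pow2_ge_0|].
    rewrite <- Rinv_1. apply Rinv_le_contravar; lra. }
  set (Z := fun t j => Y (x0 + h) t j - Y x0 t j - h * opx w (x0, t) (Y x0 t) j).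
  set (F := fun t j => su2 (ay w (x0 + h, t) - ay w (x0, t) - h * ay' (x0, t))
       (by_ w (x0 + h, t) - by_ w (x0, t) - h * by' (x0, t))
       (cy w (x0 + h, t) - cy w (x0, t) - h * cy' (x0, t)) (Y (x0 + h) t) j
     + h * su2 (ay' (x0, t)) (by' (x0, t)) (cy' (x0, t)) (Dd t) j).
  set (rho := (3 * e1 + 3 * K * e2) * Rabs h).
  intros t Ht j Hj.
  assert (Q : sqnorm (Z t) <= (sqnorm (Z 0) + 4 * rho ^ 2) * exp b).
  { apply (transport_forced (fun t => ay w (x0, t)) (fun t => by_ w (x0, t)) (fun t => cy w (x0, t)) Z F); try assumption.
    - unfold rho. apply Rmult_le_pos; [nra|exact Hhp].
    - intros k s Hs.
      assert (Hxx : Rabs (x0 - x0) < d0) by (replace (x0 - x0) with 0 by ring; rewrite Rabs_R0; exact Hd0).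
      destruct (Hdy x0 s D0) as [E1 [E2 E3]].
      eapply derive_val.
      + unfold Z. apply derive_Rminus; [apply derive_Rminus; apply Vert; assumption|].
        apply derive_scal. apply (su2_derive (fun t => ax w (x0, t)) (fun t => bx w (x0, t)) (fun t => cx w (x0, t)) (Y x0));
         [exact E1|exact E2|exact E3|]. intros m. apply Vert, Hxx.
      + pose proof (Hz (x0, s) (Y x0 s) k D0) as Fl.
        transitivity (opy w (x0 + h, s) (Y (x0 + h) s) k - opy w (x0, s) (Y x0 s) k - h *
          (su2 (ay' (x0, s)) (by' (x0, s)) (cy' (x0, s)) (Y x0 s) k + opy w (x0, s) (opx w (x0, s) (Y x0 s)) k)).
        { apply (f_equal (fun X => opy w (x0 + h, s) (Y (x0 + h) s) k - opy w (x0, s) (Y x0 s) k - h * X)). exact Fl. }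
        unfold F, Z, Dd, opx, opy. unfold su2; destruct k as [|[|[|k]]]; ring.
    - intros k s Hs. unfold F, rho. eapply Rle_trans; [apply Rabs_triang|].
      rewrite Rmult_plus_distr_r. apply Rplus_le_compat.
      + replace (3 * e1 * Rabs h) with (3 * (e1 * Rabs h) * 1) by ring.
        apply su2_bound4; [apply U1; [lra|exact Hs]|apply U2; [lra|exact Hs]|apply U3; [lra|exact Hs]|].
        intros m Hm. apply N2, Hm.
      + rewrite Rabs_mult, Rmult_comm. apply Rmult_le_compat_r; [exact Hhp|].
        specialize (QA1 s Hs). specialize (QA2 s Hs). specialize (QA3 s Hs).
        apply su2_bound4; try (unfold K; lra). intros m Hm. apply HDd; assumption. }
  assert (Q0 : sqnorm (Z 0) <= 4 * (e1 * Rabs h) ^ 2).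
  { apply sqnorm_le. intros k Hk'. unfold Z. destruct (HY (x0 + h)) as [Y1 _]. destruct (HY x0) as [Y2 _].
    rewrite Y1, Y2 by exact Hk'.
    replace (opx w (x0, 0) (Y x0 0) k) with (opx w (x0, 0) (c x0) k); [apply Hax', Hk'|].
    unfold opx, su2. destruct k as [|[|[|k]]]; rewrite !Y2 by lia; reflexivity. }
  apply sqr_le_abs; [nra|]. eapply Rle_trans; [apply (sqnorm_comp (Z t) j Hj)|].
  eapply Rle_trans; [exact Q|]. fold R2.
  assert (T1 : e1 * Rabs h <= eps / (24 * R2) * Rabs h) by (apply Rmult_le_compat_r; assumption).
  assert (T2 : rho <= eps / (4 * R2) * Rabs h).
  { unfold rho. apply Rmult_le_compat_r; [exact Hhp|].
    assert (K * e2 = eps / (24 * R2)) by (unfold e2; field; lra).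
    replace (eps / (4 * R2)) with (6 * (eps / (24 * R2))) by (field; lra). lra. }
  assert (Hq : 0 <= eps / (4 * R2) * Rabs h) by (apply Rmult_le_pos; [apply Rlt_le, Rdiv_lt_0_compat; lra|exact Hhp]).
  assert (T3 : e1 * Rabs h <= eps / (4 * R2) * Rabs h).
  { eapply Rle_trans; [exact T1|]. apply Rmult_le_compat_r; [exact Hhp|].
    apply Rmult_le_compat_l; [lra|]. apply Rinv_le_contravar; lra. }
  assert (T4 : sqnorm (Z 0) + 4 * rho ^ 2 <= 8 * (eps / (4 * R2) * Rabs h) ^ 2).
  { assert ((e1 * Rabs h) ^ 2 <= (eps / (4 * R2) * Rabs h) ^ 2) by (apply pow_incr; split; [nra|exact T3]).
    assert (rho ^ 2 <= (eps / (4 * R2) * Rabs h) ^ 2).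
    { apply pow_incr; split; [unfold rho; apply Rmult_le_pos; [nra|exact Hhp]|exact T2]. }
    lra. }
  apply Rle_trans with (8 * (eps / (4 * R2) * Rabs h) ^ 2 * R2); [apply Rmult_le_compat_r; lra|].
  replace (8 * (eps / (4 * R2) * Rabs h) ^ 2 * R2) with ((eps * Rabs h) ^ 2 * (/ (2 * R2))) by (field; lra).
  rewrite <- (Rmult_1_r ((eps * Rabs h) ^ 2)) at 2. apply Rmult_le_compat_l; [apply pow2_ge_0|].
  rewrite <- Rinv_1. apply Rinv_le_contravar; lra. }
apply is_derive_epsilon. intros eps He. destruct (Small eps He) as [d [Hd [_ Q]]].
exists d. split; [exact Hd|]. intros s Hs. specialize (Q (s - x0) Hs y ltac:(unfold b; lra) i Hi).
replace (x0 + (s - x0)) with s in Q by ring. rewrite (Rmult_comm (opx w (x0, y) (Y x0 y) i)). exact Q.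
Qed.

(** * Liouville's equation as a zero curvature condition *)

(** The derivatives are explicit functions, so that they can be transported by the
    chain rule; both mixed derivatives occur since they are not assumed equal. *)
Record C2_real (f fx fy fxx fxy fyx fyy : C -> R) (U : C -> Prop) : Prop := {
  C2_x : forall z, U z -> is_derive (fun s => f (s, snd z)) (fst z) (fx z);
  C2_y : forall z, U z -> is_derive (fun t => f (fst z, t)) (snd z) (fy z);
  C2_xx : forall z, U z -> is_derive (fun s => fx (s, snd z)) (fst z) (fxx z);
  C2_xy : forall z, U z -> is_derive (fun t => fx (fst z, t)) (snd z) (fxy z);
  C2_yx : forall z, U z -> is_derive (fun s => fy (s, snd z)) (fst z) (fyx z);
  C2_yy : forall z, U z -> is_derive (fun t => fy (fst z, t)) (snd z) (fyy z);
  C2_c : forall z, U z -> continuous f z /\ continuous fx z /\ continuous fy z;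
  C2_cc : forall z, U z -> continuous fxx z /\ continuous fxy z /\ continuous fyx z /\ continuous fyy z
}.

Lemma continuous_exp_comp {T : UniformSpace} (u : T -> R) x : continuous u x -> continuous (fun t => exp (u t)) x.
Proof. intros H. apply (continuous_of_R u exp); [exact H|]. auto_derive. exact I. Qed.

Lemma is_derive_exp_comp (u : R -> R) (x u' : R) : is_derive u x u' -> is_derive (fun t => exp (u t)) x (u' * exp (u x)).
Proof. intros H. apply (is_derive_comp exp u x); [apply is_derive_exp|exact H]. Qed.

Lemma continuous_bounded_near (f : C -> R) z : continuous f z ->
  exists d M, 0 < d /\ forall w, Cmod (w - z) < d -> Rabs (f w) <= M.
Proof.
intros H. destruct (proj1 (continuous_CR f z) H 1 Rlt_0_1) as [d [Hd K]].
exists d, (Rabs (f z) + 1). split; [exact Hd|]. intros w Hw. specialize (K w Hw).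
replace (f w) with (f z + (f w - f z)) by ring. eapply Rle_trans; [apply Rabs_triang|]. lra.
Qed.

(** Parallel sections are known through their partial derivatives only; joint
    continuity follows from the boundedness of these. *)
Lemma continuous_bounded_partials (F p q : C -> R) z d K : 0 < d ->
  (forall w, Cmod (w - z) < d ->
     is_derive (fun s => F (s, snd w)) (fst w) (p w) /\
     is_derive (fun t => F (fst w, t)) (snd w) (q w) /\ Rabs (p w) <= K /\ Rabs (q w) <= K) ->
  continuous F z.
Proof.
intros Hd H.
assert (HK : 0 <= K).
{ destruct (H z) as [_ [_ [B _]]]; [replace (z - z)%C with (RtoC 0) by ring; rewrite Cmod_0; exact Hd|].
  eapply Rle_trans; [apply Rabs_pos|exact B]. }
apply continuous_CR. intros eps He.
exists (Rmin (d / 2) (eps / (2 * K + 1))). split; [apply Rmin_glb_lt; [lra|apply Rdiv_lt_0_compat; lra]|].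
intros w Hw.
assert (H1 : Cmod (w - z) < d / 2) by (eapply Rlt_le_trans; [exact Hw|apply Rmin_l]).
assert (H2 : Cmod (w - z) < eps / (2 * K + 1)) by (eapply Rlt_le_trans; [exact Hw|apply Rmin_r]).
destruct z as [x y]. destruct w as [s t].
assert (Bx : Rabs (s - x) <= Cmod ((s, t) - (x, y))) by (apply (Cmod_fst_le ((s, t) - (x, y)))).
assert (By : Rabs (t - y) <= Cmod ((s, t) - (x, y))) by (apply (Cmod_snd_le ((s, t) - (x, y)))).
assert (In : forall a b, Rmin x s <= a <= Rmax x s -> Rmin y t <= b <= Rmax y t -> Cmod ((a, b) - (x, y)) < d).
{ intros a b Ha Hb. eapply Rle_lt_trans; [apply Cmod_le_abs|]. simpl.
  assert (Rabs (a + - x) <= Rabs (s - x)).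
  { unfold Rmin, Rmax in Ha. destruct (Rle_dec x s); unfold Rabs; repeat destruct Rcase_abs; lra. }
  assert (Rabs (b + - y) <= Rabs (t - y)).
  { unfold Rmin, Rmax in Hb. destruct (Rle_dec y t); unfold Rabs; repeat destruct Rcase_abs; lra. }
  lra. }
assert (Mx : Rmin x s <= x <= Rmax x s) by (split; [apply Rmin_l|apply Rmax_l]).
assert (My : Rmin y t <= y <= Rmax y t) by (split; [apply Rmin_l|apply Rmax_l]).
assert (Mt : Rmin y t <= t <= Rmax y t) by (split; [apply Rmin_r|apply Rmax_r]).
destruct (MVT_gen (fun a => F (a, t)) x s (fun a => p (a, t))) as [a [Ha Ea]].
{ intros a Ha. apply (H (a, t)), In; [lra|exact Mt]. }
{ intros a Ha. apply continuity_pt_filterlim. apply (ex_derive_continuous (fun a => F (a, t))).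
  exists (p (a, t)). apply (H (a, t)), In; assumption. }
destruct (MVT_gen (fun b => F (x, b)) y t (fun b => q (x, b))) as [b [Hb Eb]].
{ intros b Hb. apply (H (x, b)), In; [exact Mx|lra]. }
{ intros b Hb. apply continuity_pt_filterlim. apply (ex_derive_continuous (fun b => F (x, b))).
  exists (q (x, b)). apply (H (x, b)), In; assumption. }
assert (P1 : Rabs (p (a, t)) <= K) by (apply H, In; assumption).
assert (Q1 : Rabs (q (x, b)) <= K) by (apply H, In; assumption).
replace (F (s, t) - F (x, y)) with (p (a, t) * (s - x) + q (x, b) * (t - y)) by lra.
eapply Rle_lt_trans; [apply Rabs_triang|]. rewrite !Rabs_mult.
apply Rle_lt_trans with ((2 * K + 1) * Cmod ((s, t) - (x, y))).
- pose proof (Rabs_pos (s - x)). pose proof (Rabs_pos (t - y)).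
  pose proof (Rabs_pos (p (a, t))). pose proof (Rabs_pos (q (x, b))). nra.
- apply Rlt_div_r in H2; [|lra]. lra.
Qed.

Section Liouville.
Variables (psi p q pxx pxy pyx pyy : C -> R) (P P' : C -> C).

(** The connection whose parallel sections are the unit vectors
    [exp(psi/2) (A, M)] for the holomorphic pairs [(A, M)] sought. *)
Definition liouville_connection : connection := {|
  ax := fun z => q z / 2;
  bx := fun z => exp (psi z) * fst (P z);
  cx := fun z => exp (psi z) * snd (P z);
  ay := fun z => - p z / 2;
  by_ := fun z => - (exp (psi z) * snd (P z));
  cy := fun z => exp (psi z) * fst (P z)
|}.

Variable U : C -> Prop.
Hypothesis HC2 : C2_real psi p q pxx pxy pyx pyy U.
Hypothesis HP : forall z, U z -> Cd P z (P' z) /\ continuous P' z.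
Hypothesis Heq : forall z, U z -> pxx z + pyy z = - 4 * Cmod (P z) ^ 2 * exp (2 * psi z).

Lemma liouville_E_derive z : U z ->
  is_derive (fun s => exp (psi (s, snd z)) * fst (P (s, snd z))) (fst z)
     (exp (psi z) * (p z * fst (P z) + fst (P' z))) /\
  is_derive (fun s => exp (psi (s, snd z)) * snd (P (s, snd z))) (fst z)
     (exp (psi z) * (p z * snd (P z) + snd (P' z))) /\
  is_derive (fun t => exp (psi (fst z, t)) * fst (P (fst z, t))) (snd z)
     (exp (psi z) * (q z * fst (P z) - snd (P' z))) /\
  is_derive (fun t => exp (psi (fst z, t)) * snd (P (fst z, t))) (snd z)
     (exp (psi z) * (q z * snd (P z) + fst (P' z))).
Proof.
intros Hz. destruct (HP z Hz) as [Hd _]. pose proof (C2_x _ _ _ _ _ _ _ _ HC2 z Hz) as Hx.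
pose proof (C2_y _ _ _ _ _ _ _ _ HC2 z Hz) as Hy.
destruct z as [x y]. simpl in *.
destruct (Cd_partials P x y _ Hd) as [D1 [D2 [D3 D4]]].
apply is_derive_exp_comp in Hx. apply is_derive_exp_comp in Hy.
split; [|split; [|split]].
- eapply derive_val; [apply (derive_Rmult (fun s => exp (psi (s, y))) (fun s => fst (P (s, y)))); eassumption|]. cbv beta. ring.
- eapply derive_val; [apply (derive_Rmult (fun s => exp (psi (s, y))) (fun s => snd (P (s, y)))); eassumption|]. cbv beta. ring.
- eapply derive_val; [apply (derive_Rmult (fun t => exp (psi (x, t))) (fun t => fst (P (x, t)))); eassumption|]. cbv beta. ring.
- eapply derive_val; [apply (derive_Rmult (fun t => exp (psi (x, t))) (fun t => snd (P (x, t)))); eassumption|]. cbv beta. ring.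
Qed.

Lemma liouville_E_continuous z : U z ->
  continuous (fun z => exp (psi z) * fst (P z)) z /\ continuous (fun z => exp (psi z) * snd (P z)) z.
Proof.
intros Hz. destruct (HP z Hz) as [Hd _]. apply Cd_continuous in Hd.
destruct (C2_c _ _ _ _ _ _ _ _ HC2 z Hz) as [C0 _]. apply continuous_exp_comp in C0.
split; apply continuous_Rmult; try exact C0; [apply continuous_Re|apply continuous_Im]; exact Hd.
Qed.

(** The off-diagonal part of the curvature vanishes because [P] is holomorphic, and
    the diagonal part is [lap psi / 2 + 2 |P|^2 exp (2 psi)]. *)
Theorem liouville_flat (D : R -> Prop) : (forall z, D (fst z) -> U z) ->
  (forall x, D x -> exists d, 0 < d /\ forall s, Rabs (s - x) < d -> D s) ->
  flat_connection liouville_connection D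
    (fun z => pyy z / 2)
    (fun z => exp (psi z) * (q z * fst (P z) - snd (P' z)))
    (fun z => exp (psi z) * (q z * snd (P z) + fst (P' z)))
    (fun z => - pxx z / 2)
    (fun z => - (exp (psi z) * (p z * snd (P z) + snd (P' z))))
    (fun z => exp (psi z) * (p z * fst (P z) + fst (P' z))).
Proof.
intros HDU Hop.
assert (Half : forall (f : R -> R) (x l : R), is_derive f x l -> is_derive (fun t => f t / 2) x (l / 2)).
{ intros f x l Hf. apply is_derive_ext with (fun t => / 2 * f t); [intros; apply Rmult_comm|].
  apply derive_val with (/ 2 * l); [apply derive_scal, Hf|apply Rmult_comm]. }
assert (Chalf : forall (f : C -> R) z, continuous f z -> continuous (fun z => f z / 2) z).
{ intros f z Hf. apply continuous_Rmult; [exact Hf|apply continuous_const]. }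
split.
- exact Hop.
- intros x y Hx. assert (Hz : U (x, y)) by (apply HDU; exact Hx).
  destruct (liouville_E_continuous _ Hz) as [E1 E2].
  destruct (C2_c _ _ _ _ _ _ _ _ HC2 _ Hz) as [C0 [C1 C2]].
  split; [|split; [|split; [|split; [|split]]]]; simpl; try assumption.
  + apply Chalf, C2.
  + apply (Chalf (fun z => - p z)), continuous_Ropp, C1.
  + apply continuous_Ropp, E2.
- intros x y Hx. assert (Hz : U (x, y)) by (apply HDU; exact Hx).
  destruct (liouville_E_derive _ Hz) as [D1 [D2 _]].
  destruct (C2_c _ _ _ _ _ _ _ _ HC2 _ Hz) as [C0 [C1 _]].
  destruct (C2_cc _ _ _ _ _ _ _ _ HC2 _ Hz) as [C3 _].
  destruct (HP _ Hz) as [CP CP']. apply Cd_continuous in CP.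
  pose proof (C2_xx _ _ _ _ _ _ _ _ HC2 _ Hz) as Dp. simpl in *.
  split; [|split; [|split; [|split; [|split]]]].
  + apply (Half (fun s => - p (s, y)) x), derive_Ropp, Dp.
  + apply (Chalf (fun z => - pxx z)), continuous_Ropp, C3.
  + apply derive_Ropp, D2.
  + apply continuous_Ropp, continuous_Rmult; [apply continuous_exp_comp, C0|].
    apply continuous_Rplus; [apply continuous_Rmult; [exact C1|]|]; apply continuous_Im; assumption.
  + exact D1.
  + apply continuous_Rmult; [apply continuous_exp_comp, C0|].
    apply continuous_Rplus; [apply continuous_Rmult; [exact C1|]|]; apply continuous_Re; assumption.
- intros x y Hx. assert (Hz : U (x, y)) by (apply HDU; exact Hx).
  destruct (liouville_E_derive _ Hz) as [_ [_ [D3 D4]]].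
  pose proof (C2_yy _ _ _ _ _ _ _ _ HC2 _ Hz) as Dq. simpl in *.
  split; [|split]; [|exact D3|exact D4]. apply (Half (fun t => q (x, t))), Dq.
- intros z Y i Hx. pose proof (Heq z (HDU z Hx)) as E.
  rewrite Cmod_sqr in E. replace (2 * psi z) with (psi z + psi z) in E by ring. rewrite exp_plus in E.
  assert (E' : pyy z = - 4 * (fst (P z) ^ 2 + snd (P z) ^ 2) * (exp (psi z) * exp (psi z)) - pxx z) by lra.
  unfold opx, opy, liouville_connection; simpl. rewrite E'.
  unfold su2; destruct i as [|[|[|i]]]; field.
Qed.

(** The factor [exp(-psi/2)] passes from the unitary to the holomorphic frame. *)
Variable Y : R -> R -> nat -> R.
Definition section_A (z : C) : C :=
  (exp (- psi z / 2) * Y (fst z) (snd z) 0%nat, exp (- psi z / 2) * Y (fst z) (snd z) 1%nat).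
Definition section_M (z : C) : C :=
  (exp (- psi z / 2) * Y (fst z) (snd z) 2%nat, exp (- psi z / 2) * Y (fst z) (snd z) 3%nat).

Variable V : C -> Prop.
Hypothesis HVU : forall z, V z -> U z.
Hypothesis HV : forall z, V z -> exists d, 0 < d /\ forall w, Cmod (w - z) < d -> V w.
Hypothesis HY1 : forall x y, sqnorm (Y x y) = 1.
Hypothesis HY : forall z i, (i < 4)%nat -> V z ->
  is_derive (fun s => Y s (snd z) i) (fst z) (opx liouville_connection z (Y (fst z) (snd z)) i) /\
  is_derive (fun t => Y (fst z) t i) (snd z) (opy liouville_connection z (Y (fst z) (snd z)) i).

Lemma section_bound x y i : (i < 4)%nat -> Rabs (Y x y i) <= 1.
Proof.
intros Hi. apply sqr_le_abs; [lra|]. pose proof (sqnorm_comp (Y x y) i Hi) as H. rewrite HY1 in H. lra.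
Qed.

Lemma section_continuous z i : (i < 4)%nat -> V z -> continuous (fun w => Y (fst w) (snd w) i) z.
Proof.
intros Hi Hz. destruct (HV z Hz) as [d0 [Hd0 K0]].
pose proof (HVU z Hz) as Hu.
destruct (liouville_E_continuous z Hu) as [E1 E2].
destruct (C2_c _ _ _ _ _ _ _ _ HC2 z Hu) as [_ [C1 C2]].
destruct (continuous_bounded_near _ z E1) as [d1 [M1 [Hd1 K1]]].
destruct (continuous_bounded_near _ z E2) as [d2 [M2 [Hd2 K2]]].
destruct (continuous_bounded_near _ z C1) as [d3 [M3 [Hd3 K3]]].
destruct (continuous_bounded_near _ z C2) as [d4 [M4 [Hd4 K4]]].
set (d := Rmin d0 (Rmin (Rmin d1 d2) (Rmin d3 d4))).
set (k := Rabs M1 + Rabs M2 + Rabs M3 + Rabs M4).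
pose proof (Rabs_pos M1). pose proof (Rabs_pos M2). pose proof (Rabs_pos M3). pose proof (Rabs_pos M4).
pose proof (Rle_abs M1). pose proof (Rle_abs M2). pose proof (Rle_abs M3). pose proof (Rle_abs M4).
apply (continuous_bounded_partials _ (fun w => opx liouville_connection w (Y (fst w) (snd w)) i)
  (fun w => opy liouville_connection w (Y (fst w) (snd w)) i) z d (3 * k * 1)).
{ repeat apply Rmin_glb_lt; assumption. }
intros w Hw.
pose proof (Rmin_l d0 (Rmin (Rmin d1 d2) (Rmin d3 d4))). pose proof (Rmin_r d0 (Rmin (Rmin d1 d2) (Rmin d3 d4))).
pose proof (Rmin_l (Rmin d1 d2) (Rmin d3 d4)). pose proof (Rmin_r (Rmin d1 d2) (Rmin d3 d4)).
pose proof (Rmin_l d1 d2). pose proof (Rmin_r d1 d2). pose proof (Rmin_l d3 d4). pose proof (Rmin_r d3 d4).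
fold d in H7, H8.
specialize (K1 w ltac:(lra)). specialize (K2 w ltac:(lra)). specialize (K3 w ltac:(lra)). specialize (K4 w ltac:(lra)).
destruct (HY w i Hi (K0 w ltac:(lra))) as [D1 D2].
split; [exact D1|]. split; [exact D2|].
assert (B : forall j, (j < 4)%nat -> Rabs (Y (fst w) (snd w) j) <= 1) by (intros; apply section_bound; assumption).
split; apply su2_bound4; try exact B; simpl; rewrite ?Rabs_Ropp; try (unfold k; lra).
- unfold Rdiv. rewrite Rabs_mult, (Rabs_pos_eq (/ 2)) by lra. unfold k. lra.
- unfold Rdiv. rewrite Rabs_mult, (Rabs_pos_eq (/ 2)), Rabs_Ropp by lra. unfold k. lra.
Qed.

Lemma half_exp_derive z : U z ->
  is_derive (fun s => exp (- psi (s, snd z) / 2)) (fst z) (- p z / 2 * exp (- psi z / 2)) /\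
  is_derive (fun t => exp (- psi (fst z, t) / 2)) (snd z) (- q z / 2 * exp (- psi z / 2)).
Proof.
intros Hz. pose proof (C2_x _ _ _ _ _ _ _ _ HC2 z Hz) as Hx. pose proof (C2_y _ _ _ _ _ _ _ _ HC2 z Hz) as Hy.
assert (G : forall (f : R -> R) (x l : R), is_derive f x l -> is_derive (fun t => exp (- f t / 2)) x (- l / 2 * exp (- f x / 2))).
{ intros f x l Hf. apply (is_derive_exp_comp (fun t => - f t / 2)).
  apply is_derive_ext with (fun t => - / 2 * f t); [intros t; change (@eq R (- / 2 * f t) (- f t / 2)); field|].
  apply derive_val with (- / 2 * l); [apply derive_scal, Hf|field]. }
apply G in Hx. apply G in Hy. rewrite <- surjective_pairing in Hx, Hy. split; assumption.
Qed.

Lemma half_exp_continuous z : U z -> continuous (fun z => exp (- psi z / 2)) z.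
Proof.
intros Hz. destruct (C2_c _ _ _ _ _ _ _ _ HC2 z Hz) as [C0 _].
apply continuous_exp_comp. apply continuous_Rmult; [apply continuous_Ropp, C0|apply continuous_const].
Qed.

(** The Wirtinger derivative of [psi]. *)
Definition psi_z (z : C) : C := (p z / 2, - q z / 2).

(** After the rescaling the antiholomorphic derivatives of the components vanish:
    the terms of the connection with [p], [q] combine with the derivative of
    [exp(- psi / 2)], and those with [P] cancel. *)
Theorem section_holomorphic z : V z ->
  Cd section_A z (- psi_z z * section_A z + RtoC (exp (psi z)) * P z * Cconj (section_M z))%C /\
  Cd section_M z (- psi_z z * section_M z - RtoC (exp (psi z)) * P z * Cconj (section_A z))%C.
Proof.
intros Hz. destruct (HV z Hz) as [d [Hd Kd]]. pose proof (HVU z Hz) as Hu.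
assert (DY : forall w i, (i < 4)%nat -> V w ->
  is_derive (fun s => exp (- psi (s, snd w) / 2) * Y s (snd w) i) (fst w)
    (exp (- psi w / 2) * (- p w / 2 * Y (fst w) (snd w) i + opx liouville_connection w (Y (fst w) (snd w)) i)) /\
  is_derive (fun t => exp (- psi (fst w, t) / 2) * Y (fst w) t i) (snd w)
    (exp (- psi w / 2) * (- q w / 2 * Y (fst w) (snd w) i + opy liouville_connection w (Y (fst w) (snd w)) i))).
{ intros w i Hi Hw. destruct (half_exp_derive w (HVU w Hw)) as [E1 E2]. destruct (HY w i Hi Hw) as [D1 D2].
  split.
  - eapply derive_val; [apply (derive_Rmult (fun s => exp (- psi (s, snd w) / 2)) (fun s => Y s (snd w) i)); eassumption|].
    cbv beta. rewrite <- surjective_pairing. ring.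
  - eapply derive_val; [apply (derive_Rmult (fun t => exp (- psi (fst w, t) / 2)) (fun t => Y (fst w) t i)); eassumption|].
    cbv beta. rewrite <- surjective_pairing. ring. }
set (X := fun w i => exp (- psi w / 2) * (- p w / 2 * Y (fst w) (snd w) i + opx liouville_connection w (Y (fst w) (snd w)) i)).
assert (CX : forall i, (i < 4)%nat -> continuous (fun w => X w i) z).
{ intros i Hi. destruct (liouville_E_continuous z Hu) as [E1 E2].
  destruct (C2_c _ _ _ _ _ _ _ _ HC2 z Hu) as [_ [C1 C2]].
  assert (CY : forall j, (j < 4)%nat -> continuous (fun w => Y (fst w) (snd w) j) z) by (intros; apply section_continuous; assumption).
  assert (T1 : forall j, (j < 4)%nat -> continuous (fun w => exp (psi w) * fst (P w) * Y (fst w) (snd w) j) z).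
  { intros j Hj. apply (continuous_Rmult (fun w => exp (psi w) * fst (P w))); [exact E1|apply CY, Hj]. }
  assert (T2 : forall j, (j < 4)%nat -> continuous (fun w => exp (psi w) * snd (P w) * Y (fst w) (snd w) j) z).
  { intros j Hj. apply (continuous_Rmult (fun w => exp (psi w) * snd (P w))); [exact E2|apply CY, Hj]. }
  assert (T3 : forall j, (j < 4)%nat -> continuous (fun w => q w / 2 * Y (fst w) (snd w) j) z).
  { intros j Hj. apply (continuous_Rmult (fun w => q w / 2)); [|apply CY, Hj].
    apply continuous_Rmult; [exact C2|apply continuous_const]. }
  assert (T4 : forall j, (j < 4)%nat -> continuous (fun w => - (q w / 2) * Y (fst w) (snd w) j) z).
  { intros j Hj. apply (continuous_Rmult (fun w => - (q w / 2))); [|apply CY, Hj].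
    apply continuous_Ropp, continuous_Rmult; [exact C2|apply continuous_const]. }
  unfold X. apply (continuous_Rmult (fun w => exp (- psi w / 2))); [apply half_exp_continuous, Hu|].
  apply (continuous_Rplus (fun w => - p w / 2 * Y (fst w) (snd w) i)).
  { apply (continuous_Rmult (fun w => - p w / 2)); [|apply CY, Hi].
    apply (continuous_Rmult (fun w => - p w)); [apply continuous_Ropp, C1|apply continuous_const]. }
  unfold opx, su2; simpl. destruct i as [|[|[|i]]].
  - apply continuous_Rplus; [apply continuous_Rplus|]; auto with arith.
  - apply continuous_Rminus; [apply continuous_Rplus|]; auto with arith.
  - apply continuous_Rminus; [apply continuous_Rminus; [apply T4|apply T1]|apply T2]; lia.
  - apply continuous_Rplus; [apply continuous_Rminus; [apply T3|apply T2]|apply T1]; lia. }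
assert (Eh : exp (psi z) * exp (- psi z / 2) * exp (- psi z / 2) = 1).
{ rewrite <- !exp_plus. replace (psi z + - psi z / 2 + - psi z / 2) with 0 by field. apply exp_0. }
split.
- eapply Cd_eq; [|apply (Cauchy_Riemann_Cd section_A (fun w => X w 0%nat) (fun w => X w 1%nat) z)].
  + unfold X, opx, section_A, section_M, psi_z, Cconj, RtoC, Cmult, Cplus, Copp, su2; simpl. f_equal; field.
  + exists d. split; [exact Hd|]. intros w Hw. specialize (Kd w Hw).
    destruct (DY w 0%nat ltac:(lia) Kd) as [A1 A2]. destruct (DY w 1%nat ltac:(lia) Kd) as [A3 A4].
    split; [exact A1|]. split; [|split; [exact A3|]].
    * eapply derive_val; [exact A2|]. unfold X, opx, opy, su2; simpl. field.
    * eapply derive_val; [exact A4|]. unfold X, opx, opy, su2; simpl. field.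
  + apply CX; lia.
  + apply CX; lia.
- eapply Cd_eq; [|apply (Cauchy_Riemann_Cd section_M (fun w => X w 2%nat) (fun w => X w 3%nat) z)].
  + unfold X, opx, section_A, section_M, psi_z, Cconj, RtoC, Cmult, Cminus, Cplus, Copp, su2; simpl. f_equal; field.
  + exists d. split; [exact Hd|]. intros w Hw. specialize (Kd w Hw).
    destruct (DY w 2%nat ltac:(lia) Kd) as [A1 A2]. destruct (DY w 3%nat ltac:(lia) Kd) as [A3 A4].
    split; [exact A1|]. split; [|split; [exact A3|]].
    * eapply derive_val; [exact A2|]. unfold X, opx, opy, su2; simpl. field.
    * eapply derive_val; [exact A4|]. unfold X, opx, opy, su2; simpl. field.
  + apply CX; lia.
  + apply CX; lia.
Qed.

Lemma section_norm z : Cmod (section_A z) ^ 2 + Cmod (section_M z) ^ 2 = exp (- psi z).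
Proof.
rewrite !Cmod_sqr. unfold section_A, section_M; simpl.
pose proof (HY1 (fst z) (snd z)) as H. unfold sqnorm in H.
assert (E : exp (- psi z / 2) * exp (- psi z / 2) = exp (- psi z)) by (rewrite <- exp_plus; f_equal; field).
rewrite <- E. set (e := exp (- psi z / 2)).
transitivity (e * e * (Y (fst z) (snd z) 0%nat ^ 2 + Y (fst z) (snd z) 1%nat ^ 2 + Y (fst z) (snd z) 2%nat ^ 2 + Y (fst z) (snd z) 3%nat ^ 2));
 [ring|rewrite H; ring].
Qed.

(** In [A' M - A M'] the terms with [psi_z] cancel and the others add up to
    [P exp(psi) (|A|^2 + |M|^2)]. *)
Lemma section_wronskian z A' M' : V z -> Cd section_A z A' -> Cd section_M z M' ->
  (A' * section_M z - section_A z * M')%C = P z.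
Proof.
intros Hz HA HM. destruct (section_holomorphic z Hz) as [EA EM].
rewrite (Cd_unique _ _ _ _ HA EA), (Cd_unique _ _ _ _ HM EM).
transitivity (P z * (RtoC (exp (psi z)) * (section_A z * Cconj (section_A z) + section_M z * Cconj (section_M z))))%C; [ring|].
rewrite <- !Cmod2_conj, <- RtoC_plus, section_norm, <- RtoC_mult, <- exp_plus.
replace (psi z + - psi z) with 0 by ring. rewrite exp_0. ring.
Qed.
End Liouville.

(** * Isolated singularities of Liouville's equation *)

Lemma chain_curve (f fx fy : C -> R) (g1 g2 : R -> R) (t l1 l2 : R) :
  (exists d, 0 < d /\ forall w, Cmod (w - (g1 t, g2 t)) < d ->
     is_derive (fun s => f (s, snd w)) (fst w) (fx w) /\
     is_derive (fun s => f (fst w, s)) (snd w) (fy w)) ->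
  continuous fx (g1 t, g2 t) -> continuous fy (g1 t, g2 t) ->
  is_derive g1 t l1 -> is_derive g2 t l2 ->
  is_derive (fun s => f (g1 s, g2 s)) t (fx (g1 t, g2 t) * l1 + fy (g1 t, g2 t) * l2).
Proof.
intros H Cx Cy D1 D2. apply is_derive_Reals.
apply (derivable_pt_lim_comp_2d (fun x y => f (x, y)) g1 g2 t); try (apply is_derive_Reals; assumption).
intros eps. assert (He : 0 < eps / 2) by (pose proof (cond_pos eps); lra).
destruct (C1_differentiable f fx fy (g1 t, g2 t) H Cx Cy (eps / 2) He) as [d [Hd K]].
assert (Hd2 : 0 < d / 2) by lra.
exists (mkposreal _ Hd2). intros u v Hu Hv. simpl in Hu, Hv.
specialize (K (u, v)). simpl in K.
assert (B : Cmod ((u, v) - (g1 t, g2 t)) <= Rabs (u - g1 t) + Rabs (v - g2 t)) by apply (Cmod_le_abs ((u, v) - (g1 t, g2 t))).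
specialize (K ltac:(lra)). eapply Rle_trans; [exact K|].
apply Rle_trans with (eps / 2 * (2 * Rmax (Rabs (u - g1 t)) (Rabs (v - g2 t)))); [|right; field].
apply Rmult_le_compat_l; [lra|].
pose proof (Rmax_l (Rabs (u - g1 t)) (Rabs (v - g2 t))). pose proof (Rmax_r (Rabs (u - g1 t)) (Rabs (v - g2 t))). lra.
Qed.

Section LogCoordinates.
Variables (f fx fy : C -> R) (U : C -> Prop).
Hypothesis HU : forall z, U z -> exists d, 0 < d /\ forall w, Cmod (w - z) < d -> U w.
Hypothesis Hx : forall z, U z -> is_derive (fun s => f (s, snd z)) (fst z) (fx z).
Hypothesis Hy : forall z, U z -> is_derive (fun t => f (fst z, t)) (snd z) (fy z).
Hypothesis Hc : forall z, U z -> continuous fx z /\ continuous fy z.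

Lemma log_derive z : U (cexp z) ->
  is_derive (fun s => f (cexp (s, snd z))) (fst z) (fx (cexp z) * fst (cexp z) + fy (cexp z) * snd (cexp z)) /\
  is_derive (fun t => f (cexp (fst z, t))) (snd z) (fx (cexp z) * - snd (cexp z) + fy (cexp z) * fst (cexp z)).
Proof.
intros Hz. destruct z as [x y]. simpl (fst (x, y)). simpl (snd (x, y)).
destruct (Cd_partials cexp x y _ (Cd_cexp (x, y))) as [D1 [D2 [D3 D4]]].
destruct (HU _ Hz) as [d [Hd K]].
assert (Hn : exists d, 0 < d /\ forall w, Cmod (w - cexp (x, y)) < d ->
     is_derive (fun s => f (s, snd w)) (fst w) (fx w) /\
     is_derive (fun s => f (fst w, s)) (snd w) (fy w)).
{ exists d. split; [exact Hd|]. intros w Hw. specialize (K w Hw). split; [apply Hx, K|apply Hy, K]. }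
destruct (Hc _ Hz) as [C1 C2].
rewrite (surjective_pairing (cexp (x, y))) in Hn, C1, C2.
split.
- pose proof (chain_curve f fx fy (fun s => fst (cexp (s, y))) (fun s => snd (cexp (s, y))) x _ _ Hn C1 C2 D1 D2) as R.
  cbv beta in R. rewrite <- surjective_pairing in R.
  apply is_derive_ext with (2 := R). intros s. rewrite <- surjective_pairing. reflexivity.
- pose proof (chain_curve f fx fy (fun t => fst (cexp (x, t))) (fun t => snd (cexp (x, t))) y _ _ Hn C1 C2 D3 D4) as R.
  cbv beta in R. rewrite <- surjective_pairing in R.
  apply is_derive_ext with (2 := R). intros s. rewrite <- surjective_pairing. reflexivity.
Qed.
End LogCoordinates.

Lemma cexp_partials z :
  is_derive (fun s => fst (cexp (s, snd z))) (fst z) (fst (cexp z)) /\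
  is_derive (fun s => snd (cexp (s, snd z))) (fst z) (snd (cexp z)) /\
  is_derive (fun t => fst (cexp (fst z, t))) (snd z) (- snd (cexp z)) /\
  is_derive (fun t => snd (cexp (fst z, t))) (snd z) (fst (cexp z)).
Proof. destruct z as [x y]. apply (Cd_partials cexp x y _ (Cd_cexp (x, y))). Qed.

Lemma C2_real_log f fx fy fxx fxy fyx fyy U :
  (forall z, U z -> exists d, 0 < d /\ forall w, Cmod (w - z) < d -> U w) ->
  C2_real f fx fy fxx fxy fyx fyy U ->
  let E := cexp in
  C2_real (fun z => f (E z))
    (fun z => fx (E z) * fst (E z) + fy (E z) * snd (E z))
    (fun z => fx (E z) * - snd (E z) + fy (E z) * fst (E z))
    (fun z => (fxx (E z) * fst (E z) + fxy (E z) * snd (E z)) * fst (E z) + fx (E z) * fst (E z)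
       + ((fyx (E z) * fst (E z) + fyy (E z) * snd (E z)) * snd (E z) + fy (E z) * snd (E z)))
    (fun z => (fxx (E z) * - snd (E z) + fxy (E z) * fst (E z)) * fst (E z) + fx (E z) * - snd (E z)
       + ((fyx (E z) * - snd (E z) + fyy (E z) * fst (E z)) * snd (E z) + fy (E z) * fst (E z)))
    (fun z => (fxx (E z) * fst (E z) + fxy (E z) * snd (E z)) * - snd (E z) + fx (E z) * - snd (E z)
       + ((fyx (E z) * fst (E z) + fyy (E z) * snd (E z)) * fst (E z) + fy (E z) * fst (E z)))
    (fun z => (fxx (E z) * - snd (E z) + fxy (E z) * fst (E z)) * - snd (E z) + fx (E z) * - fst (E z)
       + ((fyx (E z) * - snd (E z) + fyy (E z) * fst (E z)) * fst (E z) + fy (E z) * - snd (E z)))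
    (fun z => U (E z)).
Proof.
intros HU [Hx Hy Hxx Hxy Hyx Hyy Hc Hcc] E.
assert (Cc : forall z, U z -> continuous fx z /\ continuous fy z) by (intros z Hz; apply (Hc z Hz)).
assert (Cx : forall z, U z -> continuous fxx z /\ continuous fxy z) by (intros z Hz; destruct (Hcc z Hz) as [? [? _]]; split; assumption).
assert (Cy : forall z, U z -> continuous fyx z /\ continuous fyy z) by (intros z Hz; destruct (Hcc z Hz) as [_ [_ [? ?]]]; split; assumption).
assert (L0 := log_derive f fx fy U HU Hx Hy Cc).
assert (L1 := log_derive fx fxx fxy U HU Hxx Hxy Cx).
assert (L2 := log_derive fy fyx fyy U HU Hyx Hyy Cy).
assert (CE : forall z, continuous E z) by (intros z; apply continuous_cexp, continuous_id).
assert (K : forall (g : C -> R) z, continuous g (E z) -> continuous (fun z => g (E z)) z).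
{ intros g z Hg. apply (continuous_comp E g); [apply CE|exact Hg]. }
assert (K1 : forall z, continuous (fun z => fst (E z)) z) by (intros; apply continuous_Re, CE).
assert (K2 : forall z, continuous (fun z => snd (E z)) z) by (intros; apply continuous_Im, CE).
assert (K3 : forall z, continuous (fun z => - snd (E z)) z) by (intros; apply continuous_Ropp, K2).
assert (K4 : forall z, continuous (fun z => - fst (E z)) z) by (intros; apply continuous_Ropp, K1).
assert (Comb : forall (a b u v : C -> R) z, continuous a z -> continuous b z -> continuous u z -> continuous v z ->
   continuous (fun z => a z * u z + b z * v z) z).
{ intros a b u v z Ha Hb Hu Hv. apply continuous_Rplus; apply continuous_Rmult; assumption. }
split; intros z Hz; destruct (cexp_partials z) as [E1 [E2 [E3 E4]]].
- apply L0, Hz.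
- apply L0, Hz.
- destruct (L1 z Hz) as [A1 A2]. destruct (L2 z Hz) as [B1 B2].
  eapply derive_val; [apply (derive_Rplus (fun s => fx (E (s, snd z)) * fst (E (s, snd z))));
   apply (derive_Rmult (fun s => _ (E (s, snd z)))); eassumption|]. cbv beta. rewrite <- !surjective_pairing. reflexivity.
- destruct (L1 z Hz) as [A1 A2]. destruct (L2 z Hz) as [B1 B2].
  eapply derive_val; [apply (derive_Rplus (fun s => fx (E (fst z, s)) * fst (E (fst z, s))));
   apply (derive_Rmult (fun s => _ (E (fst z, s)))); eassumption|]. cbv beta. rewrite <- !surjective_pairing. reflexivity.
- destruct (L1 z Hz) as [A1 A2]. destruct (L2 z Hz) as [B1 B2]. apply derive_Ropp in E2.
  eapply derive_val; [apply (derive_Rplus (fun s => fx (E (s, snd z)) * - snd (E (s, snd z))));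
   apply (derive_Rmult (fun s => _ (E (s, snd z)))); eassumption|]. cbv beta. rewrite <- !surjective_pairing. reflexivity.
- destruct (L1 z Hz) as [A1 A2]. destruct (L2 z Hz) as [B1 B2]. apply derive_Ropp in E4.
  eapply derive_val; [apply (derive_Rplus (fun s => fx (E (fst z, s)) * - snd (E (fst z, s))));
   apply (derive_Rmult (fun s => _ (E (fst z, s)))); eassumption|]. cbv beta. rewrite <- !surjective_pairing. reflexivity.
- destruct (Hc _ Hz) as [C0 [C1 C2]].
  split; [apply K, C0|]. split; apply Comb; auto.
- destruct (Hc _ Hz) as [C0 [C1 C2]]. destruct (Hcc _ Hz) as [C3 [C4 [C5 C6]]].
  pose proof (K _ z C1). pose proof (K _ z C2). pose proof (K _ z C3). pose proof (K _ z C4).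
  pose proof (K _ z C5). pose proof (K _ z C6).
  split; [|split; [|split]]; apply continuous_Rplus; apply Comb; auto; apply Comb; auto.
Qed.

(** Near a puncture where [psi] stays continuous, the pair [(A, M)] in the
    logarithmic coordinate has a monodromy in [SU(2)].  The distance between
    [(A, M)] and its translate by a period is a constant multiple of
    [exp(-psi/2)]; by Cauchy's estimate it tends to zero at the puncture while
    [exp(-psi/2)] does not, so the monodromy is trivial. *)
Theorem isolated_singularity psi p q pxx pxy pyx pyy P P' rho : 0 < rho ->
  C2_real psi p q pxx pxy pyx pyy (fun z => z <> RtoC 0 /\ Cmod z < rho) ->
  (forall z, Cmod z < rho -> Cd P z (P' z) /\ continuous P' z) ->
  (forall z, z <> RtoC 0 -> Cmod z < rho -> pxx z + pyy z = - 4 * Cmod (P z) ^ 2 * exp (2 * psi z)) ->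
  continuous psi (RtoC 0) ->
  exists r a a1 a2 b b1 b2, 0 < r /\
    C2_holo a a1 a2 (fun w => Cmod w < r) /\ C2_holo b b1 b2 (fun w => Cmod w < r) /\
    forall w, w <> RtoC 0 -> Cmod w < r -> Cmod (a w) ^ 2 + Cmod (b w) ^ 2 = exp (- psi w).
Proof.
intros Hrho HC2 HP Heq Hc0. pose proof PI_RGT_0 as Hpi.
set (U0 := fun z => z <> RtoC 0 /\ Cmod z < rho) in *.
assert (HU0 : forall z, U0 z -> exists d, 0 < d /\ forall w, Cmod (w - z) < d -> U0 w).
{ intros z [N Hz]. apply Cmod_pos in N. exists (Rmin (Cmod z) (rho - Cmod z)).
  split; [apply Rmin_glb_lt; lra|]. intros w Hw.
  assert (W1 : Cmod (w - z) < Cmod z) by (eapply Rlt_le_trans; [exact Hw|apply Rmin_l]).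
  assert (W2 : Cmod (w - z) < rho - Cmod z) by (eapply Rlt_le_trans; [exact Hw|apply Rmin_r]).
  split.
  - intros ->. rewrite Cmod_minus_sym in W1. replace (z - 0)%C with z in W1 by ring. lra.
  - pose proof (Cmod_triangle_rev w z). lra. }
pose proof (C2_real_log _ _ _ _ _ _ _ _ HU0 HC2) as HL. cbv zeta in HL.
match type of HL with C2_real ?a ?b ?c ?d ?e ?f ?g ?h =>
  set (tpsi := a) in *; set (tp := b) in *; set (tq := c) in *; set (txx := d) in *; set (txy := e) in *;
  set (tyx := f) in *; set (tyy := g) in *; set (U := h) in * end.
set (tP := fun z => (P (cexp z) * cexp z)%C).
set (tP' := fun z => (P' (cexp z) * cexp z * cexp z + P (cexp z) * cexp z)%C).
assert (HUx : forall z, fst z < ln rho -> U z).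
{ intros z Hz. split; [apply cexp_neq0|]. rewrite Cmod_cexp, <- (exp_ln rho Hrho). apply exp_increasing, Hz. }
assert (HtP : forall z, U z -> Cd tP z (tP' z) /\ continuous tP' z).
{ intros z [_ Hz]. destruct (HP _ Hz) as [D C'].
  assert (Ce : continuous cexp z) by (apply continuous_cexp, continuous_id).
  assert (C1 : continuous (fun z => P (cexp z)) z).
  { apply (continuous_comp cexp P); [exact Ce|apply (Cd_continuous _ _ _ D)]. }
  assert (C2 : continuous (fun z => P' (cexp z)) z) by (apply (continuous_comp cexp P'); assumption).
  split.
  - unfold tP, tP'. apply (Cd_mult (fun z => P (cexp z)) cexp); [|apply Cd_cexp]. apply (Cd_comp cexp P); [apply Cd_cexp|exact D].
  - unfold tP'. apply continuous_Cplus; [apply continuous_Cmult; [apply continuous_Cmult|]|apply continuous_Cmult]; assumption. }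
assert (Hteq : forall z, U z -> txx z + tyy z = - 4 * Cmod (tP z) ^ 2 * exp (2 * tpsi z)).
{ intros z [N Hz]. pose proof (Heq _ N Hz) as E. unfold txx, tyy, tP, tpsi.
  rewrite Cmod_mult, Rpow_mult_distr, (Cmod_sqr (cexp z)).
  set (x := fst (cexp z)) in *. set (y := snd (cexp z)) in *.
  transitivity ((pxx (cexp z) + pyy (cexp z)) * (x ^ 2 + y ^ 2)); [ring|]. rewrite E. ring. }
(* [kap] retracts the line onto abscissas where the connection is defined. *)
set (s1 := ln rho - 1). set (D := fun x => x < ln rho). set (kap := fun x => Rmin x s1).
assert (Hflat := liouville_flat tpsi tp tq txx txy tyx tyy tP tP' U HL HtP Hteq D
   (fun z Hz => HUx z Hz)).
assert (HDo : forall x, D x -> exists d, 0 < d /\ forall s, Rabs (s - x) < d -> D s).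
{ intros x Hx. unfold D in *. exists (ln rho - x). split; [lra|]. intros s Hs. apply Rabs_def2 in Hs. lra. }
specialize (Hflat HDo).
destruct (parallel_transport _ D _ _ _ _ _ _ kap (fun i => match i with 0%nat => 1 | _ => 0 end) Hflat) as [Y [HY1 HY2]].
{ intros x. apply (continuous_ext (fun x => (x + s1 - Rabs (x - s1)) / 2)).
  - intros t. unfold kap, Rmin. destruct (Rle_dec t s1); unfold Rabs; destruct Rcase_abs; lra.
  - apply continuous_Rmult; [|apply continuous_const]. apply continuous_Rminus.
    + apply continuous_Rplus; [apply continuous_id|apply continuous_const].
    + apply (continuous_comp (fun x => x - s1) Rabs); [|apply continuous_Rabs].
      apply continuous_Rminus; [apply continuous_id|apply continuous_const]. }
{ intros x. unfold kap, D. eapply Rle_lt_trans; [apply Rmin_r|]. unfold s1. lra. }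
{ unfold sqnorm. simpl. ring. }
set (V := fun z : C => fst z < s1).
assert (HVo : forall z, V z -> exists d, 0 < d /\ forall w, Cmod (w - z) < d -> V w).
{ intros z Hz. unfold V in *. exists (s1 - fst z). split; [lra|]. intros w Hw.
  pose proof (Cmod_fst_le (w - z)) as T. simpl in T. apply Rabs_le_between in T. lra. }
assert (HVU : forall z, V z -> U z) by (intros z Hz; apply HUx; unfold V, s1 in *; lra).
assert (HYd : forall z i, (i < 4)%nat -> V z ->
  is_derive (fun s => Y s (snd z) i) (fst z) (opx (liouville_connection tpsi tp tq tP) z (Y (fst z) (snd z)) i) /\
  is_derive (fun t => Y (fst z) t i) (snd z) (opy (liouville_connection tpsi tp tq tP) z (Y (fst z) (snd z)) i)).
{ intros z i Hi Hz. destruct z as [x y]. apply HY2; [exact Hi|]. unfold V in Hz. simpl in *.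
  exists (s1 - x). split; [lra|]. intros s Hs. apply Rabs_def2 in Hs. unfold kap. apply Rmin_left. lra. }
set (A := section_A tpsi Y). set (M := section_M tpsi Y).
assert (Hhol : forall z, V z -> holo A z /\ holo M z).
{ intros z Hz. destruct (section_holomorphic tpsi tp tq txx txy tyx tyy tP tP' U HL HtP Y V HVU HVo HY1 HYd z Hz) as [E1 E2].
  split; eexists; eassumption. }
assert (Hnorm : forall z, Cmod (A z) ^ 2 + Cmod (M z) ^ 2 = exp (- tpsi z)) by (intros; apply section_norm, HY1).
assert (Hper : forall z, tpsi (fst z, snd z + 2 * PI) = tpsi z).
{ intros z. unfold tpsi. rewrite cexp_period, <- surjective_pairing. reflexivity. }
(* By periodicity of the connection, a section and its translate by [2 i PI] are
   parallel for the same rotations, so their distance is constant. *)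
set (dist := fun x y => sqnorm (fun i => Y x (y + 2 * PI) i - Y x y i)).
assert (Dop : forall z, opx (liouville_connection tpsi tp tq tP) (fst z, snd z + 2 * PI) = opx (liouville_connection tpsi tp tq tP) z /\
  opy (liouville_connection tpsi tp tq tP) (fst z, snd z + 2 * PI) = opy (liouville_connection tpsi tp tq tP) z).
{ intros z. cbv beta iota delta [opx opy liouville_connection ax bx cx ay by_ cy tpsi tp tq tP].
  rewrite cexp_period, <- surjective_pairing. split; reflexivity. }
assert (Ddist : forall x y, x < s1 -> is_derive (fun s => dist s y) x 0 /\ is_derive (fun t => dist x t) y 0).
{ intros x y Hx.
  assert (Sk : forall al e1 e2 Z W, 2 * ((Z 0%nat - W 0%nat) * (su2 al e1 e2 Z 0 - su2 al e1 e2 W 0)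
     + (Z 1%nat - W 1%nat) * (su2 al e1 e2 Z 1 - su2 al e1 e2 W 1)
     + (Z 2%nat - W 2%nat) * (su2 al e1 e2 Z 2 - su2 al e1 e2 W 2)
     + (Z 3%nat - W 3%nat) * (su2 al e1 e2 Z 3 - su2 al e1 e2 W 3)) = 0) by (intros; unfold su2; ring).
  assert (G : forall (F : R -> nat -> R) F' t, (forall j, (j < 4)%nat -> is_derive (fun s => F s j) t (F' j)) ->
     is_derive (fun s => sqnorm (F s)) t (2 * (F t 0%nat * F' 0%nat + F t 1%nat * F' 1%nat + F t 2%nat * F' 2%nat + F t 3%nat * F' 3%nat))).
  { intros F F' t HF. unfold sqnorm. eapply derive_val.
    - apply derive_Rplus; [apply derive_Rplus; [apply derive_Rplus|]|]; apply derive_sqr; apply HF; lia.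
    - cbv beta. ring. }
  destruct (Dop (x, y)) as [O1 O2]. simpl in O1, O2.
  split.
  - eapply derive_val; [apply (G (fun s i => Y s (y + 2 * PI) i - Y s y i)
      (fun i => opx (liouville_connection tpsi tp tq tP) (x, y) (Y x (y + 2 * PI)) i - opx (liouville_connection tpsi tp tq tP) (x, y) (Y x y) i))|].
    + intros j Hj. apply derive_Rminus.
      * rewrite <- O1. apply (HYd (x, y + 2 * PI) j Hj Hx).
      * apply (HYd (x, y) j Hj Hx).
    + apply Sk.
  - eapply derive_val; [apply (G (fun t i => Y x (t + 2 * PI) i - Y x t i)
      (fun i => opy (liouville_connection tpsi tp tq tP) (x, y) (Y x (y + 2 * PI)) i - opy (liouville_connection tpsi tp tq tP) (x, y) (Y x y) i))|].
    + intros j Hj. apply derive_Rminus.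
      * destruct (HYd (x, y + 2 * PI) j Hj Hx) as [_ H2]. simpl in H2. rewrite O2 in H2.
        eapply derive_val; [apply (is_derive_comp (fun t => Y x t j) (fun t => t + 2 * PI) y); [exact H2|]|].
        -- apply derive_val with (1 + 0); [apply derive_Rplus; [apply (is_derive_id y)|apply (is_derive_const (2 * PI))]|reflexivity].
        -- unfold scal; simpl; unfold mult; simpl. ring.
      * apply (HYd (x, y) j Hj Hx).
    + apply Sk. }
assert (Cdist : forall x y, x < s1 -> dist x y = dist (s1 - 1) 0).
{ intros x y Hx. transitivity (dist x 0).
  - apply (derive_zero_const (fun t => dist x t)). intros t _. exact (proj2 (Ddist x t Hx)).
  - apply (derive_zero_const (fun s => dist s 0)). intros t Ht.
    refine (proj1 (Ddist t 0 _)). eapply Rle_lt_trans; [apply Ht|]. apply Rmax_lub_lt; lra. }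
assert (HdistAM : forall x y, Cmod (A (x, y + 2 * PI) - A (x, y)) ^ 2 + Cmod (M (x, y + 2 * PI) - M (x, y)) ^ 2
   = exp (- tpsi (x, y)) * dist x y).
{ intros x y. rewrite !Cmod_sqr. unfold A, M, section_A, section_M; simpl.
  pose proof (Hper (x, y)) as Hp. simpl in Hp. rewrite Hp.
  replace (exp (- tpsi (x, y))) with (exp (- tpsi (x, y) / 2) * exp (- tpsi (x, y) / 2)) by (rewrite <- exp_plus; f_equal; field).
  unfold dist, sqnorm. ring. }
destruct (proj1 (continuous_CR psi (RtoC 0)) Hc0 1 Rlt_0_1) as [d1 [Hd1 K1]].
set (s2 := Rmin s1 (ln d1)).
assert (Hs21 : s2 <= s1) by apply Rmin_l.
assert (Hpsi : forall z, fst z < s2 -> Rabs (tpsi z - psi (RtoC 0)) < 1).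
{ intros z Hz. apply K1. replace (cexp z - 0)%C with (cexp z) by ring. rewrite Cmod_cexp, <- (exp_ln d1 Hd1).
  apply exp_increasing. eapply Rlt_le_trans; [exact Hz|apply Rmin_r]. }
set (B2 := exp (- psi (RtoC 0) + 1)).
assert (HB2 : 0 < B2) by apply exp_pos.
assert (Hbd : forall z, fst z < s2 -> Cmod (A z) <= B2 + 1 /\ Cmod (M z) <= B2 + 1).
{ intros z Hz. specialize (Hpsi z Hz). apply Rabs_def2 in Hpsi. specialize (Hnorm z).
  assert (exp (- tpsi z) < B2) by (apply exp_increasing; lra).
  pose proof (Cmod_ge_0 (A z)). pose proof (Cmod_ge_0 (M z)). split; nra. }
assert (Hzero : dist (s1 - 1) 0 = 0).
{ destruct (Rle_lt_or_eq_dec 0 (dist (s1 - 1) 0)) as [Hpos|E]; [|exfalso|symmetry; exact E].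
  { unfold dist, sqnorm. repeat apply Rplus_le_le_0_compat; apply pow2_ge_0. }
  set (k0 := dist (s1 - 1) 0) in *.
  set (low := exp (- psi (RtoC 0) - 1)). assert (Hlow : 0 < low) by apply exp_pos.
  set (e := Rmin 1 (low * k0 / 4)). assert (He : 0 < e) by (apply Rmin_glb_lt; [lra|nra]).
  assert (He1 : e <= 1) by apply Rmin_l. assert (He2 : e <= low * k0 / 4) by apply Rmin_r.
  (* [r] makes the oscillation bound at most [e]; the disc of radius [r] around
     [(x, PI)] lies in the half-plane where [A] and [M] are bounded. *)
  set (r := 2 * PI + 32 * PI * (B2 + 1) / e).
  assert (Hr0 : 0 < 32 * PI * (B2 + 1) / e) by (apply Rdiv_lt_0_compat; [nra|exact He]).
  assert (Hr : 2 * PI < r) by (unfold r; lra).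
  set (x := s2 - r - 1).
  assert (Hball : forall z, Cmod (z - (x, PI)) < r -> fst z < s2).
  { intros z Hz. pose proof (Cmod_fst_le (z - (x, PI))) as T. change (Rabs (fst z - x) <= Cmod (z - (x, PI))) in T. apply Rabs_le_between in T.
    assert (x = s2 - r - 1) by reflexivity. lra. }
  assert (Hosc : forall f, (forall z, fst z < s2 -> holo f z) -> (forall z, fst z < s2 -> Cmod (f z) <= B2 + 1) ->
     Cmod (f (x, 0 + 2 * PI) - f (x, 0)) <= e).
  { intros f Hf Hfb. pose proof (Cauchy_oscillation f (x, PI) r (B2 + 1) ltac:(lra)
      (fun z Hz => Hf z (Hball z Hz)) (fun z Hz => Hfb z (Hball z Hz))) as O.
    replace ((x, PI) + (0, PI))%C with ((x, 0 + 2 * PI) : C) in O by (unfold Cplus; simpl; f_equal; ring).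
    replace ((x, PI) + (0, (- PI)%R))%C with ((x, 0) : C) in O by (unfold Cplus; simpl; f_equal; ring).
    eapply Rle_trans; [exact O|].
    apply Rle_trans with (8 * PI * (B2 + 1) * r / (r / 2) ^ 2).
    - apply Rmult_le_compat_l; [apply Rmult_le_pos; [apply Rmult_le_pos|]; lra|].
      apply Rinv_le_contravar; [apply pow_lt; lra|]. apply pow_incr. lra.
    - replace (8 * PI * (B2 + 1) * r / (r / 2) ^ 2) with (32 * PI * (B2 + 1) / r) by (field; lra).
      apply Rle_div_l; [lra|].
      apply Rle_trans with (e * (32 * PI * (B2 + 1) / e)); [right; field; lra|].
      apply Rmult_le_compat_l; [lra|unfold r; lra]. }
  assert (HA := Hosc A (fun z Hz => proj1 (Hhol z ltac:(unfold V; lra))) (fun z Hz => proj1 (Hbd z Hz))).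
  assert (HM := Hosc M (fun z Hz => proj2 (Hhol z ltac:(unfold V; lra))) (fun z Hz => proj2 (Hbd z Hz))).
  pose proof (HdistAM x 0) as E. rewrite (Cdist x 0) in E by (unfold x; lra). fold k0 in E.
  assert (Hx2 : fst (x, 0) < s2) by (simpl; unfold x; lra).
  specialize (Hpsi (x, 0) Hx2). apply Rabs_def2 in Hpsi.
  assert (Hl : low < exp (- tpsi (x, 0))) by (apply exp_increasing; lra).
  pose proof (Cmod_ge_0 (A (x, 0 + 2 * PI) - A (x, 0))). pose proof (Cmod_ge_0 (M (x, 0 + 2 * PI) - M (x, 0))).
  assert (low * k0 < exp (- tpsi (x, 0)) * k0) by (apply Rmult_lt_compat_r; assumption).
  nra. }
assert (HAM : forall x y, x < s1 -> A (x, y + 2 * PI) = A (x, y) /\ M (x, y + 2 * PI) = M (x, y)).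
{ intros x y Hx. pose proof (HdistAM x y) as E. rewrite Cdist, Hzero, Rmult_0_r in E by exact Hx.
  pose proof (pow2_ge_0 (Cmod (A (x, y + 2 * PI) - A (x, y)))). pose proof (pow2_ge_0 (Cmod (M (x, y + 2 * PI) - M (x, y)))).
  split; apply Ceq_minus, Cmod_eq_0; nra. }
assert (PA : periodic_holo A s1).
{ split; [intros z Hz; apply (Hhol z Hz)|]. split; [intros; apply HAM; assumption|].
  exists s2, (B2 + 1). intros z Hz. apply (Hbd z Hz). }
assert (PM : periodic_holo M s1).
{ split; [intros z Hz; apply (Hhol z Hz)|]. split; [intros; apply HAM; assumption|].
  exists s2, (B2 + 1). intros z Hz. apply (Hbd z Hz). }
destruct (removable_singularity A s1 (s1 - 1) PA ltac:(lra)) as [a [a1 [a2 [Ha Ea]]]].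
destruct (removable_singularity M s1 (s1 - 1) PM ltac:(lra)) as [b [b1 [b2 [Hb Eb]]]].
exists (exp (s1 - 1)), a, a1, a2, b, b1, b2.
split; [apply exp_pos|]. split; [exact Ha|]. split; [exact Hb|].
intros w N Hw. destruct (polar w N) as [z [Ez [Fz Iz]]].
assert (Hz : fst z < s1 - 1).
{ rewrite Fz, <- (ln_exp (s1 - 1)). apply ln_increasing; [apply Cmod_pos, N|exact Hw]. }
rewrite <- Ez, <- Ea, <- Eb by assumption. apply Hnorm.
Qed.

(** * Local calculus of twice differentiable real functions *)

Definition near_disc (z : C) (d : R) : C -> Prop := fun w => Cmod (w - z) < d.

Definition C2_at (f : C -> R) (z : C) : Prop :=
  exists d fx fy fxx fxy fyx fyy, 0 < d /\ C2_real f fx fy fxx fxy fyx fyy (near_disc z d).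

Definition lap (f : C -> R) (z : C) : R := dx (dx f) z + dy (dy f) z.

Lemma near_disc_center z d : 0 < d -> near_disc z d z.
Proof. intros H. unfold near_disc. replace (z - z)%C with (RtoC 0) by ring. rewrite Cmod_0. exact H. Qed.

Lemma near_disc_open z d w : near_disc z d w -> exists e, 0 < e /\ forall x, near_disc w e x -> near_disc z d x.
Proof.
unfold near_disc. intros H. exists (d - Cmod (w - z)). split; [lra|]. intros x Hx.
replace (x - z)%C with ((x - w) + (w - z))%C by ring. eapply Rle_lt_trans; [apply Cmod_triangle|]. lra.
Qed.

Lemma C2_real_sub f fx fy fxx fxy fyx fyy (U V : C -> Prop) : (forall z, V z -> U z) ->
  C2_real f fx fy fxx fxy fyx fyy U -> C2_real f fx fy fxx fxy fyx fyy V.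
Proof. intros H [H1 H2 H3 H4 H5 H6 H7 H8]. split; auto. Qed.

Lemma slice_x_loc (P : C -> Prop) z d : 0 < d -> (forall w, near_disc z d w -> P w) ->
  locally (fst z) (fun s => P (s, snd z)).
Proof.
intros Hd H. exists (mkposreal d Hd). intros s Hs. apply H. unfold near_disc.
replace ((s, snd z) - z)%C with (RtoC (s - fst z)).
- rewrite Cmod_R. exact Hs.
- unfold RtoC, Cminus, Cplus, Copp; simpl. f_equal; ring.
Qed.

Lemma slice_y_loc (P : C -> Prop) z d : 0 < d -> (forall w, near_disc z d w -> P w) ->
  locally (snd z) (fun t => P (fst z, t)).
Proof.
intros Hd H. exists (mkposreal d Hd). intros t Ht. apply H. unfold near_disc.
eapply Rle_lt_trans; [apply Cmod_le_abs|]. simpl.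
replace (fst z + - fst z) with 0 by ring. rewrite Rabs_R0, Rplus_0_l. exact Ht.
Qed.

Lemma derive_x_ext (f g : C -> R) z l d : 0 < d -> (forall w, near_disc z d w -> f w = g w) ->
  is_derive (fun s => f (s, snd z)) (fst z) l -> is_derive (fun s => g (s, snd z)) (fst z) l.
Proof.
intros Hd H. apply is_derive_ext_loc. apply (slice_x_loc (fun w => f w = g w) z d Hd H).
Qed.

Lemma derive_y_ext (f g : C -> R) z l d : 0 < d -> (forall w, near_disc z d w -> f w = g w) ->
  is_derive (fun t => f (fst z, t)) (snd z) l -> is_derive (fun t => g (fst z, t)) (snd z) l.
Proof.
intros Hd H. apply is_derive_ext_loc. apply (slice_y_loc (fun w => f w = g w) z d Hd H).
Qed.

Lemma continuous_loc (f g : C -> R) z d : 0 < d -> (forall w, near_disc z d w -> f w = g w) ->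
  continuous f z -> continuous g z.
Proof.
intros Hd H Hf. apply continuous_ext_loc with f; [|exact Hf].
apply locally_C. exists d. split; [exact Hd|exact H].
Qed.

(** The derivative functions chosen on overlapping discs agree, being the values of
    [Derive]. *)
Lemma C2_at_real f U : (forall z, U z -> C2_at f z) ->
  C2_real f (dx f) (dy f) (dx (dx f)) (dy (dx f)) (dx (dy f)) (dy (dy f)) U.
Proof.
intros H.
assert (K : forall z, U z -> exists d fx fy fxx fxy fyx fyy, 0 < d /\ C2_real f fx fy fxx fxy fyx fyy (near_disc z d) /\
  (forall w, near_disc z d w -> fx w = dx f w /\ fy w = dy f w /\ fxx w = dx (dx f) w /\ fxy w = dy (dx f) w /\
     fyx w = dx (dy f) w /\ fyy w = dy (dy f) w)).
{ intros z Hz. destruct (H z Hz) as [d [fx [fy [fxx [fxy [fyx [fyy [Hd HC]]]]]]]].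
  exists d, fx, fy, fxx, fxy, fyx, fyy. split; [exact Hd|]. split; [exact HC|].
  destruct HC as [H1 H2 H3 H4 H5 H6 _ _].
  assert (E1 : forall w, near_disc z d w -> fx w = dx f w).
  { intros w Hw. symmetry. apply is_derive_unique, H1, Hw. }
  assert (E2 : forall w, near_disc z d w -> fy w = dy f w).
  { intros w Hw. symmetry. apply is_derive_unique, H2, Hw. }
  intros w Hw. destruct (near_disc_open z d w Hw) as [e [He Ke]].
  split; [apply E1, Hw|]. split; [apply E2, Hw|].
  split; [|split; [|split]]; symmetry; apply is_derive_unique.
  - apply (derive_x_ext fx _ w _ e He); [intros; apply E1, Ke; assumption|apply H3, Hw].
  - apply (derive_y_ext fx _ w _ e He); [intros; apply E1, Ke; assumption|apply H4, Hw].
  - apply (derive_x_ext fy _ w _ e He); [intros; apply E2, Ke; assumption|apply H5, Hw].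
  - apply (derive_y_ext fy _ w _ e He); [intros; apply E2, Ke; assumption|apply H6, Hw]. }
assert (L : forall z, U z -> exists d, 0 < d /\
  C2_real f (dx f) (dy f) (dx (dx f)) (dy (dx f)) (dx (dy f)) (dy (dy f)) (near_disc z d)).
{ intros z Hz. destruct (K z Hz) as [d [fx [fy [fxx [fxy [fyx [fyy [Hd [[H1 H2 H3 H4 H5 H6 H7 H8] E]]]]]]]]].
  exists d. split; [exact Hd|]. split; intros w Hw; destruct (near_disc_open z d w Hw) as [e [He Ke]];
   destruct (E w Hw) as [E1 [E2 [E3 [E4 [E5 E6]]]]].
  - rewrite <- E1. apply H1, Hw.
  - rewrite <- E2. apply H2, Hw.
  - rewrite <- E3. apply (derive_x_ext fx _ w _ e He); [intros; apply E, Ke; assumption|apply H3, Hw].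
  - rewrite <- E4. apply (derive_y_ext fx _ w _ e He); [intros; apply E, Ke; assumption|apply H4, Hw].
  - rewrite <- E5. apply (derive_x_ext fy _ w _ e He); [intros; apply E, Ke; assumption|apply H5, Hw].
  - rewrite <- E6. apply (derive_y_ext fy _ w _ e He); [intros; apply E, Ke; assumption|apply H6, Hw].
  - destruct (H7 w Hw) as [C0 [C1 C2]]. split; [exact C0|].
    split; [apply (continuous_loc fx _ w e He)|apply (continuous_loc fy _ w e He)]; try assumption; intros; apply E, Ke; assumption.
  - destruct (H8 w Hw) as [C1 [C2 [C3 C4]]].
    split; [|split; [|split]].
    + apply (continuous_loc fxx _ w e He); [intros; apply E, Ke; assumption|exact C1].
    + apply (continuous_loc fxy _ w e He); [intros; apply E, Ke; assumption|exact C2].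
    + apply (continuous_loc fyx _ w e He); [intros; apply E, Ke; assumption|exact C3].
    + apply (continuous_loc fyy _ w e He); [intros; apply E, Ke; assumption|exact C4]. }
split; intros z Hz; destruct (L z Hz) as [d [Hd [H1 H2 H3 H4 H5 H6 H7 H8]]];
 pose proof (near_disc_center z d Hd) as Hc; auto.
Qed.

Lemma C2_real_at f fx fy fxx fxy fyx fyy z d : 0 < d -> C2_real f fx fy fxx fxy fyx fyy (near_disc z d) ->
  C2_at f z /\ lap f z = fxx z + fyy z.
Proof.
intros Hd H. assert (HA : C2_at f z) by (exists d, fx, fy, fxx, fxy, fyx, fyy; split; assumption).
split; [exact HA|].
destruct H as [H1 H2 H3 H4 H5 H6 _ _]. pose proof (near_disc_center z d Hd) as Hc.
unfold lap. f_equal; apply is_derive_unique.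
- apply (derive_x_ext fx _ z _ d Hd); [|apply H3, Hc]. intros w Hw. symmetry. apply is_derive_unique, H1, Hw.
- apply (derive_y_ext fy _ z _ d Hd); [|apply H6, Hc]. intros w Hw. symmetry. apply is_derive_unique, H2, Hw.
Qed.

Lemma C2_at_nearby f z : C2_at f z -> exists d, 0 < d /\ forall w, near_disc z d w -> C2_at f w.
Proof.
intros [d [fx [fy [fxx [fxy [fyx [fyy [Hd H]]]]]]]]. exists d. split; [exact Hd|]. intros w Hw.
destruct (near_disc_open z d w Hw) as [e [He Ke]].
exists e, fx, fy, fxx, fxy, fyx, fyy. split; [exact He|]. apply (C2_real_sub _ _ _ _ _ _ _ _ _ Ke H).
Qed.

Lemma C2_at_lap_continuous f z : C2_at f z -> continuous (lap f) z.
Proof.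
intros H. destruct (C2_at_nearby f z H) as [d [Hd K]].
destruct (C2_at_real f (near_disc z d) K) as [_ _ _ _ _ _ _ Hcc].
destruct (Hcc z (near_disc_center z d Hd)) as [C1 [_ [_ C2]]]. apply continuous_Rplus; assumption.
Qed.

Lemma C2_at_continuous f z : C2_at f z -> continuous f z.
Proof.
intros [d [fx [fy [fxx [fxy [fyx [fyy [Hd [_ _ _ _ _ _ H _]]]]]]]]]. apply (H z (near_disc_center z d Hd)).
Qed.

Lemma C2_at_ext f g z d : 0 < d -> (forall w, near_disc z d w -> f w = g w) -> C2_at f z ->
  C2_at g z /\ lap g z = lap f z.
Proof.
intros Hd E [e [fx [fy [fxx [fxy [fyx [fyy [He H]]]]]]]].
assert (Hlf : lap f z = fxx z + fyy z) by apply (C2_real_at _ _ _ _ _ _ _ z e He H).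
assert (Hm : 0 < Rmin d e) by (apply Rmin_glb_lt; assumption).
assert (S1 : forall w, near_disc z (Rmin d e) w -> near_disc z d w).
{ intros w Hw. unfold near_disc in *. eapply Rlt_le_trans; [exact Hw|apply Rmin_l]. }
assert (S2 : forall w, near_disc z (Rmin d e) w -> near_disc z e w).
{ intros w Hw. unfold near_disc in *. eapply Rlt_le_trans; [exact Hw|apply Rmin_r]. }
rewrite Hlf. apply (C2_real_at g fx fy fxx fxy fyx fyy z _ Hm).
destruct H as [H1 H2 H3 H4 H5 H6 H7 H8].
split; intros w Hw; auto.
- destruct (near_disc_open z d w (S1 w Hw)) as [r [Hr Kr]].
  apply (derive_x_ext f _ w _ r Hr); [intros; apply E, Kr; assumption|apply H1, S2, Hw].
- destruct (near_disc_open z d w (S1 w Hw)) as [r [Hr Kr]].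
  apply (derive_y_ext f _ w _ r Hr); [intros; apply E, Kr; assumption|apply H2, S2, Hw].
- destruct (H7 w (S2 w Hw)) as [C0 [C1 C2]]. split; [|split; assumption].
  destruct (near_disc_open z d w (S1 w Hw)) as [r [Hr Kr]].
  apply (continuous_loc f _ w r Hr); [intros; apply E, Kr; assumption|exact C0].
Qed.

(** ** Translations *)

Lemma Derive_shift (h : R -> R) c x : Derive (fun s => h (c + s)) x = Derive h (c + x).
Proof.
unfold Derive. f_equal. apply Lim_ext. intros t. rewrite Rplus_assoc. reflexivity.
Qed.

Lemma dx_shift f a z : dx (fun w => f (a + w)%C) z = dx f (a + z)%C.
Proof. exact (Derive_shift (fun s => f (s, snd a + snd z)) (fst a) (fst z)). Qed.

Lemma dy_shift f a z : dy (fun w => f (a + w)%C) z = dy f (a + z)%C.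
Proof. exact (Derive_shift (fun t => f (fst a + fst z, t)) (snd a) (snd z)). Qed.

Lemma dx_ext f g z : (forall w, f w = g w) -> dx f z = dx g z.
Proof. intros H. unfold dx. apply Derive_ext. intros; apply H. Qed.

Lemma dy_ext f g z : (forall w, f w = g w) -> dy f z = dy g z.
Proof. intros H. unfold dy. apply Derive_ext. intros; apply H. Qed.

Lemma lap_shift f a z : lap (fun w => f (a + w)%C) z = lap f (a + z)%C.
Proof.
unfold lap. rewrite (dx_ext _ (fun w => dx f (a + w)%C)) by (intros; apply dx_shift).
rewrite (dy_ext _ (fun w => dy f (a + w)%C)) by (intros; apply dy_shift).
rewrite dx_shift, dy_shift. reflexivity.
Qed.

Lemma derive_translate (h : R -> R) (c x l : R) : is_derive h (c + x) l -> is_derive (fun s => h (c + s)) x l.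
Proof.
intros H. eapply derive_val; [apply (is_derive_comp h (fun s => c + s) x); [exact H|]|].
- apply derive_val with (0 + 1); [apply derive_Rplus; [apply (is_derive_const c)|apply (is_derive_id x)]|reflexivity].
- unfold scal; simpl; unfold mult; simpl. ring.
Qed.

Lemma continuous_translate (f : C -> R) a z : continuous f (a + z)%C -> continuous (fun w => f (a + w)%C) z.
Proof.
intros H. apply (continuous_comp (fun w => (a + w)%C) f); [|exact H].
apply continuous_Cplus; [apply continuous_const|apply continuous_id].
Qed.

Lemma C2_at_shift f a z : C2_at f (a + z)%C -> C2_at (fun w => f (a + w)%C) z.
Proof.
intros [d [fx [fy [fxx [fxy [fyx [fyy [Hd [H1 H2 H3 H4 H5 H6 H7 H8]]]]]]]]].
exists d, (fun w => fx (a + w)%C), (fun w => fy (a + w)%C), (fun w => fxx (a + w)%C),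
  (fun w => fxy (a + w)%C), (fun w => fyx (a + w)%C), (fun w => fyy (a + w)%C).
split; [exact Hd|].
assert (S : forall w, near_disc z d w -> near_disc (a + z)%C d (a + w)%C).
{ intros w Hw. unfold near_disc in *. replace (a + w - (a + z))%C with (w - z)%C by ring. exact Hw. }
split; intros w Hw; specialize (S w Hw).
- exact (derive_translate (fun s => f (s, snd a + snd w)) (fst a) (fst w) _ (H1 _ S)).
- exact (derive_translate (fun t => f (fst a + fst w, t)) (snd a) (snd w) _ (H2 _ S)).
- exact (derive_translate (fun s => fx (s, snd a + snd w)) (fst a) (fst w) _ (H3 _ S)).
- exact (derive_translate (fun t => fx (fst a + fst w, t)) (snd a) (snd w) _ (H4 _ S)).
- exact (derive_translate (fun s => fy (s, snd a + snd w)) (fst a) (fst w) _ (H5 _ S)).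
- exact (derive_translate (fun t => fy (fst a + fst w, t)) (snd a) (snd w) _ (H6 _ S)).
- destruct (H7 _ S) as [C0 [C1 C2]]. split; [|split]; apply continuous_translate; assumption.
- destruct (H8 _ S) as [C1 [C2 [C3 C4]]]. split; [|split; [|split]]; apply continuous_translate; assumption.
Qed.

Lemma C2_at_unshift f a : C2_at (fun w => f (a + w)%C) (RtoC 0) -> C2_at f a.
Proof.
intros H. assert (H' : C2_at (fun w => f (a + w)%C) (- a + a)%C) by (replace (- a + a)%C with (RtoC 0) by ring; exact H).
apply (C2_at_shift (fun w => f (a + w)%C)) in H'.
apply (C2_at_ext _ f a 1 Rlt_0_1) in H'; [apply H'|].
intros w _. f_equal. ring.
Qed.

(** ** Algebraic operations *)

Lemma C2_at_smooth f : smooth_near_0 f -> C2_at f (RtoC 0).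
Proof.
intros [eps [He H]]. destruct (H 2%nat) as [C0 [D0 [[C1 [D1 [[C2 _] [C3 _]]]] [C4 [D2 [[C5 _] [C6 _]]]]]]].
exists eps, (dx f), (dy f), (dx (dx f)), (dy (dx f)), (dx (dy f)), (dy (dy f)).
split; [exact He|].
assert (S : forall z, near_disc (RtoC 0) eps z -> Cmod z < eps).
{ intros z Hz. unfold near_disc in Hz. replace (z - 0)%C with z in Hz by ring. exact Hz. }
split; intros z Hz; apply S in Hz.
- apply Derive_correct, (D0 z Hz).
- apply Derive_correct, (D0 z Hz).
- apply Derive_correct, (D1 z Hz).
- apply Derive_correct, (D1 z Hz).
- apply Derive_correct, (D2 z Hz).
- apply Derive_correct, (D2 z Hz).
- split; [apply C0, Hz|split; [apply C1, Hz|apply C4, Hz]].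
- split; [apply C2, Hz|split; [apply C3, Hz|split; [apply C5, Hz|apply C6, Hz]]].
Qed.

Lemma C2_real_combine f fx fy fxx fxy fyx fyy g gx gy gxx gxy gyx gyy U (s : R) :
  C2_real f fx fy fxx fxy fyx fyy U -> C2_real g gx gy gxx gxy gyx gyy U ->
  C2_real (fun z => f z + s * g z) (fun z => fx z + s * gx z) (fun z => fy z + s * gy z)
    (fun z => fxx z + s * gxx z) (fun z => fxy z + s * gxy z)
    (fun z => fyx z + s * gyx z) (fun z => fyy z + s * gyy z) U.
Proof.
intros [F1 F2 F3 F4 F5 F6 F7 F8] [G1 G2 G3 G4 G5 G6 G7 G8].
assert (D : forall (u v : R -> R) (x l m : R), is_derive u x l -> is_derive v x m -> is_derive (fun t => u t + s * v t) x (l + s * m)).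
{ intros u v x l m Hu Hv. apply derive_Rplus; [exact Hu|]. apply derive_scal, Hv. }
assert (K : forall (u v : C -> R) z, continuous u z -> continuous v z -> continuous (fun t => u t + s * v t) z).
{ intros u v z Hu Hv. apply continuous_Rplus; [exact Hu|]. apply continuous_Rmult; [apply continuous_const|exact Hv]. }
split; intros z Hz.
- exact (D _ _ _ _ _ (F1 z Hz) (G1 z Hz)).
- exact (D _ _ _ _ _ (F2 z Hz) (G2 z Hz)).
- exact (D _ _ _ _ _ (F3 z Hz) (G3 z Hz)).
- exact (D _ _ _ _ _ (F4 z Hz) (G4 z Hz)).
- exact (D _ _ _ _ _ (F5 z Hz) (G5 z Hz)).
- exact (D _ _ _ _ _ (F6 z Hz) (G6 z Hz)).
- destruct (F7 z Hz) as [A1 [A2 A3]]. destruct (G7 z Hz) as [B1 [B2 B3]]. split; [|split]; apply K; assumption.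
- destruct (F8 z Hz) as [A1 [A2 [A3 A4]]]. destruct (G8 z Hz) as [B1 [B2 [B3 B4]]]. split; [|split; [|split]]; apply K; assumption.
Qed.

Lemma C2_at_combine f g s z : C2_at f z -> C2_at g z ->
  C2_at (fun w => f w + s * g w) z /\ lap (fun w => f w + s * g w) z = lap f z + s * lap g z.
Proof.
intros Hf Hg. destruct (C2_at_nearby f z Hf) as [d [Hd Kd]]. destruct (C2_at_nearby g z Hg) as [e [He Ke]].
assert (Hm : 0 < Rmin d e) by (apply Rmin_glb_lt; assumption).
assert (F := C2_at_real f (near_disc z (Rmin d e)) (fun w Hw => Kd w (Rlt_le_trans _ _ _ Hw (Rmin_l d e)))).
assert (G := C2_at_real g (near_disc z (Rmin d e)) (fun w Hw => Ke w (Rlt_le_trans _ _ _ Hw (Rmin_r d e)))).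
destruct (C2_real_at _ _ _ _ _ _ _ z _ Hm (C2_real_combine _ _ _ _ _ _ _ _ _ _ _ _ _ _ _ s F G)) as [A E].
split; [exact A|]. rewrite E. unfold lap. ring.
Qed.

Lemma C2_real_const c U : C2_real (fun _ => c) (fun _ => 0) (fun _ => 0) (fun _ => 0) (fun _ => 0) (fun _ => 0) (fun _ => 0) U.
Proof.
split; intros z _; try (apply (is_derive_const c)); try (apply (is_derive_const 0));
 repeat split; apply continuous_const.
Qed.

Lemma C2_real_mult f fx fy fxx fxy fyx fyy g gx gy gxx gxy gyx gyy U :
  C2_real f fx fy fxx fxy fyx fyy U -> C2_real g gx gy gxx gxy gyx gyy U ->
  C2_real (fun z => f z * g z) (fun z => fx z * g z + f z * gx z) (fun z => fy z * g z + f z * gy z)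
    (fun z => (fxx z * g z + fx z * gx z) + (fx z * gx z + f z * gxx z))
    (fun z => (fxy z * g z + fx z * gy z) + (fy z * gx z + f z * gxy z))
    (fun z => (fyx z * g z + fy z * gx z) + (fx z * gy z + f z * gyx z))
    (fun z => (fyy z * g z + fy z * gy z) + (fy z * gy z + f z * gyy z)) U.
Proof.
intros [F1 F2 F3 F4 F5 F6 F7 F8] [G1 G2 G3 G4 G5 G6 G7 G8].
assert (K : forall (a b c d : C -> R) z, continuous a z -> continuous b z -> continuous c z -> continuous d z ->
  continuous (fun t => a t * b t + c t * d t) z).
{ intros a b c d z Ha Hb Hc Hd. apply continuous_Rplus; apply continuous_Rmult; assumption. }
assert (Px : forall (u v ux vx : C -> R) z, is_derive (fun s => u (s, snd z)) (fst z) (ux z) ->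
  is_derive (fun s => v (s, snd z)) (fst z) (vx z) ->
  is_derive (fun s => u (s, snd z) * v (s, snd z)) (fst z) (ux z * v z + u z * vx z)).
{ intros u v ux vx z Hu Hv. eapply derive_val; [apply (derive_Rmult (fun s => u (s, snd z)) (fun s => v (s, snd z))); eassumption|].
  cbv beta. rewrite <- surjective_pairing. reflexivity. }
assert (Py : forall (u v uy vy : C -> R) z, is_derive (fun s => u (fst z, s)) (snd z) (uy z) ->
  is_derive (fun s => v (fst z, s)) (snd z) (vy z) ->
  is_derive (fun s => u (fst z, s) * v (fst z, s)) (snd z) (uy z * v z + u z * vy z)).
{ intros u v uy vy z Hu Hv. eapply derive_val; [apply (derive_Rmult (fun s => u (fst z, s)) (fun s => v (fst z, s))); eassumption|].
  cbv beta. rewrite <- surjective_pairing. reflexivity. }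
split; intros z Hz.
- apply Px; auto.
- apply Py; auto.
- apply (derive_Rplus (fun s => fx (s, snd z) * g (s, snd z)) (fun s => f (s, snd z) * gx (s, snd z))); apply Px; auto.
- apply (derive_Rplus (fun s => fx (fst z, s) * g (fst z, s)) (fun s => f (fst z, s) * gx (fst z, s))); apply Py; auto.
- apply (derive_Rplus (fun s => fy (s, snd z) * g (s, snd z)) (fun s => f (s, snd z) * gy (s, snd z))); apply Px; auto.
- apply (derive_Rplus (fun s => fy (fst z, s) * g (fst z, s)) (fun s => f (fst z, s) * gy (fst z, s))); apply Py; auto.
- destruct (F7 z Hz) as [A1 [A2 A3]]. destruct (G7 z Hz) as [B1 [B2 B3]].
  split; [apply continuous_Rmult; assumption|]. split; apply K; assumption.
- destruct (F7 z Hz) as [A1 [A2 A3]]. destruct (G7 z Hz) as [B1 [B2 B3]].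
  destruct (F8 z Hz) as [A4 [A5 [A6 A7]]]. destruct (G8 z Hz) as [B4 [B5 [B6 B7]]].
  split; [|split; [|split]]; apply continuous_Rplus; apply K; assumption.
Qed.

Lemma C2_at_mult f g z : C2_at f z -> C2_at g z -> C2_at (fun w => f w * g w) z.
Proof.
intros Hf Hg. destruct (C2_at_nearby f z Hf) as [d [Hd Kd]]. destruct (C2_at_nearby g z Hg) as [e [He Ke]].
assert (Hm : 0 < Rmin d e) by (apply Rmin_glb_lt; assumption).
assert (F := C2_at_real f (near_disc z (Rmin d e)) (fun w Hw => Kd w (Rlt_le_trans _ _ _ Hw (Rmin_l d e)))).
assert (G := C2_at_real g (near_disc z (Rmin d e)) (fun w Hw => Ke w (Rlt_le_trans _ _ _ Hw (Rmin_r d e)))).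
apply (C2_real_at _ _ _ _ _ _ _ z _ Hm (C2_real_mult _ _ _ _ _ _ _ _ _ _ _ _ _ _ _ F G)).
Qed.

Lemma derive_ln_comp (u : R -> R) (x l : R) : 0 < u x -> is_derive u x l -> is_derive (fun t => ln (u t)) x (l * / u x).
Proof.
intros Hp H. eapply derive_val; [apply (is_derive_comp ln u x); [apply is_derive_Reals, derivable_pt_lim_ln, Hp|exact H]|].
unfold scal; simpl; unfold mult; simpl. reflexivity.
Qed.

Lemma derive_inv_comp (u : R -> R) (x l : R) : u x <> 0 -> is_derive u x l -> is_derive (fun t => / u t) x (- l * (/ u x * / u x)).
Proof.
intros Hp H. eapply derive_val; [apply (is_derive_inv u x l H Hp)|]. simpl. field. exact Hp.
Qed.

Lemma C2_at_ln u z : C2_at u z -> 0 < u z -> C2_at (fun w => ln (u w)) z.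
Proof.
intros Hu Hp. destruct (C2_at_nearby u z Hu) as [d [Hd Kd]].
destruct (proj1 (continuous_CR u z) (C2_at_continuous u z Hu) (u z) Hp) as [e [He Ke]].
assert (Hm : 0 < Rmin d e) by (apply Rmin_glb_lt; assumption).
assert (Pos : forall w, near_disc z (Rmin d e) w -> 0 < u w).
{ intros w Hw. specialize (Ke w (Rlt_le_trans _ _ _ Hw (Rmin_r d e))). apply Rabs_def2 in Ke. lra. }
destruct (C2_at_real u (near_disc z (Rmin d e)) (fun w Hw => Kd w (Rlt_le_trans _ _ _ Hw (Rmin_l d e))))
  as [F1 F2 F3 F4 F5 F6 F7 F8].
set (V := near_disc z (Rmin d e)) in *.
exists (Rmin d e), (fun w => dx u w * / u w), (fun w => dy u w * / u w),
  (fun w => dx (dx u) w * / u w + dx u w * (- dx u w * (/ u w * / u w))),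
  (fun w => dy (dx u) w * / u w + dx u w * (- dy u w * (/ u w * / u w))),
  (fun w => dx (dy u) w * / u w + dy u w * (- dx u w * (/ u w * / u w))),
  (fun w => dy (dy u) w * / u w + dy u w * (- dy u w * (/ u w * / u w))).
split; [exact Hm|].
assert (Px : forall (v vx : C -> R) w, V w -> is_derive (fun s => v (s, snd w)) (fst w) (vx w) ->
  is_derive (fun s => v (s, snd w) * / u (s, snd w)) (fst w) (vx w * / u w + v w * (- dx u w * (/ u w * / u w)))).
{ intros v vx w Hw Hv. pose proof (F1 w Hw) as Hd1. apply derive_inv_comp in Hd1.
  2: { rewrite <- surjective_pairing. apply Rgt_not_eq, Pos, Hw. }
  rewrite <- surjective_pairing in Hd1.
  eapply derive_val; [apply (derive_Rmult (fun s => v (s, snd w)) (fun s => / u (s, snd w))); eassumption|].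
  cbv beta. rewrite <- surjective_pairing. reflexivity. }
assert (Py : forall (v vy : C -> R) w, V w -> is_derive (fun s => v (fst w, s)) (snd w) (vy w) ->
  is_derive (fun s => v (fst w, s) * / u (fst w, s)) (snd w) (vy w * / u w + v w * (- dy u w * (/ u w * / u w)))).
{ intros v vy w Hw Hv. pose proof (F2 w Hw) as Hd1. apply derive_inv_comp in Hd1.
  2: { rewrite <- surjective_pairing. apply Rgt_not_eq, Pos, Hw. }
  rewrite <- surjective_pairing in Hd1.
  eapply derive_val; [apply (derive_Rmult (fun s => v (fst w, s)) (fun s => / u (fst w, s))); eassumption|].
  cbv beta. rewrite <- surjective_pairing. reflexivity. }
assert (Ci : forall w, V w -> continuous (fun w => / u w) w).
{ intros w Hw. apply continuous_Rinv; [apply (F7 w Hw)|apply Rgt_not_eq, Pos, Hw]. }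
split; intros w Hw.
- pose proof (F1 w Hw) as Hd1. apply derive_ln_comp in Hd1; [|rewrite <- surjective_pairing; apply Pos, Hw].
  rewrite <- surjective_pairing in Hd1. exact Hd1.
- pose proof (F2 w Hw) as Hd1. apply derive_ln_comp in Hd1; [|rewrite <- surjective_pairing; apply Pos, Hw].
  rewrite <- surjective_pairing in Hd1. exact Hd1.
- apply Px; auto.
- apply Py; auto.
- apply Px; auto.
- apply Py; auto.
- destruct (F7 w Hw) as [A1 [A2 A3]]. specialize (Ci w Hw). split; [|split].
  + apply (continuous_of_R u ln); [exact A1|]. eexists. apply is_derive_Reals, derivable_pt_lim_ln, Pos, Hw.
  + apply continuous_Rmult; assumption.
  + apply continuous_Rmult; assumption.
- destruct (F7 w Hw) as [A1 [A2 A3]]. destruct (F8 w Hw) as [A4 [A5 [A6 A7]]]. specialize (Ci w Hw).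
  assert (Cn : forall a b c : C -> R, continuous a w -> continuous b w -> continuous c w ->
    continuous (fun w => a w * / u w + b w * (- c w * (/ u w * / u w))) w).
  { intros a b c Ha Hb Hc. apply continuous_Rplus; [apply continuous_Rmult; assumption|].
    apply continuous_Rmult; [exact Hb|]. apply continuous_Rmult; [apply continuous_Ropp, Hc|].
    apply continuous_Rmult; assumption. }
  split; [|split; [|split]]; apply Cn; assumption.
Qed.

Lemma C2_at_Re_Im f f1 f2 z d : 0 < d -> C2_holo f f1 f2 (near_disc z d) ->
  C2_at (fun w => fst (f w)) z /\ C2_at (fun w => snd (f w)) z.
Proof.
intros Hd H.
assert (Pd : forall g l w, Cd g w l ->
  is_derive (fun s => fst (g (s, snd w))) (fst w) (fst l) /\
  is_derive (fun s => snd (g (s, snd w))) (fst w) (snd l) /\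
  is_derive (fun t => fst (g (fst w, t))) (snd w) (- snd l) /\
  is_derive (fun t => snd (g (fst w, t))) (snd w) (fst l)).
{ intros g l w Hg. rewrite (surjective_pairing w) in Hg. apply (Cd_partials g _ _ l Hg). }
split.
- exists d, (fun w => fst (f1 w)), (fun w => - snd (f1 w)), (fun w => fst (f2 w)), (fun w => - snd (f2 w)),
   (fun w => - snd (f2 w)), (fun w => - fst (f2 w)). split; [exact Hd|].
  split; intros w Hw; destruct (H w Hw) as [D1 [D2 C2]]; destruct (Pd _ _ _ D1) as [A1 [A2 [A3 A4]]];
   destruct (Pd _ _ _ D2) as [B1 [B2 [B3 B4]]]; auto.
  + apply derive_Ropp, B2.
  + apply derive_Ropp, B4.
  + apply Cd_continuous in D1. apply Cd_continuous in D2. split; [apply continuous_Re, D1|].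
    split; [apply continuous_Re, D2|apply continuous_Ropp, continuous_Im, D2].
  + split; [apply continuous_Re, C2|]. split; [apply continuous_Ropp, continuous_Im, C2|].
    split; [apply continuous_Ropp, continuous_Im, C2|apply continuous_Ropp, continuous_Re, C2].
- exists d, (fun w => snd (f1 w)), (fun w => fst (f1 w)), (fun w => snd (f2 w)), (fun w => fst (f2 w)),
   (fun w => fst (f2 w)), (fun w => - snd (f2 w)). split; [exact Hd|].
  split; intros w Hw; destruct (H w Hw) as [D1 [D2 C2]]; destruct (Pd _ _ _ D1) as [A1 [A2 [A3 A4]]];
   destruct (Pd _ _ _ D2) as [B1 [B2 [B3 B4]]]; auto.
  + apply Cd_continuous in D1. apply Cd_continuous in D2. split; [apply continuous_Im, D1|].
    split; [apply continuous_Im, D2|apply continuous_Re, D2].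
  + split; [apply continuous_Im, C2|]. split; [apply continuous_Re, C2|].
    split; [apply continuous_Re, C2|apply continuous_Ropp, continuous_Im, C2].
Qed.

Lemma C2_at_sqr_mod f f1 f2 z d : 0 < d -> C2_holo f f1 f2 (near_disc z d) -> C2_at (fun w => Cmod (f w) ^ 2) z.
Proof.
intros Hd H. destruct (C2_at_Re_Im f f1 f2 z d Hd H) as [H1 H2].
pose proof (C2_at_mult _ _ _ H1 H1) as K1. pose proof (C2_at_mult _ _ _ H2 H2) as K2.
destruct (C2_at_combine _ _ 1 z K1 K2) as [K3 _].
apply (C2_at_ext _ (fun w => Cmod (f w) ^ 2) z 1 Rlt_0_1) in K3; [apply K3|].
intros w _. rewrite Cmod_sqr. ring.
Qed.

(** [ln |f|] is harmonic: its gradient is given by the holomorphic function [f1 / f]. *)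
Lemma ln_mod_harmonic f f1 f2 z d : 0 < d -> C2_holo f f1 f2 (near_disc z d) -> f z <> RtoC 0 ->
  C2_at (fun w => ln (Cmod (f w))) z /\ lap (fun w => ln (Cmod (f w))) z = 0.
Proof.
intros Hd H N.
destruct (continuous_nonzero f z) as [e [He Ke]]; [apply (Cd_continuous _ _ _ (proj1 (H z (near_disc_center z d Hd))))|exact N|].
assert (Hm : 0 < Rmin d e) by (apply Rmin_glb_lt; assumption).
set (V := near_disc z (Rmin d e)).
assert (HV : forall w, V w -> near_disc z d w) by (intros w Hw; exact (Rlt_le_trans _ _ _ Hw (Rmin_l d e))).
assert (NV : forall w, V w -> f w <> RtoC 0) by (intros w Hw; apply Ke; exact (Rlt_le_trans _ _ _ Hw (Rmin_r d e))).
set (L := fun w => (f1 w / f w)%C). set (L1 := fun w => ((f2 w * f w - f1 w * f1 w) / (f w * f w))%C).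
assert (DL : forall w, V w -> Cd L w (L1 w) /\ continuous L1 w).
{ intros w Hw. destruct (H w (HV w Hw)) as [D1 [D2 C2]]. specialize (NV w Hw). split.
  - apply Cd_div; assumption.
  - apply Cd_continuous in D1. apply Cd_continuous in D2. unfold L1.
    apply continuous_Cdiv; [apply continuous_Cminus|apply continuous_Cmult|apply Cmult_neq_0]; try assumption;
     apply continuous_Cmult; assumption. }
assert (Pd : forall g l w, Cd g w l ->
  is_derive (fun s => fst (g (s, snd w))) (fst w) (fst l) /\
  is_derive (fun s => snd (g (s, snd w))) (fst w) (snd l) /\
  is_derive (fun t => fst (g (fst w, t))) (snd w) (- snd l) /\
  is_derive (fun t => snd (g (fst w, t))) (snd w) (fst l)).
{ intros g l w Hg. rewrite (surjective_pairing w) in Hg. apply (Cd_partials g _ _ l Hg). }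
assert (Eln : forall w, V w -> ln (Cmod (f w)) = / 2 * ln (fst (f w) ^ 2 + snd (f w) ^ 2)).
{ intros w Hw. rewrite <- Cmod_sqr. pose proof (Cmod_pos _ (NV w Hw)) as Hp.
  simpl. rewrite Rmult_1_r, ln_mult by assumption. field. }
assert (Sq : forall w, V w -> 0 < fst (f w) ^ 2 + snd (f w) ^ 2).
{ intros w Hw. rewrite <- Cmod_sqr. apply pow_lt, Cmod_pos, NV, Hw. }
assert (Ds : forall (u v : R -> R) (x l m : R), 0 < u x ^ 2 + v x ^ 2 -> is_derive u x l -> is_derive v x m ->
  is_derive (fun t => / 2 * ln (u t ^ 2 + v t ^ 2)) x ((u x * l + v x * m) / (u x ^ 2 + v x ^ 2))).
{ intros u v x l m Hp Hu Hv. apply derive_val with (/ 2 * ((2 * u x * l + 2 * v x * m) * / (u x ^ 2 + v x ^ 2))).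
  - apply derive_scal. apply (derive_ln_comp (fun t => u t ^ 2 + v t ^ 2)); [exact Hp|].
    apply derive_Rplus; apply derive_sqr; assumption.
  - field. lra. }
assert (R : C2_real (fun w => ln (Cmod (f w))) (fun w => fst (L w)) (fun w => - snd (L w)) (fun w => fst (L1 w))
   (fun w => - snd (L1 w)) (fun w => - snd (L1 w)) (fun w => - fst (L1 w)) V).
{ split; intros w Hw; destruct (DL w Hw) as [D2 C2]; destruct (Pd _ _ _ D2) as [B1 [B2 [B3 B4]]];
   try destruct (near_disc_open z _ w Hw) as [r [Hr Kr]]; auto.
  - destruct (H w (HV w Hw)) as [D1 _]. destruct (Pd _ _ _ D1) as [A1 [A2 _]].
    apply (derive_x_ext (fun w => / 2 * ln (fst (f w) ^ 2 + snd (f w) ^ 2)) (fun w => ln (Cmod (f w))) w _ r Hr).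
    { intros x Hx. symmetry. apply Eln, Kr, Hx. }
    eapply derive_val; [apply (Ds (fun s => fst (f (s, snd w))) (fun s => snd (f (s, snd w)))); [|exact A1|exact A2]; rewrite <- surjective_pairing; apply Sq, Hw|].
    cbv beta.
    rewrite <- surjective_pairing. unfold L. specialize (Sq w Hw).
    unfold Cdiv, Cinv, Cmult; simpl fst. field. nra.
  - destruct (H w (HV w Hw)) as [D1 _]. destruct (Pd _ _ _ D1) as [_ [_ [A1 A2]]].
    apply (derive_y_ext (fun w => / 2 * ln (fst (f w) ^ 2 + snd (f w) ^ 2)) (fun w => ln (Cmod (f w))) w _ r Hr).
    { intros x Hx. symmetry. apply Eln, Kr, Hx. }
    eapply derive_val; [apply (Ds (fun s => fst (f (fst w, s))) (fun s => snd (f (fst w, s)))); [|exact A1|exact A2]; rewrite <- surjective_pairing; apply Sq, Hw|].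
    cbv beta.
    rewrite <- surjective_pairing. unfold L. specialize (Sq w Hw).
    unfold Cdiv, Cinv, Cmult; simpl snd. field. nra.
  - apply derive_Ropp, B2.
  - apply derive_Ropp, B4.
  - destruct (H w (HV w Hw)) as [D1 _]. apply Cd_continuous in D1. apply Cd_continuous in D2. split; [|split].
    + apply (continuous_of_R (fun w => Cmod (f w)) ln); [apply continuous_Cmod, D1|].
      eexists. apply is_derive_Reals, derivable_pt_lim_ln, Cmod_pos, NV, Hw.
    + apply continuous_Re, D2.
    + apply continuous_Ropp, continuous_Im, D2.
  - split; [apply continuous_Re, C2|]. split; [apply continuous_Ropp, continuous_Im, C2|].
    split; [apply continuous_Ropp, continuous_Im, C2|apply continuous_Ropp, continuous_Re, C2]. }
destruct (C2_real_at _ _ _ _ _ _ _ z _ Hm R) as [A E]. split; [exact A|]. rewrite E. ring.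
Qed.

(** * The regularized potential of the metric on the plane *)

Definition C2_entire (f : C -> C) : Prop := exists f1 f2, C2_holo f f1 f2 (fun _ => True).

Lemma C2_entire_mult f g : C2_entire f -> C2_entire g -> C2_entire (fun z => f z * g z)%C.
Proof.
intros [f1 [f2 Hf]] [g1 [g2 Hg]].
exists (fun z => f1 z * g z + f z * g1 z)%C,
  (fun z => (f2 z * g z + f1 z * g1 z) + (f1 z * g1 z + f z * g2 z))%C.
intros z _. destruct (Hf z I) as [A1 [A2 A3]]. destruct (Hg z I) as [B1 [B2 B3]].
split; [apply (Cd_mult f g); assumption|]. split.
- apply (Cd_plus (fun z => f1 z * g z)%C (fun z => f z * g1 z)%C); [apply (Cd_mult f1 g)|apply (Cd_mult f g1)]; assumption.
- pose proof (Cd_continuous _ _ _ A1). pose proof (Cd_continuous _ _ _ A2).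
  pose proof (Cd_continuous _ _ _ B1). pose proof (Cd_continuous _ _ _ B2).
  apply continuous_Cplus; apply continuous_Cplus; apply continuous_Cmult; assumption.
Qed.

Lemma C2_entire_linear a : C2_entire (fun z => z - a)%C.
Proof.
exists (fun _ => RtoC 1), (fun _ => RtoC 0). intros z _. split; [|split].
- eapply Cd_eq; [|apply Cd_minus; [apply Cd_id|apply Cd_const]]. ring.
- apply Cd_const.
- apply continuous_const.
Qed.

Lemma C2_entire_const c : C2_entire (fun _ => c).
Proof.
exists (fun _ => RtoC 0), (fun _ => RtoC 0). intros z _.
split; [apply Cd_const|]. split; [apply Cd_const|apply continuous_const].
Qed.

Lemma C2_entire_linear_pow a k : C2_entire (fun z => (z - a) ^ k)%C.
Proof.
induction k as [|k IH]; [exact (C2_entire_const (RtoC 1))|].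
apply (C2_entire_mult (fun z => z - a)%C (fun z => (z - a) ^ k)%C); [apply C2_entire_linear|exact IH].
Qed.

Lemma C2_entire_continuous f z : C2_entire f -> continuous f z.
Proof. intros [f1 [f2 H]]. apply (Cd_continuous _ _ _ (proj1 (H z I))). Qed.

(** The polynomial whose divisor is the finite part of [D], which is effective and
    integral.  The logarithm of its modulus is harmonic off
    the cone points and has there the singularities of the potential of the metric. *)
Lemma divisor_polynomial (D : divisor) : NoDup (map fst D) -> effective_Z_divisor D ->
  exists P : C -> C, C2_entire P /\
    (forall z, regular D (Some z) -> P z <> RtoC 0) /\
    (forall a alpha, In (Some a, alpha) D -> exists (k : nat) (Q : C -> C),
       alpha - 1 = INR k /\ continuous Q (RtoC 0) /\ Q (RtoC 0) <> RtoC 0 /\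
       forall w, P (a + w)%C = (w ^ k * Q w)%C) /\
    (exists K N, 0 <= K /\ forall z, 1 <= Cmod z -> Cmod (P z) <= K * Cmod z ^ N).
Proof.
induction D as [|[q alpha] D IH]; intros Hnd Heff.
- exists (fun _ => RtoC 1). split; [apply C2_entire_const|]. split; [intros z _; apply C1_nz|].
  split; [intros a alpha []|]. exists 1, 0%nat. split; [lra|]. intros z _. rewrite Cmod_1. simpl. lra.
- simpl in Hnd. inversion Hnd as [|? ? Hni Hnd']; subst.
  destruct IH as [P [HP [Hreg [Hsing [K [N [HK Hgr]]]]]]]; [exact Hnd'| |].
  { intros p beta Hin. apply (Heff p beta). right. exact Hin. }
  destruct q as [a|].
  + destruct (Heff (Some a) alpha (or_introl eq_refl)) as [k Hk].
    exists (fun z => (z - a) ^ k * P z)%C. split; [|split; [|split]].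
    * apply C2_entire_mult; [apply C2_entire_linear_pow|exact HP].
    * intros z Hz. apply Cmult_neq_0.
      -- apply Cpow_nz. apply Cminus_eq_contra. intros ->. apply Hz. left. reflexivity.
      -- apply Hreg. intros Hin. apply Hz. right. exact Hin.
    * intros b beta [E|Hin].
      -- injection E as <- <-. exists k, (fun w => P (a + w)%C). split; [exact Hk|].
         split; [|split].
         ++ apply (continuous_comp (fun w => a + w)%C P); [|apply C2_entire_continuous, HP].
            apply continuous_Cplus; [apply continuous_const|apply continuous_id].
         ++ rewrite Cplus_0_r. apply Hreg. exact Hni.
         ++ intros w. replace (a + w - a)%C with w by ring. reflexivity.
      -- destruct (Hsing b beta Hin) as [m [Q [Hm [CQ [Q0 EQ]]]]].
         exists m, (fun w => (b + w - a) ^ k * Q w)%C. split; [exact Hm|]. split; [|split].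
         ++ apply continuous_Cmult; [|exact CQ]. apply continuous_Cpow.
            apply continuous_Cminus; [|apply continuous_const].
            apply continuous_Cplus; [apply continuous_const|apply continuous_id].
         ++ apply Cmult_neq_0; [|exact Q0]. apply Cpow_nz. rewrite Cplus_0_r.
            apply Cminus_eq_contra. intros ->. apply Hni. apply (in_map fst) in Hin. exact Hin.
         ++ intros w. rewrite EQ. ring.
    * exists ((1 + Cmod a) ^ k * K), (k + N)%nat. pose proof (Cmod_ge_0 a) as Ha. split.
      { apply Rmult_le_pos; [apply pow_le; lra|exact HK]. }
      intros z Hz. rewrite Cmod_mult, Cmod_pow, pow_add.
      replace ((1 + Cmod a) ^ k * K * (Cmod z ^ k * Cmod z ^ N)) with
        (((1 + Cmod a) * Cmod z) ^ k * (K * Cmod z ^ N)) by (rewrite Rpow_mult_distr; ring).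
      apply Rmult_le_compat; [apply pow_le, Cmod_ge_0|apply Cmod_ge_0| |apply Hgr, Hz].
      apply pow_incr. split; [apply Cmod_ge_0|]. eapply Rle_trans; [apply Cmod_minus_triangle|]. nra.
  + exists P. split; [exact HP|]. split; [|split].
    * intros z Hz. apply Hreg. intros Hin. apply Hz. right. exact Hin.
    * intros b beta [E|Hin]; [discriminate E|]. apply (Hsing b beta Hin).
    * exists K, N. split; assumption.
Qed.

Lemma punctured_disc_avoids (L : list sphere) z :
  exists d, 0 < d /\ forall w, Cmod (w - z) < d -> w <> z -> ~ In (Some w) L.
Proof.
induction L as [|q L [d [Hd IH]]].
- exists 1. split; [lra|]. intros w _ _ [].
- destruct q as [a|].
  + destruct (Ceq_dec a z) as [->|N].
    * exists d. split; [exact Hd|]. intros w Hw Hn [E|Hin]; [congruence|]. apply (IH w Hw Hn Hin).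
    * apply Cminus_eq_contra in N. apply Cmod_pos in N.
      exists (Rmin d (Cmod (a - z))). split; [apply Rmin_glb_lt; assumption|].
      intros w Hw Hn [E|Hin].
      -- injection E as ->. assert (Cmod (w - z) < Cmod (w - z)) by (eapply Rlt_le_trans; [exact Hw|apply Rmin_r]). lra.
      -- apply (IH w); [eapply Rlt_le_trans; [exact Hw|apply Rmin_l]|exact Hn|exact Hin].
  + exists d. split; [exact Hd|]. intros w Hw Hn [E|Hin]; [discriminate E|]. apply (IH w Hw Hn Hin).
Qed.

Lemma continuous_zero (h : C -> R) z d : 0 < d -> continuous h z ->
  (forall w, Cmod (w - z) < d -> w <> z -> h w = 0) -> h z = 0.
Proof.
intros Hd Hc H. destruct (Req_dec (h z) 0) as [E|N]; [exact E|exfalso].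
apply Rabs_pos_lt in N. destruct (proj1 (continuous_CR h z) Hc _ N) as [e [He K]].
set (t := Rmin d e / 2). assert (Hm : 0 < Rmin d e) by (apply Rmin_glb_lt; assumption).
pose proof (Rmin_l d e). pose proof (Rmin_r d e).
assert (M : Cmod (z + RtoC t - z)%C = t).
{ replace (z + RtoC t - z)%C with (RtoC t) by ring. rewrite Cmod_R, Rabs_pos_eq; unfold t; lra. }
specialize (K (z + RtoC t)%C). rewrite M in K. specialize (K ltac:(unfold t; lra)).
rewrite H in K.
- rewrite Rminus_0_l, Rabs_Ropp in K. lra.
- rewrite M. unfold t; lra.
- intros E. rewrite E in M. replace (z - z)%C with (RtoC 0) in M by ring. rewrite Cmod_0 in M. unfold t in M; lra.
Qed.

Section Potential.
Variables (g : conformal_metric) (D : divisor).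
Hypothesis HD : represents g D.
Hypothesis HK : constant_curvature_one g D.
Variable P : C -> C.
Hypothesis HP : C2_entire P.
Hypothesis HPreg : forall z, regular D (Some z) -> P z <> RtoC 0.
Hypothesis HPsing : forall a alpha, In (Some a, alpha) D -> exists (k : nat) (Q : C -> C),
   alpha - 1 = INR k /\ continuous Q (RtoC 0) /\ Q (RtoC 0) <> RtoC 0 /\
   forall w, P (a + w)%C = (w ^ k * Q w)%C.

Definition phi (z : C) : R := ln (g (Some z)) / 2.

(** The normalization turns [lap phi = - exp (2 phi)] into
    [lap psi = - 4 |P|^2 exp (2 psi)]. *)
Definition reg_potential (z : C) : R := phi z - ln 2 - ln (Cmod (P z)).

Definition liouville_at (f : C -> R) (z : C) : Prop :=
  C2_at f z /\ lap f z = - 4 * Cmod (P z) ^ 2 * exp (2 * f z).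

Lemma phi_liouville z : regular D (Some z) -> C2_at phi z /\ lap phi z = - exp (2 * phi z).
Proof.
intros Hz. destruct HD as [_ [Hs _]].
assert (A : C2_at (fun w => phi (z + w)%C) (RtoC 0)) by (apply C2_at_smooth, (Hs _ Hz)).
split; [apply C2_at_unshift, A|].
pose proof (HK _ Hz) as E. unfold gauss_curvature in E.
change (- exp (- (2 * phi (z + RtoC 0)%C)) * lap (fun w => phi (z + w)%C) (RtoC 0) = 1) in E.
rewrite lap_shift, Cplus_0_r, exp_Ropp in E. pose proof (exp_pos (2 * phi z)) as He.
set (e := exp (2 * phi z)) in *.
transitivity (- e * (- / e * lap phi z)); [field; lra|rewrite E; ring].
Qed.

Lemma reg_potential_liouville z : regular D (Some z) -> liouville_at reg_potential z.
Proof.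
intros Hz. destruct (phi_liouville z Hz) as [C1 L1]. pose proof (HPreg z Hz) as N.
destruct HP as [P1 [P2 HP']].
destruct (ln_mod_harmonic P P1 P2 z 1 Rlt_0_1 (fun w _ => HP' w I) N) as [C2 L2].
destruct (C2_at_combine _ _ (-1) z C1 C2) as [C3 L3].
assert (C4 := C2_real_at _ _ _ _ _ _ _ z 1 Rlt_0_1 (C2_real_const (- ln 2) (near_disc z 1))).
destruct C4 as [C4 L4]. destruct (C2_at_combine _ _ 1 z C3 C4) as [C5 L5].
apply (C2_at_ext _ reg_potential z 1 Rlt_0_1) in C5.
2: { intros w _. unfold reg_potential. ring. }
destruct C5 as [C5 L6]. split; [exact C5|].
rewrite L6, L5, L4, L3, L2, L1. unfold reg_potential.
replace (2 * (phi z - ln 2 - ln (Cmod (P z)))) with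
  (2 * phi z + - (ln 2 + ln 2 + (ln (Cmod (P z)) + ln (Cmod (P z))))) by ring.
apply Cmod_pos in N. rewrite exp_plus, exp_Ropp, !exp_plus, !exp_ln by lra. field. lra.
Qed.

Lemma liouville_at_ext f h z d : 0 < d -> (forall w, near_disc z d w -> f w = h w) ->
  liouville_at f z -> liouville_at h z.
Proof.
intros Hd E [A B]. destruct (C2_at_ext f h z d Hd E A) as [A' B']. split; [exact A'|].
rewrite B', B, (E z (near_disc_center z d Hd)). reflexivity.
Qed.

(** Near a cone point [exp(- psi) = |A|^2 + |B|^2] with [A], [B] holomorphic across
    the point, so the continuous extension is of class C^2, and the equation passes to
    the limit. *)
Lemma conical_extension a alpha : In (Some a, alpha) D ->
  exists v, liouville_at (fun w => if Ceq_dec w a then v else reg_potential w) a.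
Proof.
intros Hin. destruct HD as [_ [_ Hcon]]. destruct (Hcon _ _ Hin) as [_ [psi [Cpsi Epsi]]].
apply locally_singleton in Cpsi.
destruct (HPsing a alpha Hin) as [k [Q [Hk [CQ [Q0 EQ]]]]].
destruct (continuous_nonzero Q (RtoC 0) CQ Q0) as [d0 [Hd0 NQ]].
unfold locally', within in Epsi. apply locally_C in Epsi. destruct Epsi as [d1 [Hd1 Epsi]].
destruct (punctured_disc_avoids (map fst D) a) as [d2 [Hd2 Reg]].
set (rho := Rmin d0 (Rmin d1 d2)).
assert (Hrho : 0 < rho) by (repeat apply Rmin_glb_lt; assumption).
assert (R0 : rho <= d0) by apply Rmin_l.
assert (R1 : rho <= d1) by (eapply Rle_trans; [apply Rmin_r|apply Rmin_l]).
assert (R2 : rho <= d2) by (eapply Rle_trans; [apply Rmin_r|apply Rmin_r]).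
set (cont := fun w => psi w - ln 2 - ln (Cmod (Q w))).
set (v := cont (RtoC 0)).
set (f := fun w => if Ceq_dec w a then v else reg_potential w).
set (F := fun w => f (a + w)%C).
assert (Z : forall w : C, (w - 0)%C = w) by (intros; ring).
assert (Ha : forall w : C, w <> RtoC 0 -> (a + w)%C <> a).
{ intros w N E. apply N. transitivity (a + w - a)%C; [ring|rewrite E; ring]. }
assert (EF : forall w, Cmod w < rho -> F w = cont w).
{ intros w Hw. unfold F, f. destruct (Ceq_dec w 0) as [->|N].
  - rewrite Cplus_0_r. destruct (Ceq_dec a a) as [_|X]; [reflexivity|congruence].
  - destruct (Ceq_dec (a + w)%C a) as [X|_]; [exfalso; exact (Ha w N X)|].
    assert (Ep := Epsi w). rewrite Z in Ep. specialize (Ep ltac:(lra) N).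
    change (potential g (Some a) w) with (phi (a + w)%C) in Ep.
    assert (Nq : Q w <> RtoC 0) by (apply NQ; rewrite Z; lra).
    unfold cont. rewrite <- Ep. unfold reg_potential. rewrite EQ, Cmod_mult, Cmod_pow.
    pose proof (Cmod_pos _ N). pose proof (Cmod_pos _ Nq).
    rewrite ln_mult, ln_pow by (try apply pow_lt; assumption). rewrite Hk. ring. }
assert (CF : continuous F (RtoC 0)).
{ apply continuous_ext_loc with cont.
  - apply locally_C. exists rho. split; [exact Hrho|]. intros w Hw. rewrite Z in Hw. symmetry. apply EF, Hw.
  - unfold cont. apply continuous_Rminus; [apply continuous_Rminus; [exact Cpsi|apply continuous_const]|].
    apply (continuous_of_R (fun w => Cmod (Q w)) ln); [apply continuous_Cmod, CQ|].
    eexists. apply is_derive_Reals, derivable_pt_lim_ln, Cmod_pos, Q0. }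
assert (LF : forall w, w <> RtoC 0 -> Cmod w < rho -> C2_at F w /\ lap F w = - 4 * Cmod (P (a + w)%C) ^ 2 * exp (2 * F w)).
{ intros w N Hw.
  assert (Hr : regular D (Some (a + w)%C)).
  { apply Reg; [replace (a + w - a)%C with w by ring; lra|apply Ha, N]. }
  assert (L : liouville_at f (a + w)%C).
  { apply (liouville_at_ext reg_potential f (a + w)%C (Cmod w)); [apply Cmod_pos, N| |apply reg_potential_liouville, Hr].
    intros x Hx. unfold f. destruct (Ceq_dec x a) as [->|_]; [|reflexivity].
    unfold near_disc in Hx. replace (a - (a + w))%C with (- w)%C in Hx by ring. rewrite Cmod_opp in Hx. lra. }
  destruct L as [L1 L2]. split; [apply C2_at_shift, L1|].
  unfold F at 1. rewrite lap_shift. exact L2. }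
destruct HP as [P1 [P2 HP']].
destruct (isolated_singularity F (dx F) (dy F) (dx (dx F)) (dy (dx F)) (dx (dy F)) (dy (dy F))
   (fun w => P (a + w)%C) (fun w => P1 (a + w)%C) rho Hrho) as [r [A [A1 [A2 [B [B1 [B2 [Hr [HA [HB HAB]]]]]]]]]].
{ apply C2_at_real. intros w [N Hw]. apply LF; assumption. }
{ intros w _. destruct (HP' (a + w)%C I) as [D1 [D2 _]]. split.
  - eapply Cd_eq; [|apply (Cd_comp (fun w => a + w)%C P); [apply Cd_plus; [apply Cd_const|apply Cd_id]|exact D1]]. ring.
  - apply (continuous_comp (fun w => a + w)%C P1); [|apply (Cd_continuous _ _ _ D2)].
    apply continuous_Cplus; [apply continuous_const|apply continuous_id]. }
{ intros w N Hw. apply (LF w N Hw). }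
{ exact CF. }
set (u := fun w => Cmod (A w) ^ 2 + Cmod (B w) ^ 2).
assert (Hc0 : near_disc (RtoC 0) r (RtoC 0)) by (apply near_disc_center, Hr).
assert (HA' : C2_holo A A1 A2 (near_disc (RtoC 0) r)) by (intros w Hw; apply HA; unfold near_disc in Hw; rewrite Z in Hw; exact Hw).
assert (HB' : C2_holo B B1 B2 (near_disc (RtoC 0) r)) by (intros w Hw; apply HB; unfold near_disc in Hw; rewrite Z in Hw; exact Hw).
assert (Cu : C2_at u (RtoC 0)).
{ destruct (C2_at_combine _ _ 1 (RtoC 0) (C2_at_sqr_mod A A1 A2 (RtoC 0) r Hr HA') (C2_at_sqr_mod B B1 B2 (RtoC 0) r Hr HB')) as [Cu _].
  apply (C2_at_ext _ u (RtoC 0) 1 Rlt_0_1) in Cu; [apply Cu|]. intros w _. unfold u. ring. }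
assert (Eu0 : u (RtoC 0) - exp (- F (RtoC 0)) = 0).
{ apply (continuous_zero (fun w => u w - exp (- F w)) (RtoC 0) r Hr).
  - apply continuous_Rminus; [apply C2_at_continuous, Cu|]. apply continuous_exp_comp, continuous_Ropp, CF.
  - intros w Hw N. rewrite Z in Hw. unfold u. rewrite HAB by assumption. ring. }
assert (Eu : forall w, Cmod w < r -> F w = - ln (u w)).
{ intros w Hw. assert (E : u w = exp (- F w)).
  { destruct (Ceq_dec w 0) as [->|N]; [lra|apply HAB; assumption]. }
  rewrite E, ln_exp. ring. }
assert (Pu : 0 < u (RtoC 0)) by (pose proof (exp_pos (- F (RtoC 0))); lra).
assert (C2F : C2_at F (RtoC 0)).
{ destruct (C2_at_combine _ _ (-1) (RtoC 0) (proj1 (C2_real_at _ _ _ _ _ _ _ (RtoC 0) 1 Rlt_0_1 (C2_real_const 0 _))) (C2_at_ln u (RtoC 0) Cu Pu)) as [C _].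
  apply (C2_at_ext _ F (RtoC 0) r Hr) in C; [apply C|]. intros w Hw. unfold near_disc in Hw. rewrite Z in Hw.
  rewrite (Eu w Hw). ring. }
exists v. change (liouville_at f a). split.
- apply C2_at_unshift. exact C2F.
- assert (E : lap F (RtoC 0) - - 4 * Cmod (P (a + 0)%C) ^ 2 * exp (2 * F (RtoC 0)) = 0).
  { apply (continuous_zero (fun w => lap F w - - 4 * Cmod (P (a + w)%C) ^ 2 * exp (2 * F w)) (RtoC 0) rho Hrho).
    - apply continuous_Rminus; [apply C2_at_lap_continuous, C2F|].
      apply continuous_Rmult.
      + apply continuous_Rmult; [apply continuous_const|]. apply continuous_Rpow, continuous_Cmod.
        apply (continuous_comp (fun w => a + w)%C P).
        * apply continuous_Cplus; [apply continuous_const|apply continuous_id].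
        * apply C2_entire_continuous. exists P1, P2. exact HP'.
      + apply continuous_exp_comp, continuous_Rmult; [apply continuous_const|exact CF].
    - intros w Hw N. rewrite Z in Hw. destruct (LF w N Hw) as [_ L]. rewrite L. ring. }
  unfold F in E at 1. rewrite lap_shift, !Cplus_0_r in E. unfold F in E. rewrite Cplus_0_r in E. lra.
Qed.

Theorem global_potential : exists psi : C -> R,
  (forall z, liouville_at psi z) /\ (forall z, regular D (Some z) -> psi z = reg_potential z).
Proof.
assert (H : forall z, exists v, liouville_at (fun w => if Ceq_dec w z then v else reg_potential w) z /\
   (regular D (Some z) -> v = reg_potential z)).
{ intros z. destruct (classic (regular D (Some z))) as [Hz|Hz].
  - exists (reg_potential z). split; [|reflexivity].
    apply (liouville_at_ext reg_potential _ z 1 Rlt_0_1); [|apply reg_potential_liouville, Hz].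
    intros w _. destruct (Ceq_dec w z) as [->|_]; reflexivity.
  - apply NNPP in Hz. apply in_map_iff in Hz. destruct Hz as [[q alpha] [E Hin]]. simpl in E. subst q.
    destruct (conical_extension z alpha Hin) as [v Hv]. exists v. split; [exact Hv|].
    intros Hr. exfalso. apply Hr. apply (in_map fst) in Hin. exact Hin. }
destruct (choice_fun _ H) as [psi Hpsi]. exists psi. split; [|intros z Hz; apply Hpsi, Hz].
intros z. destruct (punctured_disc_avoids (map fst D) z) as [d [Hd Reg]].
apply (liouville_at_ext _ psi z d Hd) with (2 := proj1 (Hpsi z)).
intros w Hw. destruct (Ceq_dec w z) as [->|N]; [reflexivity|].
symmetry. apply Hpsi, Reg; assumption.
Qed.
End Potential.

(** * The entire pair and its degree *)

Lemma large_disc_contains (L : list sphere) : exists R, forall w, R <= Cmod w -> ~ In (Some w) L.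
Proof.
induction L as [|q L [R IH]].
- exists 0. intros w _ [].
- destruct q as [a|].
  + exists (Rmax R (Cmod a + 1)). intros w Hw [E|Hin].
    * injection E as ->. pose proof (Rmax_r R (Cmod w + 1)). lra.
    * apply (IH w); [|exact Hin]. eapply Rle_trans; [apply Rmax_l|exact Hw].
  + exists R. intros w Hw [E|Hin]; [discriminate E|apply (IH w Hw Hin)].
Qed.

Lemma potential_at_infinity g z : z <> RtoC 0 ->
  potential g None (/ z) = phi g z + 2 * ln (Cmod z).
Proof.
intros N. assert (N' : (/ z)%C <> RtoC 0).
{ intros E. apply N. transitivity (/ / z)%C; [field; exact N|]. rewrite E.
  unfold Cinv, RtoC; simpl. f_equal; unfold Rdiv; ring. }
unfold potential, coef_at. destruct (Ceq_dec (/ z) (RtoC 0)) as [E|_]; [congruence|].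
replace (/ / z)%C with z by (field; exact N).
pose proof (Cmod_pos _ N) as Hm. pose proof (coef_pos g (Some z)) as Hg.
rewrite Cmod_inv by exact N. unfold phi. unfold Rdiv at 2.
rewrite ln_mult; [|exact Hg|apply Rinv_0_lt_compat, pow_lt, Rinv_0_lt_compat, Hm].
rewrite ln_Rinv by (apply pow_lt, Rinv_0_lt_compat, Hm).
rewrite ln_pow by (apply Rinv_0_lt_compat, Hm). rewrite ln_Rinv by exact Hm. simpl INR. field.
Qed.

(** Infinity is a cone point of angle [2 PI (k + 1)], or a regular point and [k = 0];
    the change of coordinate contributes the exponent [2]. *)
Lemma growth_at_infinity g D : represents g D -> effective_Z_divisor D ->
  exists (k : nat) B R, 0 < B /\ forall z, R <= Cmod z -> exp (- phi g z) <= B * Cmod z ^ (k + 2).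
Proof.
intros [_ [Hs Hcon]] Heff.
assert (H : exists (k : nat) B d, 0 < d /\ forall w, w <> RtoC 0 -> Cmod w < d ->
   Rabs (potential g None w - INR k * ln (Cmod w)) <= B).
{ assert (Z : forall w : C, (w - 0)%C = w) by (intros; ring).
  destruct (classic (regular D None)) as [Hr|Hr].
  - exists 0%nat. destruct (Hs None Hr) as [eps [He Hcl]]. destruct (Hcl 0%nat) as [Hc _].
    assert (H0 : continuous (potential g None) (RtoC 0)) by (apply Hc; rewrite Cmod_0; exact He).
    destruct (continuous_bounded_near _ _ H0) as [d [M [Hd K]]].
    exists M, d. split; [exact Hd|]. intros w _ Hw. simpl INR.
    replace (potential g None w - 0 * ln (Cmod w)) with (potential g None w) by ring.
    apply K. rewrite Z. exact Hw.
  - apply NNPP in Hr. apply in_map_iff in Hr. destruct Hr as [[q alpha] [E Hin]]. simpl in E. subst q.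
    destruct (Heff _ _ Hin) as [k Hk]. destruct (Hcon _ _ Hin) as [_ [psi [Cpsi Epsi]]].
    apply locally_singleton in Cpsi. unfold locally', within in Epsi. apply locally_C in Epsi.
    destruct Epsi as [d1 [Hd1 Epsi]].
    destruct (continuous_bounded_near _ _ Cpsi) as [d [M [Hd K]]].
    exists k, M, (Rmin d d1). split; [apply Rmin_glb_lt; assumption|].
    intros w N Hw. rewrite <- Hk. rewrite (Epsi w); [|rewrite Z; eapply Rlt_le_trans; [exact Hw|apply Rmin_r]|exact N].
    apply K. rewrite Z. eapply Rlt_le_trans; [exact Hw|apply Rmin_l]. }
destruct H as [k [B [d [Hd H]]]].
exists k, (exp B), (/ d + 1). split; [apply exp_pos|].
intros z Hz. pose proof (Rinv_0_lt_compat d Hd) as Hi.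
assert (N : z <> RtoC 0) by (apply Cmod_gt_0; lra).
assert (N' : (/ z)%C <> RtoC 0).
{ apply Cmod_gt_0. rewrite Cmod_inv by exact N. apply Rinv_0_lt_compat. lra. }
assert (Hlt : Cmod (/ z) < d).
{ rewrite Cmod_inv by exact N. rewrite <- (Rinv_inv d). apply Rinv_lt_contravar; [|lra]. apply Rmult_lt_0_compat; lra. }
specialize (H _ N' Hlt). rewrite (potential_at_infinity g z N), Cmod_inv, ln_Rinv in H by (try exact N; lra).
apply Rabs_le_between in H.
assert (Hm : 0 < Cmod z) by lra.
assert (E : exp (INR (k + 2) * ln (Cmod z)) = Cmod z ^ (k + 2)).
{ rewrite <- ln_pow by exact Hm. apply exp_ln, pow_lt, Hm. }
rewrite <- E, <- exp_plus.
assert (L : - phi g z <= B + INR (k + 2) * ln (Cmod z)) by (rewrite plus_INR; simpl (INR 2); lra).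
destruct L as [L|L]; [left; apply exp_increasing, L|rewrite L; lra].
Qed.

Lemma poly_eval_S d a z : poly_eval (S d) a z = (poly_eval d a z + a (S d) * z ^ (S d))%C.
Proof. unfold poly_eval. rewrite sum_Sn. reflexivity. Qed.

Lemma poly_eval_0 a z : poly_eval 0 a z = a 0%nat.
Proof. unfold poly_eval. rewrite sum_O. simpl. ring. Qed.

Lemma poly_top_coefficients d a b : (exists z, poly_eval d a z <> RtoC 0 \/ poly_eval d b z <> RtoC 0) ->
  exists n, (a n <> RtoC 0 \/ b n <> RtoC 0) /\
    (forall z, poly_eval d a z = poly_eval n a z) /\ (forall z, poly_eval d b z = poly_eval n b z).
Proof.
intros H. induction d as [|d IH].
- exists 0%nat. split; [|split; reflexivity]. destruct H as [z H]. rewrite !poly_eval_0 in H. exact H.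
- destruct (Ceq_dec (a (S d)) 0) as [Ea|Na]; [|exists (S d); split; [left; exact Na|split; reflexivity]].
  destruct (Ceq_dec (b (S d)) 0) as [Eb|Nb]; [|exists (S d); split; [right; exact Nb|split; reflexivity]].
  assert (Xa : forall z, poly_eval (S d) a z = poly_eval d a z) by (intros; rewrite poly_eval_S, Ea; ring).
  assert (Xb : forall z, poly_eval (S d) b z = poly_eval d b z) by (intros; rewrite poly_eval_S, Eb; ring).
  destruct IH as [n [Hn [H1 H2]]].
  { destruct H as [z H]. exists z. rewrite Xa, Xb in H. exact H. }
  exists n. split; [exact Hn|]. split; intros z; [rewrite Xa; apply H1|rewrite Xb; apply H2].
Qed.

(** The parallel section over the whole plane gives an entire pair with
    [|A|^2 + |M|^2 = exp(- psi) = 2 |P| exp(- phi)], which has polynomial growth. *)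
Theorem developing_pair g D : represents g D -> effective_Z_divisor D -> constant_curvature_one g D ->
  exists (d : nat) (a b : nat -> C) (P : C -> C),
    (a d <> RtoC 0 \/ b d <> RtoC 0) /\
    (forall z, ~ (poly_eval d a z = RtoC 0 /\ poly_eval d b z = RtoC 0)) /\
    (forall z A' B', Cd (poly_eval d a) z A' -> Cd (poly_eval d b) z B' ->
       (A' * poly_eval d b z - poly_eval d a z * B')%C = P z) /\
    (forall z, regular D (Some z) -> P z <> RtoC 0 /\
       g (Some z) = 4 * Cmod (P z) ^ 2 / (Cmod (poly_eval d a z) ^ 2 + Cmod (poly_eval d b z) ^ 2) ^ 2).
Proof.
intros HD Heff HK.
destruct (divisor_polynomial D (proj1 HD) Heff) as [P [HP [Hreg [Hsing [K [N [HK0 Hgr]]]]]]].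
destruct (global_potential g D HD HK P HP Hreg Hsing) as [psi [Hpsi Epsi]].
assert (C2 := C2_at_real psi (fun _ => True) (fun z _ => proj1 (Hpsi z))).
destruct HP as [P1 [P2 HP']].
assert (HPd : forall z, True -> Cd P z (P1 z) /\ continuous P1 z).
{ intros z _. destruct (HP' z I) as [D1 [D2 _]]. split; [exact D1|apply (Cd_continuous _ _ _ D2)]. }
assert (Hflat := liouville_flat psi _ _ _ _ _ _ P P1 (fun _ => True) C2 HPd (fun z _ => proj2 (Hpsi z)) (fun _ => True)
  (fun _ _ => I) (fun x _ => ex_intro _ 1 (conj Rlt_0_1 (fun _ _ => I)))).
destruct (parallel_transport _ _ _ _ _ _ _ _ (fun x => x) (fun i => match i with 0%nat => 1 | _ => 0 end) Hflat) as [Y [HY1 HY2]].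
{ intros x. apply continuous_id. }
{ intros x. exact I. }
{ unfold sqnorm. simpl. ring. }
set (con := liouville_connection psi (dx psi) (dy psi) P) in *.
assert (HYd : forall z i, (i < 4)%nat -> True ->
  is_derive (fun s => Y s (snd z) i) (fst z) (opx con z (Y (fst z) (snd z)) i) /\
  is_derive (fun t => Y (fst z) t i) (snd z) (opy con z (Y (fst z) (snd z)) i)).
{ intros z i Hi _. destruct z as [x y]. apply HY2; [exact Hi|]. exists 1. split; [lra|reflexivity]. }
assert (HVo : forall z : C, True -> exists d, 0 < d /\ forall w, Cmod (w - z) < d -> True).
{ intros z _. exists 1. split; [lra|auto]. }
set (A := section_A psi Y). set (M := section_M psi Y).
assert (Hhol : forall z, holo A z /\ holo M z).
{ intros z. destruct (section_holomorphic psi _ _ _ _ _ _ P P1 (fun _ => True) C2 HPd Y (fun _ => True) (fun _ _ => I) HVo HY1 HYd z I) as [E1 E2].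
  split; eexists; eassumption. }
assert (Hnorm : forall z, Cmod (A z) ^ 2 + Cmod (M z) ^ 2 = exp (- psi z)) by (intros; apply section_norm, HY1).
assert (Hwr : forall z A' M', Cd A z A' -> Cd M z M' -> (A' * M z - A z * M')%C = P z).
{ intros z A' M' HA HM. apply (section_wronskian psi _ _ _ _ _ _ P P1 (fun _ => True) C2 HPd Y (fun _ => True) (fun _ _ => I) HVo HY1 HYd z A' M' I HA HM). }
assert (Eexp : forall z, regular D (Some z) -> exp (- psi z) = 2 * Cmod (P z) * exp (- phi g z)).
{ intros z Hz. rewrite (Epsi z Hz). unfold reg_potential.
  replace (- (phi g z - ln 2 - ln (Cmod (P z)))) with (ln 2 + ln (Cmod (P z)) + - phi g z) by ring.
  rewrite !exp_plus, !exp_ln by (try apply Cmod_pos, Hreg, Hz; lra). reflexivity. }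
destruct (growth_at_infinity g D HD Heff) as [k [B [R1 [HB Hphi]]]].
destruct (large_disc_contains (map fst D)) as [R2 HR2].
set (R0 := Rmax 1 (Rmax R1 R2)). set (K' := 1 + 2 * K * B). set (n := (N + (k + 2))%nat).
assert (HK' : 0 <= K') by (unfold K'; nra).
assert (Hbd : forall z, R0 <= Cmod z -> Cmod (A z) <= K' * Cmod z ^ n /\ Cmod (M z) <= K' * Cmod z ^ n).
{ intros z Hz. unfold R0 in Hz.
  assert (Z1 : 1 <= Cmod z) by (eapply Rle_trans; [apply Rmax_l|exact Hz]).
  assert (Z2 : R1 <= Cmod z) by (eapply Rle_trans; [apply Rmax_l|eapply Rle_trans; [apply Rmax_r|exact Hz]]).
  assert (Z3 : R2 <= Cmod z) by (eapply Rle_trans; [apply Rmax_r|eapply Rle_trans; [apply Rmax_r|exact Hz]]).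
  specialize (Hnorm z). rewrite (Eexp z (HR2 z Z3)) in Hnorm. specialize (Hgr z Z1). specialize (Hphi z Z2).
  assert (Q : 2 * Cmod (P z) * exp (- phi g z) <= 2 * K * B * Cmod z ^ n).
  { unfold n. rewrite pow_add.
    replace (2 * K * B * (Cmod z ^ N * Cmod z ^ (k + 2))) with (2 * (K * Cmod z ^ N) * (B * Cmod z ^ (k + 2))) by ring.
    apply Rmult_le_compat; [pose proof (Cmod_ge_0 (P z)); lra|left; apply exp_pos|lra|exact Hphi]. }
  assert (Q1 : 1 <= Cmod z ^ n) by (apply pow_R1_Rle, Z1).
  unfold K'. pose proof (pow2_ge_0 (Cmod (A z) - 1)). pose proof (pow2_ge_0 (Cmod (M z) - 1)).
  pose proof (Cmod_ge_0 (A z)). pose proof (Cmod_ge_0 (M z)). split; nra. }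
destruct (Liouville_polynomial A n K' R0 (fun z => proj1 (Hhol z)) HK' (fun z Hz => proj1 (Hbd z Hz))) as [a0 Ea].
destruct (Liouville_polynomial M n K' R0 (fun z => proj2 (Hhol z)) HK' (fun z Hz => proj2 (Hbd z Hz))) as [b0 Eb].
assert (Hnz : forall z, ~ (A z = RtoC 0 /\ M z = RtoC 0)).
{ intros z [E1 E2]. specialize (Hnorm z). rewrite E1, E2, Cmod_0 in Hnorm. pose proof (exp_pos (- psi z)). lra. }
destruct (poly_top_coefficients n a0 b0) as [d [Htop [Ta Tb]]].
{ exists (RtoC 0). destruct (Ceq_dec (poly_eval n a0 0) 0) as [E1|N1]; [right|left; exact N1].
  intros E2. apply (Hnz (RtoC 0)). rewrite Ea, Eb. split; assumption. }
assert (EA : forall z, A z = poly_eval d a0 z) by (intros z; rewrite Ea; apply Ta).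
assert (EM : forall z, M z = poly_eval d b0 z) by (intros z; rewrite Eb; apply Tb).
exists d, a0, b0, P. split; [exact Htop|]. split; [|split].
- intros z. rewrite <- EA, <- EM. apply Hnz.
- intros z A' B' HA HM. rewrite <- EA, <- EM. apply Hwr.
  + apply Cd_ext with (2 := HA). intros; symmetry; apply EA.
  + apply Cd_ext with (2 := HM). intros; symmetry; apply EM.
- intros z Hz. pose proof (Hreg z Hz) as Np. split; [exact Np|].
  rewrite <- EA, <- EM, Hnorm, (Eexp z Hz). apply Cmod_pos in Np.
  assert (E : g (Some z) = exp (phi g z) * exp (phi g z)).
  { rewrite <- exp_plus. unfold phi. replace (ln (g (Some z)) / 2 + ln (g (Some z)) / 2) with (ln (g (Some z))) by field.
    symmetry. apply exp_ln, coef_pos. }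
  rewrite E, exp_Ropp. pose proof (exp_pos (phi g z)). field. split; lra.
Qed.

(** * Maps to the sphere in homogeneous coordinates *)

Lemma is_derive_C_Cd (f : C -> C) z l :
  @is_derive C_AbsRing C_NormedModule f z l <-> Cd f z l.
Proof.
rewrite Cd_epsilon. split.
- intros [_ H] eps He. specialize (H z (fun P HP => HP) (mkposreal eps He)).
  destruct H as [d H]. exists d. split; [apply cond_pos|]. intros w Hw. exact (H w Hw).
- intros H. split; [apply is_linear_scal_l|]. intros x Hx.
  apply (is_filter_lim_locally_unique (V := AbsRing_NormedModule C_AbsRing)) in Hx. subst x.
  intros eps. destruct (H eps (cond_pos eps)) as [d [Hd K]]. exists (mkposreal d Hd).
  intros w Hw. exact (K w Hw).
Qed.

Lemma near_iff p (Q : sphere -> Prop) : near p Q <-> exists d, 0 < d /\ forall z, Cmod z < d -> Q (param p z).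
Proof.
unfold near, filtermap. rewrite locally_C. split; intros [d [Hd H]]; exists d; (split; [exact Hd|]);
 intros w Hw; apply H; replace (w - 0)%C with w in * by ring; exact Hw.
Qed.

Lemma param_0 p : param p (RtoC 0) = p.
Proof.
destruct p as [a|]; simpl; [rewrite Cplus_0_r; reflexivity|].
destruct (Ceq_dec 0 0) as [_|N]; [reflexivity|congruence].
Qed.

Lemma Cinv_neq0 z : z <> RtoC 0 -> (/ z)%C <> RtoC 0.
Proof.
intros N. apply Cmod_gt_0. rewrite Cmod_inv by exact N. apply Rinv_0_lt_compat, Cmod_pos, N.
Qed.

Lemma Cinv_inv z : z <> RtoC 0 -> (/ / z)%C = z.
Proof. intros N. field. exact N. Qed.

Lemma coord_param q w : coord q (param q w) = w.
Proof.
destruct q as [a|]; simpl; [ring|].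
destruct (Ceq_dec w 0) as [->|N]; [reflexivity|]. apply Cinv_inv, N.
Qed.

Lemma near_center p (Q : sphere -> Prop) : near p Q -> Q p.
Proof.
intros H. apply near_iff in H. destruct H as [d [Hd K]]. rewrite <- (param_0 p). apply K. rewrite Cmod_0. exact Hd.
Qed.

Lemma near_and p (Q R : sphere -> Prop) : near p Q -> near p R -> near p (fun q => Q q /\ R q).
Proof. intros H1 H2. unfold near, filtermap in *. apply filter_and; assumption. Qed.

Lemma near_imp p (Q R : sphere -> Prop) : (forall q, Q q -> R q) -> near p Q -> near p R.
Proof. intros H. unfold near, filtermap. apply filter_imp. intros x. apply H. Qed.

Lemma near_all p (Q : sphere -> Prop) : (forall q, Q q) -> near p Q.
Proof. intros H. apply near_iff. exists 1. split; [lra|auto]. Qed.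

(** A coordinate disc around [p] is a neighbourhood of each of its points, and
    holomorphy does not depend on the centre, because the changes of centre
    [recenter] and [recenter_inv] are holomorphic. *)
Lemma recenter p z0 : exists rho, holo rho (RtoC 0) /\ rho (RtoC 0) = z0 /\
  exists d, 0 < d /\ forall h, Cmod h < d -> param (param p z0) h = param p (rho h).
Proof.
destruct p as [a|].
- exists (fun h => z0 + h)%C. split; [eexists; apply Cd_plus; [apply Cd_const|apply Cd_id]|]. split; [ring|].
  exists 1. split; [lra|]. intros h _. cbn [param]. apply (f_equal Some). ring.
- destruct (Ceq_dec z0 0) as [->|N].
  + exists (fun h => h). split; [eexists; apply Cd_id|]. split; [reflexivity|].
    exists 1. split; [lra|]. intros h _. rewrite param_0. reflexivity.
  + pose proof (Cinv_neq0 z0 N) as N'.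
    exists (fun h => / (/ z0 + h))%C. split; [|split].
    * eexists. apply Cd_inv; [apply Cd_plus; [apply Cd_const|apply Cd_id]|]. rewrite Cplus_0_r. exact N'.
    * rewrite Cplus_0_r. apply Cinv_inv, N.
    * exists (Cmod (/ z0)). split; [apply Cmod_pos, N'|]. intros h Hh.
      assert (Ns : (/ z0 + h)%C <> RtoC 0).
      { intros E. replace h with (- (/ z0))%C in Hh by (transitivity (- (/ z0) + (/ z0 + h))%C; [rewrite E|]; ring).
        rewrite Cmod_opp in Hh. lra. }
      cbn [param]. destruct (Ceq_dec z0 0) as [X|_]; [congruence|].
      destruct (Ceq_dec (/ (/ z0 + h)) 0) as [X|_]; [exfalso; exact (Cinv_neq0 _ Ns X)|].
      rewrite Cinv_inv by exact Ns. reflexivity.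
Qed.

Lemma recenter_inv p z0 : exists tau, holo tau z0 /\ tau z0 = RtoC 0 /\
  exists d, 0 < d /\ forall z, Cmod (z - z0) < d -> param p z = param (param p z0) (tau z).
Proof.
destruct p as [a|].
- exists (fun z => z - z0)%C. split; [eexists; apply Cd_minus; [apply Cd_id|apply Cd_const]|]. split; [ring|].
  exists 1. split; [lra|]. intros z _. cbn [param]. apply (f_equal Some). ring.
- destruct (Ceq_dec z0 0) as [->|N].
  + exists (fun h => h). split; [eexists; apply Cd_id|]. split; [reflexivity|].
    exists 1. split; [lra|]. intros h _. rewrite param_0. reflexivity.
  + exists (fun z => / z - / z0)%C. split; [|split].
    * eexists. apply Cd_minus; [apply Cd_inv; [apply Cd_id|exact N]|apply Cd_const].
    * ring.
    * exists (Cmod z0). split; [apply Cmod_pos, N|]. intros z Hz.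
      assert (Nz : z <> RtoC 0).
      { intros ->. rewrite Cmod_minus_sym in Hz. replace (z0 - 0)%C with z0 in Hz by ring. lra. }
      cbn [param]. destruct (Ceq_dec z0 0) as [X|_]; [congruence|]. destruct (Ceq_dec z 0) as [X|_]; [congruence|].
      apply (f_equal Some). ring.
Qed.

Lemma continuous_at_disc (f : C -> C) z eps : continuous f z -> 0 < eps ->
  exists d, 0 < d /\ forall w, Cmod (w - z) < d -> Cmod (f w - f z) < eps.
Proof. intros H He. exact (proj1 (continuous_CC f z) H eps He). Qed.

Lemma near_near p (Q : sphere -> Prop) : near p Q -> near p (fun q => near q Q).
Proof.
intros H. apply near_iff in H. destruct H as [d [Hd K]]. apply near_iff. exists d. split; [exact Hd|].
intros z0 Hz0. destruct (recenter p z0) as [rho [Hh [E0 [e [He Er]]]]].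
destruct (continuous_at_disc rho (RtoC 0) (d - Cmod z0) (holo_continuous _ _ Hh) ltac:(lra)) as [r [Hr Kr]].
apply near_iff. exists (Rmin e r). split; [apply Rmin_glb_lt; assumption|]. intros h Hh'.
rewrite Er by (eapply Rlt_le_trans; [exact Hh'|apply Rmin_l]). apply K.
specialize (Kr h). replace (h - 0)%C with h in Kr by ring.
specialize (Kr ltac:(eapply Rlt_le_trans; [exact Hh'|apply Rmin_r])). rewrite E0 in Kr.
pose proof (Cmod_triangle_rev (rho h) z0). lra.
Qed.

(** The equation on [u] determines [f] near [p]; the function [coord (f p)] alone
    does not, as it takes the value [0] also at a point far from [f p]. *)
Lemma chart_derive f p u L d : 0 < d -> (forall z, Cmod z < d -> f (param p z) = param (f p) (u z)) ->
  u (RtoC 0) = RtoC 0 -> Cd u (RtoC 0) L -> is_derive_at f p L.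
Proof.
intros Hd E U0 HL. split.
- intros Q HQ. apply near_iff in HQ. destruct HQ as [e [He K]]. apply near_iff.
  destruct (continuous_at_disc u (RtoC 0) e (Cd_continuous _ _ _ HL) He) as [r [Hr Kr]].
  exists (Rmin d r). split; [apply Rmin_glb_lt; assumption|]. intros z Hz.
  rewrite E by (eapply Rlt_le_trans; [exact Hz|apply Rmin_l]). apply K.
  specialize (Kr z). rewrite U0 in Kr.
  replace (z - 0)%C with z in Kr by ring. replace (u z - 0)%C with (u z) in Kr by ring.
  apply Kr. eapply Rlt_le_trans; [exact Hz|apply Rmin_r].
- apply is_derive_C_Cd. apply Cd_ext_loc with u; [|exact HL].
  exists d. split; [exact Hd|]. intros w Hw. replace (w - 0)%C with w in Hw by ring.
  rewrite E, coord_param by exact Hw. reflexivity.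
Qed.

Lemma derive_chart f p L : is_derive_at f p L ->
  exists d, 0 < d /\ (forall z, Cmod z < d -> f (param p z) = param (f p) (coord (f p) (f (param p z)))) /\
    Cd (fun z => coord (f p) (f (param p z))) (RtoC 0) L.
Proof.
intros [Hc Hd]. apply is_derive_C_Cd in Hd.
specialize (Hc (fun q => q = param (f p) (coord (f p) q))).
assert (K : near (f p) (fun q => q = param (f p) (coord (f p) q))).
{ apply near_iff. exists 1. split; [lra|]. intros w _. rewrite coord_param. reflexivity. }
specialize (Hc K). unfold filtermap in Hc. apply near_iff in Hc. destruct Hc as [d [Hd0 H]].
exists d. split; [exact Hd0|]. split; [exact H|exact Hd].
Qed.

Lemma is_derive_at_ext f h p l : near p (fun q => f q = h q) -> is_derive_at f p l -> is_derive_at h p l.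
Proof.
intros E H. pose proof (near_center _ _ E) as E0. destruct (derive_chart f p l H) as [d [Hd [K D]]].
apply near_iff in E. destruct E as [e [He Ke]].
apply (chart_derive h p (fun z => coord (f p) (f (param p z))) l (Rmin d e)).
- apply Rmin_glb_lt; assumption.
- intros z Hz. rewrite <- Ke by (eapply Rlt_le_trans; [exact Hz|apply Rmin_r]). rewrite <- E0.
  apply K. eapply Rlt_le_trans; [exact Hz|apply Rmin_l].
- rewrite param_0. rewrite <- (param_0 (f p)) at 2. apply coord_param.
- exact D.
Qed.

(** The point of the projective line with homogeneous coordinates [x : y]. *)
Definition proj (x y : C) : sphere := if Ceq_dec y (RtoC 0) then None else Some (x / y)%C.

Lemma proj_scal c x y : c <> RtoC 0 -> proj (c * x) (c * y) = proj x y.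
Proof.
intros N. unfold proj. destruct (Ceq_dec y 0) as [->|Ny].
- destruct (Ceq_dec (c * 0) 0) as [_|X]; [reflexivity|]. exfalso. apply X. ring.
- destruct (Ceq_dec (c * y) 0) as [X|_]; [exfalso; exact (Cmult_neq_0 _ _ N Ny X)|].
  apply (f_equal Some). field. split; assumption.
Qed.

Lemma proj_eq x y x' y' : ~ (x = RtoC 0 /\ y = RtoC 0) -> ~ (x' = RtoC 0 /\ y' = RtoC 0) ->
  (proj x y = proj x' y' <-> (x * y')%C = (x' * y)%C).
Proof.
intros H H'. unfold proj. destruct (Ceq_dec y 0) as [->|Ny]; destruct (Ceq_dec y' 0) as [->|Ny'].
- split; [intros _; ring|reflexivity].
- split; [discriminate|]. intros E. exfalso. apply H. split; [|reflexivity].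
  transitivity (x * y' / y')%C; [field; exact Ny'|rewrite E; field; exact Ny'].
- split; [discriminate|]. intros E. exfalso. apply H'. split; [|reflexivity].
  transitivity (x' * y / y)%C; [field; exact Ny|rewrite <- E; field; exact Ny].
- split.
  + intros E. assert (E' : (x / y)%C = (x' / y')%C) by (exact (f_equal (fun o => match o with Some v => v | None => RtoC 0 end) E)).
    transitivity (x / y * (y * y'))%C; [field; exact Ny|]. rewrite E'. field. exact Ny'.
  + intros E. apply (f_equal Some). transitivity (x * y' / (y * y'))%C; [field; split; assumption|rewrite E; field; split; assumption].
Qed.

(** The standard metric is invariant under exchange of the two homogeneous
    coordinates, so the charts [al / be] and [be / al] give the same expression. *)
Lemma proj_derive f p al be l m d : 0 < d -> (forall z, Cmod z < d -> f (param p z) = proj (al z) (be z)) ->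
  ~ (al (RtoC 0) = RtoC 0 /\ be (RtoC 0) = RtoC 0) -> Cd al (RtoC 0) l -> Cd be (RtoC 0) m ->
  exists L, is_derive_at f p L /\
    st_coef (f p) * Cmod L ^ 2 =
      4 * Cmod (l * be (RtoC 0) - al (RtoC 0) * m) ^ 2 / (Cmod (al (RtoC 0)) ^ 2 + Cmod (be (RtoC 0)) ^ 2) ^ 2.
Proof.
intros Hd E N Ha Hb.
assert (Ep : f p = proj (al (RtoC 0)) (be (RtoC 0))) by (rewrite <- (param_0 p) at 1; apply E; rewrite Cmod_0; exact Hd).
set (a0 := al (RtoC 0)) in *. set (b0 := be (RtoC 0)) in *.
destruct (Ceq_dec b0 0) as [Eb|Nb].
- assert (Na : a0 <> RtoC 0) by (intros X; apply N; split; assumption).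
  destruct (continuous_nonzero al (RtoC 0) (Cd_continuous _ _ _ Ha) Na) as [e [He Ke]].
  exists ((m * a0 - b0 * l) / (a0 * a0))%C.
  assert (Fp : f p = None) by (rewrite Ep; unfold proj; destruct (Ceq_dec b0 0); [reflexivity|congruence]).
  split.
  + apply (chart_derive f p (fun z => be z / al z)%C _ (Rmin d e)).
    * apply Rmin_glb_lt; assumption.
    * intros z Hz. assert (Nz : al z <> RtoC 0).
      { apply Ke. replace (z - 0)%C with z by ring. eapply Rlt_le_trans; [exact Hz|apply Rmin_r]. }
      rewrite E by (eapply Rlt_le_trans; [exact Hz|apply Rmin_l]). rewrite Fp. unfold proj, param.
      destruct (Ceq_dec (be z) 0) as [->|Nbz].
      -- destruct (Ceq_dec (0 / al z) 0) as [_|X]; [reflexivity|]. exfalso. apply X. field. exact Nz.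
      -- destruct (Ceq_dec (be z / al z) 0) as [X|_].
         { exfalso. apply Nbz. transitivity (be z / al z * al z)%C; [field; exact Nz|rewrite X; ring]. }
         apply (f_equal Some). field. split; assumption.
    * fold a0 b0. rewrite Eb. field. exact Na.
    * apply Cd_div; assumption.
  + rewrite Fp. unfold st_coef. rewrite Cmod_div by (apply Cmult_neq_0; exact Na).
    rewrite Cmod_mult, Eb, Cmod_0.
    replace (m * a0 - 0 * l)%C with (- (l * 0 - a0 * m))%C by ring. rewrite Cmod_opp.
    apply Cmod_pos in Na. field. lra.
- destruct (continuous_nonzero be (RtoC 0) (Cd_continuous _ _ _ Hb) Nb) as [e [He Ke]].
  exists ((l * b0 - a0 * m) / (b0 * b0))%C.
  assert (Fp : f p = Some (a0 / b0)%C) by (rewrite Ep; unfold proj; destruct (Ceq_dec b0 0); [congruence|reflexivity]).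
  split.
  + apply (chart_derive f p (fun z => al z / be z - a0 / b0)%C _ (Rmin d e)).
    * apply Rmin_glb_lt; assumption.
    * intros z Hz. assert (Nz : be z <> RtoC 0).
      { apply Ke. replace (z - 0)%C with z by ring. eapply Rlt_le_trans; [exact Hz|apply Rmin_r]. }
      rewrite E by (eapply Rlt_le_trans; [exact Hz|apply Rmin_l]). rewrite Fp. unfold proj, param.
      destruct (Ceq_dec (be z) 0) as [X|_]; [congruence|]. apply (f_equal Some). ring.
    * fold a0 b0. ring.
    * eapply Cd_eq; [|apply Cd_minus; [apply Cd_div; eassumption|apply Cd_const]]. fold a0 b0. ring.
  + rewrite Fp. unfold st_coef. rewrite !Cmod_div by (try apply Cmult_neq_0; exact Nb). rewrite !Cmod_mult.
    apply Cmod_pos in Nb. pose proof (Cmod_ge_0 a0). field.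
    assert (0 < Cmod b0 ^ 2) by (apply pow_lt; assumption). pose proof (pow2_ge_0 (Cmod a0)).
    repeat split; lra.
Qed.

(** Divided differences: they give the derivative of a polynomial and, off the
    zeros of the Wronskian, the local injectivity of a quotient. *)
Lemma poly_divided_difference d a : exists K : C -> C -> C,
  (forall z w, (poly_eval d a z - poly_eval d a w)%C = ((z - w) * K z w)%C) /\
  (forall c : C * C, continuous (fun q : C * C => K (fst q) (snd q)) c).
Proof.
assert (Pow : forall n, exists K : C -> C -> C, (forall z w, (z ^ n - w ^ n)%C = ((z - w) * K z w)%C) /\
  (forall c : C * C, continuous (fun q : C * C => K (fst q) (snd q)) c)).
{ induction n as [|n [K [E HK]]].
  - exists (fun _ _ => RtoC 0). split; [intros; simpl; ring|intros; apply continuous_const].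
  - exists (fun z w => K z w * z + w ^ n)%C. split.
    + intros z w. rewrite !Cpow_S. transitivity ((z ^ n - w ^ n) * z + (z - w) * w ^ n)%C; [ring|]. rewrite E. ring.
    + intros c. apply continuous_Cplus; [apply continuous_Cmult; [apply HK|apply continuous_fst]|].
      apply (continuous_Cpow (fun q : C * C => snd q)). apply continuous_snd. }
induction d as [|d [K [E HK]]].
- exists (fun _ _ => RtoC 0). split; [intros; rewrite !poly_eval_0; ring|intros; apply continuous_const].
- destruct (Pow (S d)) as [Kp [Ep HKp]].
  exists (fun z w => K z w + a (S d) * Kp z w)%C. split.
  + intros z w. rewrite !poly_eval_S.
    transitivity ((poly_eval d a z - poly_eval d a w) + a (S d) * (z ^ S d - w ^ S d))%C; [ring|].
    rewrite E, Ep. ring.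
  + intros c. apply continuous_Cplus; [apply HK|]. apply continuous_Cmult; [apply continuous_const|apply HKp].
Qed.

Lemma poly_translate d a c : exists a', forall z, poly_eval d a (c + z)%C = poly_eval d a' z.
Proof.
assert (Mul : forall n b, exists b', forall z, ((c + z) * poly_eval n b z)%C = poly_eval (S n) b' z).
{ intros n. induction n as [|n IH]; intros b.
  - exists (fun k => match k with 0%nat => c * b 0%nat | _ => b 0%nat end)%C.
    intros z. rewrite poly_eval_S, !poly_eval_0. simpl. ring.
  - destruct (IH b) as [b' Hb'].
    exists (fun k => if Nat.eq_dec k (S (S n)) then b (S n) else if Nat.eq_dec k (S n) then b' (S n) + c * b (S n) else b' k)%C.
    intros z. rewrite poly_eval_S, Cmult_plus_distr_l, Hb'.
    rewrite (poly_eval_S (S n)), (poly_eval_S n b'), (poly_eval_S n).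
    destruct (Nat.eq_dec (S (S n)) (S (S n))) as [_|X]; [|congruence].
    destruct (Nat.eq_dec (S n) (S (S n))) as [X|_]; [lia|].
    destruct (Nat.eq_dec (S n) (S n)) as [_|X]; [|congruence].
    replace (poly_eval n (fun k => if Nat.eq_dec k (S (S n)) then b (S n) else if Nat.eq_dec k (S n) then (b' (S n) + c * b (S n))%C else b' k) z)
      with (poly_eval n b' z).
    + rewrite !Cpow_S. ring.
    + apply sum_n_ext_loc. intros k Hk. destruct (Nat.eq_dec k (S (S n))); [lia|]. destruct (Nat.eq_dec k (S n)); [lia|reflexivity]. }
assert (Pow : forall n, exists b, forall z, ((c + z) ^ n)%C = poly_eval n b z).
{ induction n as [|n [b Hb]].
  - exists (fun _ => RtoC 1). intros z. rewrite poly_eval_0. reflexivity.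
  - destruct (Mul n b) as [b' Hb']. exists b'. intros z. rewrite Cpow_S, Hb. apply Hb'. }
induction d as [|d [a' Ha']].
- exists a. intros z. rewrite !poly_eval_0. reflexivity.
- destruct (Pow (S d)) as [b Hb].
  exists (fun k => if Nat.eq_dec k (S d) then a (S d) * b (S d) else a' k + a (S d) * b k)%C.
  intros z. rewrite !poly_eval_S, Ha', Hb, poly_eval_S.
  destruct (Nat.eq_dec (S d) (S d)) as [_|X]; [|congruence].
  replace (poly_eval d (fun k => if Nat.eq_dec k (S d) then (a (S d) * b (S d))%C else (a' k + a (S d) * b k)%C) z)
    with (poly_eval d a' z + a (S d) * poly_eval d b z)%C; [ring|].
  unfold poly_eval. rewrite <- (sum_n_mult_l (K := C_Ring) (a (S d))).
  rewrite <- (sum_n_plus (G := C_AbelianMonoid)). apply sum_n_ext_loc. intros k Hk.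
  destruct (Nat.eq_dec k (S d)); [lia|]. change plus with Cplus. change mult with Cmult.
  match goal with |- ?x = ?y => change (@eq C x y) end. ring.
Qed.

Lemma poly_reverse d a z : z <> RtoC 0 ->
  (z ^ d * poly_eval d a (/ z))%C = poly_eval d (fun k => a (d - k)%nat) z.
Proof.
intros N. induction d as [|d IH] in a |- *.
- rewrite !poly_eval_0. simpl. ring.
- assert (Shift : forall n b, poly_eval (S n) b z = (b 0%nat + z * poly_eval n (fun k => b (S k)) z)%C).
  { clear. induction n as [|n IH]; intros b.
    - rewrite poly_eval_S, !poly_eval_0. simpl. ring.
    - rewrite poly_eval_S, IH, (poly_eval_S n). rewrite !Cpow_S. ring. }
  rewrite Shift. rewrite poly_eval_S.
  replace (poly_eval d (fun k => a (S d - S k)%nat) z) with (poly_eval d (fun k => a (d - k)%nat) z).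
  + rewrite <- IH. simpl (S d - 0)%nat. rewrite Cpow_inv by exact N. rewrite Cpow_S.
    pose proof (Cpow_nz z d N). field. split; assumption.
  + apply sum_n_ext. intros k. reflexivity.
Qed.

(** * The rational developing map *)

Lemma poly_eval_at_0 d a : poly_eval d a (RtoC 0) = a 0%nat.
Proof.
induction d as [|d IH]; [apply poly_eval_0|]. rewrite poly_eval_S, IH, Cpow_S. ring.
Qed.

Lemma poly_Cd d a (K : C -> C -> C) c :
  (forall z w, (poly_eval d a z - poly_eval d a w)%C = ((z - w) * K z w)%C) ->
  (forall c : C * C, continuous (fun q : C * C => K (fst q) (snd q)) c) ->
  Cd (poly_eval d a) c (K c c).
Proof.
intros E HK. exists (fun z => K z c). split; [|split].
- apply (continuous_comp_2 (fun z : C => z) (fun _ : C => c) K); [apply continuous_id|apply continuous_const|apply HK].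
- reflexivity.
- intros w. transitivity (poly_eval d a c + (poly_eval d a w - poly_eval d a c))%C; [ring|]. rewrite E. reflexivity.
Qed.

Lemma poly_holo d a z : holo (poly_eval d a) z.
Proof. destruct (poly_divided_difference d a) as [K [E HK]]. eexists. apply (poly_Cd d a K z E HK). Qed.

Lemma continuous_diagonal (K : C -> C -> C) z :
  (forall c : C * C, continuous (fun q : C * C => K (fst q) (snd q)) c) -> continuous (fun z => K z z) z.
Proof. intros HK. apply (continuous_comp_2 (fun z : C => z) (fun z : C => z) K); [apply continuous_id|apply continuous_id|apply HK]. Qed.

Lemma continuous_pair_near (K : C * C -> C) : continuous K (RtoC 0, RtoC 0) -> K (RtoC 0, RtoC 0) <> RtoC 0 ->
  exists d, 0 < d /\ forall z w, Cmod z < d -> Cmod w < d -> K (z, w) <> RtoC 0.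
Proof.
intros HK N.
assert (L : locally (K (RtoC 0, RtoC 0)) (fun y => y <> RtoC 0)).
{ apply locally_C. exists (Cmod (K (RtoC 0, RtoC 0))). split; [apply Cmod_pos, N|]. intros w Hw ->.
  rewrite Cmod_minus_sym in Hw. replace (K (RtoC 0, RtoC 0) - 0)%C with (K (RtoC 0, RtoC 0)) in Hw by ring. lra. }
destruct (HK _ L) as [e He]. exists e. split; [apply cond_pos|].
assert (Bl : forall z : C, Cmod z < e -> ball (RtoC 0) e z).
{ intros z Hz. split; unfold ball; simpl; unfold AbsRing_ball, abs, minus, plus, opp; simpl.
  - replace (fst z + - 0) with (fst z) by ring. eapply Rle_lt_trans; [apply Cmod_fst_le|exact Hz].
  - replace (snd z + - 0) with (snd z) by ring. eapply Rle_lt_trans; [apply Cmod_snd_le|exact Hz]. }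
intros z w Hz Hw. apply He. split; apply Bl; assumption.
Qed.

Section RationalMap.
Variables (d : nat) (a b : nat -> C).
Hypothesis Htop : a d <> RtoC 0 \/ b d <> RtoC 0.
Hypothesis Hcop : forall z, ~ (poly_eval d a z = RtoC 0 /\ poly_eval d b z = RtoC 0).

(** With degree bounded by [d], the value at infinity is given by the coefficients of
    degree [d]. *)
Definition rat_map (p : sphere) : sphere :=
  match p with
  | Some z => proj (poly_eval d a z) (poly_eval d b z)
  | None => proj (a d) (b d)
  end.

Lemma rat_map_infinity z : rat_map (param None z) =
    proj (poly_eval d (fun k => a (d - k)%nat) z) (poly_eval d (fun k => b (d - k)%nat) z) /\
  ~ (poly_eval d (fun k => a (d - k)%nat) z = RtoC 0 /\ poly_eval d (fun k => b (d - k)%nat) z = RtoC 0).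
Proof.
simpl. destruct (Ceq_dec z 0) as [->|N].
- rewrite !poly_eval_at_0, Nat.sub_0_r. split; [reflexivity|]. intros [E1 E2]. destruct Htop; contradiction.
- rewrite <- !poly_reverse by exact N. simpl.
  pose proof (Cpow_nz z d N) as Np. split.
  + rewrite proj_scal by exact Np. reflexivity.
  + intros [E1 E2]. apply (Hcop (/ z)). split.
    * transitivity (/ z ^ d * (z ^ d * poly_eval d a (/ z)))%C; [field; exact Np|rewrite E1; ring].
    * transitivity (/ z ^ d * (z ^ d * poly_eval d b (/ z)))%C; [field; exact Np|rewrite E2; ring].
Qed.

Lemma rat_map_chart p : exists a' b', forall z,
  rat_map (param p z) = proj (poly_eval d a' z) (poly_eval d b' z) /\
  ~ (poly_eval d a' z = RtoC 0 /\ poly_eval d b' z = RtoC 0).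
Proof.
destruct p as [c|].
- destruct (poly_translate d a c) as [a' Ha]. destruct (poly_translate d b c) as [b' Hb].
  exists a', b'. intros z. simpl. rewrite Ha, Hb. split; [reflexivity|]. rewrite <- Ha, <- Hb. apply Hcop.
- exists (fun k => a (d - k)%nat), (fun k => b (d - k)%nat). apply rat_map_infinity.
Qed.

Lemma rat_map_derive p : exists l, is_derive_at rat_map p l.
Proof.
destruct (rat_map_chart p) as [a' [b' H]].
destruct (poly_holo d a' (RtoC 0)) as [l Hl]. destruct (poly_holo d b' (RtoC 0)) as [m Hm].
destruct (proj_derive rat_map p _ _ l m 1 Rlt_0_1 (fun z _ => proj1 (H z)) (proj2 (H (RtoC 0))) Hl Hm) as [L [HL _]].
exists L. exact HL.
Qed.

Lemma rat_map_meromorphic p : meromorphic_at rat_map p.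
Proof. apply near_all. intros q. apply rat_map_derive. Qed.

(** [al(z) be(w) - al(w) be(z) = (z - w) N(z, w)] with [N] continuous, and [N] is the
    Wronskian on the diagonal. *)
Lemma rat_map_injective p a' b' l m :
  (forall z, rat_map (param p z) = proj (poly_eval d a' z) (poly_eval d b' z) /\
  ~ (poly_eval d a' z = RtoC 0 /\ poly_eval d b' z = RtoC 0)) ->
  Cd (poly_eval d a') (RtoC 0) l -> Cd (poly_eval d b') (RtoC 0) m ->
  (l * poly_eval d b' 0 - poly_eval d a' 0 * m)%C <> RtoC 0 -> locally_injective_at rat_map p.
Proof.
intros H Hl Hm N.
destruct (poly_divided_difference d a') as [Ka [Ea HKa]]. destruct (poly_divided_difference d b') as [Kb [Eb HKb]].
rewrite (Cd_unique _ _ _ _ Hl (poly_Cd d a' Ka _ Ea HKa)), (Cd_unique _ _ _ _ Hm (poly_Cd d b' Kb _ Eb HKb)) in N.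
set (NN := fun q : C * C => (Ka (fst q) (snd q) * poly_eval d b' (snd q) - poly_eval d a' (snd q) * Kb (fst q) (snd q))%C).
destruct (continuous_pair_near NN) as [r [Hr Kr]].
- assert (Cs : forall c, continuous (fun q : C * C => poly_eval d c (snd q)) (RtoC 0, RtoC 0)).
  { intros c. apply (continuous_comp (fun q : C * C => snd q) (poly_eval d c)); [apply continuous_snd|].
    apply holo_continuous, poly_holo. }
  apply (continuous_Cminus (fun q : C * C => Ka (fst q) (snd q) * poly_eval d b' (snd q))%C
    (fun q : C * C => poly_eval d a' (snd q) * Kb (fst q) (snd q))%C).
  + exact (continuous_Cmult _ _ _ (HKa _) (Cs b')).
  + exact (continuous_Cmult _ _ _ (Cs a') (HKb _)).
- exact N.
- exists (fun q => exists z, Cmod z < r /\ q = param p z). split.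
  + apply near_iff. exists r. split; [exact Hr|]. intros z Hz. exists z. split; [exact Hz|reflexivity].
  + intros q q' [z [Hz ->]] [w [Hw ->]] E. f_equal.
    destruct (H z) as [Ez Nz]. destruct (H w) as [Ew Nw]. rewrite Ez, Ew in E.
    apply proj_eq in E; [|exact Nz|exact Nw]. specialize (Kr z w Hz Hw).
    destruct (Ceq_dec z w) as [X|X]; [exact X|exfalso].
    apply Cminus_eq_contra in X. refine (Cmult_neq_0 _ _ X Kr _). unfold NN; simpl.
    transitivity ((z - w) * Ka z w * poly_eval d b' w - poly_eval d a' w * ((z - w) * Kb z w))%C; [ring|].
    rewrite <- Ea, <- Eb. transitivity (poly_eval d a' z * poly_eval d b' w - poly_eval d a' w * poly_eval d b' z)%C; [ring|].
    rewrite E. ring.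
Qed.

Lemma rat_map_rational : (exists z, poly_eval d b z <> RtoC 0) -> rational_function rat_map.
Proof.
intros Hb. exists d, a, b. split; [exact Hb|]. split; [exact Hcop|]. split; [reflexivity|].
destruct (rat_map_derive None) as [l [Hl _]]. exact Hl.
Qed.

(** ** The identity theorem for germs *)

(** In a single pair of charts a meromorphic element is an ordinary holomorphic
    function, to which the identity theorem applies. *)
Lemma meromorphic_coordinate f p : meromorphic_at f p ->
  exists r, 0 < r /\ (forall z, Cmod z < r -> f (param p z) = param (f p) (coord (f p) (f (param p z)))) /\
    forall z, Cmod z < r -> holo (fun z => coord (f p) (f (param p z))) z.
Proof.
intros H. unfold meromorphic_at in H. destruct (near_center _ _ H) as [l0 Hl0]. destruct (derive_chart f p l0 Hl0) as [d1 [Hd1 [E1 _]]].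
destruct (proj1 (near_iff _ _) H) as [d0 [Hd0 K]].
exists (Rmin d0 d1). split; [apply Rmin_glb_lt; assumption|]. split.
{ intros z Hz. apply E1. eapply Rlt_le_trans; [exact Hz|apply Rmin_r]. }
intros z0 Hz0.
assert (Z0 : Cmod z0 < d0) by (eapply Rlt_le_trans; [exact Hz0|apply Rmin_l]).
assert (Z1 : Cmod z0 < d1) by (eapply Rlt_le_trans; [exact Hz0|apply Rmin_r]).
destruct (K z0 Z0) as [l Hl]. destruct (derive_chart _ _ _ Hl) as [d2 [Hd2 [E2 D2]]].
set (v := fun h => coord (f (param p z0)) (f (param (param p z0) h))) in *.
destruct (recenter_inv p z0) as [tau [[t Ht] [T0 [d3 [Hd3 E3]]]]].
destruct (recenter (f p) (coord (f p) (f (param p z0)))) as [sg [[s Hs] [S0 [d4 [Hd4 E4]]]]].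
rewrite <- (E1 z0 Z1) in E4.
assert (V0 : v (RtoC 0) = RtoC 0).
{ unfold v. rewrite param_0. rewrite <- (param_0 (f (param p z0))) at 2. apply coord_param. }
assert (Cv : continuous (fun z => v (tau z)) z0).
{ apply (continuous_comp tau v); [apply (Cd_continuous _ _ _ Ht)|]. rewrite T0. apply (Cd_continuous _ _ _ D2). }
destruct (continuous_at_disc tau z0 d2 (Cd_continuous _ _ _ Ht) Hd2) as [r2 [Hr2 Kr2]].
destruct (continuous_at_disc _ z0 d4 Cv Hd4) as [r4 [Hr4 Kr4]].
eexists. apply (Cd_ext_loc (fun z => sg (v (tau z)))).
- exists (Rmin d3 (Rmin r2 r4)). split; [repeat apply Rmin_glb_lt; assumption|]. intros z Hz.
  assert (Y3 : Cmod (z - z0) < d3) by (eapply Rlt_le_trans; [exact Hz|apply Rmin_l]).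
  assert (Y2 : Cmod (z - z0) < r2) by (eapply Rlt_le_trans; [exact Hz|eapply Rle_trans; [apply Rmin_r|apply Rmin_l]]).
  assert (Y4 : Cmod (z - z0) < r4) by (eapply Rlt_le_trans; [exact Hz|eapply Rle_trans; [apply Rmin_r|apply Rmin_r]]).
  specialize (Kr2 z Y2). specialize (Kr4 z Y4). cbv beta in Kr4. rewrite T0 in Kr2, Kr4. rewrite V0 in Kr4.
  replace (tau z - 0)%C with (tau z) in Kr2 by ring. replace (v (tau z) - 0)%C with (v (tau z)) in Kr4 by ring.
  rewrite (E3 z Y3). rewrite (E2 (tau z) Kr2). fold (v (tau z)). rewrite (E4 _ Kr4), coord_param. reflexivity.
- apply (Cd_comp (fun z => v (tau z)) sg).
  + apply (Cd_comp tau v); [exact Ht|]. rewrite T0. exact D2.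
  + rewrite T0, V0. exact Hs.
Qed.

(** In charts, [f = rat_map] reads [T = 0] for a holomorphic function [T]: the cross
    product of the homogeneous coordinates. *)
Lemma germ_identity f p : meromorphic_at f p ->
  near p (fun q => germ_eq q f rat_map -> germ_eq p f rat_map).
Proof.
intros Hf. destruct (meromorphic_coordinate f p Hf) as [r [Hr [E Hu]]].
set (u := fun z => coord (f p) (f (param p z))) in *.
destruct (rat_map_chart p) as [a' [b' H]].
set (al := poly_eval d a'). set (be := poly_eval d b'). fold al be in H.
set (T := fun z => match f p with
  | Some c => ((c + u z) * be z - al z)%C
  | None => (u z * al z - be z)%C end).
assert (TE : forall z, Cmod z < r -> (f (param p z) = rat_map (param p z) <-> T z = RtoC 0)).
{ intros z Hz. destruct (H z) as [Ez Nz]. rewrite (E z Hz), Ez. fold (u z). unfold T, param, proj.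
  destruct (f p) as [c|].
  - destruct (Ceq_dec (be z) 0) as [Eb|Nb].
    + split; [discriminate|]. intros X. exfalso. apply Nz. split; [|exact Eb].
      rewrite Eb in X. transitivity (- ((c + u z) * 0 - al z))%C; [ring|rewrite X; ring].
    + split.
      * intros X. assert (X' : (c + u z)%C = (al z / be z)%C) by (exact (f_equal (fun o => match o with Some v => v | None => RtoC 0 end) X)).
        rewrite X'. field. exact Nb.
      * intros X. apply (f_equal Some). transitivity (((c + u z) * be z - al z) / be z + al z / be z)%C; [field; exact Nb|].
        rewrite X. field. exact Nb.
  - destruct (Ceq_dec (u z) 0) as [Eu|Nu].
    + rewrite Eu. destruct (Ceq_dec (be z) 0) as [Eb|Nb].
      * split; [intros _; rewrite Eb; ring|reflexivity].
      * split; [discriminate|]. intros X. exfalso. apply Nb. transitivity (- (0 * al z - be z))%C; [ring|rewrite X; ring].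
    + destruct (Ceq_dec (be z) 0) as [Eb|Nb].
      * split; [discriminate|]. intros X. exfalso. apply Nz. split; [|exact Eb]. rewrite Eb in X.
        transitivity ((u z * al z - 0) / u z)%C; [field; exact Nu|rewrite X; field; exact Nu].
      * split.
        -- intros X. assert (X' : (/ u z)%C = (al z / be z)%C) by (exact (f_equal (fun o => match o with Some v => v | None => RtoC 0 end) X)).
           transitivity (u z * be z * (al z / be z) - be z)%C; [field; exact Nb|]. rewrite <- X'. field. exact Nu.
        -- intros X. apply (f_equal Some).
           assert (X' : be z = (u z * al z)%C) by (transitivity (u z * al z - (u z * al z - be z))%C; [ring|rewrite X; ring]).
           assert (Na : al z <> RtoC 0) by (intros Y; apply Nb; rewrite X', Y; ring).
           rewrite X'. field. split; assumption. }
assert (TH : forall z, Cmod z < r -> holo T z).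
{ intros z Hz. destruct (Hu z Hz) as [l Hl]. destruct (poly_holo d a' z) as [la Hla]. destruct (poly_holo d b' z) as [lb Hlb].
  unfold T. destruct (f p) as [c|]; eexists.
  - apply Cd_minus; [|exact Hla]. apply (Cd_mult (fun z => c + u z)%C be); [|exact Hlb]. apply Cd_plus; [apply Cd_const|exact Hl].
  - apply Cd_minus; [|exact Hlb]. apply (Cd_mult u al); [exact Hl|exact Hla]. }
apply near_iff. exists (r / 3). split; [lra|]. intros z0 Hz0 G.
apply near_iff in G. destruct G as [e [He KG]].
destruct (recenter_inv p z0) as [tau [Ht [T0 [d3 [Hd3 E3]]]]].
destruct (continuous_at_disc tau z0 e (holo_continuous _ _ Ht) He) as [r2 [Hr2 Kr2]].
assert (Z : forall z, Cmod (z - z0) < 2 * r / 3 -> T z = RtoC 0).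
{ apply (identity_disc T z0 (2 * r / 3)).
  - intros z Hz. apply TH. pose proof (Cmod_triangle_rev z z0). lra.
  - exists (Rmin (r / 3) (Rmin d3 r2)). split; [repeat apply Rmin_glb_lt; lra|]. intros z Hz.
    assert (Y1 : Cmod (z - z0) < r / 3) by (eapply Rlt_le_trans; [exact Hz|apply Rmin_l]).
    assert (Y2 : Cmod (z - z0) < d3) by (eapply Rlt_le_trans; [exact Hz|eapply Rle_trans; [apply Rmin_r|apply Rmin_l]]).
    assert (Y3 : Cmod (z - z0) < r2) by (eapply Rlt_le_trans; [exact Hz|eapply Rle_trans; [apply Rmin_r|apply Rmin_r]]).
    apply TE; [pose proof (Cmod_triangle_rev z z0); lra|]. rewrite (E3 z Y2). apply KG.
    specialize (Kr2 z Y3). rewrite T0 in Kr2. replace (tau z - 0)%C with (tau z) in Kr2 by ring. exact Kr2. }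
apply near_iff. exists (r / 3). split; [lra|]. intros z Hz.
apply TE; [lra|]. apply Z. pose proof (Cmod_minus_triangle z z0). lra.
Qed.

(** ** Uniqueness of continuation *)

Lemma unit_interval_connected (Q : R -> Prop) : Q 0 ->
  (forall t, 0 <= t <= 1 -> exists d, 0 < d /\ forall s, 0 <= s <= 1 -> Rabs (s - t) < d -> (Q s <-> Q t)) ->
  forall t, 0 <= t <= 1 -> Q t.
Proof.
intros Q0 H.
set (S := fun t => 0 <= t <= 1 /\ forall s, 0 <= s <= t -> Q s).
assert (S0 : S 0).
{ split; [lra|]. intros s Hs. replace s with 0 by lra. exact Q0. }
destruct (completeness S) as [m [Hub Hlub]].
{ exists 1. intros t [Ht _]. lra. }
{ exists 0. exact S0. }
assert (Hm : 0 <= m <= 1).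
{ split; [apply Hub, S0|]. apply Hlub. intros t [Ht _]. lra. }
destruct (H m Hm) as [e [He Ke]].
assert (Below : forall s, 0 <= s < m -> Q s).
{ intros s Hs. destruct (classic (exists t, S t /\ s < t)) as [[t [[_ St] Hst]]|N]; [apply St; lra|].
  exfalso. assert (m <= s); [|lra]. apply Hlub. intros t St. destruct (Rle_or_lt t s) as [L|L]; [exact L|].
  exfalso. apply N. exists t. split; assumption. }
assert (Qm : Q m).
{ destruct (Rle_lt_or_eq_dec 0 m (proj1 Hm)) as [P|<-]; [|exact Q0].
  set (s := Rmax 0 (m - e / 2)).
  assert (0 <= s) by apply Rmax_l. assert (m - e / 2 <= s) by apply Rmax_r.
  assert (s < m) by (apply Rmax_lub_lt; lra).
  apply (Ke s); [lra|apply Rabs_def1; lra|]. apply Below. lra. }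
assert (Near : forall s, 0 <= s <= 1 -> s < m + e -> Q s).
{ intros s Hs Hse. destruct (Rlt_or_le s m) as [L|L]; [apply Below; lra|].
  apply (Ke s Hs); [apply Rabs_def1; lra|exact Qm]. }
intros t Ht. apply Near; [exact Ht|].
destruct (Rlt_or_le t (m + e)) as [L|L]; [exact L|exfalso].
assert (St : S (m + e / 2)).
{ split; [lra|]. intros s Hs. apply Near; lra. }
specialize (Hub _ St). lra.
Qed.

Lemma germ_eq_sym p f h : germ_eq p f h -> germ_eq p h f.
Proof. apply near_imp. intros q E. symmetry. exact E. Qed.

Lemma germ_eq_trans p f h k : germ_eq p f h -> germ_eq p h k -> germ_eq p f k.
Proof.
unfold germ_eq. intros H1 H2. pose proof (near_and _ _ _ H1 H2) as H. revert H. apply near_imp. intros q [E1 E2]. congruence.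
Qed.

(** The set of times at which the continuation coincides with [rat_map] is open
    by definition of a continuation, and closed by the identity theorem. *)
Lemma continuation_unique D gamma F : path_in D gamma -> continuation gamma F ->
  germ_eq (gamma 0) (F 0) rat_map -> forall t, 0 <= t <= 1 -> germ_eq (gamma t) (F t) rat_map.
Proof.
intros Hg HF H0. apply (unit_interval_connected (fun t => germ_eq (gamma t) (F t) rat_map)); [exact H0|].
intros t Ht. destruct (Hg t Ht) as [_ Hlim]. destruct (HF t Ht) as [[Hmer _] Hloc].
assert (N1 := germ_identity (F t) (gamma t) Hmer).
assert (N2 : near (gamma t) (fun q => germ_eq (gamma t) (F t) rat_map -> germ_eq q (F t) rat_map)).
{ destruct (classic (germ_eq (gamma t) (F t) rat_map)) as [G|G].
  - apply near_near in G. revert G. apply near_imp. intros q Hq _. exact Hq.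
  - apply near_all. intros q X. contradiction. }
pose proof (Hlim _ (near_and _ _ _ N1 N2)) as L. unfold filtermap, within in L.
destruct L as [e1 L]. destruct Hloc as [e2 Hloc].
exists (Rmin e1 e2). split; [apply Rmin_glb_lt; apply cond_pos|].
intros s Hs Hst.
assert (B1 : ball t e1 s) by (eapply Rlt_le_trans; [exact Hst|apply Rmin_l]).
assert (B2 : ball t e2 s) by (eapply Rlt_le_trans; [exact Hst|apply Rmin_r]).
destruct (L s B1 Hs) as [L1 L2]. specialize (Hloc s B2 Hs).
split.
- intros G. apply L1. apply (germ_eq_trans _ _ (F s)); [apply germ_eq_sym, Hloc|exact G].
- intros G. apply (germ_eq_trans _ _ (F t)); [exact Hloc|apply L2, G].
Qed.

Lemma continues_to_unique D gamma f1 : path_in D gamma -> continues_to gamma rat_map f1 ->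
  germ_eq (gamma 1) f1 rat_map.
Proof.
intros Hg [F [HF [H0 H1]]].
apply (germ_eq_trans _ _ (F 1)); [apply germ_eq_sym, H1|].
apply (continuation_unique D gamma F Hg HF H0). lra.
Qed.
End RationalMap.

(** * The metric is the pullback of the standard one *)

(** [coord p q = 0] only for [q = p] and for one point outside the chart at
    [p], so that a neighbourhood avoiding [q <> p] can be read off [coord p q]. *)
Lemma near_neq p q : q <> p -> near p (fun x => x <> q).
Proof.
intros N. apply near_iff.
assert (K : forall z, param p z = q -> z = coord p q) by (intros z <-; symmetry; apply coord_param).
destruct (Ceq_dec (coord p q) 0) as [E|E].
- exists 1. split; [lra|]. intros z _ X. apply N. rewrite <- X, (K z X), E. apply param_0.
- exists (Cmod (coord p q)). split; [apply Cmod_pos, E|]. intros z Hz X. rewrite (K z X) in Hz. lra.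
Qed.

Lemma near_regular D p : regular D p -> near p (regular D).
Proof.
unfold regular. induction (map fst D) as [|q L IH]; intros H.
- apply near_all. intros q [].
- refine (near_imp _ _ _ _ (near_and _ _ _ (near_neq p q _) (IH _))).
  + intros x [N1 N2] [E|Hin]; [exact (N1 (eq_sym E))|exact (N2 Hin)].
  + intros E. apply H. left. exact E.
  + intros Hin. apply H. right. exact Hin.
Qed.

(** The reversed polynomials are [z^d a(1/z)] and [z^d b(1/z)]; the terms in which
    [z^d] is differentiated cancel. *)
Lemma wronskian_at_infinity d a b z al' be' A' B' : z <> RtoC 0 ->
  Cd (poly_eval d (fun k => a (d - k)%nat)) z al' -> Cd (poly_eval d (fun k => b (d - k)%nat)) z be' ->
  Cd (poly_eval d a) (/ z)%C A' -> Cd (poly_eval d b) (/ z)%C B' ->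
  (al' * poly_eval d (fun k => b (d - k)%nat) z - poly_eval d (fun k => a (d - k)%nat) z * be')%C =
  (- (z ^ d * z ^ d / (z * z)) * (A' * poly_eval d b (/ z) - poly_eval d a (/ z) * B'))%C.
Proof.
intros N Hal Hbe HA HB.
assert (R : forall c c' C', Cd (poly_eval d (fun k => c (d - k)%nat)) z c' -> Cd (poly_eval d c) (/ z)%C C' ->
  c' = (INR d * z ^ (pred d) * 1 * poly_eval d c (/ z) + z ^ d * (C' * (- (1) / (z * z))))%C).
{ intros c c' C' Hc HC. refine (Cd_unique _ _ _ _ Hc _).
  apply (Cd_ext_loc (fun w => w ^ d * poly_eval d c (/ w))%C).
  - exists (Cmod z). split; [apply Cmod_pos, N|]. intros w Hw. apply poly_reverse.
    intros ->. rewrite Cmod_minus_sym in Hw. replace (z - 0)%C with z in Hw by ring. lra.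
  - apply (Cd_mult (fun w => w ^ d)%C (fun w => poly_eval d c (/ w))%C).
    + apply (Cd_pow (fun w => w)). apply Cd_id.
    + apply (Cd_comp (fun w => / w)%C (poly_eval d c)); [|exact HC].
      apply (Cd_inv (fun w => w)); [apply Cd_id|exact N]. }
rewrite (R a al' A' Hal HA), (R b be' B' Hbe HB), <- !poly_reverse by exact N. field. exact N.
Qed.

Section Pullback.
Variables (g : conformal_metric) (D : divisor) (d : nat) (a b : nat -> C) (P : C -> C).
Hypothesis Htop : a d <> RtoC 0 \/ b d <> RtoC 0.
Hypothesis Hcop : forall z, ~ (poly_eval d a z = RtoC 0 /\ poly_eval d b z = RtoC 0).
Hypothesis HP : forall z A' B', Cd (poly_eval d a) z A' -> Cd (poly_eval d b) z B' ->
  (A' * poly_eval d b z - poly_eval d a z * B')%C = P z.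
Hypothesis Hmetric : forall z, regular D (Some z) -> P z <> RtoC 0 /\
  g (Some z) = 4 * Cmod (P z) ^ 2 / (Cmod (poly_eval d a z) ^ 2 + Cmod (poly_eval d b z) ^ 2) ^ 2.
Hypothesis Hsmooth : forall p, regular D p -> smooth_at g p.

Lemma norm_pos x y : ~ (x = RtoC 0 /\ y = RtoC 0) -> 0 < Cmod x ^ 2 + Cmod y ^ 2.
Proof.
intros H. pose proof (pow2_ge_0 (Cmod x)). pose proof (pow2_ge_0 (Cmod y)).
destruct (Ceq_dec x 0) as [E|N].
- assert (Ny : y <> RtoC 0) by (intros E'; apply H; split; assumption). apply Cmod_pos in Ny.
  assert (0 < Cmod y ^ 2) by (apply pow_lt, Ny). lra.
- apply Cmod_pos in N. assert (0 < Cmod x ^ 2) by (apply pow_lt, N). lra.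
Qed.

(** At infinity both sides are continuous functions of the coordinate which
    agree off the centre. *)
Lemma metric_at_infinity : regular D None -> forall l m,
  Cd (poly_eval d (fun k => a (d - k)%nat)) (RtoC 0) l -> Cd (poly_eval d (fun k => b (d - k)%nat)) (RtoC 0) m ->
  g None = 4 * Cmod (l * poly_eval d (fun k => b (d - k)%nat) (RtoC 0) - poly_eval d (fun k => a (d - k)%nat) (RtoC 0) * m) ^ 2
    / (Cmod (poly_eval d (fun k => a (d - k)%nat) (RtoC 0)) ^ 2 + Cmod (poly_eval d (fun k => b (d - k)%nat) (RtoC 0)) ^ 2) ^ 2.
Proof.
intros Hr l m Hl Hm.
pose proof (fun z => proj2 (rat_map_infinity d a b Htop Hcop z)) as N.
assert (HA : forall z, exists l, Cd (poly_eval d a) z l) by (intros; apply poly_holo).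
assert (HB : forall z, exists l, Cd (poly_eval d b) z l) by (intros; apply poly_holo).
assert (Rev : forall c z, z <> RtoC 0 -> poly_eval d (fun k => c (d - k)%nat) z = (z ^ d * poly_eval d c (/ z))%C).
{ intros c z Hz. symmetry. apply poly_reverse, Hz. }
pose proof (fun z l m A' B' Hz Hl Hm => wronskian_at_infinity d a b z l m A' B' Hz Hl Hm) as W.
set (al := poly_eval d (fun k => a (d - k)%nat)) in *. set (be := poly_eval d (fun k => b (d - k)%nat)) in *.
destruct (poly_divided_difference d (fun k => a (d - k)%nat)) as [Ka [Ea HKa]].
destruct (poly_divided_difference d (fun k => b (d - k)%nat)) as [Kb [Eb HKb]].
pose proof (fun z => poly_Cd d _ Ka z Ea HKa) as Da. pose proof (fun z => poly_Cd d _ Kb z Eb HKb) as Db.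
fold al in Da. fold be in Db.
rewrite (Cd_unique _ _ _ _ Hl (Da _)), (Cd_unique _ _ _ _ Hm (Db _)).
set (G := fun z => 4 * Cmod (Ka z z * be z - al z * Kb z z) ^ 2 * / (Cmod (al z) ^ 2 + Cmod (be z) ^ 2) ^ 2).
change (g None = G (RtoC 0)).
assert (Ca : continuous al (RtoC 0)) by exact (Cd_continuous _ _ _ (Da _)).
assert (Cb : continuous be (RtoC 0)) by exact (Cd_continuous _ _ _ (Db _)).
assert (CW : continuous (fun z => Ka z z * be z - al z * Kb z z)%C (RtoC 0)).
{ apply (continuous_Cminus (fun z => Ka z z * be z)%C (fun z => al z * Kb z z)%C).
  - exact (continuous_Cmult _ _ _ (continuous_diagonal Ka _ HKa) Cb).
  - exact (continuous_Cmult _ _ _ Ca (continuous_diagonal Kb _ HKb)). }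
assert (CG : continuous G (RtoC 0)).
{ apply (continuous_Rmult (fun z => 4 * Cmod (Ka z z * be z - al z * Kb z z) ^ 2) (fun z => / (Cmod (al z) ^ 2 + Cmod (be z) ^ 2) ^ 2)).
  - apply (continuous_Rmult (fun _ => 4) (fun z => Cmod (Ka z z * be z - al z * Kb z z) ^ 2)); [apply continuous_const|].
    exact (continuous_Rpow _ 2 _ (continuous_Cmod _ _ CW)).
  - apply (continuous_Rinv (fun z => (Cmod (al z) ^ 2 + Cmod (be z) ^ 2) ^ 2)).
    + apply (continuous_Rpow (fun z => Cmod (al z) ^ 2 + Cmod (be z) ^ 2)).
      exact (continuous_Rplus _ _ _ (continuous_Rpow _ 2 _ (continuous_Cmod _ _ Ca)) (continuous_Rpow _ 2 _ (continuous_Cmod _ _ Cb))).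
    + apply pow_nonzero, Rgt_not_eq, norm_pos, N. }
assert (Pos : forall z, 0 < coef_at g None z).
{ intros z. unfold coef_at. destruct (Ceq_dec z 0) as [_|Nz]; [apply coef_pos|].
  apply Rdiv_lt_0_compat; [apply coef_pos|apply pow_lt, Cmod_pos, Nz]. }
assert (Ex : forall z, coef_at g None z = exp (2 * potential g None z)).
{ intros z. unfold potential. replace (2 * (ln (coef_at g None z) / 2)) with (ln (coef_at g None z)) by field.
  symmetry. apply exp_ln, Pos. }
assert (Cp : continuous (potential g None) (RtoC 0)).
{ destruct (Hsmooth None Hr) as [e [He Hc]]. destruct (Hc 0%nat) as [Hc0 _]. apply Hc0. rewrite Cmod_0. exact He. }
assert (Near := near_regular D None Hr). apply near_iff in Near. destruct Near as [e [He Ke]].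
assert (Z : exp (2 * potential g None (RtoC 0)) - G (RtoC 0) = 0).
{ apply (continuous_zero (fun z => exp (2 * potential g None z) - G z) (RtoC 0) e He).
  - apply (continuous_Rminus (fun z => exp (2 * potential g None z)) G); [|exact CG].
    apply (continuous_exp_comp (fun z => 2 * potential g None z)).
    exact (continuous_Rmult (fun _ => 2) _ _ (continuous_const _ _) Cp).
  - intros z Hz Nz. replace (z - 0)%C with z in Hz by ring. rewrite <- Ex. specialize (Ke z Hz).
    unfold coef_at. simpl in Ke. destruct (Ceq_dec z 0) as [X|_]; [contradiction|].
    destruct (Hmetric _ Ke) as [_ ->]. unfold G.
    destruct (HA (/ z)%C) as [A' HA']. destruct (HB (/ z)%C) as [B' HB'].
    pose proof (N z) as Nz'. rewrite (W z _ _ A' B' Nz (Da z) (Db z) HA' HB'), (HP _ A' B' HA' HB').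
    unfold al, be in *. rewrite (Rev a z Nz), (Rev b z Nz) in *.
    apply norm_pos in Nz'. rewrite !Cmod_mult in *. rewrite Cmod_opp, Cmod_div by (apply Cmult_neq_0; exact Nz).
    rewrite !Cmod_mult. pose proof (norm_pos _ _ (Hcop (/ z))). pose proof (Cmod_pos _ (Cpow_nz z d Nz)).
    apply Cmod_pos in Nz. field.
    repeat split; lra. }
rewrite <- Ex in Z. unfold coef_at in Z. destruct (Ceq_dec (RtoC 0) 0) as [_|X]; [lra|congruence].
Qed.

(** In every chart the metric is expressed by the Wronskian of the local homogeneous
    coordinates, exactly as the pullback of the standard metric is. *)
Lemma metric_in_chart p : regular D p -> exists a' b' l m,
  (forall z, rat_map d a b (param p z) = proj (poly_eval d a' z) (poly_eval d b' z) /\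
     ~ (poly_eval d a' z = RtoC 0 /\ poly_eval d b' z = RtoC 0)) /\
  Cd (poly_eval d a') (RtoC 0) l /\ Cd (poly_eval d b') (RtoC 0) m /\
  g p = 4 * Cmod (l * poly_eval d b' (RtoC 0) - poly_eval d a' (RtoC 0) * m) ^ 2
    / (Cmod (poly_eval d a' (RtoC 0)) ^ 2 + Cmod (poly_eval d b' (RtoC 0)) ^ 2) ^ 2.
Proof.
intros Hr. destruct p as [c|].
- destruct (poly_translate d a c) as [a' Ha]. destruct (poly_translate d b c) as [b' Hb].
  destruct (poly_holo d a c) as [l Hl]. destruct (poly_holo d b c) as [m Hm].
  exists a', b', l, m. split; [|split; [|split]].
  + intros z. simpl. rewrite Ha, Hb. split; [reflexivity|]. rewrite <- Ha, <- Hb. apply Hcop.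
  + apply (Cd_ext (fun z => poly_eval d a (c + z))); [intros; apply Ha|].
    eapply Cd_eq; [|apply (Cd_comp (fun z => c + z)%C (poly_eval d a));
      [apply Cd_plus; [apply Cd_const|apply Cd_id]|rewrite Cplus_0_r; exact Hl]]. ring.
  + apply (Cd_ext (fun z => poly_eval d b (c + z))); [intros; apply Hb|].
    eapply Cd_eq; [|apply (Cd_comp (fun z => c + z)%C (poly_eval d b));
      [apply Cd_plus; [apply Cd_const|apply Cd_id]|rewrite Cplus_0_r; exact Hm]]. ring.
  + rewrite <- Ha, <- Hb, Cplus_0_r, (HP c l m Hl Hm). apply Hmetric, Hr.
- destruct (poly_holo d (fun k => a (d - k)%nat) (RtoC 0)) as [l Hl].
  destruct (poly_holo d (fun k => b (d - k)%nat) (RtoC 0)) as [m Hm].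
  exists (fun k => a (d - k)%nat), (fun k => b (d - k)%nat), l, m.
  split; [apply rat_map_infinity; assumption|]. split; [exact Hl|]. split; [exact Hm|].
  apply metric_at_infinity; assumption.
Qed.

Lemma rat_map_pullback p : regular D p -> is_pullback_at (rat_map d a b) g_st g p.
Proof.
intros Hr. destruct (metric_in_chart p Hr) as [a' [b' [l [m [H [Hl [Hm E]]]]]]].
destruct (proj_derive (rat_map d a b) p _ _ l m 1 Rlt_0_1 (fun z _ => proj1 (H z)) (proj2 (H (RtoC 0))) Hl Hm) as [L [HL EL]].
exists L. split; [exact HL|]. rewrite E. symmetry. exact EL.
Qed.

(** The coefficient of a metric does not vanish, hence neither does the
    Wronskian. *)
Lemma rat_map_element p : regular D p -> function_element (rat_map d a b) p.
Proof.
intros Hr. split; [apply rat_map_meromorphic; assumption|].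
destruct (metric_in_chart p Hr) as [a' [b' [l [m [H [Hl [Hm E]]]]]]].
apply (rat_map_injective d a b p a' b' l m H Hl Hm).
intros X. pose proof (coef_pos g p) as Pos. rewrite E, X, Cmod_0 in Pos.
replace (4 * 0 ^ 2) with 0 in Pos by ring. unfold Rdiv in Pos. lra.
Qed.

(** Otherwise the Wronskian would vanish far from the origin, where all points are
    regular. *)
Lemma denominator_nonzero : exists z, regular D (Some z) /\ poly_eval d b z <> RtoC 0.
Proof.
destruct (large_disc_contains (map fst D)) as [R HR].
apply NNPP. intros N.
assert (Z : forall z, R <= Cmod z -> poly_eval d b z = RtoC 0).
{ intros z Hz. apply NNPP. intros X. apply N. exists z. split; [exact (HR z Hz)|exact X]. }
set (z0 := RtoC (Rabs R + 1)).
assert (M0 : Cmod z0 = Rabs R + 1).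
{ unfold z0. rewrite Cmod_R. apply Rabs_pos_eq. pose proof (Rabs_pos R). lra. }
pose proof (Rle_abs R) as AR.
destruct (poly_holo d a z0) as [A' HA].
assert (HB : Cd (poly_eval d b) z0 (RtoC 0)).
{ apply (Cd_ext_loc (fun _ => RtoC 0)); [|apply Cd_const]. exists 1. split; [lra|]. intros w Hw. symmetry. apply Z.
  pose proof (Cmod_triangle_rev z0 w). rewrite Cmod_minus_sym in Hw. lra. }
destruct (Hmetric z0 (HR z0 ltac:(lra))) as [X _]. apply X.
rewrite <- (HP z0 A' _ HA HB), (Z z0) by lra. ring.
Qed.

(** ** Developing map and monodromy *)

Lemma continues_to_self gamma : path_in D gamma -> continues_to gamma (rat_map d a b) (rat_map d a b).
Proof.
intros Hg. exists (fun _ => rat_map d a b).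
assert (Refl : forall p, germ_eq p (rat_map d a b) (rat_map d a b)) by (intros p; apply near_all; reflexivity).
split; [|split; apply Refl].
intros t Ht. split; [apply rat_map_element, Hg, Ht|]. unfold within. apply filter_forall. intros s. intros _. apply Refl.
Qed.

Lemma moebius_id p : moebius 1 0 (- Cconj 0) (Cconj 1) p = p.
Proof.
replace (- Cconj 0)%C with (RtoC 0) by (apply injective_projections; simpl; ring).
replace (Cconj 1) with (RtoC 1) by (apply injective_projections; simpl; ring).
unfold moebius. destruct p as [z|].
- destruct (Ceq_dec (0 * z + 1) 0) as [E|_].
  + exfalso. apply C1_nz. rewrite <- E. ring.
  + apply (f_equal Some). field.
- destruct (Ceq_dec 0 0) as [_|X]; [reflexivity|congruence].
Qed.

(** Along every path [rat_map] is its own, unique continuation. *)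
Lemma rat_map_developing p0 : regular D p0 -> developing_map g D p0 (rat_map d a b).
Proof.
intros H0. split; [exact H0|]. split; [apply rat_map_element, H0|]. split; [|split].
- intros gamma Hg _. exists (rat_map d a b). apply continues_to_self, Hg.
- intros gamma f1 Hg _ H1.
  pose proof (continues_to_unique d a b Htop Hcop D gamma f1 Hg H1) as G.
  apply germ_eq_sym in G. unfold germ_eq in G.
  assert (Hr : regular D (gamma 1)) by (apply Hg; lra).
  refine (near_imp _ _ _ _ (near_and _ _ _ (near_near _ _ G) (near_regular D _ Hr))).
  intros q [Gq Rq]. destruct (rat_map_pullback q Rq) as [l [Hl E]]. exists l. split.
  + apply (is_derive_at_ext (rat_map d a b)); assumption.
  + rewrite <- (near_center _ _ Gq). exact E.
- intros gamma [Hg [G0 G1]]. exists (fun p => p). split.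
  + exists (RtoC 1), (RtoC 0). split; [rewrite Cmod_1, Cmod_0; ring|]. intros p. symmetry. apply moebius_id.
  + apply continues_to_self, Hg.
Qed.

(** Finite fixed points are roots of the quadratic polynomial
    [conj be x^2 + (al - conj al) x + be], which must vanish. *)
Lemma moebius_three_fixed_points al be x1 x2 x3 : Cmod al ^ 2 + Cmod be ^ 2 = 1 ->
  x1 <> x2 -> x1 <> x3 -> x2 <> x3 ->
  (forall x, x = x1 \/ x = x2 \/ x = x3 -> moebius al be (- Cconj be) (Cconj al) (Some x) = Some x) ->
  forall p, moebius al be (- Cconj be) (Cconj al) p = p.
Proof.
intros Hn N12 N13 N23 H.
assert (Q : forall x, x = x1 \/ x = x2 \/ x = x3 -> (Cconj be * x * x + (al - Cconj al) * x + be)%C = RtoC 0).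
{ intros x Hx. specialize (H x Hx). unfold moebius in H.
  destruct (Ceq_dec (- Cconj be * x + Cconj al) 0) as [_|Nd]; [discriminate|].
  assert (E : ((al * x + be) / (- Cconj be * x + Cconj al))%C = x) by (exact (f_equal (fun o => match o with Some v => v | None => RtoC 0 end) H)).
  transitivity ((al * x + be) / (- Cconj be * x + Cconj al) * (- Cconj be * x + Cconj al) - x * (- Cconj be * x + Cconj al))%C;
    [field; exact Nd|rewrite E; ring]. }
pose proof (Q x1 (or_introl eq_refl)) as Q1. pose proof (Q x2 (or_intror (or_introl eq_refl))) as Q2.
pose proof (Q x3 (or_intror (or_intror eq_refl))) as Q3.
assert (Zf : forall u v, u <> v -> forall y : C, ((u - v) * y)%C = RtoC 0 -> y = RtoC 0).
{ intros u v N y E. apply Cminus_eq_contra in N. transitivity ((u - v) * y / (u - v))%C; [field; exact N|rewrite E; field; exact N]. }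
(* Divided differences of the quadratic equation at the fixed points. *)
assert (D12 : (Cconj be * (x1 + x2) + (al - Cconj al))%C = RtoC 0).
{ apply (Zf x1 x2 N12). transitivity ((Cconj be * x1 * x1 + (al - Cconj al) * x1 + be) - (Cconj be * x2 * x2 + (al - Cconj al) * x2 + be))%C; [ring|rewrite Q1, Q2; ring]. }
assert (D13 : (Cconj be * (x1 + x3) + (al - Cconj al))%C = RtoC 0).
{ apply (Zf x1 x3 N13). transitivity ((Cconj be * x1 * x1 + (al - Cconj al) * x1 + be) - (Cconj be * x3 * x3 + (al - Cconj al) * x3 + be))%C; [ring|rewrite Q1, Q3; ring]. }
assert (Eb' : Cconj be = RtoC 0).
{ apply (Zf x2 x3 N23). transitivity ((Cconj be * (x1 + x2) + (al - Cconj al)) - (Cconj be * (x1 + x3) + (al - Cconj al)))%C; [ring|rewrite D12, D13; ring]. }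
assert (Eb : be = RtoC 0) by (rewrite <- (Cconj_conj be), Eb'; apply injective_projections; simpl; ring).
assert (Ea : Cconj al = al).
{ rewrite Eb' in D12. transitivity (al - (0 * (x1 + x2) + (al - Cconj al)))%C; [ring|rewrite D12; ring]. }
assert (Na : al <> RtoC 0).
{ intros X. rewrite X, Eb, Cmod_0 in Hn. lra. }
intros p. rewrite Eb', Ea, Eb. replace (- RtoC 0)%C with (RtoC 0) by ring. unfold moebius. destruct p as [z|].
- destruct (Ceq_dec (0 * z + al) 0) as [E|_].
  + exfalso. apply Na. rewrite <- E. ring.
  + apply (f_equal Some). field. exact Na.
- destruct (Ceq_dec 0 0) as [_|X]; [reflexivity|congruence].
Qed.

(** The values of an injective element near a point where it is finite provide
    the three fixed points. *)
Lemma rat_map_trivial_monodromy z0 : regular D (Some z0) -> poly_eval d b z0 <> RtoC 0 ->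
  forall M, monodromy_group D (Some z0) (rat_map d a b) M -> forall p, M p = p.
Proof.
intros H0 Nb M [gamma [[Hg [G0 G1]] [[al [be [Hn HM]]] Hc]]].
pose proof (continues_to_unique d a b Htop Hcop D gamma _ Hg Hc) as G. rewrite G1 in G.
destruct (rat_map_element _ H0) as [_ [U [HU Inj]]].
unfold germ_eq in G. pose proof (near_and _ _ _ G HU) as Near. apply near_iff in Near. destruct Near as [e [He K]].
destruct (continuous_nonzero (poly_eval d b) z0 (holo_continuous _ _ (poly_holo d b z0)) Nb) as [r [Hr Kr]].
assert (V : forall t, 0 <= t <= 1 -> exists x, rat_map d a b (param (Some z0) (RtoC (t * Rmin e r / 2))) = Some x /\
   U (param (Some z0) (RtoC (t * Rmin e r / 2))) /\ M (Some x) = Some x).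
{ intros t Ht. pose proof (Rmin_glb_lt _ _ _ He Hr) as Pm.
  set (h := RtoC (t * Rmin e r / 2)).
  assert (Hh : Cmod h < Rmin e r).
  { unfold h. rewrite Cmod_R. rewrite Rabs_pos_eq; nra. }
  destruct (K h ltac:(eapply Rlt_le_trans; [exact Hh|apply Rmin_l])) as [E1 E2].
  assert (Nh : poly_eval d b (z0 + h) <> RtoC 0).
  { apply Kr. replace (z0 + h - z0)%C with h by ring. eapply Rlt_le_trans; [exact Hh|apply Rmin_r]. }
  simpl in E1 |- *. unfold proj in *. destruct (Ceq_dec (poly_eval d b (z0 + h)) 0) as [X|_]; [contradiction|].
  eexists. split; [reflexivity|]. split; [exact E2|exact E1]. }
assert (Dist : forall t t' x x', t <> t' ->
   rat_map d a b (param (Some z0) (RtoC (t * Rmin e r / 2))) = Some x -> U (param (Some z0) (RtoC (t * Rmin e r / 2))) ->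
   rat_map d a b (param (Some z0) (RtoC (t' * Rmin e r / 2))) = Some x' -> U (param (Some z0) (RtoC (t' * Rmin e r / 2))) -> x <> x').
{ intros t t' x x' Nt E1 U1 E2 U2 ->. pose proof (Inj _ _ U1 U2 (eq_trans E1 (eq_sym E2))) as E.
  apply (f_equal (coord (Some z0))) in E. rewrite !coord_param in E. apply RtoC_inj in E.
  pose proof (Rmin_glb_lt _ _ _ He Hr). apply Nt. apply (Rmult_eq_reg_r (Rmin e r / 2)); lra. }
destruct (V 0 ltac:(lra)) as [x1 [E1 [U1 F1]]]. destruct (V (1 / 2) ltac:(lra)) as [x2 [E2 [U2 F2]]].
destruct (V 1 ltac:(lra)) as [x3 [E3 [U3 F3]]].
intros p. rewrite HM. apply (moebius_three_fixed_points al be x1 x2 x3 Hn).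
- exact (Dist 0 (1 / 2) x1 x2 ltac:(lra) E1 U1 E2 U2).
- exact (Dist 0 1 x1 x3 ltac:(lra) E1 U1 E3 U3).
- exact (Dist (1 / 2) 1 x2 x3 ltac:(lra) E2 U2 E3 U3).
- intros x Hx. rewrite <- HM. destruct Hx as [E|[E|E]]; rewrite E; assumption.
Qed.
End Pullback.

Theorem theorem1p3 (g : conformal_metric) (D : divisor)
    (HD : represents g D)
    (Heff : effective_Z_divisor D)
    (HK : constant_curvature_one g D) :
  trivial_reducible g D /\
  exists f : sphere -> sphere,
    rational_function f /\
    forall p, regular D p -> is_pullback_at f g_st g p.
Proof.
destruct (developing_pair g D HD Heff HK) as [d [a [b [P [Htop [Hcop [HP Hm]]]]]]].
destruct HD as [_ [Hs _]].
destruct (denominator_nonzero g D d a b P HP Hm) as [z0 [R0 Nb]].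
split.
- exists (Some z0), (rat_map d a b). split.
  + apply (rat_map_developing g D d a b P); assumption.
  + apply (rat_map_trivial_monodromy g D d a b P); assumption.
- exists (rat_map d a b). split.
  + apply rat_map_rational; [assumption|assumption|]. exists z0. exact Nb.
  + intros p Hr. apply (rat_map_pullback g D d a b P); assumption.
Qed.
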